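(* Let $\mathbb{G}$ be a Carnot group of homogeneous dimension $Q$ and let $p\in[1,\infty)$. Fix $\lambda\in[1,Q)$ and let $\mathcal{L}$ be a $\lambda$-homogeneous, left-invariant linear differential operator on $\mathbb{G}$ such that both $\mathcal{L}$ and its transpose $\mathcal{L}^t$ are hypoelliptic. A compact set $K\subset\mathbb{G}$ is removable for $L^p_{\mathrm{loc}}$ $\mathcal{L}$-solutions if and only if $\kappa^p(K)=0$, where $$\kappa^p(K)=\sup\{|\langle\mathcal{L}f,1\rangle| : f\in L^p_{\mathrm{loc}}(\mathbb{G}),\ \|f\|_{L^p(K)}\le1,\ \operatorname{supp}(\mathcal{L}f)\subset K\}.$$
   Context: Carnot groups. A Carnot group $\mathbb{G}$ is a connected, simply connected, nilpotent Lie group whose Lie algebra has a stratification $\mathfrak{g}=\mathfrak{v}_1\oplus\cdots\oplus\mathfrak{v}_s$ into non-zero subspaces with $[\mathfrak{v}_1,\mathfrak{v}_i]=\mathfrak{v}_{i+1}$ for $1\le i\le s-1$ and $[\mathfrak{v}_1,\mathfrak{v}_s]=\{0\}$. Via the exponential map $\mathbb{G}$ is identified with $\mathbb{R}^N$, $N=\sum_i\dim\mathfrak{v}_i$, with identity $0$; the homogeneous dimension is $Q=\sum_i i\dim\mathfrak{v}_i$. For $t>0$ the dilation $\delta_t$ is $\delta_t(X)=t^iX$ for $X\in\mathfrak{v}_i$, extended linearly and transferred to $\mathbb{G}$ by $\exp$. $L^p$ norms are with respect to Haar (Lebesgue) measure; $\|f\|_{L^p(K)}$ is the $L^p$ norm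 over $K$. Operators. $\mathcal{L}$ is left-invariant if $\mathcal{L}(T\circ\tau_\alpha)=(\mathcal{L}T)\circ\tau_\alpha$ for all $\alpha\in\mathbb{G}$ and distributions $T$, where $\tau_\alpha(x)=\alpha\cdot x$; homogeneous of degree $\lambda$ if $\mathcal{L}(T\circ\delta_t)=t^\lambda(\mathcal{L}T)\circ\delta_t$ for all $t>0$ and all distributions $T$; hypoelliptic if for every open $\Omega$ and distributions $T,F$ on $\Omega$ with $\mathcal{L}T=F$, $F\in C^\infty(\Omega)$ implies $T\in C^\infty(\Omega)$. $\mathcal{L}f$ and its support are distributional; $\langle\mathcal{L}f,1\rangle$ means $\langle\mathcal{L}f,\psi\rangle$ for any $\psi\in C_0^\infty$ equal to $1$ near $K$. Removability. $K$ is removable for $L^p_{\mathrm{loc}}$ $\mathcal{L}$-solutions if for every domain $\Omega\subset\mathbb{G}$ (not required to contain $K$), every $f\in L^p_{\mathrm{loc}}(\Omega)$ with $\mathcal{L}f=0$ in $\Omega\setminus K$ (distributionally) satisfies $\mathcal{L}f=0$ in $\Omega$. *)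

(* Defs.v *)
From HB Require Import structures.
From mathcomp Require Import all_boot all_order all_algebra.
From mathcomp Require Import complex.
From mathcomp Require Import all_classical all_reals all_analysis.

Set Implicit Arguments.
Unset Strict Implicit.
Unset Printing Implicit Defensive.

Import Order.TTheory GRing.Theory Num.Theory.
Import numFieldNormedType.Exports.

Local Open Scope classical_set_scope.
Local Open Scope ring_scope.

(* Lebesgue measure on R^n: on 'rV[R]_n we put the sigma-algebra generated by
   the coordinates, and the measure is built one coordinate at a time. *)

Section measurable_rV.
Context {R : realType} {n : nat}.

Let coord (i : 'I_n) (x : 'rV[R]_n) : R := x ord0 i.

Let rV_set0 : g_sigma_preimage coord set0.
Proof. exact: sigma_algebra0. Qed.

Let rV_setC A : g_sigma_preimage coord A -> g_sigma_preimage coord (~` A).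
Proof. exact: sigma_algebraC. Qed.

Let rV_bigcup (F : _^nat) : (forall i, g_sigma_preimage coord (F i)) ->
  g_sigma_preimage coord (\bigcup_i (F i)).
Proof. exact: sigma_algebra_bigcup. Qed.

HB.instance Definition _ :=
  @isMeasurable.Build (measure_tuple_display default_measure_display)
    'rV[R]_n (g_sigma_preimage coord) rV_set0 rV_setC rV_bigcup.

End measurable_rV.

Section measurable_fun_rV.
Context {R : realType}.

Lemma measurable_coord n (i : 'I_n) :
  measurable_fun [set: 'rV[R]_n] (fun x => x ord0 i).
Proof.
move=> _ Y mY; rewrite setTI; apply: sub_sigma_algebra => /=.
rewrite -bigcup_seq/=; exists i => /=; first by rewrite mem_index_enum.
by exists Y => //; rewrite setTI.
Qed.

Lemma measurable_fun_rV d (T : measurableType d) n (f : T -> 'rV[R]_n) :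
  (forall i, measurable_fun [set: T] (fun x => f x ord0 i)) ->
  measurable_fun [set: T] f.
Proof.
move=> mf.
pose F i x := f x ord0 i.
have : g_sigma_preimage F `<=` measurable.
  apply: smallest_sub; first exact: sigma_algebra_measurable.
  case: n => [|n] in f mf F *; first by rewrite big_ord0.
  rewrite -bigcup_mkord_ord; apply: bigcup_sub => i Ii.
  by move=> A [B mB <-]; exact: mf.
have -> : F = (fun i => (fun v : 'rV[R]_n => v ord0 i) \o f) by [].
rewrite g_sigma_preimage_comp => sub _ A mA.
by apply: sub; exists A.
Qed.

Definition rV_cons n (z : R * 'rV[R]_n) : 'rV[R]_n.+1 :=
  row_mx (z.1)%:M z.2.

Definition rV_uncons n (x : 'rV[R]_n.+1) : R * 'rV[R]_n :=
  (x ord0 ord0, \row_i x ord0 (lift ord0 i)).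

Lemma rV_cons0 n (z : R * 'rV[R]_n) : rV_cons z ord0 ord0 = z.1.
Proof. by rewrite mxE; case: splitP => [j _|k]; rewrite ?(ord1 j) ?mxE. Qed.

Lemma rV_consS n (z : R * 'rV[R]_n) i :
  rV_cons z ord0 (lift ord0 i) = z.2 ord0 i.
Proof.
rewrite mxE; case: splitP => [j|k]; first by rewrite ord1.
by rewrite lift0 add1n => -[ik]; congr (z.2 _ _); exact/val_inj.
Qed.

Lemma rV_consK n : cancel (@rV_cons n) (@rV_uncons n).
Proof.
move=> [a v]; rewrite /rV_uncons rV_cons0; congr pair.
by apply/rowP => i; rewrite mxE rV_consS.
Qed.

Lemma measurable_rV_cons n : measurable_fun [set: R * 'rV[R]_n] (@rV_cons n).
Proof.
apply: measurable_fun_rV => i; case: (unliftP ord0 i) => [j ->|->].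
- rewrite (_ : (fun _ => _) = (fun x : 'rV[R]_n => x ord0 j) \o snd).
    by apply: measurableT_comp; [exact: measurable_coord|exact: measurable_snd].
  by apply/funext => z; rewrite rV_consS.
- rewrite (_ : (fun _ => _) = fst); first exact: measurable_fst.
  by apply/funext => z; rewrite rV_cons0.
Qed.

Lemma measurable_rV_uncons n :
  measurable_fun [set: 'rV[R]_n.+1] (@rV_uncons n).
Proof.
apply/measurable_fun_pairP; split; first exact: measurable_coord.
apply: measurable_fun_rV => i.
rewrite (_ : (fun _ => _) = fun x : 'rV[R]_n.+1 => x ord0 (lift ord0 i)).
  exact: measurable_coord.
by apply/funext => x; rewrite /= mxE.
Qed.

End measurable_fun_rV.

Section cons_measure.
Context {R : realType} {n : nat}.
Variable mu : {sigma_finite_measure set 'rV[R]_n -> \bar R}.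

Definition cons_measure : set 'rV[R]_n.+1 -> \bar R :=
  pushforward (@lebesgue_measure R \x mu)%E (@rV_cons R n).

Let mpre (A : set 'rV[R]_n.+1) :
  measurable A -> measurable (@rV_cons R n @^-1` A).
Proof.
by move=> mA; rewrite -[X in measurable X]setTI; exact: measurable_rV_cons.
Qed.

Let cons_measure0 : cons_measure set0 = 0%E.
Proof. by rewrite /cons_measure /pushforward preimage_set0 measure0. Qed.

Let cons_measure_ge0 A : (0 <= cons_measure A)%E.
Proof. by rewrite /cons_measure /pushforward measure_ge0. Qed.

Let cons_measure_sigma_additive : semi_sigma_additive cons_measure.
Proof.
move=> F mF tF mUF; rewrite /cons_measure /pushforward preimage_bigcup.
apply: measure_semi_sigma_additive.
- by move=> k; exact: mpre.
- apply/trivIsetP => /= i j _ _ ij; rewrite -preimage_setI.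
  by move/trivIsetP : tF => /(_ _ _ _ _ ij) ->//; rewrite preimage_set0.
- by rewrite -preimage_bigcup; exact: mpre.
Qed.

HB.instance Definition _ := isMeasure.Build _ _ _ cons_measure
  cons_measure0 cons_measure_ge0 cons_measure_sigma_additive.

Let cons_measure_sigma_finite : sigma_finite setT cons_measure.
Proof.
have /sigma_finiteP[F [TF ndF Foo]] := sigma_finiteT (@lebesgue_measure R).
have /sigma_finiteP[G [TG ndG Goo]] := sigma_finiteT mu.
exists (fun k => @rV_uncons R n @^-1` (F k `*` G k)).
  rewrite -preimage_bigcup (_ : \bigcup_k _ = setT) ?preimage_setT//.
  apply/seteqP; split => // -[x y] _.
  have [k _ Fk] : (\bigcup_k F k) x by rewrite -TF.
  have [l _ Gl] : (\bigcup_k G k) y by rewrite -TG.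
  exists (maxn k l) => //; split.
  - by move: x Fk; exact/subsetPset/ndF/leq_maxl.
  - by move: y Gl; exact/subsetPset/ndG/leq_maxr.
move=> k; have [mF muF] := Foo k; have [mG muG] := Goo k; split.
  rewrite -[X in measurable X]setTI; apply: measurable_rV_uncons => //.
  exact: measurableX.
rewrite /cons_measure /pushforward -comp_preimage.
rewrite (_ : _ \o _ = id); last by apply/funext => z; exact: rV_consK.
by rewrite preimage_id product_measure1E// lte_mul_pinfty// ge0_fin_numE.
Qed.

HB.instance Definition _ := Measure_isSigmaFinite.Build _ _ _ cons_measure
  cons_measure_sigma_finite.

End cons_measure.

Fixpoint lebesgue_rV {R : realType} (n : nat) :
    {sigma_finite_measure set 'rV[R]_n -> \bar R} :=
  match n with
  | 0 => \d_ (0 : 'rV[R]_0)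
  | m.+1 => cons_measure (lebesgue_rV m)
  end.

Lemma lebesgue_rV_box {R : realType} n (A : 'I_n -> set R) :
  (forall i, measurable (A i)) ->
  lebesgue_rV n [set x | forall i, A i (x ord0 i)] =
  (\prod_(i < n) lebesgue_measure (A i))%E.
Proof.
elim: n A => [|n IHn] A mA.
  rewrite big_ord0 /= diracE mem_set //.
  by move=> [].
rewrite big_ord_recl -IHn; last by move=> i; exact: mA.
have mB : measurable [set x : 'rV[R]_n | forall i, A (lift ord0 i) (x ord0 i)].
  rewrite (_ : [set _ | _] =
      \bigcap_(i in [set: 'I_n]) ((fun x : 'rV[R]_n => x ord0 i) @^-1` A (lift ord0 i))).
    apply: fin_bigcap_measurable => // i _.
    by rewrite -[X in measurable X]setTI; exact: measurable_coord.
  by apply/seteqP; split => x /= H i; [move=> _|]; exact: H.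
rewrite -(@product_measure1E _ _ _ _ _ _ (lebesgue_rV n)) //.
rewrite /= /cons_measure /pushforward; congr (product_measure1 _ _ _).
apply/seteqP; split => -[a v] /= H.
  split; first by have := H ord0; rewrite rV_cons0.
  by move=> i; have := H (lift ord0 i); rewrite rV_consS.
move=> i; have [Ha Hv] := H.
by case: (unliftP ord0 i) => [j ->|->]; rewrite ?rV_consS ?rV_cons0.
exact: mA.
Qed.

(* Smooth functions.  [iter_derive [:: v1; ...; vk] f] is D_v1 (... (D_vk f)).
   On finite-dimensional spaces, existence and continuity of all iterated
   directional derivatives is C^oo smoothness. *)

Definition iter_derive {R : realType} {V W : normedModType R}
    (vs : seq V) (f : V -> W) : V -> W :=
  foldr (fun v g => 'D_v g) f vs.

Definition smooth {R : realType} {V W : normedModType R}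
    (Omega : set V) (f : V -> W) : Prop :=
  forall (vs : seq V) (x : V), Omega x ->
    {for x, continuous (iter_derive vs f)} /\
    (forall v, derivable (iter_derive vs f) x v).

Section complex_functions.
Context {R : realType} {N : nat}.
Local Notation V := 'rV[R]_N.
Local Notation C := R[i].

Definition re_part (f : V -> C) : V -> R := fun x => complex.Re (f x).
Definition im_part (f : V -> C) : V -> R := fun x => complex.Im (f x).

Definition csmooth (Omega : set V) (f : V -> C) : Prop :=
  smooth Omega (re_part f) /\ smooth Omega (im_part f).

(* [cpartial [:: i1; ...; ik] f] is the partial derivative
   d_i1 (... (d_ik f)). *)
Definition cpartial (I : seq 'I_N) (f : V -> C) : V -> C :=
  let vs := [seq delta_mx ord0 i : V | i <- I] in
  fun x => (iter_derive vs (re_part f) x +i* iter_derive vs (im_part f) x)%C.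

Definition cintegral (D : set V) (f : V -> C) : C :=
  ((\int[lebesgue_rV N]_(x in D) re_part f x)%R +i*
   (\int[lebesgue_rV N]_(x in D) im_part f x)%R)%C.

Definition Lp_norm (p : R) (D : set V) (f : V -> C) : \bar R :=
  Lnorm (lebesgue_rV N) p%:E ((fun x => (Normc.normc (f x))%:E) \_ D).

Definition Lp_loc (p : R) (Omega : set V) (f : V -> C) : Prop :=
  [/\ measurable_fun Omega (re_part f), measurable_fun Omega (im_part f) &
    forall D : set V, compact D -> D `<=` Omega -> (Lp_norm p D f < +oo)%E].

End complex_functions.

Section distributions.
Context {R : realType} {N : nat}.
Local Notation V := 'rV[R]_N.
Local Notation C := R[i].

(* [test_fun Omega phi] : phi belongs to C_0^oo(Omega). *)
Definition test_fun (Omega : set V) (phi : V -> C) : Prop :=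
  csmooth setT phi /\
  exists D : set V, [/\ compact D, D `<=` Omega &
    forall x, ~ D x -> phi x = 0].

(* Functionals are total on V -> C; a distribution on Omega is only considered
   through its values on [test_fun Omega]. *)
Definition functional := (V -> C) -> C.

Definition distribution_on (Omega : set V) (T : functional) : Prop :=
  (forall (c : C) (phi psi : V -> C),
     test_fun Omega phi -> test_fun Omega psi ->
     T (fun x => c * phi x + psi x) = c * T phi + T psi) /\
  (forall D : set V, compact D -> D `<=` Omega ->
     exists (B : R) (m : nat), forall (phi : V -> C) (M : R),
       test_fun Omega phi ->
       (forall x, ~ D x -> phi x = 0) ->
       (forall (I : seq 'I_N) x, (size I <= m)%N ->
          Normc.normc (cpartial I phi x) <= M) ->
       Normc.normc (T phi) <= B * M).

Definition distr_of_fun (Omega : set V) (f : V -> C) : functional :=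
  fun phi => cintegral Omega (fun x => f x * phi x).

Definition smooth_distr (Omega : set V) (T : functional) : Prop :=
  exists g : V -> C, csmooth Omega g /\
    forall phi, test_fun Omega phi -> T phi = distr_of_fun Omega g phi.

Definition distr_supp (T : functional) : set V :=
  ~` \bigcup_(U in [set U : set V | open U /\
        forall phi, test_fun U phi -> T phi = 0]) U.

Definition hypoelliptic (P : functional -> functional) : Prop :=
  forall (Omega : set V) (T F : functional), open Omega ->
    distribution_on Omega T -> distribution_on Omega F ->
    (forall phi, test_fun Omega phi -> P T phi = F phi) ->
    smooth_distr Omega F -> smooth_distr Omega T.

End distributions.

Arguments functional : clear implicits.

(* Linear differential operators sum_k a_k d^(I_k) on R^N, with smooth complex
   coefficients. *)
Record diffop (R : realType) (N : nat) := DiffOp {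
  nterms : nat;
  coef : 'I_nterms -> 'rV[R]_N -> R[i];
  dindex : 'I_nterms -> seq 'I_N;
  coef_smooth : forall k, csmooth setT (coef k)
}.

Section diffop.
Context {R : realType} {N : nat}.
Local Notation V := 'rV[R]_N.
Local Notation C := R[i].
Variable L : diffop R N.

Definition diffop_fun (phi : V -> C) : V -> C :=
  fun x => \sum_(k < nterms L) coef k x * cpartial (dindex k) phi x.

(* The transpose for the pairing int f phi, obtained by integration by parts. *)
Definition transpose_fun (phi : V -> C) : V -> C :=
  fun x => \sum_(k < nterms L) (-1) ^+ size (dindex k) *
    cpartial (rev (dindex k)) (fun y => coef k y * phi y) x.

(* <L T, phi> = <T, L^t phi>, and <L^t T, phi> = <T, L phi> since L^tt = L. *)
Definition diffop_distr (T : functional R N) : functional R N :=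
  fun phi => T (transpose_fun phi).
Definition transpose_distr (T : functional R N) : functional R N :=
  fun phi => T (diffop_fun phi).

End diffop.

(* Carnot groups in exponential coordinates: G is R^N with a smooth group law
   of neutral element 0, and exp is the identity map, i.e. t |-> t x is the
   one-parameter subgroup of velocity x; in particular the inverse of x is - x.
   The Lie algebra is then the tangent space R^N at 0. *)

Section bracket.
Context {R : realType} {N : nat}.
Local Notation V := 'rV[R]_N.
Variable mul : V -> V -> V.

(* The left-invariant vector field with value X at 0. *)
Definition left_field (X : V) : V -> V := fun x => 'D_X (mul x) 0.

(* The commutator of the left-invariant fields of X and Y, evaluated at 0. *)
Definition lie_bracket (X Y : V) : V :=
  'D_X (left_field Y) 0 - 'D_Y (left_field X) 0.

End bracket.

Definition is_span {R : realType} {N : nat}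
    (U : {vspace 'rV[R]_N}) (A : set 'rV[R]_N) : Prop :=
  (forall x, A x -> x \in U) /\
  (forall W : {vspace 'rV[R]_N}, (forall x, A x -> x \in W) -> (U <= W)%VS).

(* The strata are [stratum 1], ..., [stratum step]. *)
Record carnot_group (R : realType) (N : nat) := CarnotGroup {
  gmul : 'rV[R]_N -> 'rV[R]_N -> 'rV[R]_N;
  step : nat;
  stratum : nat -> {vspace 'rV[R]_N};
  gmulA : associative gmul;
  gmul0l : left_id 0 gmul;
  gmul0r : right_id 0 gmul;
  gmul_smooth : smooth setT (fun z : 'rV[R]_N * 'rV[R]_N => gmul z.1 z.2);
  gmul_exp : forall (a b : R) x, gmul (a *: x) (b *: x) = (a + b) *: x;
  step_gt0 : (0 < step)%N;
  stratum_neq0 : forall i, (1 <= i <= step)%N -> stratum i != 0%VS;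
  stratum_direct : directv (\sum_(i < step) stratum i.+1);
  stratum_full : (\sum_(i < step) stratum i.+1)%VS = fullv;
  stratum_next : forall i, (1 <= i < step)%N ->
    is_span (stratum i.+1)
      [set lie_bracket gmul X Y | X in [set` stratum 1] & Y in [set` stratum i]];
  stratum_last : forall X Y, X \in stratum 1 -> Y \in stratum step ->
    lie_bracket gmul X Y = 0
}.

Section carnot.
Context {R : realType} {N : nat}.
Local Notation V := 'rV[R]_N.
Local Notation C := R[i].
Variable G : carnot_group R N.

Definition hom_dim : nat := (\sum_(i < step G) i.+1 * \dim (stratum G i.+1))%N.

Definition dilation (t : R) (x : V) : V :=
  \sum_(i < step G)
    t ^+ i.+1 *: sumv_pi (\sum_(i < step G) stratum G i.+1)%VS i x.

(* T o tau_alpha; left translations preserve Lebesgue measure. *)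
Definition distr_translate (alpha : V) (T : functional R N) : functional R N :=
  fun phi => T (fun x => phi (gmul G (- alpha) x)).

(* T o delta_t; the Jacobian determinant of delta_t is t^Q. *)
Definition distr_dilate (t : R) (T : functional R N) : functional R N :=
  fun phi => ((t ^- hom_dim)%:C)%C * T (fun x => phi (dilation t^-1 x)).

Definition left_invariant (P : functional R N -> functional R N) : Prop :=
  forall (alpha : V) (T : functional R N) (phi : V -> C),
    distribution_on setT T -> test_fun setT phi ->
    P (distr_translate alpha T) phi = distr_translate alpha (P T) phi.

Definition homogeneous (lambda : R) (P : functional R N -> functional R N) :
    Prop :=
  forall (t : R) (T : functional R N) (phi : V -> C), 0 < t ->
    distribution_on setT T -> test_fun setT phi ->
    P (distr_dilate t T) phi =
    ((t `^ lambda)%:C)%C * distr_dilate t (P T) phi.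

End carnot.

Section removability.
Context {R : realType} {N : nat}.
Local Notation V := 'rV[R]_N.
Local Notation C := R[i].
Variables (L : diffop R N) (p : R) (K : set V).

Definition removable : Prop :=
  forall Omega : set V, open Omega -> connected Omega -> Omega !=set0 ->
  forall f : V -> C, Lp_loc p Omega f ->
    (forall phi, test_fun (Omega `\` K) phi ->
       diffop_distr L (distr_of_fun Omega f) phi = 0) ->
    forall phi, test_fun Omega phi ->
      diffop_distr L (distr_of_fun Omega f) phi = 0.

Definition cutoff (psi : V -> C) : Prop :=
  test_fun setT psi /\
  exists U : set V, [/\ open U, K `<=` U & forall x, U x -> psi x = 1].

Definition kappa : \bar R :=
  ereal_sup [set y | exists (f psi : V -> C),
    [/\ Lp_loc p setT f, (Lp_norm p K f <= 1)%E,
        distr_supp (diffop_distr L (distr_of_fun setT f)) `<=` K,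
        cutoff psi &
        y = (Normc.normc (diffop_distr L (distr_of_fun setT f) psi))%:E]].

End removability.

(* Main.v *)
(* Write P for the transpose of L acting on functions, so that <L f, phi> = \int f P phi.

   (=>) If L f is supported in K, then a finite cover by bump functions shows that L f vanishes on test functions
   supported off K; removability with Omega the whole group gives L f = 0.

   (<=) Let f be a solution off K on Omega with <L f, phi> <> 0 for some test function phi. We look for g in L^p_loc
   of the whole group such that L g = phi L f: it is supported in K, and <L g, psi> = <L f, phi> for a cutoff psi equal
   to 1 near K and the support of phi, so a multiple of g shows that kappa > 0. If P had a fundamental solution, then
   P (phi eta) = phi P eta + [P, phi] eta with [P, phi] eta (y) = \int k(x, y) P eta (x) dx, and
   g = phi f + \int f(y) k(., y) dy would do, since k is a kernel with \int |k| dx and \int |k| dy locally bounded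
   (Schur test), the commutator being one order better than the fundamental solution.

   The fundamental solution is only needed in the form of an expansion. Hypoellipticity of the transpose of L and a
   gliding hump give the a priori estimate |psi| <= C ||P psi||_{C^m} on small balls, Hahn-Banach then gives E with
   E (P psi) = psi(0). Let D be a dilation such that D^-1 contracts by 1/2, a = t^lambda and q = t^Q its factors on P and on
   Lebesgue measure. The distribution a E (. o D) - E is annihilated by L, hence smooth, and summing its rescalings,
   which converges because a < q, makes E homogeneous up to a smooth function. Off 0 it is smooth, and cutting it
   dyadically gives psi(0) = \int gammaoo P psi + sum_j a^-j \int gamma(z) P psi(D^-j z) dz with gamma smooth, compactly
   supported and zero near 0. Translating to y and applying [P, phi] gives k as a series of pieces of size (q/2)^j
   living on |D^j (x^-1 y)| <= C, a set of measure O(q^-j): hence the Schur bounds. *)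

Require Import Defs.
From HB Require Import structures.
From mathcomp Require Import all_boot all_order fingroup perm all_algebra.
From mathcomp Require Import complex ring lra.
From mathcomp Require Import all_classical all_reals all_analysis.
From mathcomp Require Import measurable_realfun.

Set Implicit Arguments.
Unset Strict Implicit.
Unset Printing Implicit Defensive.

Import Order.TTheory GRing.Theory Num.Theory.
Import numFieldNormedType.Exports.

Local Open Scope classical_set_scope.
Local Open Scope ring_scope.

(** * Smooth functions *)

Section calculus.
Context {R : realType}.

(** The gain that the Schur test needs comes from one identity: at the point y, [P, phi] psi is P
    applied to (phi - phi(y)) psi. On the j-th piece, where x^-1 y = D^-j w with w bounded, the
    factor phi - phi(y) and its derivatives in w are O(2^-j), because D^-1 contracts by 1/2. This
    lowers the size q^j of the piece to (q/2)^j; integrated over a set of measure O(q^-j), it leaves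
    2^-j, which is summable whatever p is. The inequality a < q, that is lambda < Q, makes the
    corrections of E converge, and a > 1 makes the remainders a^-J of the truncated expansions
    vanish. Remainders are always carried with such a geometric rate, so the limits to be taken are
    limits of numbers and of functions, never of distributions. The a priori estimate is local, so E
    is only known near 0. The identity for an arbitrary test function is recovered by shrinking its
    support with D^k, and the finitely many pieces which this adds at large scales are the values of
    the single smooth function gammaoo on the support. *)

Lemma line_quotient (V W : normedModType R) (f : V -> W) (x v : V) (t : R) :
  (fun h : R => h^-1 *: ((f \o shift (x + t *: v)) (h *: v) - f (x + t *: v))) =
  (fun h : R => h^-1 *: (((fun s : R => f (x + s *: v)) \o shift t) (h *: (1:R^o)) - f (x + t *: v))).
Proof.
apply/funext => h /=; congr (_ *: (f _ - _)).
by change (h *: v + (x + t *: v) = x + (h * 1 + t) *: v); rewrite mulr1 scalerDl addrCA.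
Qed.

Lemma line_derivable (V W : normedModType R) (f : V -> W) (x v : V) (t : R) :
  derivable f (x + t *: v) v <-> derivable (fun s : R => f (x + s *: v)) t 1.
Proof. by rewrite /derivable line_quotient. Qed.

Lemma line_derive (V W : normedModType R) (f : V -> W) (x v : V) (t : R) :
  'D_v f (x + t *: v) = 'D_1 (fun s : R => f (x + s *: v)) t.
Proof. by rewrite /derive line_quotient. Qed.

Lemma line_is_derive (V W : normedModType R) (f : V -> W) (x v : V) (t : R) :
  derivable f (x + t *: v) v ->
  is_derive t (1:R) (fun s : R => f (x + s *: v)) ('D_v f (x + t *: v)).
Proof. by move=> /line_derivable fd; apply: DeriveDef => //; rewrite line_derive. Qed.

Lemma MVT_line (V : normedModType R) (f : V -> R) (x v : V) (c : R) :
  (forall s, `|s| <= `|c| -> derivable f (x + s *: v) v) ->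
  exists2 s, `|s| <= `|c| & f (x + c *: v) - f x = c * 'D_v f (x + s *: v).
Proof.
move=> fd; pose g s := f (x + s *: v).
have gd s : `|s| <= `|c| -> is_derive s (1:R) g ('D_v f (x + s *: v)).
  by move=> /fd; exact: line_is_derive.
have gc a b : (forall s, s \in `[a, b] -> `|s| <= `|c|) -> {within `[a, b], continuous g}.
  move=> H; apply: derivable_within_continuous => s /H /gd ?; exact: ex_derive.
have [c0|c0|c0] := ltgtP c 0.
- have [||s sI E] := @MVT R g (fun s => 'D_v f (x + s *: v)) c 0 c0.
  + move=> s; rewrite in_itv/= => /andP[cs s0]; apply: gd.
    by rewrite !ltr0_norm// lerN2 ltW.
  + apply: gc => s; rewrite in_itv/= => /andP[cs s0].
    by rewrite ler0_norm// ltr0_norm// lerN2.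
  move: sI; rewrite in_itv/= => /andP[cs s0]; exists s.
    by rewrite !ltr0_norm// lerN2 ltW.
  move: E; rewrite /g scale0r addr0 sub0r => E.
  by rewrite -opprB E mulrN opprK mulrC.
- have [||s sI E] := @MVT R g (fun s => 'D_v f (x + s *: v)) 0 c c0.
  + move=> s; rewrite in_itv/= => /andP[cs s0]; apply: gd.
    by rewrite !gtr0_norm// ltW.
  + apply: gc => s; rewrite in_itv/= => /andP[cs s0].
    by rewrite ger0_norm// gtr0_norm.
  move: sI; rewrite in_itv/= => /andP[cs s0]; exists s.
    by rewrite !gtr0_norm// ltW.
  by move: E; rewrite /g scale0r addr0 subr0 => ->; rewrite mulrC.
- by exists 0; rewrite ?normr0// c0 scale0r addr0 subrr mul0r.
Qed.

Lemma rV_coord_le n (x : 'rV[R]_n) i : `|x ord0 i| <= `|x|.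
Proof.
rewrite [leRHS]/Num.Def.normr/= mx_normrE.
exact: (le_bigmax _ (fun j : 'I_1 * 'I_n => `|x j.1 j.2|) (ord0, i)).
Qed.

Lemma rV_norm_le n (x : 'rV[R]_n) (M : R) : 0 <= M ->
  (forall i, `|x ord0 i| <= M) -> `|x| <= M.
Proof.
move=> M0 H; rewrite /Num.Def.normr/= mx_normrE bigmax_le // => -[i j] _ /=.
by rewrite (ord1 i).
Qed.

Lemma rV_norm_delta n (i : 'I_n) : `|delta_mx ord0 i : 'rV[R]_n| = 1.
Proof.
apply/eqP; rewrite eq_le; apply/andP; split.
  by apply: rV_norm_le => // j; rewrite mxE /=; case: (j == i); rewrite ?normr1 ?normr0.
by have := rV_coord_le (delta_mx ord0 i : 'rV[R]_n) i; rewrite mxE !eqxx /= normr1.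
Qed.

Lemma rV_linear_lipschitz n (W : normedModType R) (f : {linear 'rV[R]_n -> W}) :
  exists2 C, 0 <= C & forall x, `|f x| <= C * `|x|.
Proof.
exists (\sum_(i < n) `|f (delta_mx ord0 i)|); first exact: sumr_ge0.
move=> x; rewrite [x in `|f x|]row_sum_delta raddf_sum /= mulr_suml.
apply: le_trans (ler_norm_sum _ _ _) _; apply: ler_sum => i _.
by rewrite linearZ /= normrZ mulrC ler_wpM2l// rV_coord_le.
Qed.

Lemma rV_linear_continuous n (W : normedModType R) (f : {linear 'rV[R]_n -> W}) :
  continuous f.
Proof.
have [C C0 Cf] := rV_linear_lipschitz f.
apply: bounded_linear_continuous; apply/linear_boundedP; near=> r => x.
apply: le_trans (Cf x) _; rewrite ler_wpM2r//; near: r; exact: nbhs_pinfty_ge.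
Unshelve. all: by end_near. Qed.

Definition lin_form n (c : 'I_n -> R) (h : 'rV[R]_n) : R^o := \sum_i h ord0 i * c i.
Lemma lin_form_linear n (c : 'I_n -> R) : linear (lin_form c).
Proof.
move=> a x y; rewrite /lin_form scaler_sumr -big_split /=; apply: eq_bigr => i _.
by rewrite !mxE mulrDl /GRing.scale /= mulrA.
Qed.
HB.instance Definition _ n c := GRing.isLinear.Build R 'rV[R]_n R^o *:%R
  (@lin_form n c) (@lin_form_linear n c).

(** One goes from [a] to [a + h] through the points [p k], changing one coordinate at a time. The
    mean value theorem on each of the n segments compares the increment with the partial derivative
    at [a], up to an oscillation at most [e / n.+1]. *)
Lemma C1_differentiable n (f : 'rV[R]_n -> R) (a : 'rV[R]_n) :
  (\forall x \near a, forall i, derivable f x (delta_mx ord0 i)) ->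
  (forall i, {for a, continuous ('D_(delta_mx ord0 i) f)}) ->
  differentiable f a.
Proof.
move=> fd fc.
pose c i := 'D_(delta_mx ord0 i) f a.
have H : f \o shift a = cst (f a) + (lin_form c : _ -> R^o) +o_ (0 : 'rV[R]_n) id.
  apply/eqaddoP => /= e e0.
  have e'0 : 0 < e / n.+1%:R by rewrite divr_gt0.
  have : \forall x \near a, forall i, derivable f x (delta_mx ord0 i) /\
     `|'D_(delta_mx ord0 i) f x - c i| <= e / n.+1%:R.
    near=> x => i; split; first by move: i; near: x.
    move: i; near: x; apply: filter_forall => i.
    have /cvgrPdist_le/(_ _ e'0) := fc i; apply: filterS => x; by rewrite distrC.
  move=> /nbhs_ballP[d /= d0 Hd].
  near=> h.
  have hd : `|h| < d by near: h; apply/nbhs_ballP; exists d => // y; rewrite -ball_normE /ball_ /= sub0r normrN.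
  pose p k : 'rV[R]_n := a + \row_i (if (i < k)%N then h ord0 i else 0).
  have p0 : p 0%N = a by rewrite /p (_ : \row_i _ = 0) ?addr0//; apply/rowP => i; rewrite !mxE.
  have pn : p n = h + a by rewrite /p addrC; congr (_ + _); apply/rowP => i; rewrite !mxE ltn_ord.
  have pS (k : 'I_n) : p k.+1 = p k + h ord0 k *: delta_mx ord0 k.
    rewrite /p -addrA; congr (_ + _); apply/rowP => i; rewrite !mxE /= ltnS leq_eqVlt.
    have [->|ik] := eqVneq i k; first by rewrite !eqxx ltnn mulr1 add0r.
    by rewrite (negbTE (_ : val i != val k)) //= mulr0 addr0.
  have st (k : 'I_n) : `|f (p k.+1) - f (p k) - h ord0 k * c k| <= `|h| * (e / n.+1%:R).
    have pb s : `|s| <= `|h ord0 k| -> ball a d (p k + s *: delta_mx ord0 k).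
      move=> sh; rewrite -ball_normE /ball_ /=; apply: le_lt_trans hd.
      rewrite /p -addrA opprD addNKr normrN; apply: rV_norm_le => // i; rewrite !mxE /=.
      have [->|ik] := eqVneq i k.
        rewrite ltnn add0r mulr1; exact: le_trans sh (rV_coord_le _ _).
      rewrite mulr0 addr0; case: ifP => _; [exact: rV_coord_le|by rewrite normr0].
    have [|s sh E] := @MVT_line _ f (p k) (delta_mx ord0 k) (h ord0 k).
      by move=> s /pb /Hd /(_ k)[].
    rewrite pS E -mulrBr normrM; apply: ler_pM => //; first exact: rV_coord_le.
    by have := Hd _ (pb _ sh) k => -[].
  have -> : (f \o shift a - (cst (f a) + (lin_form c : _ -> R^o))) h =
     \sum_(k < n) (f (p k.+1) - f (p k) - h ord0 k * c k).
    rewrite big_split /= sumrN -(big_mkord xpredT (fun k => f (p k.+1) - f (p k))) telescope_sumr// p0 pn.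
    by rewrite !fctE /= /lin_form opprD addrA.
  apply: le_trans (ler_norm_sum _ _ _) _.
  apply: le_trans (ler_sum _ (fun k _ => st k)) _.
  rewrite sumr_const card_ord -mulrnAr mulrC ler_wpM2r//.
  by rewrite -mulr_natr -mulrA ler_piMr ?(ltW e0)// mulrC ler_pdivrMr// mul1r ler_nat.
have dE := diff_unique (@rV_linear_continuous _ _ (lin_form c)) H.
apply/diff_locallyP; split; first by rewrite dE; exact: rV_linear_continuous.
by rewrite dE.
Unshelve. all: by end_near. Qed.

End calculus.

(** * Closure properties of smooth functions *)

Section smooth_calculus.
Context {R : realType}.

Section locality.
Variables (V W : normedModType R) (Om : set V).
Hypothesis oOm : open Om.

Lemma open_near (P : V -> Prop) x : Om x -> (forall y, Om y -> P y) -> \forall y \near x, P y.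
Proof. by move=> Ox H; have := open_nbhs_nbhs (conj oOm Ox); apply: filterS. Qed.

Lemma iter_derive_eq_on (f g : V -> W) : (forall x, Om x -> f x = g x) ->
  forall vs x, Om x -> iter_derive vs f x = iter_derive vs g x.
Proof.
move=> fg; elim=> [|v vs IH] x Ox /=; first exact: fg.
by apply: near_eq_derive; exact: open_near.
Qed.

Lemma continuous_eq_on (f g : V -> W) x : (forall x, Om x -> f x = g x) ->
  Om x -> {for x, continuous f} -> {for x, continuous g}.
Proof.
move=> fg Ox fc; rewrite /prop_for /continuous_at -fg//.
apply: cvg_trans fc; apply: near_eq_cvg; exact: open_near.
Qed.

Lemma derivable_eq_on (f g : V -> W) x v : (forall x, Om x -> f x = g x) ->
  Om x -> derivable f x v -> derivable g x v.
Proof. by move=> fg Ox; apply: near_eq_derivable; exact: open_near. Qed.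

(** Coinduction principle: [smooth] speaks of all iterated derivatives, and a class stable under
    derivation, whose members are continuous and derivable, replaces formulas for them. Stability is
    only asked up to equality on [Om]. *)
Lemma smooth_coind (C : (V -> W) -> Prop) :
  (forall f, C f -> forall x, Om x ->
    {for x, continuous f} /\ forall v, derivable f x v) ->
  (forall f v, C f -> exists2 g, C g & forall x, Om x -> 'D_v f x = g x) ->
  forall f, C f -> smooth Om f.
Proof.
move=> C1 C2 f Cf vs; suff [g Cg fg] : exists2 g, C g & forall x, Om x -> g x = iter_derive vs f x.
  move=> x Ox; have [gc gd] := C1 _ Cg _ Ox; split; first exact: continuous_eq_on gc.
  by move=> v; exact: derivable_eq_on (gd v).
elim: vs => [|v vs [g Cg fg]]; first by exists f.
have [g' Cg' gg'] := C2 _ v Cg; exists g' => // x Ox /=.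
by rewrite -gg'//; apply: near_eq_derive; apply: open_near.
Qed.

Lemma smooth_eq_on (f g : V -> W) : (forall x, Om x -> f x = g x) -> smooth Om f -> smooth Om g.
Proof.
move=> fg sf vs x Ox; have [fc fd] := sf vs x Ox.
have H := iter_derive_eq_on fg vs.
split; first exact: continuous_eq_on fc.
by move=> v; exact: derivable_eq_on (fd v).
Qed.

End locality.

Lemma smooth_derive (V W : normedModType R) (Om : set V) (f : V -> W) v :
  smooth Om f -> smooth Om ('D_v f).
Proof.
move=> sf vs x Ox; have := sf (rcons vs v) x Ox.
by rewrite /iter_derive foldr_rcons.
Qed.

Lemma smooth_iter_derive (V W : normedModType R) (Om : set V) (f : V -> W) vs :
  smooth Om f -> smooth Om (iter_derive vs f).
Proof. by move=> sf; elim: vs => //= v vs; exact: smooth_derive. Qed.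

Lemma smooth_subset (V W : normedModType R) (Om Om' : set V) (f : V -> W) :
  Om' `<=` Om -> smooth Om f -> smooth Om' f.
Proof. by move=> O sf vs x /O; exact: sf. Qed.

Lemma smooth_local (V W : normedModType R) (Om : set V) (f : V -> W) :
  (forall x, Om x -> exists2 U, U x & smooth U f) -> smooth Om f.
Proof. by move=> H vs x /H[U Ux sU]; exact: sU. Qed.

Lemma smooth_cst (V W : normedModType R) (Om : set V) (c : W) : open Om -> smooth Om (fun _ : V => c).
Proof.
move=> oOm; apply: (@smooth_coind _ _ _ oOm (fun f => exists c, f = fun _ => c)); last by exists c.
  by move=> f [{}c ->] x _; split; [exact: cst_continuous|move=> v; exact: derivable_cst].
by move=> f v [{}c ->]; exists (fun _ => 0); [exists 0|move=> x _; exact: derive_cst].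
Qed.

Lemma smooth_continuous (V W : normedModType R) (Om : set V) (f : V -> W) x :
  smooth Om f -> Om x -> {for x, continuous f}.
Proof. by move=> sf Ox; exact: (sf [::] x Ox).1. Qed.

Lemma smooth_derivable (V W : normedModType R) (Om : set V) (f : V -> W) x v :
  smooth Om f -> Om x -> derivable f x v.
Proof. by move=> sf Ox; exact: (sf [::] x Ox).2. Qed.

Lemma smooth_differentiable n (Om : set 'rV[R]_n) (f : 'rV[R]_n -> R) x :
  open Om -> smooth Om f -> Om x -> differentiable f x.
Proof.
move=> oOm sf Ox; apply: C1_differentiable.
  by apply: (open_near oOm Ox) => y Oy i; exact: smooth_derivable sf Oy.
by move=> i; apply: (smooth_continuous (smooth_derive _ sf)).
Qed.

Lemma differentiable_rV (V : normedModType R) k (F : V -> 'rV[R]_k) x :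
  (forall i, differentiable (fun x => F x ord0 i) x) -> differentiable F x.
Proof.
move=> Fd; have -> : F = \sum_(i < k) (fun x => F x ord0 i *: delta_mx ord0 i).
  by apply/funext => y; rewrite fct_sumE [LHS]row_sum_delta.
apply: differentiable_sum => i; exact: differentiableZl.
Qed.

Lemma derive_rV (V : normedModType R) k (F : V -> 'rV[R]_k) x v i :
  differentiable F x -> ('D_v F x) ord0 i = 'D_v (fun x => F x ord0 i) x.
Proof. by move=> Fd; rewrite derive_mx ?mxE//; exact: diff_derivable. Qed.

Lemma derive_comp_rV (V : normedModType R) k (F : V -> 'rV[R]_k) (g : 'rV[R]_k -> R) x v :
  (forall i, differentiable (fun x => F x ord0 i) x) -> differentiable g (F x) ->
  'D_v (g \o F) x = \sum_i 'D_v (fun x => F x ord0 i) x * 'D_(delta_mx ord0 i) g (F x).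
Proof.
move=> /differentiable_rV Fd gd.
rewrite deriveE; last exact: differentiable_comp.
rewrite diff_comp//= -(deriveE _ Fd) [in LHS](row_sum_delta ('D_v F x)) linear_sum; apply: eq_bigr => i _.
by rewrite linearZ /= -(deriveE _ gd) derive_rV.
Qed.

Lemma smooth_linear n (W : normedModType R) (Om : set 'rV[R]_n) (f : {linear 'rV[R]_n -> W}) :
  open Om -> smooth Om f.
Proof.
move=> oOm.
apply: (@smooth_coind _ _ _ oOm (fun g => (exists c, g = fun _ => c) \/ g = f)); last by right.
  move=> g [[c ->]|->] x _; first by split; [exact: cst_continuous|move=> v; exact: derivable_cst].
  split; first exact: rV_linear_continuous.
  by move=> v; apply/diff_derivable/linear_differentiable/rV_linear_continuous.
move=> g v [[c ->]|->]; first by exists (fun _ => 0); [left; exists 0|move=> x _; exact: derive_cst].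
exists (fun _ => f v); first by left; exists (f v).
have fd x := @linear_differentiable _ _ _ f x (@rV_linear_continuous _ _ _ f).
by move=> x _; rewrite deriveE// diff_lin//; exact: rV_linear_continuous.
Qed.

Lemma smooth_coord n (Om : set 'rV[R]_n) i : open Om -> smooth Om (fun x => x ord0 i : R).
Proof.
move=> oOm.
have H : (fun x : 'rV[R]_n => x ord0 i) = lin_form (fun j => (j == i)%:R).
  apply/funext => x; rewrite /lin_form (bigD1 i)//= eqxx mulr1 big1 ?addr0// => j /negbTE ->.
  by rewrite mulr0.
by rewrite H; exact: smooth_linear.
Qed.

Local Opaque smooth.

Section algebra.
Variables (n : nat) (Om : set 'rV[R]_n).
Hypothesis oOm : open Om.
Local Notation V := 'rV[R]_n.

(** The derivative of [g \o F] is a sum of products of smooth functions and compositions, that of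
    1/f is a product of -1, f' and two factors 1/f. Closing these generators under sums and products
    gives a class stable under derivation, to which [smooth_coind] applies. *)
Inductive smooth_alg : (V -> R) -> Prop :=
| salg_smooth (f : V -> R) : smooth Om f -> smooth_alg f
| salg_comp k (Om' : set 'rV[R]_k) (F : V -> 'rV[R]_k) (g : 'rV[R]_k -> R) : open Om' ->
    (forall i, smooth Om (fun x => F x ord0 i)) -> smooth Om' g ->
    (forall x, Om x -> Om' (F x)) -> smooth_alg (g \o F)
| salg_inv (f : V -> R) : smooth Om f -> (forall x, Om x -> f x != 0) -> smooth_alg (fun x => (f x)^-1)
| salg_add f g : smooth_alg f -> smooth_alg g -> smooth_alg (fun x => f x + g x)
| salg_mul f g : smooth_alg f -> smooth_alg g -> smooth_alg (fun x => f x * g x).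

Lemma smooth_alg_differentiable f : smooth_alg f -> forall x, Om x -> differentiable f x.
Proof.
elim=> {f} [f sf x Ox|k Om' F g oOm' sF sg FO x Ox|f sf f0 x Ox|f g _ df _ dg x Ox|f g _ df _ dg x Ox].
- exact: smooth_differentiable sf Ox.
- apply: differentiable_comp.
    by apply: differentiable_rV => i; exact: smooth_differentiable (sF i) Ox.
  exact: smooth_differentiable sg (FO _ Ox).
- by apply: differentiableV; [exact: smooth_differentiable sf Ox|exact: f0].
- by apply: (@differentiableD _ _ _ f g); [exact: df|exact: dg].
- by apply: (@differentiableM _ _ f g); [exact: df|exact: dg].
Qed.

Lemma smooth_algP f : smooth_alg f -> smooth Om f.
Proof.
apply: (@smooth_coind _ _ _ oOm) => {}f.
  move=> af x Ox; have df := smooth_alg_differentiable af Ox; split.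
    exact: differentiable_continuous.
  by move=> v; exact: diff_derivable.
move=> v; elim=> {f} [f sf|k Om' F g oOm' sF sg FO|f sf f0|f g af [f' af' ff'] ag [g' ag' gg']|
   f g af [f' af' ff'] ag [g' ag' gg']].
- by exists ('D_v f) => //; exact/salg_smooth/smooth_derive.
- exists (fun x => \sum_(i <- index_enum 'I_k) 'D_v (fun x => F x ord0 i) x * ('D_(delta_mx ord0 i) g \o F) x).
    elim: (index_enum _) => [|i s IH].
      rewrite (_ : (fun _ => _) = fun _ => 0); first exact/salg_smooth/smooth_cst.
      by apply/funext => x; rewrite big_nil.
    rewrite (_ : (fun _ => _) = (fun x => 'D_v (fun x => F x ord0 i) x * ('D_(delta_mx ord0 i) g \o F) x
        + \sum_(i <- s) 'D_v (fun x => F x ord0 i) x * ('D_(delta_mx ord0 i) g \o F) x)).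
      apply: salg_add => //; apply: salg_mul; first exact/salg_smooth/smooth_derive.
      exact: salg_comp oOm' sF (smooth_derive _ sg) FO.
    by apply/funext => x; rewrite big_cons.
  move=> x Ox; rewrite derive_comp_rV//.
    by move=> i; exact: smooth_differentiable (sF i) Ox.
  exact: smooth_differentiable sg (FO _ Ox).
- exists (fun x => -1 * ((f x)^-1 * ((f x)^-1 * 'D_v f x))).
    apply: salg_mul; first exact/salg_smooth/smooth_cst.
    apply: salg_mul; first exact: salg_inv.
    apply: salg_mul; first exact: salg_inv.
    exact/salg_smooth/smooth_derive.
  move=> x Ox; rewrite deriveV; [|exact: f0|exact: smooth_derivable sf Ox].
  by rewrite mulN1r mulrA -invfM -expr2 /GRing.scale /= mulNr.
- exists (fun x => f' x + g' x); first exact: salg_add.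
  move=> x Ox; rewrite -ff'// -gg'//; apply: (@deriveD _ _ _ f g); apply: diff_derivable.
    exact: smooth_alg_differentiable af _ Ox.
  exact: smooth_alg_differentiable ag _ Ox.
- exists (fun x => f x * g' x + g x * f' x).
    by apply: salg_add; exact: salg_mul.
  move=> x Ox; rewrite -ff'// -gg'//; apply: (@deriveM _ _ f g); apply: diff_derivable.
    exact: smooth_alg_differentiable af _ Ox.
  exact: smooth_alg_differentiable ag _ Ox.
Qed.

Lemma smoothD (f g : V -> R) : smooth Om f -> smooth Om g -> smooth Om (fun x => f x + g x).
Proof. by move=> sf sg; apply/smooth_algP/salg_add; exact: salg_smooth. Qed.

Lemma smoothM (f g : V -> R) : smooth Om f -> smooth Om g -> smooth Om (fun x => f x * g x).
Proof. by move=> sf sg; apply/smooth_algP/salg_mul; exact: salg_smooth. Qed.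

Lemma smoothN (f : V -> R) : smooth Om f -> smooth Om (fun x => - f x).
Proof.
move=> sf; rewrite (_ : (fun _ => _) = (fun x => -1 * f x)).
  exact: (smoothM (smooth_cst (-1 : R) oOm) sf).
by apply/funext => x; rewrite mulN1r.
Qed.

Lemma smoothB (f g : V -> R) : smooth Om f -> smooth Om g -> smooth Om (fun x => f x - g x).
Proof. by move=> sf sg; exact: (smoothD sf (smoothN sg)). Qed.

Lemma smooth_sum (I : Type) (s : seq I) (P : pred I) (f : I -> V -> R) :
  (forall i, P i -> smooth Om (f i)) -> smooth Om (fun x => \sum_(i <- s | P i) f i x).
Proof.
move=> sf; elim: s => [|i s IH].
  by rewrite (_ : (fun _ => _) = fun _ => 0); [exact: smooth_cst|apply/funext => x; rewrite big_nil].
rewrite (_ : (fun _ => _) = fun x => (if P i then f i x else 0) + \sum_(i <- s | P i) f i x).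
  apply: smoothD IH; case: (P i) (sf i) => [/(_ isT)//|_]; exact: smooth_cst.
by apply/funext => x; rewrite big_cons; case: ifP; rewrite ?add0r.
Qed.

Lemma smooth_prod (I : Type) (s : seq I) (P : pred I) (f : I -> V -> R) :
  (forall i, P i -> smooth Om (f i)) -> smooth Om (fun x => \prod_(i <- s | P i) f i x).
Proof.
move=> sf; elim: s => [|i s IH].
  by rewrite (_ : (fun _ => _) = fun _ => 1); [exact: smooth_cst|apply/funext => x; rewrite big_nil].
rewrite (_ : (fun _ => _) = fun x => (if P i then f i x else 1) * \prod_(i <- s | P i) f i x).
  apply: smoothM IH; case: (P i) (sf i) => [/(_ isT)//|_]; exact: smooth_cst.
by apply/funext => x; rewrite big_cons; case: ifP; rewrite ?mul1r.
Qed.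

Lemma smooth_comp k (Om' : set 'rV[R]_k) (F : V -> 'rV[R]_k) (g : 'rV[R]_k -> R) : open Om' ->
  (forall i, smooth Om (fun x => F x ord0 i)) -> smooth Om' g ->
  (forall x, Om x -> Om' (F x)) -> smooth Om (fun x => g (F x)).
Proof. by move=> *; apply/smooth_algP; exact: (salg_comp (Om' := Om')). Qed.

Lemma smoothV (f : V -> R) : smooth Om f -> (forall x, Om x -> f x != 0) -> smooth Om (fun x => (f x)^-1).
Proof. by move=> *; apply/smooth_algP; exact: salg_inv. Qed.

End algebra.
Local Transparent smooth.

(** The two difference quotients are the same function of [h], because the inner map is linear. *)
Lemma derive_linear_comp (V V' W : normedModType R) (f : V' -> W) (L : {linear V -> V'}) v x :
  'D_v (f \o L) x = 'D_(L v) f (L x).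
Proof.
rewrite /derive; suff -> : (fun h : R => h^-1 *: (((f \o L) \o shift x) (h *: v) - (f \o L) x)) =
  (fun h => h^-1 *: ((f \o shift (L x)) (h *: L v) - f (L x))) by [].
by apply/funext => h /=; rewrite [L (_ + _)]linearD [L (_ *: _)]linearZ.
Qed.

Lemma iter_derive_linear_comp (V V' W : normedModType R) (f : V' -> W) (L : {linear V -> V'}) vs :
  iter_derive vs (f \o L) = iter_derive (map L vs) f \o L.
Proof.
by elim: vs => //= v vs ->; apply/funext => x; rewrite derive_linear_comp.
Qed.

Lemma derivable_linear_comp (V V' W : normedModType R) (f : V' -> W) (L : {linear V -> V'}) v x :
  derivable f (L x) (L v) -> derivable (f \o L) x v.
Proof.
rewrite /derivable; suff -> : (fun h : R => h^-1 *: ((f \o shift (L x)) (h *: L v) - f (L x))) =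
  (fun h => h^-1 *: (((f \o L) \o shift x) (h *: v) - (f \o L) x)) by [].
by apply/funext => h /=; rewrite [L (_ + _)]linearD [L (_ *: _)]linearZ.
Qed.

Lemma smooth_linear_comp (V V' W : normedModType R) (Om : set V') (f : V' -> W) (L : {linear V -> V'}) :
  continuous L -> smooth Om f -> smooth (L @^-1` Om) (f \o L).
Proof.
move=> Lc sf vs x Ox; rewrite iter_derive_linear_comp; split.
  by apply: continuous_comp; [exact: Lc|exact: (sf _ _ Ox).1].
by move=> v; apply: derivable_linear_comp; exact: (sf _ _ Ox).2.
Qed.

End smooth_calculus.

Local Opaque smooth derive.

(** * Pointwise bounds on all derivatives up to a given order *)

Section bounds.
Context {R : realType}.

Lemma geometric_cvg (a : nat -> R) (C rho : R) (m : nat) : 0 < rho < 1 ->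
  (forall k, (m <= k)%N -> `|a k.+1 - a k| <= C * rho ^+ k) ->
  exists l : R, a @ \oo --> l /\
    forall k, (m <= k)%N -> `|a k - l| <= C / (1 - rho) * rho ^+ k.
Proof.
move=> /andP[r0 r1] H.
have r1' : 0 < 1 - rho by rewrite subr_gt0.
have C0 : 0 <= C.
  by have := le_trans (normr_ge0 _) (H m (leqnn _)); rewrite pmulr_lge0// exprn_gt0.
have st k j : (m <= k)%N -> `|a (k + j)%N - a k| <= C / (1 - rho) * rho ^+ k.
  (* The bound with the difference of the two powers is the one that induction on [j] preserves. *)
  move=> mk; suff : `|a (k + j)%N - a k| <= C / (1 - rho) * (rho ^+ k - rho ^+ (k + j)).
    move=> /le_trans; apply; rewrite ler_wpM2l ?divr_ge0 ?(ltW r1')//.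
    by rewrite lerBlDr lerDl exprn_ge0// ltW.
  elim: j => [|j IH]; first by rewrite addn0 !subrr normr0 mulr0.
  rewrite addnS -(subrKA (a (k + j)%N)).
  apply: le_trans (ler_normD _ _) _.
  have := lerD (H (k + j)%N (leq_trans mk (leq_addr _ _))) IH.
  move=> /le_trans; apply; rewrite le_eqVlt; apply/orP; left; apply/eqP.
  by rewrite exprS; field; rewrite gt_eqF.
have r_to0 : rho ^+ k @[k --> \oo] --> (0 : R).
  by apply: cvg_expr; rewrite ger0_norm// ltW.
have B_to0 : C / (1 - rho) * rho ^+ k @[k --> \oo] --> (0 : R).
  by rewrite -[X in _ --> X](mulr0 (C / (1 - rho))); apply: cvgM => //; exact: cvg_cst.
have ca : cvgn a.
  apply/cauchy_cvgP/cauchy_exP => e e0.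
  have /cvgr0_norm_lt/(_ _ e0) Be := B_to0.
  near \oo => k; exists (a k); exists k => // j /= kj.
  rewrite -ball_normE /ball_ /= -(subnKC kj) distrC.
  apply: le_lt_trans (st k (j - k)%N _) _; first by near: k; exact: nbhs_infty_ge.
  by apply: le_lt_trans (ler_norm _) _; near: k.
have [l al] := (cvg_ex _).1 ca; exists l; split => // k mk.
apply/ler_addgt0Pr => e e0.
have /cvgrPdist_le/(_ _ e0)[N _ HN] := al.
have := HN (k + N)%N (leq_addl _ _) => /= HN'.
rewrite -(subrKA (a (k + N)%N)) (le_trans (ler_normD _ _))// lerD//.
  by rewrite distrC; exact: st.
by rewrite distrC.
Unshelve. all: by end_near. Qed.

(** Directions range over the whole unit ball and not only over coordinate vectors: a linear
    contraction sends admissible directions to admissible ones, so composing with it keeps the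
    bound. *)
Definition dbound (V : normedModType R) (m : nat) (f : V -> R) (x : V) (M : R) :=
  forall vs, (size vs <= m)%N -> all (fun v => `|v| <= 1) vs ->
    `|iter_derive vs f x| <= M.

Lemma dboundW (V : normedModType R) m (f : V -> R) x M : dbound m f x M -> `|f x| <= M.
Proof. by move=> /(_ [::]); exact. Qed.

Lemma dbound_le (V : normedModType R) m m' (f : V -> R) x M M' :
  (m' <= m)%N -> M <= M' -> dbound m f x M -> dbound m' f x M'.
Proof.
move=> mm MM' fM vs vm va; apply: le_trans (MM'); exact: (fM vs (leq_trans vm mm) va).
Qed.

Lemma dbound_derive (V : normedModType R) m (f : V -> R) x v M :
  `|v| <= 1 -> dbound m.+1 f x M -> dbound m ('D_v f) x M.
Proof.
move=> v1 fM vs vm va; have := fM (rcons vs v).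
rewrite /iter_derive foldr_rcons size_rcons all_rcons v1 va; exact.
Qed.

Section open_set.
Variables (n : nat) (Om : set 'rV[R]_n).
Hypothesis oOm : open Om.
Local Notation V := 'rV[R]_n.

Lemma iter_deriveD (f g : V -> R) vs x : smooth Om f -> smooth Om g -> Om x ->
  iter_derive vs (fun y => f y + g y) x = iter_derive vs f x + iter_derive vs g x.
Proof.
move=> sf sg; elim: vs x => [//|v vs IH] x Ox /=.
rewrite -(@deriveD _ _ _ _ _ x v (smooth_derivable (smooth_iter_derive vs sf) Ox) (smooth_derivable (smooth_iter_derive vs sg) Ox)).
apply: near_eq_derive; exact: (open_near oOm Ox).
Qed.

Lemma iter_deriveZ (f : V -> R) (c : R) vs x : smooth Om f -> Om x ->
  iter_derive vs (fun y => c * f y) x = c * iter_derive vs f x.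
Proof.
move=> sf; elim: vs x => [//|v vs IH] x Ox /=.
rewrite -[RHS](@deriveZ _ _ _ _ c x v (smooth_derivable (smooth_iter_derive vs sf) Ox)).
apply: near_eq_derive; exact: (open_near oOm Ox).
Qed.

Lemma iter_deriveB (f g : V -> R) vs x : smooth Om f -> smooth Om g -> Om x ->
  iter_derive vs (fun y => f y - g y) x = iter_derive vs f x - iter_derive vs g x.
Proof.
move=> sf sg Ox.
rewrite (@iter_derive_eq_on _ _ _ _ oOm _ (fun y => f y + -1 * g y))//; last by move=> y _; rewrite mulN1r.
have sNg : smooth Om (fun y => -1 * g y) := smoothM oOm (smooth_cst (-1 : R) oOm) sg.
by rewrite (iter_deriveD vs sf sNg Ox) (iter_deriveZ (-1) vs sg Ox) mulN1r.
Qed.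

Lemma iter_derive_sum (I : Type) (s : seq I) (f : I -> V -> R) vs x :
  (forall i, smooth Om (f i)) -> Om x ->
  iter_derive vs (fun y => \sum_(i <- s) f i y) x = \sum_(i <- s) iter_derive vs (f i) x.
Proof.
move=> sf Ox; elim: s => [|i s IH].
  rewrite big_nil (@iter_derive_eq_on _ _ _ _ oOm _ (fun _ => 0 * 0 : R))//.
    by rewrite (iter_deriveZ 0 vs (smooth_cst (0 : R) oOm) Ox) mul0r.
  by move=> y _; rewrite big_nil mul0r.
rewrite big_cons -IH -(iter_deriveD _ (sf i) _ Ox).
  by apply: (iter_derive_eq_on oOm) => // y _; rewrite big_cons.
by apply: (smooth_sum oOm) => j _; exact: sf.
Qed.

Lemma derive_sum_coord (f : V -> R) v x : smooth Om f -> Om x ->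
  'D_v f x = \sum_(i < n) v ord0 i * 'D_(delta_mx ord0 i) f x.
Proof.
move=> sf Ox; have fd := smooth_differentiable oOm sf Ox.
rewrite deriveE// [in LHS](row_sum_delta v) linear_sum; apply: eq_bigr => i _.
by rewrite linearZ /= -deriveE.
Qed.

Lemma iter_derive_rcons (f : V -> R) vs v x : smooth Om f -> Om x ->
  iter_derive (rcons vs v) f x =
  \sum_(i < n) v ord0 i * iter_derive vs ('D_(delta_mx ord0 i) f) x.
Proof.
move=> sf Ox; rewrite /iter_derive foldr_rcons -/(iter_derive _ _).
rewrite (@iter_derive_eq_on _ _ _ _ oOm _
  (fun y => \sum_(i <- index_enum 'I_n) v ord0 i * 'D_(delta_mx ord0 i) f y) _ vs x Ox); last first.
  by move=> y Oy; rewrite (derive_sum_coord _ sf Oy).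
have sD i : smooth Om ('D_(delta_mx ord0 i) f) by exact: smooth_derive.
have sM i : smooth Om (fun y => v ord0 i * 'D_(delta_mx ord0 i) f y).
  exact: (smoothM oOm (smooth_cst (v ord0 i) oOm) (sD i)).
rewrite (iter_derive_sum _ _ sM Ox).
by apply: eq_bigr => i _; rewrite (iter_deriveZ _ _ (sD i) Ox).
Qed.

Lemma dboundS m (f : V -> R) x M0 (M : 'I_n -> R) : smooth Om f -> Om x ->
  `|f x| <= M0 -> (forall i, dbound m ('D_(delta_mx ord0 i) f) x (M i)) ->
  dbound m.+1 f x (M0 + \sum_i M i).
Proof.
move=> sf Ox f0 fi vs; case: (lastP vs) => [_ _|{}vs v].
  rewrite /= (le_trans f0)// lerDl sumr_ge0// => i _.
  exact: le_trans (normr_ge0 _) (dboundW (fi i)).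
rewrite size_rcons ltnS all_rcons => vm /andP[v1 va].
rewrite (iter_derive_rcons vs v sf Ox) -[leLHS]add0r lerD ?(le_trans _ f0)//.
apply: le_trans (ler_norm_sum _ _ _) _; apply: ler_sum => i _.
rewrite normrM -[M i]mul1r ler_pM//; last exact: fi.
exact: le_trans (rV_coord_le _ _) v1.
Qed.

(** A direction of norm at most 1 is a combination of the n coordinate vectors with coefficients at
    most 1. Passing from partial derivatives to arbitrary directions thus costs one factor [n.+1]
    per order. *)
Lemma coord_dbound m (f : V -> R) x M : smooth Om f -> Om x ->
  (forall I : seq 'I_n, (size I <= m)%N -> `|iter_derive [seq delta_mx ord0 i : V | i <- I] f x| <= M) ->
  dbound m f x (M * n.+1%:R ^+ m).
Proof.
elim: m f => [|m IH] f sf Ox fM.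
  by move=> vs; rewrite leqn0 size_eq0 => /eqP-> _; rewrite expr0 mulr1; exact: (fM [::]).
have M0 : 0 <= M by have := fM [::] isT; exact: le_trans.
have H i : dbound m ('D_(delta_mx ord0 i) f) x (M * n.+1%:R ^+ m).
  apply: (IH _ (smooth_derive _ sf) Ox) => I Im; have := fM (rcons I i); rewrite size_rcons map_rcons.
  by rewrite /iter_derive foldr_rcons; exact.
apply: dbound_le (dboundS sf Ox (fM [::] isT) H) => //.
have T1 : 1 <= n.+1%:R ^+ m :> R by rewrite exprn_ege1// ler1n.
rewrite sumr_const card_ord exprS -[_ *+ _]mulr_natr; move: (n.+1%:R ^+ m) T1 => T T1.
rewrite -natr1 (_ : M * ((n%:R + 1) * T) = M * T + M * T * n%:R); last by ring.
by rewrite lerD2r; exact: ler_peMr.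
Qed.

(** By the product rule each derivative doubles the number of terms, whence [2 ^+ m]. *)
Lemma dboundM m (f g : V -> R) x Mf Mg : smooth Om f -> smooth Om g -> Om x ->
  dbound m f x Mf -> dbound m g x Mg -> dbound m (fun y => f y * g y) x (2 ^+ m * (Mf * Mg)).
Proof.
elim: m f g => [|m IH] f g sf sg Ox fM gM vs.
  rewrite leqn0 size_eq0 => /eqP-> _ /=; rewrite expr0 mul1r normrM.
  by rewrite ler_pM//; [exact: (dboundW fM)|exact: (dboundW gM)].
have Mf0 : 0 <= Mf by exact: le_trans (normr_ge0 _) (dboundW fM).
have Mg0 : 0 <= Mg by exact: le_trans (normr_ge0 _) (dboundW gM).
case: (lastP vs) => [_ _|{}vs v].
  apply: (@le_trans _ _ (1 * (Mf * Mg))); last first.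
    by rewrite ler_wpM2r ?mulr_ge0// exprn_ege1// ler1n.
  by rewrite /= mul1r normrM ler_pM//; [exact: (dboundW fM)|exact: (dboundW gM)].
rewrite size_rcons ltnS all_rcons => vm /andP[v1 va].
rewrite /iter_derive foldr_rcons -/(iter_derive _ _).
have sf' : smooth Om ('D_v f) by exact: smooth_derive.
have sg' : smooth Om ('D_v g) by exact: smooth_derive.
rewrite (@iter_derive_eq_on _ _ _ _ oOm _ (fun y => f y * 'D_v g y + 'D_v f y * g y) _ vs x Ox); last first.
  move=> y Oy; have := (@deriveM _ _ f g y v (smooth_derivable sf Oy) (smooth_derivable sg Oy)).
  by move=> /= ->; rewrite /GRing.scale /= [g y * _]mulrC.
rewrite (iter_deriveD _ (smoothM oOm sf sg') (smoothM oOm sf' sg) Ox).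
apply: le_trans (ler_normD _ _) _; rewrite exprS -mulrA mulr_natl mulr2n lerD//.
  apply: (IH _ _ sf sg' Ox _ _ vs vm va); first by apply: dbound_le fM.
  exact: dbound_derive.
apply: (IH _ _ sf' sg Ox _ _ vs vm va); first exact: dbound_derive.
by apply: dbound_le gM.
Qed.

End open_set.

Lemma compact_bound (T : topologicalType) (D : set T) (f : T -> R) : compact D ->
  (forall x, D x -> {for x, continuous f}) ->
  exists2 M, 0 <= M & forall x, D x -> `|f x| <= M.
Proof.
move=> cD cf; have [D0|/set0P D0] := eqVneq D set0.
  by exists 0 => // x; rewrite D0.
have [|c /set_mem Dc H] := @compact_EVT_max T R (fun x => `|f x|) D D0 cD.
  apply: continuous_in_subspaceT => x /set_mem Dx.
  by apply: continuous_comp; [exact: cf|exact: norm_continuous].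
by exists `|f c| => // x Dx; apply: H; exact: mem_set.
Qed.

Lemma compact_dbound n (Om D : set 'rV[R]_n) m (f : 'rV[R]_n -> R) :
  open Om -> compact D -> D `<=` Om -> smooth Om f ->
  exists2 M, 0 <= M & forall x, D x -> dbound m f x M.
Proof.
move=> oOm cD DO; elim: m f => [|m IH] f sf.
  have [|M M0 HM] := @compact_bound _ D f cD.
    by move=> x /DO; exact: smooth_continuous.
  exists M => // x Dx vs; rewrite leqn0 size_eq0 => /eqP-> _; exact: HM.
have [|M M0 HM] := @compact_bound _ D f cD.
  by move=> x /DO; exact: smooth_continuous.
have /choice[Mi HMi] : forall i : 'I_n, exists Mi, 0 <= Mi /\ forall x, D x -> dbound m ('D_(delta_mx ord0 i) f) x Mi.
  by move=> i; have [|Mi ? ?] := IH ('D_(delta_mx ord0 i) f); [exact: smooth_derive|exists Mi].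
exists (M + \sum_i Mi i); first by rewrite addr_ge0// sumr_ge0// => i _; have [] := HMi i.
move=> x Dx; apply: (dboundS oOm sf (DO _ Dx)); first exact: HM.
by move=> i; have [_] := HMi i; exact.
Qed.

Lemma derive_scale_vec n (f : 'rV[R]_n -> R) c v x : differentiable f x ->
  'D_(c *: v) f x = c * 'D_v f x.
Proof. by move=> fd; rewrite !(deriveE _ fd) linearZ. Qed.

Lemma iter_derive_scale n (f : 'rV[R]_n -> R) c vs x : smooth setT f ->
  iter_derive (map ( *:%R c) vs) f x = c ^+ size vs * iter_derive vs f x.
Proof.
move=> sf; elim: vs x => [|v vs IH] x; first by rewrite expr0 mul1r.
have sD := smooth_iter_derive vs sf.
have E : iter_derive (map ( *:%R c) vs) f = (fun y => c ^+ size vs * iter_derive vs f y) by apply/funext.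
rewrite /= E (@deriveZ _ _ _ _ _ x _ (smooth_derivable sD (I : setT x))).
by rewrite (derive_scale_vec _ _ (smooth_differentiable openT sD I)) exprS /GRing.scale /= mulrCA mulrA.
Qed.

(** Rescaling: all vectors of [vs] are divided by a common [c] exceeding their norms, and the
    derivative is multilinear in its directions. *)
Lemma dbound_vec n (vs : seq 'rV[R]_n) : exists2 c, 0 < c &
  forall m (f : 'rV[R]_n -> R) x M, smooth setT f -> (size vs <= m)%N -> dbound m f x M ->
  `|iter_derive vs f x| <= c * M.
Proof.
pose c := 1 + \sum_(v <- vs) `|v|.
have c0 : 0 < c by rewrite ltr_pwDl// sumr_ge0.
exists (c ^+ size vs); first exact: exprn_gt0.
move=> m g x M sg vm gM.
have -> : vs = map ( *:%R c) (map ( *:%R c^-1) vs).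
  rewrite -map_comp -[LHS]map_id; apply: eq_map => v /=.
  by rewrite scalerA divff ?scale1r ?gt_eqF.
rewrite (iter_derive_scale _ _ _ sg) !size_map normrM ger0_norm; last by rewrite exprn_ge0 ?ltW.
rewrite ler_wpM2l ?exprn_ge0 ?(ltW c0)//; apply: gM; first by rewrite size_map.
rewrite all_map; apply/allP => v vvs /=; rewrite normrZ gtr0_norm ?invr_gt0// mulrC ler_pdivrMr// mul1r.
rewrite /c (big_rem v)//= addrA [1 + _]addrC -addrA lerDl addr_ge0// sumr_ge0//.
Qed.

(** Every derivative of [f \o L] brings a factor [r]; as [r <= 1], one factor is kept and the others
    are dropped, which is why order zero is excluded. This is the origin of the factors 2^-j in the
    estimates of the kernel. *)
Lemma dbound_contract n k (f : 'rV[R]_k -> R) (L : {linear 'rV[R]_n -> 'rV[R]_k}) r m x M vs :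
  smooth setT f -> 0 < r <= 1 -> (forall v, `|L v| <= r * `|v|) ->
  dbound m f (L x) M -> (0 < size vs <= m)%N -> all (fun v => `|v| <= 1) vs ->
  `|iter_derive vs (f \o L) x| <= r * M.
Proof.
move=> sf /andP[r0 r1] Lr fM /andP[vs0 vsm] va; rewrite iter_derive_linear_comp /=.
have -> : map L vs = map ( *:%R r) (map (fun v => r^-1 *: L v) vs).
  rewrite -map_comp; apply: eq_map => v /=.
  by rewrite scalerA divff ?scale1r ?gt_eqF.
rewrite (iter_derive_scale _ _ _ sf) !size_map normrM ger0_norm; last by rewrite exprn_ge0 ?ltW.
rewrite ler_pM ?exprn_ge0 ?(ltW r0)//.
  by case: (size vs) vs0 => // s _; rewrite exprS ger_pMr//; apply: exprn_ile1 => //; exact: ltW.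
apply: fM; first by rewrite size_map.
rewrite all_map; apply/allP => v /(allP va) /= v1.
by rewrite normrZ gtr0_norm ?invr_gt0// ler_pdivrMl// mulr1 (le_trans (Lr _))// ler_piMr// ltW.
Qed.

End bounds.

(** * Limits of geometrically convergent sequences of smooth functions *)

Section smooth_limit.
Context {R : realType}.

(** For a fixed step [h] the mean value theorem turns the difference quotient of [u k] into [u' k]
    at an intermediate point, where it is close to [g'] uniformly in [k]; then [k] goes to infinity
    before [h] goes to 0. *)
Lemma derive_limit (V : normedModType R) (u u' : nat -> V -> R) (g g' : V -> R) x v :
  (forall k y, is_derive y v (u k) (u' k y)) ->
  (forall y, u k y @[k --> \oo] --> g y) ->
  (forall e, 0 < e -> exists K, forall k s, (K <= k)%N -> `|s| <= 1 ->
     `|u' k (x + s *: v) - g' (x + s *: v)| <= e) ->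
  {for x, continuous g'} ->
  is_derive x v g (g' x).
Proof.
move=> ud ug unif g'c.
have key : h^-1 *: ((g \o shift x) (h *: v) - g x) @[h --> 0^'] --> g' x.
  apply/cvgrPdist_le => e e0.
  have e20 : 0 < e / 2 by rewrite divr_gt0.
  have [K HK] := unif _ e20.
  have /cvgrPdist_le/(_ _ e20)/nbhs_ballP[d /= d0 Hd] := g'c.
  have v1 : 0 < 1 + `|v| by rewrite ltr_pwDl.
  near=> h.
  have h0 : h != 0 by near: h; exact: nbhs_dnbhs_neq.
  have h1 : `|h| <= 1 by near: h; apply: dnbhs0_le.
  have hd : `|h| < d / (1 + `|v|) by near: h; apply: dnbhs0_lt; rewrite divr_gt0.
  have q k : (K <= k)%N -> `|g' x - h^-1 * (u k (x + h *: v) - u k x)| <= e.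
    move=> Kk; have [|s sh ->] := @MVT_line _ _ (u k) x v h.
      by move=> s _; have [] := ud k (x + s *: v).
    rewrite (@derive_val _ _ _ _ _ _ _ (ud k _)) mulrA mulVf// mul1r -(subrKA (g' (x + s *: v))) [e]splitr.
    apply: le_trans (ler_normD _ _) _; apply: lerD.
      apply: Hd; rewrite -ball_normE /ball_ /= opprD addNKr normrN normrZ.
      rewrite (le_lt_trans (ler_wpM2r (normr_ge0 _) sh))//.
      move: hd; rewrite ltr_pdivlMr//; apply: le_lt_trans.
      by rewrite ler_wpM2l// lerDr.
    by rewrite distrC; apply: HK => //; exact: le_trans h1.
  have cv : h^-1 * (u k (x + h *: v) - u k x) @[k --> \oo] --> h^-1 * (g (x + h *: v) - g x).
    by apply: cvgM; [exact: cvg_cst|apply: cvgB; exact: ug].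
  rewrite /= [h *: v + x]addrC.
  apply/ler_addgt0Pr => a a0.
  have /cvgrPdist_le/(_ _ a0)[N _ HN] := cv.
  have := HN (K + N)%N (leq_addl _ _) => /= HN'.
  rewrite -(subrKA (h^-1 * (u (K + N)%N (x + h *: v) - u (K + N)%N x))).
  apply: le_trans (ler_normD _ _) _; apply: lerD; first exact: q (leq_addr _ _).
  by rewrite distrC.
by apply: DeriveDef; [apply/cvg_ex; exists (g' x)|exact: cvg_lim].
Unshelve. all: by end_near. Qed.

Lemma continuous_limit (V : normedModType R) (u : nat -> V -> R) (g : V -> R) x :
  (forall k, {for x, continuous (u k)}) ->
  (forall e, 0 < e -> exists k, forall y, `|x - y| <= 1 -> `|u k y - g y| <= e) ->
  {for x, continuous g}.
Proof.
move=> uc H; apply/cvgrPdist_le => e e0.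
have e30 : 0 < e / 3 by rewrite divr_gt0.
have [k Hk] := H _ e30.
have /cvgrPdist_le/(_ _ e30) ukc := uc k.
have : \forall y \near x, `|x - y| <= 1.
  by apply/nbhs_ballP; exists 1 => [/=|y]; [exact: ltr01|rewrite -ball_normE => /ltW].
apply: filterS2 ukc => y h1 h2.
rewrite (_ : g x - g y = (u k x - u k y) - (u k x - g x) + (u k y - g y)); last by ring.
rewrite (_ : e = e / 3 + e / 3 + e / 3); last by field.
apply: le_trans (ler_normD _ _) _; apply: lerD; last exact: Hk.
apply: le_trans (ler_normB _ _) _; apply: lerD => //.
by apply: Hk; rewrite subrr normr0.
Qed.

Lemma geometric_small (C rho e : R) m : 0 < rho < 1 -> 0 < e ->
  exists K, (m <= K)%N /\ forall k, (K <= k)%N -> C * rho ^+ k <= e.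
Proof.
move=> /andP[r0 r1] e0.
have : C * rho ^+ k @[k --> \oo] --> (0 : R).
  rewrite -[X in _ --> X](mulr0 C); apply: cvgM; first exact: cvg_cst.
  by apply: cvg_expr; rewrite ger0_norm// ltW.
move=> /cvgrPdist_le/(_ _ e0)[N _ HN]; exists (m + N)%N; split; first exact: leq_addr.
move=> k Nk; have /= := HN k (leq_trans (leq_addl _ _) Nk).
by rewrite sub0r normrN; exact: le_trans (ler_norm _).
Qed.

(** The estimate of order [m] is only asked from the rank [k = m] on. This suits the gliding hump,
    whose k-th term is controlled up to an order at least k and not beyond. *)
Lemma smooth_geometric_limit n (f : nat -> 'rV[R]_n -> R) (rho : R) : 0 < rho < 1 ->
  (forall k, smooth setT (f k)) ->
  (forall m r, exists C, forall k, (m <= k)%N -> forall x, `|x| <= r ->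
    dbound m (fun y => f k.+1 y - f k y) x (C * rho ^+ k)) ->
  exists2 g, smooth setT g & forall m r, exists C, forall k, (m <= k)%N ->
    forall x, `|x| <= r -> dbound m (fun y => f k y - g y) x (C * rho ^+ k).
Proof.
move=> rho01 sf H.
have Hvs (vs : seq 'rV[R]_n) r : exists C, forall k, (size vs <= k)%N -> forall x, `|x| <= r ->
    `|iter_derive vs (f k.+1) x - iter_derive vs (f k) x| <= C * rho ^+ k.
  have [C HC] := H (size vs) r; have [c c0 cvs] := dbound_vec vs.
  exists (c * C) => k vk x xr; rewrite -(iter_deriveB openT vs (sf k.+1) (sf k) I) -mulrA.
  by apply: (cvs (size vs) _ x _ (smoothB openT (sf k.+1) (sf k)) (leqnn _)); exact: HC.
(* Limits are chosen at once for all iterated derivatives at all points; [gd] and [gE] then show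
   that they are the iterated derivatives of the limit [g [::]]. *)
have /choice[G HG] : forall vsx : seq 'rV[R]_n * 'rV[R]_n, exists l : R,
    iter_derive vsx.1 (f k) vsx.2 @[k --> \oo] --> l.
  move=> [vs x]; have [C HC] := Hvs vs `|x|.
  have [l [lP _]] := @geometric_cvg _ (fun k => iter_derive vs (f k) x) C rho (size vs) rho01
    (fun k vk => HC k vk x (lexx _)).
  by exists l.
pose g vs x := G (vs, x).
have gP vs x : iter_derive vs (f k) x @[k --> \oo] --> g vs x by exact: HG (vs, x).
have rate (vs : seq 'rV[R]_n) r : exists C, forall k, (size vs <= k)%N -> forall x, `|x| <= r ->
    `|iter_derive vs (f k) x - g vs x| <= C * rho ^+ k.
  have [C HC] := Hvs vs r; exists (C / (1 - rho)) => k vk x xr.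
  have [l [lP /(_ k vk)]] := @geometric_cvg _ (fun k => iter_derive vs (f k) x) C rho (size vs) rho01
    (fun k vk => HC k vk x xr).
  by rewrite -(cvg_lim _ lP)// (cvg_lim _ (gP vs x)).
have gc vs x : {for x, continuous (g vs)}.
  apply: (@continuous_limit _ (fun k => iter_derive vs (f k))).
    by move=> k; exact: smooth_continuous (smooth_iter_derive vs (sf k)) I.
  move=> e e0; have [C HC] := rate vs (`|x| + 1).
  have [K [vK HK]] := geometric_small C (size vs) rho01 e0.
  exists K => y xy; apply: le_trans (HC K vK y _) (HK K (leqnn _)).
  rewrite -[y](subrK x) addrC (le_trans (ler_normD _ _))// lerD2l//.
  by rewrite distrC.
have gd vs v x : is_derive x v (g vs) (g (v :: vs) x).
  apply: (@derive_limit _ (fun k => iter_derive vs (f k)) (fun k => iter_derive (v :: vs) (f k))).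
  - move=> k y; apply: DeriveDef => //.
    exact: smooth_derivable (smooth_iter_derive vs (sf k)) I.
  - by move=> y; exact: gP.
  - move=> e e0; have [C HC] := rate (v :: vs) (`|x| + `|v|).
    have [K [vK HK]] := geometric_small C (size (v :: vs)) rho01 e0.
    exists K => k s Kk s1; apply: le_trans (HC k (leq_trans vK Kk) _ _) (HK k Kk).
    by rewrite (le_trans (ler_normD _ _))// lerD2l normrZ ler_piMl.
  - exact: gc.
have gE vs : iter_derive vs (g [::]) = g vs.
  elim: vs => [//|v vs IH]; apply/funext => x /=; rewrite IH.
  exact: (@derive_val _ _ _ _ _ _ _ (gd vs v x)).
have sg : smooth setT (g [::]).
  apply: (@smooth_coind _ _ _ setT openT (fun h => exists vs, h = g vs)); last by exists [::].
    move=> h [vs ->] x _; split; first exact: gc.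
    by move=> v; have [] := gd vs v x.
  move=> h v [vs ->]; exists (g (v :: vs)); first by exists (v :: vs).
  by move=> x _; exact: (@derive_val _ _ _ _ _ _ _ (gd vs v x)).
exists (g [::]) => // m r; have [C HC] := H m r.
exists (C / (1 - rho)) => k mk x xr vs vm va.
rewrite (iter_deriveB openT vs (sf k) sg I) gE.
have [|l [lP /(_ k mk)]] := @geometric_cvg _ (fun k => iter_derive vs (f k) x) C rho m rho01.
  move=> j mj; rewrite -(iter_deriveB openT vs (sf j.+1) (sf j) I).
  exact: HC.
by rewrite -(cvg_lim _ lP)// (cvg_lim _ (gP vs x)).
Qed.

End smooth_limit.

(** * Lebesgue measure on R^n *)

Section lebesgue_rV_theory.
Context {R : realType}.

Definition pushforward_measure d1 d2 (X : measurableType d1) (Y : measurableType d2)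
    (mu : {measure set X -> \bar R}) (phi : X -> Y) (mphi : measurable_fun [set: X] phi) :
    {measure set Y -> \bar R} :=
  measure_function_pushforward__canonical__measure_function_Measure mu mphi.

Lemma measurable_box n (A : 'I_n -> set R) : (forall i, measurable (A i)) ->
  measurable [set x : 'rV[R]_n | forall i, A i (x ord0 i)].
Proof.
move=> mA; rewrite (_ : [set _ | _] =
    \bigcap_(i in [set: 'I_n]) ((fun x : 'rV[R]_n => x ord0 i) @^-1` A i)).
  apply: fin_bigcap_measurable => // i _.
  by rewrite -[X in measurable X]setTI; exact: measurable_coord.
by apply/seteqP; split => x /= H i; [move=> _|]; exact: H.
Qed.

(** The sigma-algebra is the one generated by the coordinates, so openness has to be reduced to it:
    an open set is the countable union of the boxes with rational centre and side 2/(k+1) that it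
    contains. *)
Lemma open_measurable_rV n (U : set 'rV[R]_n) : open U -> measurable U.
Proof.
move=> oU.
pose box (qk : {ffun 'I_n -> rat} * nat) : set 'rV[R]_n :=
  [set x | forall i, `](ratr (qk.1 i) - qk.2.+1%:R^-1), (ratr (qk.1 i) + qk.2.+1%:R^-1)[%classic (x ord0 i)].
have -> : U = \bigcup_qk (if `[< box qk `<=` U >] then box qk else set0).
  apply/seteqP; split => [x Ux|x [qk _]]; last by case: asboolP => // H /H.
  have /nbhs_ballP[d /= d0 dU] := open_nbhs_nbhs (conj oU Ux).
  have [k kd] : exists k : nat, k.+1%:R^-1 < d / 2 :> R.
    have d20 : 0 < d / 2 by rewrite divr_gt0.
    exists (Num.truncn (d / 2)^-1); rewrite invf_plt ?posrE//; exact: truncnS_gt.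
  have /choice[q Hq] : forall i, exists q : rat, ratr q \in `](x ord0 i - k.+1%:R^-1), (x ord0 i + k.+1%:R^-1)[.
    move=> i; apply: rat_in_itvoo; rewrite ltrBlDr -addrA ltrDl.
    by rewrite addr_gt0// invr_gt0 ltr0n.
  have qE i : `|x ord0 i - ratr (q i)| < k.+1%:R^-1.
    by have := Hq i; rewrite in_itv/= distrC ltr_distl.
  exists ([ffun i => q i], k) => //; case: asboolP => [_|[]].
    by move=> i; rewrite /= ffunE in_itv/= -ltr_distl; exact: qE.
  move=> y Hy; apply: dU; rewrite -ball_normE /ball_ /=.
  apply: le_lt_trans (_ : k.+1%:R^-1 + k.+1%:R^-1 < _); last first.
    by rewrite [ltRHS]splitr ltrD.
  apply: rV_norm_le; first by rewrite addr_ge0// invr_ge0.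
  move=> i; rewrite !mxE -(subrKA (ratr (q i))) (le_trans (ler_normD _ _))// lerD//.
    exact: ltW.
  by have := Hy i; rewrite /= ffunE in_itv/= -ltr_distl distrC => /ltW.
apply: countable_bigcupT_measurable => // qk; case: ifP => _ //.
exact: (@measurable_box n (fun i => `](ratr (qk.1 i) - qk.2.+1%:R^-1), (ratr (qk.1 i) + qk.2.+1%:R^-1)[%classic)).
Qed.

Lemma closed_measurable_rV n (U : set 'rV[R]_n) : closed U -> measurable U.
Proof. by move/closed_openC/open_measurable_rV/measurableC; rewrite setCK. Qed.

Lemma rV_hausdorff n : hausdorff_space 'rV[R]_n.
Proof. exact: norm_hausdorff. Qed.

Lemma compact_closed_rV n (D : set 'rV[R]_n) : compact D -> closed D.
Proof. by apply: compact_closed; exact: rV_hausdorff. Qed.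

Lemma compact_measurable_rV n (D : set 'rV[R]_n) : compact D -> measurable D.
Proof. by move=> /compact_closed_rV/closed_measurable_rV. Qed.

Lemma continuous_measurable_rV n (f : 'rV[R]_n -> R) : continuous f -> measurable_fun setT f.
Proof.
move=> /continuousP cf; apply: (measurability _ (RGenOpens.measurableE R)).
move=> _ [_ [a [b ->] <-]]; rewrite setTI; apply: open_measurable_rV.
exact/cf/interval_open.
Qed.

Lemma continuous_measurable_pair n m (f : 'rV[R]_(n + m) -> R) : continuous f ->
  measurable_fun [set: 'rV[R]_n * 'rV[R]_m] (fun z => f (row_mx z.1 z.2)).
Proof.
move=> cf; apply: (measurableT_comp (continuous_measurable_rV cf)).
apply: measurable_fun_rV => i; case: (splitP i) => j ij.
  rewrite (_ : (fun _ => _) = (fun x : 'rV[R]_n => x ord0 j) \o fst).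
    by apply: measurableT_comp; [exact: measurable_coord|exact: measurable_fst].
  by apply/funext => z /=; rewrite (_ : i = lshift m j) ?row_mxEl//; exact/val_inj.
rewrite (_ : (fun _ => _) = (fun x : 'rV[R]_m => x ord0 j) \o snd).
  by apply: measurableT_comp; [exact: measurable_coord|exact: measurable_snd].
by apply/funext => z /=; rewrite (_ : i = rshift n j) ?row_mxEr//; exact/val_inj.
Qed.

Lemma lebesgue_translate (c : R) (A : set R) : measurable A ->
  lebesgue_measure ((fun t => t + c) @^-1` A) = lebesgue_measure A.
Proof.
move=> mA.
have mc : measurable_fun [set: measurableTypeR R] (fun t : measurableTypeR R => (t + c : measurableTypeR R)).
  by apply: measurable_funD; [exact: measurable_id|exact: measurable_cst].
rewrite [RHS](@lebesgue_measure_unique R (pushforward_measure lebesgue_measure mc))//.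
move=> _ [[a b] _ <-]; rewrite /= /pushforward.
rewrite (_ : _ @^-1` _ = `](a - c), (b - c)]%classic); last first.
  by apply/seteqP; split => t /=; rewrite !in_itv/= ltrBlDr lerBrDr.
rewrite !lebesgue_measure_itv/= !lte_fin ltrD2r; case: ifP => // _.
by rewrite -!EFinD; congr (_%:E); ring.
Qed.

(** Boxes are stable under intersection and generate the sigma-algebra, and the cubes [g k] exhaust
    the space with finite measure. *)
Lemma measure_rV_unique n (mu : {measure set 'rV[R]_n -> \bar R}) :
  (forall A : 'I_n -> set R, (forall i, measurable (A i)) ->
     mu [set x | forall i, A i (x ord0 i)] = (\prod_(i < n) lebesgue_measure (A i))%E) ->
  forall A, measurable A -> lebesgue_rV n A = mu A.
Proof.
move=> H.
pose G : set (set 'rV[R]_n) := [set B : set 'rV[R]_n | exists2 A : 'I_n -> set R, (forall i, measurable (A i)) &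
   B = [set x : 'rV[R]_n | forall i, A i (x ord0 i)]].
pose g (k : nat) : set 'rV[R]_n := [set x | forall i, `[- k%:R, k%:R]%classic (x ord0 i)].
apply: (@measure_unique _ _ _ G g).
- apply/seteqP; split => [A mA|]; last first.
    apply: smallest_sub; first exact: sigma_algebra_measurable.
    by move=> _ [A mA ->]; exact: measurable_box.
  (* It is enough that the identity be measurable from the sigma-algebra generated by boxes to that
     of the coordinates, and this is checked on one coordinate at a time. *)
  suff : measurable_fun [set: g_sigma_algebraType G] (id : g_sigma_algebraType G -> 'rV[R]_n).
    by move=> /(_ measurableT _ mA); rewrite setTI preimage_id.
  apply: measurable_fun_rV => i _ B mB; rewrite setTI.
  apply: sub_sigma_algebra; exists (fun j => if j == i then B else setT).
    by move=> j; case: ifP.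
  by apply/seteqP; split => x /=; [move=> Bx j; case: eqP => // ->|move=> /(_ i); rewrite eqxx].
- move=> _ _ [A mA ->] [B mB ->]; exists (fun i => A i `&` B i); first by move=> i; exact: measurableI.
  apply/seteqP; split => x /=; first by move=> [Ax Bx] i; split.
  by move=> ABx; split=> i; have [] := ABx i.
- by move=> k; exists (fun=> `[- k%:R, k%:R]%classic).
- apply/seteqP; split => // x _; exists (Num.truncn `|x|).+1 => // i.
  rewrite /= in_itv/= -ler_norml; apply/ltW/(le_lt_trans (rV_coord_le _ _)).
  exact: truncnS_gt.
- by move=> _ [A mA ->]; rewrite [RHS]H//; exact: lebesgue_rV_box.
- move=> k; rewrite [X in (X < _)%E](_ : _ = (\prod_(i < n) lebesgue_measure (`[- k%:R, k%:R]%classic%R : set R))%E); last first.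
    exact: (@lebesgue_rV_box R n (fun=> `[- k%:R, k%:R]%classic)).
  rewrite (eq_bigr (fun=> (k%:R + k%:R)%:E)).
    suff -> : forall m (c : R), (\prod_(i < m) c%:E)%E = (c ^+ m)%:E by exact: ltry.
    by elim=> [|m IH] c; [rewrite big_ord0 expr0|rewrite big_ord_recl IH exprS EFinM].
  move=> i _; rewrite lebesgue_measure_itv/= lte_fin; case: ltP => [_|].
    by rewrite -EFinD opprK.
  rewrite le_eqVlt => /orP[/eqP k0|]; last by rewrite ltNge ge0_cp.
  have -> : k%:R = 0 :> R by have : k%:R = - k%:R :> R by []; lra.
  by rewrite addr0.
Qed.

Lemma measurable_translate n (v : 'rV[R]_n) : measurable_fun [set: 'rV[R]_n] (fun x : 'rV[R]_n => x + v).
Proof.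
apply: measurable_fun_rV => i.
rewrite (_ : (fun _ => _) = fun x : 'rV[R]_n => x ord0 i + v ord0 i).
  by apply: measurable_funD; [exact: measurable_coord|exact: measurable_cst].
by apply/funext => x; rewrite mxE.
Qed.

Lemma lebesgue_rV_translate n (v : 'rV[R]_n) A : measurable A ->
  lebesgue_rV n ((fun x => x + v) @^-1` A) = lebesgue_rV n A.
Proof.
move=> mA; rewrite [RHS](@measure_rV_unique n (pushforward_measure (lebesgue_rV n) (measurable_translate v)))//.
move=> {mA}A mA; rewrite /= /pushforward.
rewrite (_ : _ @^-1` _ = [set x : 'rV[R]_n | forall i, ((fun t => t + v ord0 i) @^-1` A i) (x ord0 i)]).
  transitivity (\prod_(i < n) lebesgue_measure ((fun t => (t + v ord0 i)%R) @^-1` A i))%E; last first.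
    by apply: eq_bigr => i _; exact: lebesgue_translate.
  apply: (@lebesgue_rV_box R n (fun i => (fun t => t + v ord0 i) @^-1` A i)).
  move=> i; rewrite -[X in measurable X]setTI.
  have mc : measurable_fun [set: R] (fun t : R => t + v ord0 i).
    by apply: measurable_funD; [exact: measurable_id|exact: measurable_cst].
  exact: mc.
by apply/seteqP; split => x /= H i; have := H i; rewrite mxE.
Qed.

Lemma measurable_linear n m (M : {linear 'rV[R]_n -> 'rV[R]_m}) : measurable_fun [set: 'rV[R]_n] M.
Proof.
apply: measurable_fun_rV => i; apply: continuous_measurable_rV => x.
apply: (@continuous_comp _ _ _ M (fun y : 'rV[R]_m => y ord0 i)).
  exact: rV_linear_continuous.
exact: coord_continuous.
Qed.

Definition unit_cube n : set 'rV[R]_n := [set x | forall i, `]0, 1]%classic (x ord0 i)].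

Local Arguments unit_cube : clear implicits.

Lemma measurable_unit_cube n : measurable (unit_cube n).
Proof. exact: (@measurable_box n (fun=> `]0, 1]%classic)). Qed.

Lemma lebesgue_unit_cube n : lebesgue_rV n (unit_cube n) = 1%E.
Proof.
rewrite (@lebesgue_rV_box R n (fun=> `]0, 1]%classic))// big1// => i _.
by rewrite lebesgue_measure_itv/= lte_fin ltr01 oppr0 adde0.
Qed.

(* Both sides are the measure of the same set of pairs, computed by slicing in the two directions:
   translation invariance of nu and mu makes nu proportional to mu. *)
Lemma lebesgue_rV_linear_mul n (M M' : {linear 'rV[R]_n -> 'rV[R]_n}) (A B : set 'rV[R]_n) :
  cancel M' M -> measurable A -> measurable B ->
  (lebesgue_rV n (M @^-1` A) * lebesgue_rV n B = lebesgue_rV n (M @^-1` B) * lebesgue_rV n (-%R @^-1` A))%E.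
Proof.
move=> MK mA mB; pose mu : {sigma_finite_measure set 'rV[R]_n -> \bar R} := lebesgue_rV n.
have mN : measurable_fun [set: 'rV[R]_n] (-%R : 'rV[R]_n -> 'rV[R]_n).
  apply: measurable_fun_rV => i.
  rewrite (_ : (fun _ => _) = fun x : 'rV[R]_n => - x ord0 i); last by apply/funext => x; rewrite mxE.
  by apply: measurableT_comp => //; exact: measurable_coord.
have mfst : measurable_fun [set: 'rV[R]_n * 'rV[R]_n] (M \o fst).
  by apply: measurableT_comp; [exact: measurable_linear|exact: measurable_fst].
have mdif (s : R) : measurable_fun [set: 'rV[R]_n * 'rV[R]_n] (fun z => M z.1 + s *: z.2).
  apply: measurable_fun_rV => i.
  rewrite (_ : (fun _ => _) = fun z : 'rV[R]_n * 'rV[R]_n => (M z.1) ord0 i + s * z.2 ord0 i).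
    apply: measurable_funD; first exact: (measurableT_comp (measurable_coord i) mfst).
    apply: measurable_funM; first exact: measurable_cst.
    exact: (measurableT_comp (measurable_coord i) measurable_snd).
  by apply/funext => z; rewrite !mxE.
have pre d (T : measurableType d) (f : T -> 'rV[R]_n) C : measurable_fun setT f -> measurable C -> measurable (f @^-1` C).
  by move=> mf mC; rewrite -[X in measurable X]setTI; exact: mf.
pose S : set ('rV[R]_n * 'rV[R]_n) := (M \o fst) @^-1` A `&` (fun z => M z.1 + 1 *: z.2) @^-1` B.
pose S' : set ('rV[R]_n * 'rV[R]_n) := (fun z => M z.1 + (-1) *: z.2) @^-1` A `&` (M \o fst) @^-1` B.
have mS : measurable S by apply: measurableI; exact: pre.
have mS' : measurable S' by apply: measurableI; exact: pre.
have SE : (\int[mu]_x (mu \o xsection S) x = lebesgue_rV n (M @^-1` A) * lebesgue_rV n B)%E.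
  rewrite (eq_integral (cst (mu B) \_ (M @^-1` A))).
    rewrite -integral_mkcond integral_cst; last exact: (pre _ _ _ _ (measurable_linear M) mA).
    exact: muleC.
  move=> x _; rewrite patchE /=; case: ifPn => [/set_mem Ax|/negP Ax].
    rewrite -(lebesgue_rV_translate (M x) mB); congr (mu _); apply/seteqP; split => y.
      by move=> /xsectionP[/= _]; rewrite scale1r addrC.
    by move=> /= H; apply/xsectionP; split => //=; rewrite scale1r addrC.
  rewrite (_ : xsection S x = set0) ?measure0//.
  by apply/seteqP; split => // y /xsectionP[/= H _]; apply: Ax; exact: mem_set.
have S'E : (\int[mu]_x (mu \o xsection S') x = lebesgue_rV n (M @^-1` B) * lebesgue_rV n (-%R @^-1` A))%E.
  rewrite (eq_integral (cst (mu (-%R @^-1` A)) \_ (M @^-1` B))).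
    rewrite -integral_mkcond integral_cst; last exact: (pre _ _ _ _ (measurable_linear M) mB).
    exact: muleC.
  move=> x _; rewrite patchE /=; case: ifPn => [/set_mem Bx|/negP Bx].
    have mNA : measurable (-%R @^-1` A) by exact: pre.
    rewrite -(lebesgue_rV_translate (- M x) mNA); congr (mu _); apply/seteqP; split => y.
      by move=> /xsectionP[/= + _]; rewrite scaleN1r opprB.
    by rewrite /= opprB => H; apply/xsectionP; split => //=; rewrite scaleN1r.
  rewrite (_ : xsection S' x = set0) ?measure0//.
  by apply/seteqP; split => // y /xsectionP[/= _ H]; apply: Bx; exact: mem_set.
have yS y : mu (ysection S y) = mu (ysection S' y).
  have mSy : measurable (ysection S' y) by exact: measurable_ysection.
  rewrite -(lebesgue_rV_translate (M' y) mSy); congr (mu _); apply/seteqP; split => x.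
    move=> /ysectionP[/= Ax]; rewrite scale1r => Bx; apply/ysectionP; split => /=.
      by rewrite linearD MK scaleN1r addrK.
    by rewrite linearD MK.
  move=> /ysectionP[/=]; rewrite linearD MK scaleN1r addrK => Ax Bx.
  by apply/ysectionP; split => //=; rewrite scale1r.
rewrite -SE -S'E -[LHS]/((mu \x mu)%E S) -[RHS]/((mu \x mu)%E S').
have E12 C : measurable C -> ((mu \x mu) C = (mu \x^ mu) C)%E.
  by move=> mC; apply: product_measure_unique => // D1 D2 m1 m2; exact: product_measure2E.
by rewrite !E12//= /product_measure2; apply: eq_integral => y _ /=; exact: yS.
Qed.

(** The case [M = id] of the identity above, with the unit cube as [B]. *)
Lemma lebesgue_rVN n (A : set 'rV[R]_n) : measurable A ->
  lebesgue_rV n (-%R @^-1` A) = lebesgue_rV n A.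
Proof.
move=> mA; have := @lebesgue_rV_linear_mul n idfun idfun A (unit_cube n) (fun=> erefl) mA (@measurable_unit_cube n).
by rewrite !preimage_id lebesgue_unit_cube mule1 mul1e.
Qed.

Lemma lebesgue_rV_linear n (M M' : {linear 'rV[R]_n -> 'rV[R]_n}) (A : set 'rV[R]_n) :
  cancel M' M -> measurable A ->
  (lebesgue_rV n (M @^-1` A) = lebesgue_rV n (M @^-1` unit_cube n) * lebesgue_rV n A)%E.
Proof.
move=> MK mA; have := lebesgue_rV_linear_mul MK mA (@measurable_unit_cube n).
by rewrite lebesgue_unit_cube mule1 lebesgue_rVN.
Qed.

End lebesgue_rV_theory.
Arguments unit_cube {R} n _.

(** * Integrals of compactly supported functions, translations and linear changes of variables *)

Section integrals.
Context {R : realType}.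
Implicit Types n k : nat.

Lemma continuous_compose (A B C : topologicalType) (f : A -> B) (g : B -> C) :
  continuous f -> continuous g -> continuous (fun x => g (f x)).
Proof. by move=> cf cg x; exact: (continuous_comp (cf x) (cg (f x))). Qed.

Lemma continuous_translate n (v : 'rV[R]_n) : continuous (fun x : 'rV[R]_n => x + v).
Proof. by move=> x; exact: (cvgD cvg_id (cvg_cst _)). Qed.

Lemma closed_ball_compact_rV n (r : R) : compact [set x : 'rV[R]_n | `|x| <= r].
Proof.
apply: bounded_closed_compact.
  by exists r; split => [|M rM x /= /le_trans]; [exact: num_real|apply; exact: ltW].
apply: (@closed_comp _ _ (fun x : 'rV[R]_n => `|x|) [set t | t <= r]); last exact: closed_le.
by move=> x _; exact: norm_continuous.
Qed.

Lemma compact_sub_ball n (D : set 'rV[R]_n) : compact D -> exists2 r, 0 < r & forall x, D x -> `|x| <= r.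
Proof.
move=> /compact_bounded[M [_ HM]]; exists (`|M| + 1); first by rewrite ltr_pwDr.
by move=> x Dx; apply: HM => //; rewrite ltr_pwDr// ler_norm.
Qed.

Lemma compact_finite_measure n (D : set 'rV[R]_n) : compact D -> (lebesgue_rV n D < +oo)%E.
Proof.
move=> cD; have [r r0 Dr] := compact_sub_ball cD.
pose B := [set x : 'rV[R]_n | forall i, `[- r, r]%classic (x ord0 i)].
have mB : measurable B by exact: (@measurable_box _ n (fun=> `[- r, r]%classic)).
apply: (@le_lt_trans _ _ (lebesgue_rV n B)).
  apply: le_measure; rewrite ?inE//; first exact: compact_measurable_rV.
  move=> x /Dr xr i; rewrite /= in_itv/= -ler_norml; exact: le_trans (rV_coord_le _ _) xr.
rewrite /B (@lebesgue_rV_box R n (fun=> `[- r, r]%classic))//.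
have H : forall m (c : R), (\prod_(i < m) c%:E)%E = (c ^+ m)%:E.
  by elim=> [|m IH] c; [rewrite big_ord0 expr0|rewrite big_ord_recl IH exprS EFinM].
rewrite (eq_bigr (fun=> (r + r)%:E)) ?H ?ltry// => i _.
by rewrite lebesgue_measure_itv/= lte_fin gt0_cp// -EFinD opprK.
Qed.

Lemma csupp_bounded n (D : set 'rV[R]_n) (f : 'rV[R]_n -> R) : compact D -> continuous f ->
  (forall x, ~ D x -> f x = 0) -> exists2 M, 0 <= M & forall x, `|f x| <= M.
Proof.
move=> cD cf f0; have [M M0 HM] := @compact_bound _ _ D f cD (fun x _ => cf x).
exists M => // x; have [/HM//|/f0->] := pselect (D x); by rewrite normr0.
Qed.

Lemma integrable_bounded_csupp n (D : set 'rV[R]_n) (f : 'rV[R]_n -> R) (M : R) : compact D ->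
  measurable_fun setT f -> (forall x, ~ D x -> f x = 0) -> (forall x, `|f x| <= M) ->
  (lebesgue_rV n).-integrable setT (EFin \o f).
Proof.
move=> cD mf f0 fM.
have -> : EFin \o f = (EFin \o f) \_ D.
  apply/funext => x; rewrite patchE; case: ifPn => //= /negP xD; rewrite f0// => Dx; apply: xD.
  exact: mem_set.
apply/integrable_restrict; rewrite ?setTI//; first exact: compact_measurable_rV.
apply: measurable_bounded_integrable.
- exact: compact_measurable_rV.
- exact: compact_finite_measure.
- exact: measurable_funTS.
- exists M; split; first exact: num_real.
  by move=> M' MM' x _; apply: le_trans (fM x) _; exact: ltW.
Qed.

Lemma integrable_csupp n (D : set 'rV[R]_n) (f : 'rV[R]_n -> R) : compact D -> continuous f ->
  (forall x, ~ D x -> f x = 0) -> (lebesgue_rV n).-integrable setT (EFin \o f).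
Proof.
move=> cD cf f0; have [M _ HM] := csupp_bounded cD cf f0.
apply: (integrable_bounded_csupp cD) => //; exact: continuous_measurable_rV.
Qed.

Lemma Rintegral_csupp_le n (D : set 'rV[R]_n) (f : 'rV[R]_n -> R) (M : R) : compact D -> continuous f ->
  (forall x, ~ D x -> f x = 0) -> (forall x, `|f x| <= M) ->
  `|\int[lebesgue_rV n]_x f x| <= M * fine (lebesgue_rV n D).
Proof.
move=> cD cf f0 fM; have If := integrable_csupp cD cf f0.
have mD := compact_measurable_rV cD.
apply: le_trans (le_normr_Rintegral _ If) _ => //.
have -> : \int[lebesgue_rV n]_x `|f x| = \int[lebesgue_rV n]_(x in D) `|f x|.
  rewrite [RHS]Rintegral_mkcond; apply: eq_Rintegral => x _; rewrite patchE; case: ifPn => // /negP xD.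
  by rewrite f0 ?normr0// => Dx; apply: xD; exact: mem_set.
rewrite -Rintegral_cst//; apply: le_Rintegral => //.
- by apply: integrable_norm; apply: integrableS If.
- apply: (@measurable_bounded_integrable _ _ _ _ (cst M)) => //.
    exact: compact_finite_measure.
  by exists `|M|; split => [|M' MM' x _]; [exact: num_real|exact: ltW].
Qed.

Lemma Rintegral_translate n (v : 'rV[R]_n) (D : set 'rV[R]_n) (f : 'rV[R]_n -> R) : compact D ->
  continuous f -> (forall x, ~ D x -> f x = 0) ->
  \int[lebesgue_rV n]_x f (x + v) = \int[lebesgue_rV n]_x f x.
Proof.
move=> cD cf f0; rewrite /Rintegral; congr fine.
have [r r0 Dr] := compact_sub_ball cD.
have mf : measurable_fun setT (EFin \o f).
  by apply/measurable_EFinP; exact: continuous_measurable_rV.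
have cfv : continuous (fun x : 'rV[R]_n => f (x + v)).
  exact: continuous_compose (@continuous_translate n v) cf.
have If' : (lebesgue_rV n).-integrable setT (EFin \o (fun x => f (x + v))).
  apply: (integrable_csupp (@closed_ball_compact_rV n (r + `|v|)) cfv) => x /= xr; apply: f0 => /Dr xvr; apply: xr.
  by rewrite -[x](addrK v) (le_trans (ler_normB _ _))// lerD2r.
have If : (lebesgue_rV n).-integrable ((fun x => x + v) @^-1` setT) ((EFin \o f) \o (fun x => x + v)).
  by rewrite preimage_setT.
have := integral_pushforward (measurable_translate v) mf If measurableT; rewrite preimage_setT => E.
rewrite -[LHS]E; apply: (@eq_measure_integral _ _ _ setT (lebesgue_rV n)
  (pushforward_measure (lebesgue_rV n) (measurable_translate v))) => A mA _.
exact: (lebesgue_rV_translate v mA).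
Qed.

(** The Jacobian factor of [M] enters as the measure [c] of the preimage of the unit cube rather
    than as a determinant: by [lebesgue_rV_linear], the image of Lebesgue measure under [M] is [c]
    times itself. *)
Lemma Rintegral_linear n (M M' : {linear 'rV[R]_n -> 'rV[R]_n}) (c : R) (D : set 'rV[R]_n) (f : 'rV[R]_n -> R) :
  cancel M M' -> cancel M' M -> lebesgue_rV n (M @^-1` unit_cube n) = c%:E ->
  compact D -> continuous f -> (forall x, ~ D x -> f x = 0) ->
  \int[lebesgue_rV n]_x f (M x) = c * \int[lebesgue_rV n]_x f x.
Proof.
move=> MK MK' cE cD cf f0.
have c0 : 0 <= c by rewrite -lee_fin -cE measure_ge0.
have [r r0 Dr] := compact_sub_ball cD.
have [C C0 HC] := rV_linear_lipschitz M'.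
have mf : measurable_fun setT (EFin \o f).
  by apply/measurable_EFinP; exact: continuous_measurable_rV.
have cfM : continuous (fun x : 'rV[R]_n => f (M x)).
  exact: continuous_compose (@rV_linear_continuous _ _ _ M) cf.
have IfM' : (lebesgue_rV n).-integrable setT (EFin \o (fun x => f (M x))).
  apply: (integrable_csupp (@closed_ball_compact_rV n (C * r)) cfM) => x /= xr; apply: f0 => /Dr xvr; apply: xr.
  by rewrite -[x]MK (le_trans (HC _))// ler_wpM2l.
have IfM : (lebesgue_rV n).-integrable (M @^-1` setT) ((EFin \o f) \o M).
  by rewrite preimage_setT.
have If := integrable_csupp cD cf f0.
have E := integral_pushforward (measurable_linear M) mf IfM measurableT.
rewrite /Rintegral -[X in _ = X * _]/(fine c%:E) -fineM//; last first.
  exact: integrable_fin_num.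
congr fine; move: E; rewrite preimage_setT => E; rewrite -[LHS]E.
transitivity (\int[mscale (NngNum c0) (lebesgue_rV n)]_x (f x)%:E)%E.
  apply: (@eq_measure_integral _ _ _ setT (mscale (NngNum c0) (lebesgue_rV n))
    (pushforward_measure (lebesgue_rV n) (measurable_linear M))) => A mA _.
  by rewrite /= /pushforward /mscale/= -cE; exact: lebesgue_rV_linear MK' mA.
have mp := measurable_funepos mf; have mn := measurable_funeneg mf.
have Ep := @ge0_integral_mscale _ _ _ (lebesgue_rV n) setT measurableT (NngNum c0) _ mp (fun x _ => funepos_ge0 _ x).
have En := @ge0_integral_mscale _ _ _ (lebesgue_rV n) setT measurableT (NngNum c0) _ mn (fun x _ => funeneg_ge0 _ x).
have fp := integrable_pos_fin_num measurableT If; have fn := integrable_neg_fin_num measurableT If.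
rewrite [LHS]integralE [X in (_ * X)%E]integralE [X in (X - _)%E = _]Ep [X in (_ - X)%E = _]En.
have key (a b : \bar R) : a \is a fin_num -> b \is a fin_num -> (c%:E * a - c%:E * b = c%:E * (a - b))%E.
  by case: a => [a||]// ; case: b => [b||]// _ _; congr (_%:E); rewrite mulrBr.
exact: key.
Qed.

End integrals.

(** * Integrals depending on a parameter, and integration by parts *)

Section parametric_integrals.
Context {R : realType}.

Definition smooth_map n k (Om : set 'rV[R]_n) (F : 'rV[R]_n -> 'rV[R]_k) :=
  forall i, smooth Om (fun x => F x ord0 i).

Lemma smooth_map_linear n k (Om : set 'rV[R]_n) (F : {linear 'rV[R]_n -> 'rV[R]_k}) :
  open Om -> smooth_map Om F.
Proof.
move=> oOm i.
have H := smooth_coord (Om := setT) i (@openT 'rV[R]_k).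
apply: smooth_subset (smooth_linear_comp (@rV_linear_continuous _ _ _ F) H).
by move=> x _.
Qed.

Lemma smooth_map_id n (Om : set 'rV[R]_n) : open Om -> smooth_map Om id.
Proof. by move=> oOm i; exact: smooth_coord. Qed.

Lemma smooth_map_cst n k (Om : set 'rV[R]_n) (c : 'rV[R]_k) : open Om -> smooth_map Om (fun=> c).
Proof. by move=> oOm i; exact: smooth_cst. Qed.

Lemma smooth_map_comp n m k (Om : set 'rV[R]_n) (F : 'rV[R]_n -> 'rV[R]_m) (G : 'rV[R]_m -> 'rV[R]_k) :
  open Om -> smooth_map Om F -> smooth_map setT G -> smooth_map Om (fun x => G (F x)).
Proof.
move=> oOm sF sG i.
exact: (smooth_comp (Om' := setT) (g := fun y => G y ord0 i) oOm openT sF (sG i)).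
Qed.

Lemma smooth_map_row_mx n m k (Om : set 'rV[R]_n) (F : 'rV[R]_n -> 'rV[R]_m) (G : 'rV[R]_n -> 'rV[R]_k) :
  smooth_map Om F -> smooth_map Om G -> smooth_map Om (fun x => row_mx (F x) (G x)).
Proof.
move=> sF sG i; case: (splitP i) => j ij.
  rewrite (_ : (fun _ => _) = fun x => F x ord0 j); first exact: sF.
  by apply/funext => x; rewrite (_ : i = lshift k j) ?row_mxEl//; exact/val_inj.
rewrite (_ : (fun _ => _) = fun x => G x ord0 j); first exact: sG.
by apply/funext => x; rewrite (_ : i = rshift m j) ?row_mxEr//; exact/val_inj.
Qed.

Lemma smooth_map_lsubmx n m : smooth_map setT (fun z : 'rV[R]_(n + m) => lsubmx z).
Proof.
move=> i; rewrite (_ : (fun _ => _) = fun z : 'rV[R]_(n + m) => z ord0 (lshift m i)).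
  by apply: smooth_coord; exact: openT.
by apply/funext => z; rewrite mxE.
Qed.

Lemma smooth_map_rsubmx n m : smooth_map setT (fun z : 'rV[R]_(n + m) => rsubmx z).
Proof.
move=> i; rewrite (_ : (fun _ => _) = fun z : 'rV[R]_(n + m) => z ord0 (rshift n i)).
  by apply: smooth_coord; exact: openT.
by apply/funext => z; rewrite mxE.
Qed.

Lemma smooth_map_N n k (Om : set 'rV[R]_n) (F : 'rV[R]_n -> 'rV[R]_k) :
  open Om -> smooth_map Om F -> smooth_map Om (fun x => - F x).
Proof.
move=> oOm sF i; rewrite (_ : (fun _ => _) = fun x => - F x ord0 i); last by apply/funext => x; rewrite mxE.
exact: (smoothN oOm (sF i)).
Qed.

Lemma smooth_map_D n k (Om : set 'rV[R]_n) (F G : 'rV[R]_n -> 'rV[R]_k) :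
  open Om -> smooth_map Om F -> smooth_map Om G -> smooth_map Om (fun x => F x + G x).
Proof.
move=> oOm sF sG i; rewrite (_ : (fun _ => _) = fun x => F x ord0 i + G x ord0 i).
  exact: (smoothD oOm (sF i) (sG i)).
by apply/funext => x; rewrite mxE.
Qed.

Lemma smooth_map_continuous n k (F : 'rV[R]_n -> 'rV[R]_k) : smooth_map setT F -> continuous F.
Proof.
move=> sF x; apply/differentiable_continuous/differentiable_rV => i.
exact: smooth_differentiable openT (sF i) _.
Qed.

Lemma smoothT_continuous n (f : 'rV[R]_n -> R) : smooth setT f -> continuous f.
Proof. by move=> sf x; exact: smooth_continuous sf _. Qed.

Lemma rV_norm_row_mx n k (x : 'rV[R]_n) (y : 'rV[R]_k) r : `|x| <= r -> `|y| <= r -> `|row_mx x y| <= r.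
Proof.
move=> xr yr; apply: rV_norm_le => [|i]; first exact: le_trans xr.
case: (splitP i) => j ij.
  by rewrite (_ : i = lshift k j) ?row_mxEl ?(le_trans (rV_coord_le _ _))//; exact/val_inj.
by rewrite (_ : i = rshift n j) ?row_mxEr ?(le_trans (rV_coord_le _ _))//; exact/val_inj.
Qed.

(** A function of two vector variables is encoded as a function on R^(n+k), so that joint smoothness
    is plain [smooth]. Partial derivatives in the second variable are then derivatives along
    [row_mx 0 v]. *)
Lemma row_mx_quotient n k (G : 'rV[R]_(n + k) -> R) x y (v : 'rV[R]_k) :
  (fun h : R => h^-1 *: ((G \o shift (row_mx x y)) (h *: row_mx 0 v) - G (row_mx x y))) =
  (fun h => h^-1 *: (((fun y => G (row_mx x y)) \o shift y) (h *: v) - G (row_mx x y))).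
Proof.
by apply/funext => h /=; rewrite scale_row_mx scaler0 add_row_mx add0r.
Qed.

Lemma derive_row_mx n k (G : 'rV[R]_(n + k) -> R) x y (v : 'rV[R]_k) :
  'D_v (fun y => G (row_mx x y)) y = 'D_(row_mx 0 v) G (row_mx x y).
Proof.
Local Transparent derive.
by rewrite /derive row_mx_quotient.
Local Opaque derive.
Qed.

Lemma derivable_row_mx n k (G : 'rV[R]_(n + k) -> R) x y (v : 'rV[R]_k) :
  derivable G (row_mx x y) (row_mx 0 v) -> derivable (fun y => G (row_mx x y)) y v.
Proof. by rewrite /derivable row_mx_quotient. Qed.

Lemma iter_derive_row_mx n k (G : 'rV[R]_(n + k) -> R) x y (vs : seq 'rV[R]_k) :
  iter_derive vs (fun y => G (row_mx x y)) y = iter_derive (map (row_mx 0) vs) G (row_mx x y).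
Proof.
suff -> : iter_derive vs (fun y => G (row_mx x y)) =
  (fun y => iter_derive (map (row_mx 0) vs) G (row_mx x y)) by [].
elim: vs => [//|v vs IH]; apply/funext => {}y /=; rewrite IH.
exact: derive_row_mx.
Qed.

Lemma derive_norm_le n (f : 'rV[R]_n -> R) x v M : differentiable f x -> dbound 1 f x M ->
  `|'D_v f x| <= `|v| * M.
Proof.
move=> df fM; have [->|v0] := eqVneq v 0; first by rewrite derive0 !normr0 mul0r.
have nv : 0 < `|v| by rewrite normr_gt0.
rewrite -[v in 'D_v _ _](@scalerKV _ _ `|v|) ?gt_eqF// derive_scale_vec// normrM normr_id.
rewrite ler_wpM2l//; apply: (fM [:: _]) => //=.
by rewrite normrZ gtr0_norm ?invr_gt0// mulVf ?lexx// gt_eqF.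
Qed.

Lemma line_derivable0 (V W : normedModType R) (f : V -> W) (x v : V) :
  derivable (fun s : R => f (x + s *: v)) 0 1 -> derivable f x v.
Proof. by move=> H; have := (line_derivable f x v 0).2 H; rewrite scale0r addr0. Qed.

Lemma line_derive0 (V W : normedModType R) (f : V -> W) (x v : V) :
  'D_v f x = 'D_1 (fun s : R => f (x + s *: v)) 0.
Proof. by rewrite -line_derive scale0r addr0. Qed.

Lemma derive_translate (V W : normedModType R) (f : V -> W) (x a v : V) :
  'D_v (fun y => f (a + y)) x = 'D_v f (a + x).
Proof.
rewrite (line_derive0 (fun y => f (a + y)) x) (line_derive0 f (a + x)).
rewrite (_ : (fun s : R => f (a + (x + s *: v))) = (fun s : R => f (a + x + s *: v))) //.
by apply/funext => s; rewrite addrA.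
Qed.

Section under_integral.
Variables (n k : nat) (Om : set 'rV[R]_k) (D : set 'rV[R]_n).
Hypotheses (oOm : open Om) (cD : compact D).
Local Notation mu := (lebesgue_rV n).

Section one_function.
Variable (G : 'rV[R]_(n + k) -> R).
Hypotheses (sG : smooth setT G) (G0 : forall x y, Om y -> ~ D x -> G (row_mx x y) = 0).

Let continuous_slice y : continuous (fun x => G (row_mx x y)).
Proof.
apply: (@continuous_compose _ _ _ (fun x : 'rV[R]_n => row_mx x y) G); last exact: smoothT_continuous.
apply/smooth_map_continuous/smooth_map_row_mx; first exact/smooth_map_id/openT.
exact/smooth_map_cst/openT.
Qed.

Lemma slice_derivative_eq0 v x y : Om y -> ~ D x -> 'D_(row_mx 0 v) G (row_mx x y) = 0.
Proof.
move=> Oy xD; rewrite -derive_row_mx -[RHS](derive_cst (0 : R) v y).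
by apply: near_eq_derive; apply: (open_near oOm Oy) => z Oz; exact: G0.
Qed.

Lemma slice_integrable y : Om y -> mu.-integrable setT (EFin \o (fun x => G (row_mx x y))).
Proof. by move=> Oy; apply: (integrable_csupp cD) => // x; exact: G0. Qed.

Lemma near_bound y : Om y -> exists d M, [/\ 0 < d, 0 <= M,
  forall z, `|y - z| < d -> Om z &
  forall x z, D x -> `|y - z| < d -> dbound 1 G (row_mx x z) M].
Proof.
move=> Oy; have /nbhs_ballP[d /= d0 dO] := open_nbhs_nbhs (conj oOm Oy).
have [r r0 Dr] := compact_sub_ball cD.
have [M M0 HM] := compact_dbound 1 openT (@closed_ball_compact_rV R (n + k) (r + `|y| + d)) (@subsetT _ _) sG.
exists d, M; split => // [z yz|x z Dx yz]; first by apply: dO; rewrite -ball_normE.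
apply: HM => /=; apply: rV_norm_row_mx.
  by rewrite (le_trans (Dr _ Dx))// -addrA lerDl addr_ge0// ltW.
rewrite -[z](subKr y) (le_trans (ler_normB _ _))// lerD//; last exact: ltW.
by rewrite lerDr ltW.
Qed.

(** Near [y] the first derivatives of [G] are bounded by some [M] over the compact set [D], outside
    which [G] vanishes. The integrable function equal to [|v| M] on [D] dominates the derivative
    along the line through [y]. *)
Lemma is_derive_under_integral y v : Om y ->
  is_derive y v (fun y => \int[mu]_x G (row_mx x y)) (\int[mu]_x 'D_(row_mx 0 v) G (row_mx x y)).
Proof.
move=> Oy; have [d [M [d0 M0 dO HM]]] := near_bound Oy.
have v0 : 0 < 1 + `|v| by rewrite ltr_pwDl.
(* For [|t| < u] the point [y + t v] stays within distance [d] of [y], where [near_bound]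
   applies. *)
pose u := d / (1 + `|v|); have u0 : 0 < u by rewrite divr_gt0.
have inO t : `]- u, u[%classic t -> `|y - (y + t *: v)| < d.
  rewrite /= in_itv/= -ltr_norml => tu; rewrite opprD addNKr normrN normrZ.
  apply: (@le_lt_trans _ _ (`|t| * (1 + `|v|))); first by rewrite ler_wpM2l// lerDr.
  by rewrite -ltr_pdivlMr.
pose f (t : R) (x : 'rV[R]_n) := G (row_mx x (y + t *: v)).
have I0 : `]- u, u[%classic 0 by rewrite /= in_itv/= oppr_lt0 u0.
have intf t : `]- u, u[%classic t -> mu.-integrable setT (EFin \o f t).
  by move=> /inO/dO; exact: slice_integrable.
have dG x z : derivable (fun y => G (row_mx x y)) z v.
  by apply: derivable_row_mx; exact: smooth_derivable sG _.
have derf t x : `]- u, u[%classic t -> [set: 'rV[R]_n] x -> derivable (f^~ x) t 1.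
  by move=> _ _; exact: ((@line_derivable _ _ _ (fun y => G (row_mx x y)) y v t).1 (dG x _)).
pose B : 'rV[R]_n -> R := (fun=> `|v| * M) \_ D.
have vM0 : 0 <= `|v| * M by rewrite mulr_ge0.
have B0 x : 0 <= B x by rewrite /B patchE; case: ifP.
have mD := compact_measurable_rV cD.
have intB : mu.-integrable setT (EFin \o B).
  apply: (@integrable_bounded_csupp R n D _ (`|v| * M)) => //.
  - apply: ((measurable_restrictT _ mD).1 (measurable_cst _)).
  - by move=> x xD; rewrite /B patchE; case: ifPn => // /set_mem.
  - by move=> x; rewrite ger0_norm//; rewrite /B patchE; case: ifP.
have dE t x : partial1of2 f t x = 'D_(row_mx 0 v) G (row_mx x (y + t *: v)).
  by rewrite partial1of2E -(@line_derive _ _ _ (fun y => G (row_mx x y))) derive_row_mx.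
have fB t x : `]- u, u[%classic t -> [set: 'rV[R]_n] x -> `|partial1of2 f t x| <= B x.
  move=> /inO tI _; rewrite dE /B patchE; case: ifPn => [/set_mem Dx|/negP xD].
    rewrite -[`|v|](_ : `|row_mx (0 : 'rV[R]_n) v| = _).
      apply: derive_norm_le; first exact: smooth_differentiable openT sG _.
      exact: HM.
    apply/eqP; rewrite eq_le rV_norm_row_mx ?normr0//=.
    apply: rV_norm_le => // i; rewrite -(row_mxEr (0 : 'rV[R]_n) v); exact: rV_coord_le.
  by rewrite slice_derivative_eq0 ?normr0//; [exact: dO|move=> Dx; apply: xD; exact: mem_set].
have D1 := differentiation_under_integral measurableT I0 intf derf B0 intB fB.
have D2 := derivable_under_integral measurableT I0 intf derf B0 intB fB.
apply: DeriveDef; first exact: (line_derivable0 D2).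
rewrite (line_derive0 _ y) -derive1E; apply: (eq_trans D1); apply: eq_Rintegral => x _.
by rewrite dE scale0r addr0.
Qed.

Lemma continuous_under_integral y : Om y -> {for y, continuous (fun y => \int[mu]_x G (row_mx x y))}.
Proof.
move=> Oy; have [d [M [d0 M0 dO HM]]] := near_bound Oy.
have mD := compact_measurable_rV cD.
have F0 : 0 <= fine (mu D) by rewrite fine_ge0.
have key z : `|y - z| < d -> `|\int[mu]_x G (row_mx x y) - \int[mu]_x G (row_mx x z)| <= `|y - z| * M * fine (mu D).
  move=> yz; have Oz := dO _ yz.
  rewrite -RintegralB//; [|exact: slice_integrable|exact: slice_integrable].
  apply: (Rintegral_csupp_le cD).
  - by move=> x; apply: continuousB; exact: continuous_slice.
  - by move=> x xD; rewrite !G0// subrr.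
  - move=> x; have [Dx|xD] := pselect (D x); last by rewrite !G0// subrr normr0 !mulr_ge0.
    have [|s s1 E] := @MVT_line _ _ (fun y => G (row_mx x y)) y (z - y) 1.
      by move=> s _; apply: derivable_row_mx; exact: smooth_derivable sG _.
    rewrite distrC; move: E; rewrite scale1r subrKC mul1r => ->.
    rewrite derive_row_mx; apply: le_trans (derive_norm_le _ _ (HM _ _ Dx _)) _.
    + exact: smooth_differentiable openT sG _.
    + rewrite opprD addNKr normrN normrZ; apply: le_lt_trans yz.
      by rewrite distrC ler_piMl// (le_trans s1)// normr1.
    + rewrite ler_wpM2r// rV_norm_row_mx ?normr0//; by rewrite distrC.
apply/(@cvgrPdist_lt _ _ _ (nbhs y)) => e e0.
have c0 : 0 < M * fine (mu D) + 1 by rewrite ltr_wpDl// mulr_ge0.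
have H1 : \forall z \near y, `|y - z| < d.
  by apply/nbhs_ballP; exists d => // z; rewrite -ball_normE.
have H2 : \forall z \near y, `|y - z| < e / (M * fine (mu D) + 1).
  by apply/nbhs_ballP; exists (e / (M * fine (mu D) + 1)) => [|z]; rewrite /= ?divr_gt0// -ball_normE.
apply: filterS2 H1 H2 => z /key zd ze; apply: le_lt_trans zd _.
move: ze; rewrite ltr_pdivlMr// mulrDr mulr1 -mulrA; apply: le_lt_trans.
by rewrite lerDl.
Qed.

End one_function.

(** The integrals of functions in the class [good] form a class to which [smooth_coind] applies: a
    derivative in [y] of such an integral is the integral of a derivative, again [good]. *)
Lemma smooth_under_integral (G : 'rV[R]_(n + k) -> R) : smooth setT G ->
  (forall x y, Om y -> ~ D x -> G (row_mx x y) = 0) ->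
  smooth Om (fun y => \int[mu]_x G (row_mx x y)) /\
  forall vs y, Om y -> iter_derive vs (fun y => \int[mu]_x G (row_mx x y)) y =
    \int[mu]_x iter_derive (map (row_mx 0) vs) G (row_mx x y).
Proof.
pose good (G : 'rV[R]_(n + k) -> R) := smooth setT G /\ (forall x y, Om y -> ~ D x -> G (row_mx x y) = 0).
have goodD G' v : good G' -> good ('D_(row_mx 0 v) G').
  by move=> [sG G0]; split; [exact: smooth_derive|move=> x y; exact: slice_derivative_eq0].
move=> sG G0; have gG : good G by [].
split.
  apply: (@smooth_coind _ _ _ _ oOm (fun f => exists2 G', good G' & f = fun y => \int[mu]_x G' (row_mx x y))).
  - move=> _ [G' [sG' G0'] ->] y Oy; split; first exact: continuous_under_integral.
    by move=> v; have [] := is_derive_under_integral sG' G0' v Oy.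
  - move=> _ v [G' gG' ->]; exists (fun y => \int[mu]_x 'D_(row_mx 0 v) G' (row_mx x y)).
      exact: (ex_intro2 _ _ _ (goodD _ v gG') erefl).
    move=> y Oy; have [sG' G0'] := gG'.
    exact: (@derive_val _ _ _ _ _ _ _ (is_derive_under_integral sG' G0' v Oy)).
  - by exists G.
move=> vs; suff [gvs H] : good (iter_derive (map (row_mx 0) vs) G) /\
   forall y, Om y -> iter_derive vs (fun y => \int[mu]_x G (row_mx x y)) y =
    \int[mu]_x iter_derive (map (row_mx 0) vs) G (row_mx x y) by exact: H.
elim: vs => [|v vs [gvs IH]]; first by split.
split => [|y Oy /=]; first exact: goodD.
have [sG' G0'] := gvs.
rewrite (_ : 'D_v _ y = 'D_v (fun y => \int[mu]_x iter_derive (map (row_mx 0) vs) G (row_mx x y)) y).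
  exact: (@derive_val _ _ _ _ _ _ _ (is_derive_under_integral sG' G0' v Oy)).
by apply: near_eq_derive; exact: (open_near oOm Oy).
Qed.

End under_integral.

(** By translation invariance the integral of [f (x + y)] in [x] does not depend on [y];
    differentiate it under the integral sign at [y = 0]. *)
Lemma Rintegral_derive n (D : set 'rV[R]_n) (f : 'rV[R]_n -> R) v : compact D -> smooth setT f ->
  (forall x, ~ D x -> f x = 0) -> \int[lebesgue_rV n]_x 'D_v f x = 0.
Proof.
move=> cD sf f0; have cf := smoothT_continuous sf.
have [r r0 Dr] := compact_sub_ball cD.
pose G (z : 'rV[R]_(n + n)) := f (lsubmx z + rsubmx z).
have sG : smooth setT G.
  apply: (smooth_comp (Om' := setT) openT openT _ sf) => //.
  apply: (smooth_map_D openT); [exact: smooth_map_lsubmx|exact: smooth_map_rsubmx].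
have GE x y : G (row_mx x y) = f (x + y) by rewrite /G row_mxKl row_mxKr.
have oB : open [set y : 'rV[R]_n | `|y| < 1].
  apply: (@open_comp _ _ (fun x : 'rV[R]_n => `|x|) [set t | t < 1]); last exact: open_lt.
  by move=> x _; exact: norm_continuous.
have G0 x (y : 'rV[R]_n) : `|y| < 1 -> ~ `|x| <= r + 1 -> G (row_mx x y) = 0.
  move=> y1 xr; rewrite GE; apply: f0 => /Dr h; apply: xr.
  by rewrite -[x](addrK y) (le_trans (ler_normB _ _))// lerD// ltW.
have B0 : [set y : 'rV[R]_n | `|y| < 1] 0 by rewrite /= normr0.
have := @is_derive_under_integral n n _ _ oB (@closed_ball_compact_rV R n (r + 1)) G sG G0 0 v B0.
move=> /(@derive_val _ _ _ _ _ _ _); set g := (fun y => _); have -> : g = cst (g 0).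
  apply/funext => y; rewrite /g /cst; under eq_Rintegral do rewrite GE.
  under [RHS]eq_Rintegral do rewrite GE.
  by rewrite !(Rintegral_translate _ cD).
rewrite derive_cst => ->; apply: eq_Rintegral => x _; rewrite -derive_row_mx.
rewrite (_ : (fun y => G (row_mx x y)) = fun y => f (x + y)); last by apply/funext => y; exact: GE.
by rewrite derive_translate addr0.
Qed.

Lemma derive_csupp n (D : set 'rV[R]_n) (f : 'rV[R]_n -> R) v x : compact D ->
  (forall x, ~ D x -> f x = 0) -> ~ D x -> 'D_v f x = 0.
Proof.
move=> cD f0 xD; rewrite -[RHS](derive_cst (0 : R) v x).
by apply: near_eq_derive; apply: (open_near (closed_openC (compact_closed_rV cD)) xD).
Qed.

Lemma iter_derive_csupp n (D : set 'rV[R]_n) (f : 'rV[R]_n -> R) vs x : compact D ->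
  (forall x, ~ D x -> f x = 0) -> ~ D x -> iter_derive vs f x = 0.
Proof.
move=> cD f0; elim: vs x => [|v vs IH] x xD /=; first exact: f0.
exact: derive_csupp cD IH xD.
Qed.

Lemma integration_by_parts_rV n (D : set 'rV[R]_n) (f g : 'rV[R]_n -> R) v : compact D ->
  smooth setT f -> smooth setT g -> (forall x, ~ D x -> g x = 0) ->
  \int[lebesgue_rV n]_x ('D_v f x * g x) = - \int[lebesgue_rV n]_x (f x * 'D_v g x).
Proof.
move=> cD sf sg g0.
have sf' := smooth_derive v sf; have sg' := smooth_derive v sg.
have sfg := smoothM openT sf sg.
have H := @Rintegral_derive n D _ v cD sfg (fun x xD => etrans (congr1 ( *%R (f x)) (g0 x xD)) (mulr0 _)).
have I1 : (lebesgue_rV n).-integrable setT (EFin \o (fun x => 'D_v f x * g x)).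
  apply: (integrable_csupp cD); first exact: smoothT_continuous (smoothM openT sf' sg).
  by move=> x xD; rewrite g0// mulr0.
have I2 : (lebesgue_rV n).-integrable setT (EFin \o (fun x => f x * 'D_v g x)).
  apply: (integrable_csupp cD); first exact: smoothT_continuous (smoothM openT sf sg').
  by move=> x xD; rewrite (derive_csupp _ cD g0 xD) mulr0.
apply/eqP; rewrite -addr_eq0 -RintegralD// -[X in _ == X]H; apply/eqP/eq_Rintegral => x _.
have := @deriveM _ _ f g x v (smooth_derivable sf I) (smooth_derivable sg I).
by move=> /= ->; rewrite /GRing.scale /= addrC [g x * _]mulrC.
Qed.

End parametric_integrals.

(** * Smooth cutoff functions *)

Section bump.
Context {R : realType}.

(** The functions t^-n exp(-1/t), extended by 0. The classical flat function is the case n = 0, and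
    the others occur in its derivatives. *)
Definition flat_exp (n : nat) (t : R) : R := if 0 < t then t^-1 ^+ n * expR (- t^-1) else 0.

(** With s = 1/t, the inequality (s / (n+1))^(n+1) <= exp s bounds s^n exp(-s) by (n+1)^(n+1) /
    s. *)
Lemma flat_exp_le n t : `|flat_exp n t| <= n.+1%:R ^+ n.+1 * `|t|.
Proof.
rewrite /flat_exp; case: ifPn => [t0|_]; last by rewrite normr0 mulr_ge0// exprn_ge0.
have s0 : 0 < t^-1 by rewrite invr_gt0.
have H : (t^-1 / n.+1%:R) ^+ n.+1 <= expR t^-1.
  have -> : expR t^-1 = expR (t^-1 / n.+1%:R) ^+ n.+1.
    by rewrite -expRM_natl mulrC divfK.
  rewrite lerXn2r ?nnegrE ?expR_ge0 ?divr_ge0 ?(ltW s0)//.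
  by apply: le_trans (expR_ge1Dx _); rewrite lerDr.
rewrite ger0_norm; last by rewrite mulr_ge0 ?expR_ge0// exprn_ge0// ltW.
rewrite expRN ler_pdivrMr ?expR_gt0// gtr0_norm//.
apply: le_trans (ler_wpM2l _ H); last by rewrite mulr_ge0 ?exprn_ge0// ltW.
have a0 : n.+1%:R ^+ n.+1 != 0 :> R by rewrite expf_neq0// pnatr_eq0.
rewrite expr_div_n; move: (n.+1%:R ^+ n.+1) a0 => a a0; rewrite exprS.
rewrite (_ : a * t * _ = t^-1 ^+ n * (t * t^-1) * (a / a)); last by ring.
by rewrite !mulfV ?mulr1 ?lexx// gt_eqF.
Qed.

Lemma flat_exp_neg n t : t <= 0 -> flat_exp n t = 0.
Proof. by move=> t0; rewrite /flat_exp ltNge t0. Qed.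

Lemma flat_exp_is_derive n (t : R) :
  is_derive t (1 : R) (flat_exp n) (- n%:R * flat_exp n.+1 t + flat_exp n.+2 t).
Proof.
have [t0|t0|->] := ltgtP t 0.
- rewrite !flat_exp_neg ?(ltW t0)// mulr0 addr0.
  apply: (@near_eq_is_derive _ _ _ (cst (0 : R))).
  have : nbhs t [set s | s < 0] by apply: open_nbhs_nbhs; split => //; exact: open_lt.
  by apply: filterS => s s0; rewrite /cst flat_exp_neg// ltW.
- have tn : t != 0 by rewrite gt_eqF.
  apply: (@near_eq_is_derive _ _ _ (fun s : R => s^-1 ^+ n * expR (- s^-1) : R)).
    have : nbhs t [set s | 0 < s] by apply: open_nbhs_nbhs; split => //; exact: open_gt.
    by apply: filterS => s s0; rewrite /flat_exp s0.
  have iD := @is_deriveV R id t 1 1 tn (is_derive_id _ _).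
  have xD := is_deriveX n iD.
  have eD := is_derive1_comp (is_derive_expR _) (is_deriveN iD).
  have -> : (fun s : R => s^-1 ^+ n * expR (- s^-1)) =
     ((fun y : R => (id y)^-1) ^+ n * (expR \o - (fun y : R => (id y)^-1))).
    have fX : (fun y : R => (id y)^-1) ^+ n = (fun y : R => y^-1 ^+ n).
      by rewrite exprfctE.
    by apply/funext => s; rewrite fX.
  apply: is_derive_eq (is_deriveM xD eD) _.
  rewrite /= !fctE /flat_exp t0 -[_ *: _]/(_ * _) -[_ *: 1]/(_ * 1).
  rewrite /GRing.scale /=; case: n {xD} => [|n].
    by rewrite !exprS !expr0; field.
  by rewrite !exprVn !exprS; field; rewrite expf_neq0// tn.
- rewrite !flat_exp_neg// mulr0 addr0.
  (* At 0 the difference quotient of [flat_exp n] is [flat_exp n.+1], which tends to 0 by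
     [flat_exp_le]. *)
  have key : h^-1 *: ((flat_exp n \o shift 0) (h *: (1 : R)) - flat_exp n 0) @[h --> (0:R)^'] --> (0 : R).
    rewrite (flat_exp_neg n (lexx 0)).
    apply/cvgrPdist_le => e e0.
    have c0 : 0 < n.+2%:R ^+ n.+2 :> R by rewrite exprn_gt0.
    near=> h.
    have h0 : h != 0 by near: h; exact: nbhs_dnbhs_neq.
    have hd : `|h| <= e / n.+2%:R ^+ n.+2 by near: h; apply: dnbhs0_le; rewrite divr_gt0.
    rewrite sub0r normrN subr0 /= addr0 [h *: _]mulr1.
    rewrite (_ : h^-1 *: flat_exp n h = flat_exp n.+1 h).
      by apply: le_trans (flat_exp_le _ _) _; rewrite mulrC -ler_pdivlMr.
    rewrite /flat_exp; case: ifP => _; last by rewrite /GRing.scale /= mulr0.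
    by rewrite /GRing.scale /= exprS mulrA.
  by apply: DeriveDef; [apply/cvg_ex; exists 0|exact: cvg_lim].
Unshelve. all: by end_near. Qed.

(** This span is stable under derivation, so it serves as the class for [smooth_coind]. *)
Inductive flat_exp_span : (R -> R) -> Prop :=
| flat_exp_span1 c n : flat_exp_span (fun t => c * flat_exp n t)
| flat_exp_spanD f g : flat_exp_span f -> flat_exp_span g -> flat_exp_span (fun t => f t + g t).

Lemma flat_exp_span_derive f : flat_exp_span f ->
  exists2 g, flat_exp_span g & forall t : R, is_derive t (1 : R) f (g t).
Proof.
elim=> {f} [c n|f g _ [f' sf' ff'] _ [g' sg' gg']].
  exists (fun t => - (c * n%:R) * flat_exp n.+1 t + c * flat_exp n.+2 t).
    by apply: flat_exp_spanD; exact: flat_exp_span1.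
  move=> t; have H := @is_deriveZ _ _ _ _ c t 1 _ (flat_exp_is_derive n t).
  apply: is_derive_eq H _; rewrite /GRing.scale /=; ring.
exists (fun t => f' t + g' t); first exact: flat_exp_spanD.
by move=> t; exact: (is_deriveD (ff' t) (gg' t)).
Qed.

Lemma smooth_flat_exp (m : nat) : smooth setT (fun x : 'rV[R]_1 => flat_exp m (x ord0 ord0)).
Proof.
have oT : open [set: 'rV[R]_1] by exact: openT.
have D1 (f g : R -> R) (v x : 'rV[R]_1) : (forall t : R, is_derive t (1 : R) f (g t)) ->
    differentiable (fun x : 'rV[R]_1 => f (x ord0 ord0)) x /\ 'D_v (fun x : 'rV[R]_1 => f (x ord0 ord0)) x = v ord0 ord0 * g (x ord0 ord0).
  move=> fg.
  have df (t : R) : differentiable f t by apply/derivable1_diffP; have [] := fg t.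
  have dc : differentiable (fun x : 'rV[R]_1 => x ord0 ord0) x by exact: differentiable_coord.
  have dd : differentiable (f \o (fun x : 'rV[R]_1 => x ord0 ord0)) x by exact: differentiable_comp.
  split; first exact: dd.
  rewrite (deriveE _ dd) diff_comp//= -(deriveE _ dc).
  have -> : 'D_v (fun x : 'rV[R]_1 => x ord0 ord0) x = v ord0 ord0.
    by rewrite -derive_rV ?derive_id//; exact: (@differentiable_rV _ _ _ id x (fun i => differentiable_coord _ _ _)).
  rewrite -[v ord0 ord0]mulr1 -[_ * 1 in LHS]/(_ *: (1 : R)) linearZ /= -(deriveE _ (df _)).
  by rewrite (@derive_val _ _ _ _ _ _ _ (fg _)) /GRing.scale /= mulr1.
pose C (h : 'rV[R]_1 -> R) := exists c f, flat_exp_span f /\ h = fun x => c * f (x ord0 ord0).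
apply: (@smooth_coind _ _ _ _ oT C).
- move=> _ [c [f [sf ->]]] x _; have [g _ fg] := flat_exp_span_derive sf.
  have dZ : differentiable (c *: (fun x : 'rV[R]_1 => f (x ord0 ord0))) x.
    by apply: differentiableZ; exact: (D1 _ _ 0 x fg).1.
  by split; [exact: differentiable_continuous dZ|move=> v; exact: diff_derivable dZ].
- move=> _ v [c [f [sf ->]]]; have [g sg fg] := flat_exp_span_derive sf.
  exists (fun x : 'rV[R]_1 => (c * v ord0 ord0) * g (x ord0 ord0)); first by exists (c * v ord0 ord0), g.
  move=> x _; have [dd E] := D1 _ _ v x fg.
  have := @deriveZ _ _ _ _ c x v (diff_derivable dd).
  by rewrite /GRing.scale /= => ->; rewrite E mulrA.
- exists 1, (fun t => 1 * flat_exp m t); split; first exact: flat_exp_span1.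
  by apply/funext => x; rewrite !mul1r.
Qed.

Definition smooth_step (t : R) : R := flat_exp 0 t / (flat_exp 0 t + flat_exp 0 (1 - t)).

Lemma flat_exp_ge0 t : 0 <= flat_exp 0 t.
Proof. by rewrite /flat_exp; case: ifP => // _; rewrite expr0 mul1r expR_ge0. Qed.

Lemma flat_exp_gt0 t : 0 < t -> 0 < flat_exp 0 t.
Proof. by move=> t0; rewrite /flat_exp t0 expr0 mul1r expR_gt0. Qed.

Lemma smooth_step_den t : 0 < flat_exp 0 t + flat_exp 0 (1 - t).
Proof.
have [t0|t0] := ltP 0 t; first by rewrite ltr_pwDl ?flat_exp_gt0 ?flat_exp_ge0.
by rewrite ltr_pwDr ?flat_exp_ge0// flat_exp_gt0// subr_gt0 (le_lt_trans t0).
Qed.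

Lemma smooth_step_bound t : 0 <= smooth_step t <= 1.
Proof.
rewrite /smooth_step divr_ge0 ?flat_exp_ge0 ?(ltW (smooth_step_den _))//=.
by rewrite ler_pdivrMr ?smooth_step_den// mul1r lerDl flat_exp_ge0.
Qed.

Lemma smooth_step0 t : t <= 0 -> smooth_step t = 0.
Proof. by move=> t0; rewrite /smooth_step flat_exp_neg// mul0r. Qed.

Lemma smooth_step1 t : 1 <= t -> smooth_step t = 1.
Proof.
move=> t1; rewrite /smooth_step [flat_exp 0 (1 - t)]flat_exp_neg ?subr_le0// addr0 divff// gt_eqF//.
by rewrite flat_exp_gt0// (lt_le_trans _ t1).
Qed.

Lemma smooth_step_comp n (f : 'rV[R]_n -> R) : smooth setT f -> smooth setT (fun x => smooth_step (f x)).
Proof.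
have oT : open [set: 'rV[R]_n] by exact: openT.
have H (g : _ -> R) : smooth setT g -> smooth setT (fun x : 'rV[R]_n => flat_exp 0 (g x)).
  move=> sg; rewrite (_ : (fun _ => _) = fun x : 'rV[R]_n => (fun y : 'rV[R]_1 => flat_exp 0 (y ord0 ord0)) (const_mx (g x))).
    have sc : smooth_map setT (fun x : 'rV[R]_n => const_mx (g x) : 'rV[R]_1).
      by move=> i; rewrite (_ : (fun _ => _) = g); [exact: sg|apply/funext => x; rewrite mxE].
    exact: (smooth_comp (Om' := setT) oT openT sc (smooth_flat_exp 0) (fun _ _ => I)).
  by apply/funext => x; rewrite mxE.
move=> sf; have s1 := H _ sf; have s2 := H _ (smoothB oT (smooth_cst (1 : R) oT) sf).
have s3 := smoothD oT s1 s2.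
have s30 x : [set: 'rV[R]_n] x -> flat_exp 0 (f x) + flat_exp 0 (1 - f x) != 0.
  by move=> _; rewrite gt_eqF// smooth_step_den.
exact: (smoothM oT s1 (smoothV oT s3 s30)).
Qed.

(** The norm on row vectors is the sup norm, so this product of one-variable cutoffs is 1 on the
    closed ball of radius [r] about [c] and 0 where the distance to [c] exceeds [2 * r]. *)
Definition plateau n (c : 'rV[R]_n) (r : R) (x : 'rV[R]_n) : R :=
  \prod_(i < n) (smooth_step (2 - (x ord0 i - c ord0 i) / r) * smooth_step (2 + (x ord0 i - c ord0 i) / r)).

Lemma smooth_plateau n (c : 'rV[R]_n) r : smooth setT (plateau c r).
Proof.
have oT : open [set: 'rV[R]_n] by exact: openT.
apply: (smooth_prod oT) => i _.
have s1 := smoothM oT (smoothB oT (smooth_coord i oT) (smooth_cst (c ord0 i) oT)) (smooth_cst (r^-1) oT).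
have s2 := smooth_cst (2 : R) oT.
exact: (smoothM oT (smooth_step_comp (smoothB oT s2 s1)) (smooth_step_comp (smoothD oT s2 s1))).
Qed.

Lemma plateau_bound n (c : 'rV[R]_n) r x : 0 <= plateau c r x <= 1.
Proof.
have H t : 0 <= smooth_step t by have /andP[] := smooth_step_bound t.
have H1 t : smooth_step t <= 1 by have /andP[] := smooth_step_bound t.
rewrite prodr_ge0/=; last by move=> i _; rewrite mulr_ge0.
by apply: prodr_ile1 => i _; rewrite mulr_ge0//= mulr_ile1.
Qed.

Lemma plateau1 n (c : 'rV[R]_n) r x : 0 < r -> `|x - c| <= r -> plateau c r x = 1.
Proof.
move=> r0 xr; rewrite /plateau big1// => i _.
have : `|(x ord0 i - c ord0 i) / r| <= 1.
  rewrite normf_div (gtr0_norm r0) ler_pdivrMr// mul1r.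
  by have := rV_coord_le (x - c) i; rewrite !mxE => /le_trans; apply.
rewrite ler_norml => /andP[h1 h2]; rewrite !smooth_step1 ?mulr1//; lra.
Qed.

Lemma plateau0 n (c : 'rV[R]_n) r x : 0 < r -> 2 * r < `|x - c| -> plateau c r x = 0.
Proof.
move=> r0 xr.
have [i Hi] : exists i, 2 * r < `|x ord0 i - c ord0 i|.
  apply: contrapT => /forallNP H; move: xr; rewrite ltNge => /negP; apply.
  apply: rV_norm_le; first by rewrite mulr_ge0// ltW.
  by move=> i; rewrite !mxE leNgt; apply/negP; exact: H.
rewrite /plateau (bigD1 i)//=.
suff -> : smooth_step (2 - (x ord0 i - c ord0 i) / r) * smooth_step (2 + (x ord0 i - c ord0 i) / r) = 0.
  by rewrite mul0r.
have : 2 < `|(x ord0 i - c ord0 i) / r| by rewrite normf_div (gtr0_norm r0) ltr_pdivlMr.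
by rewrite ltr_normr => /orP[h|h]; [rewrite smooth_step0 ?mul0r//; lra|rewrite [X in _ * X]smooth_step0 ?mulr0//; lra].
Qed.

End bump.

(** * Complex-valued smooth functions *)

Section complex_valued.
Context {R : realType}.
Local Notation C := R[i].

Lemma complex_eq (x y : C) : complex.Re x = complex.Re y -> complex.Im x = complex.Im y -> x = y.
Proof. by case: x => a b; case: y => c d /= -> ->. Qed.

Lemma ReD (x y : C) : complex.Re (x + y) = complex.Re x + complex.Re y.
Proof. by case: x; case: y. Qed.
Lemma ImD (x y : C) : complex.Im (x + y) = complex.Im x + complex.Im y.
Proof. by case: x; case: y. Qed.
Lemma ReN (x : C) : complex.Re (- x) = - complex.Re x.
Proof. by case: x. Qed.
Lemma ImN (x : C) : complex.Im (- x) = - complex.Im x.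
Proof. by case: x. Qed.
Lemma ReM (x y : C) : complex.Re (x * y) = complex.Re x * complex.Re y - complex.Im x * complex.Im y.
Proof. by case: x; case: y. Qed.
Lemma ImM (x y : C) : complex.Im (x * y) = complex.Re x * complex.Im y + complex.Im x * complex.Re y.
Proof. by case: x; case: y. Qed.
Lemma normc_ge0 (z : C) : 0 <= Normc.normc z.
Proof. by case: z => a b; rewrite /= sqrtr_ge0. Qed.

Lemma Re_le_normc (z : C) : `|complex.Re z| <= Normc.normc z.
Proof. by case: z => a b /=; rewrite -sqrtr_sqr ler_wsqrtr// lerDl sqr_ge0. Qed.

Lemma Im_le_normc (z : C) : `|complex.Im z| <= Normc.normc z.
Proof. by case: z => a b /=; rewrite -sqrtr_sqr ler_wsqrtr// lerDr sqr_ge0. Qed.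

Lemma normc_le (z : C) : Normc.normc z <= `|complex.Re z| + `|complex.Im z|.
Proof.
case: z => a b /=; rewrite -[leRHS]ger0_norm ?addr_ge0// -sqrtr_sqr ler_wsqrtr//.
rewrite sqrrD !real_normK ?num_real// [leRHS]addrAC lerDl.
by rewrite mulrn_wge0// mulr_ge0.
Qed.

Lemma normc_sum (I : Type) (s : seq I) (f : I -> C) :
  Normc.normc (\sum_(i <- s) f i) <= \sum_(i <- s) Normc.normc (f i).
Proof.
elim: s => [|i s IH]; first by rewrite !big_nil Normc.normc0.
by rewrite !big_cons (le_trans (le_normcD _ _))// lerD2l.
Qed.

Lemma normc_real (x : R) : Normc.normc (x%:C)%C = `|x|.
Proof. by rewrite /= expr0n/= addr0 sqrtr_sqr. Qed.

Lemma re_partD N (f g : 'rV[R]_N -> C) : re_part (fun x => f x + g x) = fun x => re_part f x + re_part g x.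
Proof. by apply/funext => x; exact: ReD. Qed.
Lemma im_partD N (f g : 'rV[R]_N -> C) : im_part (fun x => f x + g x) = fun x => im_part f x + im_part g x.
Proof. by apply/funext => x; exact: ImD. Qed.
Lemma re_partM N (f g : 'rV[R]_N -> C) : re_part (fun x => f x * g x) =
  fun x => re_part f x * re_part g x - im_part f x * im_part g x.
Proof. by apply/funext => x; exact: ReM. Qed.
Lemma im_partM N (f g : 'rV[R]_N -> C) : im_part (fun x => f x * g x) =
  fun x => re_part f x * im_part g x + im_part f x * re_part g x.
Proof. by apply/funext => x; exact: ImM. Qed.

Section csmooth_closure.
Variables (N : nat) (Om : set 'rV[R]_N).
Hypothesis oOm : open Om.
Local Notation V := 'rV[R]_N.

Lemma csmooth_eq_on (f g : V -> C) : (forall x, Om x -> f x = g x) -> csmooth Om f -> csmooth Om g.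
Proof.
move=> fg [s1 s2]; split.
  by apply: (smooth_eq_on oOm _ s1) => x Ox; rewrite /re_part fg.
by apply: (smooth_eq_on oOm _ s2) => x Ox; rewrite /im_part fg.
Qed.

Lemma csmooth_cst (c : C) : csmooth Om (fun _ : V => c).
Proof. by split; exact: smooth_cst. Qed.

Lemma csmoothD (f g : V -> C) : csmooth Om f -> csmooth Om g -> csmooth Om (fun x => f x + g x).
Proof.
move=> [f1 f2] [g1 g2]; split; first by rewrite re_partD; exact: (smoothD oOm f1 g1).
by rewrite im_partD; exact: (smoothD oOm f2 g2).
Qed.

Lemma csmoothM (f g : V -> C) : csmooth Om f -> csmooth Om g -> csmooth Om (fun x => f x * g x).
Proof.
move=> [f1 f2] [g1 g2]; split.
  by rewrite re_partM; exact: (smoothB oOm (smoothM oOm f1 g1) (smoothM oOm f2 g2)).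
by rewrite im_partM; exact: (smoothD oOm (smoothM oOm f1 g2) (smoothM oOm f2 g1)).
Qed.

Lemma csmoothZ (c : C) (f : V -> C) : csmooth Om f -> csmooth Om (fun x => c * f x).
Proof. by move=> sf; exact: (csmoothM (csmooth_cst c) sf). Qed.

Lemma csmoothN (f : V -> C) : csmooth Om f -> csmooth Om (fun x => - f x).
Proof.
move=> sf; rewrite (_ : (fun _ => _) = fun x => -1 * f x); first exact: (csmoothZ (-1) sf).
by apply/funext => x; rewrite mulN1r.
Qed.

Lemma csmoothB (f g : V -> C) : csmooth Om f -> csmooth Om g -> csmooth Om (fun x => f x - g x).
Proof. by move=> sf sg; exact: (csmoothD sf (csmoothN sg)). Qed.

Lemma csmooth_sum (I : Type) (s : seq I) (f : I -> V -> C) :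
  (forall i, csmooth Om (f i)) -> csmooth Om (fun x => \sum_(i <- s) f i x).
Proof.
move=> sf; elim: s => [|i s IH].
  by rewrite (_ : (fun _ => _) = fun _ => 0); [exact: csmooth_cst|apply/funext => x; rewrite big_nil].
rewrite (_ : (fun _ => _) = fun x => f i x + \sum_(i <- s) f i x); first exact: (csmoothD (sf i) IH).
by apply/funext => x; rewrite big_cons.
Qed.

Lemma csmooth_real (f : V -> R) : smooth Om f -> csmooth Om (fun x => (f x)%:C)%C.
Proof. by move=> sf; split; [exact: sf|exact: smooth_cst]. Qed.

Lemma csmooth_comp k (Om' : set 'rV[R]_k) (F : V -> 'rV[R]_k) (g : 'rV[R]_k -> C) : open Om' ->
  smooth_map Om F -> csmooth Om' g -> (forall x, Om x -> Om' (F x)) -> csmooth Om (fun x => g (F x)).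
Proof.
move=> oOm' sF [g1 g2] FO; split.
  exact: (smooth_comp oOm oOm' sF g1 FO).
exact: (smooth_comp oOm oOm' sF g2 FO).
Qed.

End csmooth_closure.

Lemma csmooth_subset N (Om Om' : set 'rV[R]_N) (f : 'rV[R]_N -> C) :
  Om' `<=` Om -> csmooth Om f -> csmooth Om' f.
Proof. by move=> OO [s1 s2]; split; apply: smooth_subset OO _. Qed.

Lemma csmooth_local N (Om : set 'rV[R]_N) (f : 'rV[R]_N -> C) :
  (forall x, Om x -> exists2 U, U x & csmooth U f) -> csmooth Om f.
Proof.
by move=> H; split; apply: smooth_local => x /H[U Ux [s1 s2]]; exists U.
Qed.

Section cderiv.
Variables (N : nat).
Local Notation V := 'rV[R]_N.

Definition cderiv (vs : seq V) (f : V -> C) : V -> C :=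
  fun x => (iter_derive vs (re_part f) x +i* iter_derive vs (im_part f) x)%C.

Lemma cpartialE I (f : V -> C) : cpartial I f = cderiv [seq delta_mx ord0 i | i <- I] f.
Proof. by []. Qed.

Lemma cderiv_smooth Om vs (f : V -> C) : csmooth Om f -> csmooth Om (cderiv vs f).
Proof. by move=> [s1 s2]; split; exact: smooth_iter_derive. Qed.

Lemma cderiv_cat us vs (f : V -> C) : cderiv (us ++ vs) f = cderiv us (cderiv vs f).
Proof. by apply/funext => x; rewrite /cderiv /iter_derive !foldr_cat. Qed.

Lemma cderiv_nil (f : V -> C) : cderiv [::] f = f.
Proof. by apply/funext => x; apply: complex_eq. Qed.

Lemma cderiv_eq_on Om vs (f g : V -> C) : open Om -> (forall x, Om x -> f x = g x) ->
  forall x, Om x -> cderiv vs f x = cderiv vs g x.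
Proof.
move=> oOm fg x Ox; congr (_ +i* _)%C.
  by apply: (iter_derive_eq_on oOm) => // y Oy; rewrite /re_part fg.
by apply: (iter_derive_eq_on oOm) => // y Oy; rewrite /im_part fg.
Qed.

Lemma cderivD Om vs (f g : V -> C) x : open Om -> csmooth Om f -> csmooth Om g -> Om x ->
  cderiv vs (fun y => f y + g y) x = cderiv vs f x + cderiv vs g x.
Proof.
move=> oOm [f1 f2] [g1 g2] Ox; rewrite /cderiv re_partD im_partD.
by rewrite (iter_deriveD oOm vs f1 g1 Ox) (iter_deriveD oOm vs f2 g2 Ox).
Qed.

Lemma cderivZ Om vs c (f : V -> C) x : open Om -> csmooth Om f -> Om x ->
  cderiv vs (fun y => c * f y) x = c * cderiv vs f x.
Proof.
move=> oOm [f1 f2] Ox; case: c => a b; apply: complex_eq.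
  rewrite ReM /= re_partM /= (iter_deriveB oOm vs (smoothM oOm (smooth_cst a oOm) f1) (smoothM oOm (smooth_cst b oOm) f2) Ox).
  by rewrite (iter_deriveZ oOm _ vs f1 Ox) (iter_deriveZ oOm _ vs f2 Ox).
rewrite ImM /= im_partM /= (iter_deriveD oOm vs (smoothM oOm (smooth_cst a oOm) f2) (smoothM oOm (smooth_cst b oOm) f1) Ox).
by rewrite (iter_deriveZ oOm _ vs f1 Ox) (iter_deriveZ oOm _ vs f2 Ox).
Qed.

Lemma cderivM1 Om v (f g : V -> C) x : open Om -> csmooth Om f -> csmooth Om g -> Om x ->
  cderiv [:: v] (fun y => f y * g y) x = f x * cderiv [:: v] g x + cderiv [:: v] f x * g x.
Proof.
move=> oOm [f1 f2] [g1 g2] Ox.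
have DM (u w : V -> R) : smooth Om u -> smooth Om w ->
    'D_v (fun y => u y * w y) x = u x * 'D_v w x + w x * 'D_v u x.
  by move=> su sw; exact: (@deriveM _ _ u w x v (smooth_derivable su Ox) (smooth_derivable sw Ox)).
have DB (u w : V -> R) : smooth Om u -> smooth Om w -> 'D_v (fun y => u y - w y) x = 'D_v u x - 'D_v w x.
  by move=> su sw; exact: (@deriveB _ _ _ u w x v (smooth_derivable su Ox) (smooth_derivable sw Ox)).
have DD (u w : V -> R) : smooth Om u -> smooth Om w -> 'D_v (fun y => u y + w y) x = 'D_v u x + 'D_v w x.
  by move=> su sw; exact: (@deriveD _ _ _ u w x v (smooth_derivable su Ox) (smooth_derivable sw Ox)).
apply: complex_eq.
  rewrite ReD !ReM /= re_partM (DB _ _ (smoothM oOm f1 g1) (smoothM oOm f2 g2)) (DM _ _ f1 g1) (DM _ _ f2 g2).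
  by rewrite /re_part /im_part; ring.
rewrite ImD !ImM /= im_partM (DD _ _ (smoothM oOm f1 g2) (smoothM oOm f2 g1)) (DM _ _ f1 g2) (DM _ _ f2 g1).
by rewrite /re_part /im_part; ring.
Qed.

(** Real and imaginary parts are bounded separately, hence the factor 2 whenever one returns to the
    modulus. *)
Definition cdbound m (f : V -> C) x M := dbound m (re_part f) x M /\ dbound m (im_part f) x M.

Lemma cdbound_cderiv m (f : V -> C) x M vs : cdbound m f x M -> (size vs <= m)%N ->
  all (fun v => `|v| <= 1) vs -> Normc.normc (cderiv vs f x) <= 2 * M.
Proof.
move=> [b1 b2] vm va; apply: le_trans (normc_le _) _; rewrite mulr_natl mulr2n.
by apply: lerD; [exact: b1|exact: b2].
Qed.

Lemma cdboundW m (f : V -> C) x M : cdbound m f x M -> Normc.normc (f x) <= 2 * M.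
Proof. by move=> b; have := @cdbound_cderiv m f x M [::] b isT isT; rewrite cderiv_nil. Qed.

Lemma cdbound_ge0 m (f : V -> C) x M : cdbound m f x M -> 0 <= M.
Proof. by move=> [/dboundW b _]; exact: le_trans b. Qed.

Lemma cdbound_le m m' (f : V -> C) x M M' : (m' <= m)%N -> M <= M' -> cdbound m f x M -> cdbound m' f x M'.
Proof. by move=> mm MM [b1 b2]; split; [exact: dbound_le b1|exact: dbound_le b2]. Qed.

Lemma dboundD Om m (f g : V -> R) x Mf Mg : open Om -> smooth Om f -> smooth Om g -> Om x ->
  dbound m f x Mf -> dbound m g x Mg -> dbound m (fun y => f y + g y) x (Mf + Mg).
Proof.
move=> oOm sf sg Ox bf bg vs vm va; rewrite (iter_deriveD oOm vs sf sg Ox).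
by rewrite (le_trans (ler_normD _ _))// lerD ?bf ?bg.
Qed.

Lemma dboundB Om m (f g : V -> R) x Mf Mg : open Om -> smooth Om f -> smooth Om g -> Om x ->
  dbound m f x Mf -> dbound m g x Mg -> dbound m (fun y => f y - g y) x (Mf + Mg).
Proof.
move=> oOm sf sg Ox bf bg vs vm va; rewrite (iter_deriveB oOm vs sf sg Ox).
by rewrite (le_trans (ler_normB _ _))// lerD ?bf ?bg.
Qed.

Lemma cdboundM Om m (f g : V -> C) x Mf Mg : open Om -> csmooth Om f -> csmooth Om g -> Om x ->
  cdbound m f x Mf -> cdbound m g x Mg -> cdbound m (fun y => f y * g y) x (2 * (2 ^+ m * (Mf * Mg))).
Proof.
move=> oOm [f1 f2] [g1 g2] Ox [bf1 bf2] [bg1 bg2]; rewrite mulr_natl mulr2n; split.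
  rewrite re_partM; apply: (dboundB oOm (smoothM oOm f1 g1) (smoothM oOm f2 g2) Ox).
    exact: (dboundM oOm f1 g1 Ox bf1 bg1).
  exact: (dboundM oOm f2 g2 Ox bf2 bg2).
rewrite im_partM; apply: (dboundD oOm (smoothM oOm f1 g2) (smoothM oOm f2 g1) Ox).
  exact: (dboundM oOm f1 g2 Ox bf1 bg2).
exact: (dboundM oOm f2 g1 Ox bf2 bg1).
Qed.

Lemma compact_cdbound (Om D : set V) m (f : V -> C) : open Om -> compact D -> D `<=` Om -> csmooth Om f ->
  exists2 M, 0 <= M & forall x, D x -> cdbound m f x M.
Proof.
move=> oOm cD DO [f1 f2].
have [M1 M10 H1] := compact_dbound m oOm cD DO f1.
have [M2 M20 H2] := compact_dbound m oOm cD DO f2.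
exists (M1 + M2); first by rewrite addr_ge0.
move=> x Dx; split.
  by apply: dbound_le (H1 _ Dx); rewrite ?lerDl.
by apply: dbound_le (H2 _ Dx); rewrite ?lerDr.
Qed.

Lemma cderiv_csupp (D : set V) (f : V -> C) vs x : compact D ->
  (forall x, ~ D x -> f x = 0) -> ~ D x -> cderiv vs f x = 0.
Proof.
move=> cD f0 xD; apply: complex_eq; rewrite /=.
  by apply: (iter_derive_csupp _ cD) => // y /f0; rewrite /re_part => ->.
by apply: (iter_derive_csupp _ cD) => // y /f0; rewrite /im_part => ->.
Qed.

Lemma cpartial_cdbound m (f : V -> C) x M : csmooth setT f ->
  (forall I : seq 'I_N, (size I <= m)%N -> Normc.normc (cpartial I f x) <= M) ->
  cdbound m f x (M * N.+1%:R ^+ m).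
Proof.
move=> [f1 f2] H; split.
  apply: (coord_dbound (@openT 'rV[R]_N) f1 Logic.I) => I Im.
  exact: le_trans (Re_le_normc (cpartial I f x)) (H I Im).
apply: (coord_dbound (@openT 'rV[R]_N) f2 Logic.I) => I Im.
exact: le_trans (Im_le_normc (cpartial I f x)) (H I Im).
Qed.

End cderiv.

End complex_valued.

(** * Integrals of complex-valued functions *)

Section complex_integrals.
Context {R : realType} {N : nat}.
Local Notation C := R[i].
Local Notation V := 'rV[R]_N.
Local Notation mu := (lebesgue_rV N).

Definition ccontinuous (f : V -> C) := continuous (re_part f) /\ continuous (im_part f).
Definition supported (D : set V) (f : V -> C) := forall x, ~ D x -> f x = 0.

Lemma csmooth_continuous (f : V -> C) : csmooth setT f -> ccontinuous f.
Proof. by move=> [s1 s2]; split; [exact: smoothT_continuous s1|exact: smoothT_continuous s2]. Qed.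

Lemma ccontinuousD (f g : V -> C) : ccontinuous f -> ccontinuous g -> ccontinuous (fun x => f x + g x).
Proof.
move=> [f1 f2] [g1 g2]; split; first by rewrite re_partD => x; exact: (cvgD (f1 x) (g1 x)).
by rewrite im_partD => x; exact: (cvgD (f2 x) (g2 x)).
Qed.

Lemma ccontinuousM (f g : V -> C) : ccontinuous f -> ccontinuous g -> ccontinuous (fun x => f x * g x).
Proof.
move=> [f1 f2] [g1 g2]; split.
  by rewrite re_partM => x; exact: (cvgB (cvgM (f1 x) (g1 x)) (cvgM (f2 x) (g2 x))).
by rewrite im_partM => x; exact: (cvgD (cvgM (f1 x) (g2 x)) (cvgM (f2 x) (g1 x))).
Qed.

Lemma ccontinuous_cst (c : C) : ccontinuous (fun=> c).
Proof. by split; [exact: (@cst_continuous _ _ (complex.Re c))|exact: (@cst_continuous _ _ (complex.Im c))]. Qed.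

Lemma ccontinuousZ c (f : V -> C) : ccontinuous f -> ccontinuous (fun x => c * f x).
Proof. by move=> cf; exact: (ccontinuousM (ccontinuous_cst c) cf). Qed.

Lemma supported_re D (f : V -> C) : supported D f -> forall x, ~ D x -> re_part f x = 0.
Proof. by move=> f0 x /f0; rewrite /re_part => ->. Qed.
Lemma supported_im D (f : V -> C) : supported D f -> forall x, ~ D x -> im_part f x = 0.
Proof. by move=> f0 x /f0; rewrite /im_part => ->. Qed.

Lemma supportedMl D (f g : V -> C) : supported D f -> supported D (fun x => f x * g x).
Proof. by move=> f0 x /f0 ->; rewrite mul0r. Qed.
Lemma supportedMr D (f g : V -> C) : supported D g -> supported D (fun x => f x * g x).
Proof. by move=> f0 x /f0 ->; rewrite mulr0. Qed.
Lemma supportedD D (f g : V -> C) : supported D f -> supported D g -> supported D (fun x => f x + g x).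
Proof. by move=> f0 g0 x xD; rewrite f0// g0// addr0. Qed.
Lemma supported_subset D D' (f : V -> C) : D `<=` D' -> supported D f -> supported D' f.
Proof. by move=> DD f0 x xD; apply: f0 => /DD. Qed.

Lemma cintegral_ext (f g : V -> C) : (forall x, f x = g x) -> cintegral setT f = cintegral setT g.
Proof. by move=> /funext ->. Qed.

Lemma cintegral_setT (Om : set V) (f : V -> C) : supported Om f -> cintegral Om f = cintegral setT f.
Proof.
move=> f0; rewrite /cintegral; congr (_ +i* _)%C; rewrite Rintegral_mkcond; apply: eq_Rintegral => x _;
  rewrite patchE; case: ifPn => // /negP xO.
  by rewrite (supported_re f0)// => Ox; apply: xO; exact: mem_set.
by rewrite (supported_im f0)// => Ox; apply: xO; exact: mem_set.
Qed.

Section compact_support.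
Variable D : set V.
Hypothesis cD : compact D.

Lemma cintegralD (f g : V -> C) : ccontinuous f -> ccontinuous g -> supported D f -> supported D g ->
  cintegral setT (fun x => f x + g x) = cintegral setT f + cintegral setT g.
Proof.
move=> [f1 f2] [g1 g2] f0 g0; rewrite /cintegral re_partD im_partD.
rewrite !RintegralD//; apply: (integrable_csupp cD) => //.
- exact: supported_im.
- exact: supported_im.
- exact: supported_re.
- exact: supported_re.
Qed.

Lemma cintegralZ c (f : V -> C) : ccontinuous f -> supported D f ->
  cintegral setT (fun x => c * f x) = c * cintegral setT f.
Proof.
move=> [f1 f2] f0; rewrite /cintegral re_partM im_partM.
have i1 := integrable_csupp cD f1 (supported_re f0).
have i2 := integrable_csupp cD f2 (supported_im f0).
have iZ (r : R) (h : V -> R) : mu.-integrable setT (EFin \o h) -> mu.-integrable setT (EFin \o (fun x => r * h x)).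
  move=> ih; have := @integrableZl _ _ _ mu setT measurableT r _ ih.
  by apply: eq_integrable => // x _; rewrite /= EFinM.
case: c => a b; rewrite /re_part /im_part /=.
rewrite RintegralB//; [|exact: iZ|exact: iZ].
rewrite RintegralD//; [|exact: iZ|exact: iZ].
by rewrite !RintegralZl.
Qed.

Lemma cintegralN (f : V -> C) : ccontinuous f -> supported D f ->
  cintegral setT (fun x => - f x) = - cintegral setT f.
Proof.
move=> cf f0; rewrite -mulN1r -cintegralZ//; apply: cintegral_ext => x; by rewrite mulN1r.
Qed.

Lemma cintegralB (f g : V -> C) : ccontinuous f -> ccontinuous g -> supported D f -> supported D g ->
  cintegral setT (fun x => f x - g x) = cintegral setT f - cintegral setT g.
Proof.
move=> cf cg f0 g0; rewrite -cintegralN// -cintegralD//.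
  by rewrite (_ : (fun x => - g x) = fun x => -1 * g x); [exact: ccontinuousZ|apply/funext => x; rewrite mulN1r].
by move=> x xD; rewrite g0// oppr0.
Qed.

Lemma cintegral_sum (I : Type) (s : seq I) (f : I -> V -> C) :
  (forall i, ccontinuous (f i)) -> (forall i, supported D (f i)) ->
  cintegral setT (fun x => \sum_(i <- s) f i x) = \sum_(i <- s) cintegral setT (f i).
Proof.
move=> cf f0; have [H1 [H2 H3]] : ccontinuous (fun x => \sum_(i <- s) f i x) /\ supported D (fun x => \sum_(i <- s) f i x) /\
    cintegral setT (fun x => \sum_(i <- s) f i x) = \sum_(i <- s) cintegral setT (f i); last by [].
elim: s => [|i s [H1 [H2 H3]]].
  rewrite (_ : (fun _ => _) = fun=> 0 * 0); last by apply/funext => x; rewrite big_nil mul0r.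
  rewrite big_nil (cintegralZ 0 (ccontinuous_cst 0)) ?mul0r//.
  by split; [exact: ccontinuous_cst|split].
rewrite (_ : (fun _ => _) = fun x => f i x + \sum_(i <- s) f i x); last by apply/funext => x; rewrite big_cons.
by split; [exact: ccontinuousD|split; [exact: supportedD|rewrite cintegralD// big_cons H3]].
Qed.

Lemma cintegral_norm_le (f : V -> C) M : ccontinuous f -> supported D f ->
  (forall x, Normc.normc (f x) <= M) ->
  Normc.normc (cintegral setT f) <= 2 * M * fine (mu D).
Proof.
move=> [f1 f2] f0 fM; apply: le_trans (normc_le _) _.
rewrite -mulrA mulr_natl mulr2n; apply: lerD.
  by apply: (Rintegral_csupp_le cD f1 (supported_re f0)) => x; exact: le_trans (Re_le_normc _) (fM x).
by apply: (Rintegral_csupp_le cD f2 (supported_im f0)) => x; exact: le_trans (Im_le_normc _) (fM x).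
Qed.

Lemma cintegral_linear (M M' : {linear V -> V}) (c : R) (f : V -> C) :
  cancel M M' -> cancel M' M -> mu (M @^-1` unit_cube N) = c%:E ->
  ccontinuous f -> supported D f ->
  cintegral setT (fun x => f (M x)) = (c%:C)%C * cintegral setT f.
Proof.
move=> MK MK' cE [f1 f2] f0; apply: complex_eq; rewrite ?ReM ?ImM /= mul0r ?subr0 ?addr0.
  exact: (Rintegral_linear MK MK' cE cD f1 (supported_re f0)).
exact: (Rintegral_linear MK MK' cE cD f2 (supported_im f0)).
Qed.

Lemma supported_cderiv vs (f : V -> C) : supported D f -> supported D (cderiv vs f).
Proof. by move=> f0 x; exact: cderiv_csupp. Qed.

Lemma cintegral_cderiv v (f : V -> C) : csmooth setT f -> supported D f ->
  cintegral setT (cderiv [:: v] f) = 0.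
Proof.
move=> [f1 f2] f0; apply: complex_eq.
  exact: (Rintegral_derive v cD f1 (supported_re f0)).
exact: (Rintegral_derive v cD f2 (supported_im f0)).
Qed.

Lemma cintegral_by_parts1 v (f g : V -> C) : csmooth setT f -> csmooth setT g -> supported D (fun x => f x * g x) ->
  supported D (fun x => f x * cderiv [:: v] g x) -> supported D (fun x => cderiv [:: v] f x * g x) ->
  cintegral setT (fun x => cderiv [:: v] f x * g x) = - cintegral setT (fun x => f x * cderiv [:: v] g x).
Proof.
move=> sf sg fg0 fg1 fg2; have oT : open [set: V] by exact: openT.
have := cintegral_cderiv v (csmoothM oT sf sg) fg0.
rewrite (_ : cderiv [:: v] _ = (fun x => f x * cderiv [:: v] g x + cderiv [:: v] f x * g x)); last first.
  by apply/funext => x; exact: (cderivM1 v oT sf sg Logic.I).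
rewrite cintegralD//.
- by move=> /eqP; rewrite addrC addr_eq0 => /eqP.
- exact: ccontinuousM (csmooth_continuous sf) (csmooth_continuous (cderiv_smooth _ sg)).
- exact: ccontinuousM (csmooth_continuous (cderiv_smooth _ sf)) (csmooth_continuous sg).
Qed.

Lemma cintegral_by_parts vs (f g : V -> C) : csmooth setT f -> csmooth setT g ->
  supported D f \/ supported D g ->
  cintegral setT (fun x => cderiv vs f x * g x) =
  (-1) ^+ size vs * cintegral setT (fun x => f x * cderiv (rev vs) g x).
Proof.
move=> sf sg S; elim: vs g sg S => [|v vs IH] g sg S.
  rewrite expr0 mul1r /rev /=; apply: cintegral_ext => x; by rewrite !cderiv_nil.
have S' vs' : supported D (fun x => cderiv vs f x * cderiv vs' g x).
  by case: S => S; [apply/supportedMl/supported_cderiv|apply/supportedMr/supported_cderiv].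
rewrite (_ : (fun x => cderiv (v :: vs) f x * g x) = (fun x => cderiv [:: v] (cderiv vs f) x * g x))//.
have h0 : supported D (fun x => cderiv vs f x * g x) by have := S' [::]; rewrite cderiv_nil.
have h2 : supported D (fun x => cderiv [:: v] (cderiv vs f) x * g x).
  case: S => S; last exact: supportedMr S.
  exact: supportedMl (supported_cderiv [:: v] (supported_cderiv vs S)).
rewrite (cintegral_by_parts1 (cderiv_smooth vs sf) sg h0 (S' [:: v]) h2).
have S2 : supported D f \/ supported D (cderiv [:: v] g).
  by case: S => S; [left; exact: S|right; exact: (supported_cderiv [:: v] S)].
rewrite (IH _ (cderiv_smooth [:: v] sg) S2) exprS mulN1r mulNr rev_cons -cats1; congr (- (_ * _)).
by apply: cintegral_ext => x; rewrite cderiv_cat.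
Qed.

End compact_support.

Lemma csmooth_under_integral (k : nat) (Om : set 'rV[R]_k) (D : set V) (G : 'rV[R]_(N + k) -> C) :
  open Om -> compact D -> csmooth setT G ->
  (forall x y, Om y -> ~ D x -> G (row_mx x y) = 0) ->
  csmooth Om (fun y => cintegral setT (fun x => G (row_mx x y))) /\
  forall vs y, Om y -> cderiv vs (fun y => cintegral setT (fun x => G (row_mx x y))) y =
    cintegral setT (fun x => cderiv (map (row_mx 0) vs) G (row_mx x y)).
Proof.
move=> oOm cD [G1 G2] G0.
have [|s1 e1] := smooth_under_integral oOm cD G1.
  by move=> x y Oy xD; rewrite /re_part G0.
have [|s2 e2] := smooth_under_integral oOm cD G2.
  by move=> x y Oy xD; rewrite /im_part G0.
split; first by split; [exact: s1|exact: s2].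
by move=> vs y Oy; congr (_ +i* _)%C; [exact: e1|exact: e2].
Qed.

Lemma Rintegral_positive (u : V -> R) (x0 : V) : continuous u -> 0 < u x0 ->
  exists c r, 0 < r /\ 0 < c /\ c <= \int[mu]_x (u x * plateau x0 r x).
Proof.
move=> cu u0; have u20 : 0 < u x0 / 2 by rewrite divr_gt0.
have /nbhs_ballP[d /= d0 Hd] : \forall x \near x0, u x0 / 2 <= u x.
  have /cvgrPdist_le/(_ _ u20) := cu x0; apply: filterS => x.
  by rewrite ler_norml => /andP[_]; lra.
(* The plateau of radius [r] is supported where [|x - x0| <= 2 r < d], and there [u] is at least
   half its value at [x0]. *)
pose r := d / 3; have r0 : 0 < r by rewrite divr_gt0.
pose D := [set x : V | `|x| <= `|x0| + 2 * r].
have cD : compact D by exact: closed_ball_compact_rV.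
have P0 x : ~ D x -> plateau x0 r x = 0.
  move=> xD; apply: plateau0 => //; rewrite ltNge; apply/negP => H; apply: xD.
  by rewrite /D /= -[x](subrK x0) addrC (le_trans (ler_normD _ _))// lerD2l.
have Pb x : 0 <= plateau x0 r x by have /andP[] := plateau_bound x0 r x.
pose B := [set x : V | forall i, `[x0 ord0 i - r, x0 ord0 i + r]%classic (x ord0 i)].
have mB : measurable B by exact: (@measurable_box _ N (fun i => `[x0 ord0 i - r, x0 ord0 i + r]%classic)).
have muB : mu B = ((2 * r) ^+ N)%:E.
  rewrite /B (@lebesgue_rV_box R N (fun i => `[x0 ord0 i - r, x0 ord0 i + r]%classic))//.
  have H : forall m (c : R), (\prod_(i < m) c%:E)%E = (c ^+ m)%:E.
    by elim=> [|m IH] c; [rewrite big_ord0 expr0|rewrite big_ord_recl IH exprS EFinM].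
  rewrite -H; apply: eq_bigr => i _; rewrite lebesgue_measure_itv/= lte_fin ltrD2l gt0_cp//.
  by rewrite -EFinD; congr (_%:E); ring.
have Bx x : B x -> `|x - x0| <= r.
  move=> Hx; apply: rV_norm_le; first exact: ltW.
  by move=> i; rewrite !mxE ler_distl; have := Hx i; rewrite /= in_itv.
exists (u x0 / 2 * (2 * r) ^+ N), r; split => //; split.
  by rewrite mulr_gt0// exprn_gt0// mulr_gt0.
have -> : u x0 / 2 * (2 * r) ^+ N = \int[mu]_(x in B) (u x0 / 2).
  by rewrite Rintegral_cst//; congr (_ * _); exact: (esym (congr1 fine muB)).
rewrite Rintegral_mkcond; apply: le_Rintegral => //.
- have : mu.-integrable B (EFin \o cst (u x0 / 2)).
    apply: (@measurable_bounded_integrable _ _ _ _ (cst (u x0 / 2))) => //.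
      exact: (eq_ind_r (fun z : \bar R => (z < +oo)%E) (ltry _) muB).
    by exists `|u x0 / 2|; split => [|M' MM' x _]; [exact: num_real|exact: ltW].
  move=> iB; have iB' : mu.-integrable setT ((EFin \o cst (u x0 / 2)) \_ B).
    by apply/integrable_restrict; rewrite ?setTI.
  by apply: eq_integrable iB' => // x _; rewrite /= !patchE; case: ifP.
- apply: (integrable_csupp cD).
    by move=> x; exact: (cvgM (cu x) (@smoothT_continuous _ _ _ (smooth_plateau x0 r) x)).
  by move=> x /P0 ->; rewrite mulr0.
- move=> x _; rewrite patchE; case: ifPn => [/set_mem xB|_].
    rewrite plateau1 ?mulr1//; last exact: Bx.
    apply: Hd; rewrite -ball_normE /ball_ /= distrC (le_lt_trans (Bx _ xB))//.
    by rewrite /r ltr_pdivrMr// ltr_pMr// ltr1n.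
  have [/P0 ->|xd] := pselect (~ D x); first by rewrite mulr0.
  have [H|H] := ltP (2 * r) `|x - x0|; first by rewrite plateau0// mulr0.
  rewrite mulr_ge0//; apply: le_trans (ltW u20) _.
  apply: Hd; rewrite -ball_normE /ball_ /= distrC (le_lt_trans H)// /r.
  by rewrite mulrA ltr_pdivrMr// mulrC ltr_pM2l// ltr_nat.
Qed.

Lemma test_plateau (x0 : V) (r : R) : 0 < r ->
  test_fun setT (fun x => (plateau x0 r x)%:C)%C.
Proof.
move=> r0; split; first by apply: (csmooth_real (@openT V)); exact: smooth_plateau.
exists [set x : V | `|x| <= `|x0| + 2 * r]; split => //; first exact: closed_ball_compact_rV.
move=> x /= xD; rewrite plateau0// ltNge; apply/negP => H; apply: xD.
by rewrite -[x](subrK x0) addrC (le_trans (ler_normD _ _))// lerD2l.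
Qed.

(** Plateaus are enough as test functions: where a continuous real function is positive, a small
    plateau gives a positive integral. This is applied to the two parts of [u] and to their
    opposites. *)
Lemma fundamental_lemma (u : V -> C) : ccontinuous u ->
  (forall phi, test_fun setT phi -> cintegral setT (fun x => u x * phi x) = 0) -> forall x, u x = 0.
Proof.
have key (w : V -> R) : continuous w ->
    (forall x0 r, 0 < r -> \int[mu]_x (w x * plateau x0 r x) = 0) -> forall x, w x <= 0.
  move=> cw H x; rewrite leNgt; apply/negP => /(Rintegral_positive cw)[c [r [r0 [c0]]]].
  by rewrite (H x r r0) leNgt c0.
have key2 (w : V -> R) : continuous w ->
    (forall x0 r, 0 < r -> \int[mu]_x (w x * plateau x0 r x) = 0) -> forall x, w x = 0.
  move=> cw H x; apply/eqP; rewrite eq_le key//= -oppr_le0.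
  apply: (key (fun y => - w y)); first by move=> y; exact: (cvgN (cw y)).
  move=> x0 r r0; transitivity (\int[mu]_y (-1 * (w y * plateau x0 r y))).
    by apply: eq_Rintegral => y _; rewrite mulN1r mulNr.
  rewrite RintegralZl//; first by rewrite H// mulr0.
  have [_ [D [cD _ D0]]] := test_plateau x0 r0.
  apply: (integrable_csupp cD).
    by move=> y; exact: (cvgM (cw y) (@smoothT_continuous _ _ _ (smooth_plateau x0 r) y)).
  by move=> y /D0 /(congr1 (@complex.Re R)) /= ->; rewrite mulr0.
move=> [c1 c2] H x; apply: complex_eq.
  apply: (key2 (re_part u) c1) => x0 r r0; have := congr1 (@complex.Re R) (H _ (test_plateau x0 r0)).
  by rewrite /= re_partM => <-; apply: eq_Rintegral => y _; rewrite /im_part /re_part /= mulr0 subr0.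
apply: (key2 (im_part u) c2) => x0 r r0; have := congr1 (@complex.Im R) (H _ (test_plateau x0 r0)).
by rewrite /= im_partM => <-; apply: eq_Rintegral => y _; rewrite /im_part /re_part /= mulr0 add0r.
Qed.

End complex_integrals.

(** * Differential operators *)

Section differential_operators.
Context {R : realType} {N : nat}.
Local Notation C := R[i].
Local Notation V := 'rV[R]_N.

(** An inductive form of the finite sums of a [diffop]: properties of differential operators are
    proved by induction on the number of terms. *)
Inductive normal_op : ((V -> C) -> V -> C) -> Prop :=
| normal_op0 : normal_op (fun _ _ => 0)
| normal_opD P a I : csmooth setT a -> normal_op P ->
    normal_op (fun phi x => a x * cpartial I phi x + P phi x).

(* Operators agreeing on smooth functions with a finite sum of a_k d^(I_k); smooth functions and
   open sets are always those of the whole space. *)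
Definition smooth_op (P : (V -> C) -> V -> C) :=
  exists2 Q, normal_op Q & forall phi, csmooth setT phi -> forall x, P phi x = Q phi x.

Let oT : open [set: V]. Proof. exact: openT. Qed.

Lemma normal_op_csmooth P phi : normal_op P -> csmooth setT phi -> csmooth setT (P phi).
Proof.
move=> nP sphi; elim: nP => [|{}P a I sa _ IH]; first exact: csmooth_cst.
exact: (csmoothD oT (csmoothM oT sa (cderiv_smooth _ sphi)) IH).
Qed.

Lemma smooth_op_csmooth P phi : smooth_op P -> csmooth setT phi -> csmooth setT (P phi).
Proof.
move=> [Q nQ PQ] sphi; apply: (csmooth_eq_on oT _ (normal_op_csmooth nQ sphi)) => x _.
by rewrite PQ.
Qed.

Lemma smooth_op_ext P P' : (forall phi, csmooth setT phi -> forall x, P phi x = P' phi x) ->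
  smooth_op P -> smooth_op P'.
Proof. by move=> E [Q nQ PQ]; exists Q => // phi s x; rewrite -(E _ s) (PQ _ s). Qed.

Lemma smooth_opD P P' : smooth_op P -> smooth_op P' -> smooth_op (fun phi x => P phi x + P' phi x).
Proof.
move=> [Q nQ PQ] [Q' nQ' PQ'].
suff H : smooth_op (fun phi x => Q phi x + Q' phi x).
  by apply: smooth_op_ext H => phi s x; rewrite (PQ _ s) (PQ' _ s).
elim: nQ => [|{PQ}Q0 a I sa _ [Q1 nQ1 E]].
  by exists Q' => // phi s x; rewrite add0r.
exists (fun phi x => a x * cpartial I phi x + Q1 phi x); first exact: normal_opD.
by move=> phi s x; rewrite -addrA (E _ s).
Qed.

Lemma smooth_opM a P : csmooth setT a -> smooth_op P -> smooth_op (fun phi x => a x * P phi x).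
Proof.
move=> sa [Q nQ PQ].
suff H : smooth_op (fun phi x => a x * Q phi x) by apply: smooth_op_ext H => phi s x; rewrite (PQ _ s).
elim: nQ => [|{PQ}Q0 b I sb _ [Q1 nQ1 E]].
  by exists (fun _ _ => 0); [exact: normal_op0|move=> phi s x; rewrite mulr0].
exists (fun phi x => (a x * b x) * cpartial I phi x + Q1 phi x).
  by apply: normal_opD nQ1; exact: (csmoothM oT sa sb).
by move=> phi s x; rewrite mulrDr mulrA (E _ s).
Qed.

Lemma smooth_op_id : smooth_op (fun phi x => phi x).
Proof.
exists (fun phi x => 1 * cpartial [::] phi x + 0); last first.
  by move=> phi s x; rewrite cpartialE /= cderiv_nil mul1r addr0.
by apply: (@normal_opD (fun _ _ => 0) (fun=> 1)); [exact: csmooth_cst|exact: normal_op0].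
Qed.

(** The product rule brings the derivative of a term b d^I back to normal form: (d_i b) d^I + b d_i
    d^I. *)
Lemma smooth_op_partial i P : smooth_op P ->
  smooth_op (fun phi x => cderiv [:: delta_mx ord0 i] (P phi) x).
Proof.
move=> [Q nQ PQ].
suff H : smooth_op (fun phi x => cderiv [:: delta_mx ord0 i] (Q phi) x).
  apply: smooth_op_ext H => phi s x; apply: (cderiv_eq_on _ oT _ Logic.I) => y _.
  by rewrite PQ.
elim: nQ => [|{PQ}Q0 b I sb nQ0 H].
  exists (fun _ _ => 0); first exact: normal_op0.
  move=> phi s x; have H := @cderivZ R N setT [:: delta_mx ord0 i] 0 _ x oT (csmooth_cst oT (0 : C)) Logic.I.
  transitivity (cderiv [:: delta_mx ord0 i] (fun=> 0 * (0 : C)) x); last by rewrite H mul0r.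
  by congr (cderiv _ _ x); apply/funext => y; rewrite mul0r.
have [Q1 nQ1 E] := H.
exists (fun phi x => cderiv [:: delta_mx ord0 i] b x * cpartial I phi x +
   (b x * cpartial (i :: I) phi x + Q1 phi x)).
  apply: normal_opD; first exact: cderiv_smooth.
  exact: normal_opD.
move=> phi s x.
have sI : csmooth setT (cpartial I phi) by exact: cderiv_smooth.
have sQ := normal_op_csmooth nQ0 s.
rewrite (cderivD [:: delta_mx ord0 i] oT (csmoothM oT sb sI) sQ Logic.I).
rewrite (cderivM1 (delta_mx ord0 i) oT sb sI Logic.I) (E _ s).
by rewrite [_ + cderiv _ b x * _]addrC -addrA.
Qed.

Lemma smooth_op_cpartialM I a : csmooth setT a ->
  smooth_op (fun phi x => cpartial I (fun y => a y * phi y) x).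
Proof.
move=> sa; elim: I => [|i I IH].
  apply: smooth_op_ext (smooth_opM sa smooth_op_id) => phi s x.
  by rewrite cpartialE cderiv_nil.
exact: (smooth_op_partial i IH).
Qed.

Lemma smooth_op_sum (I : Type) (s : seq I) (P : I -> (V -> C) -> V -> C) :
  (forall i, smooth_op (P i)) -> smooth_op (fun phi x => \sum_(i <- s) P i phi x).
Proof.
move=> sP; elim: s => [|i s IH].
  by exists (fun _ _ => 0); [exact: normal_op0|move=> phi _ x; rewrite big_nil].
by apply: smooth_op_ext (smooth_opD (sP i) IH) => phi _ x; rewrite big_cons.
Qed.

Lemma smooth_op_diffop (L : diffop R N) : smooth_op (diffop_fun L).
Proof.
apply: smooth_op_sum => k; have := @smooth_op_cpartialM (dindex k) (fun=> 1) (csmooth_cst oT 1).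
move=> /(smooth_opM (coef_smooth k)); apply: smooth_op_ext => phi s x.
by congr (_ * cpartial _ _ x); apply/funext => y; rewrite mul1r.
Qed.

Lemma smooth_op_transpose (L : diffop R N) : smooth_op (transpose_fun L).
Proof.
apply: smooth_op_sum => k; apply: (smooth_opM (csmooth_cst oT ((-1) ^+ size (dindex k)))).
exact: (smooth_op_cpartialM (rev (dindex k)) (coef_smooth k)).
Qed.

Section properties.
Variable P : (V -> C) -> V -> C.
Hypothesis sP : smooth_op P.

Lemma smooth_op_linear c phi psi : csmooth setT phi -> csmooth setT psi ->
  forall x, P (fun y => c * phi y + psi y) x = c * P phi x + P psi x.
Proof.
move=> s1 s2 x; have [Q nQ PQ] := sP.
rewrite (PQ _ s1) (PQ _ s2) (PQ _ (csmoothD oT (csmoothZ oT c s1) s2)).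
elim: nQ {PQ} => [|Q0 b I sb _ IH]; first by rewrite mulr0 addr0.
rewrite IH !cpartialE (cderivD _ oT (csmoothZ oT c s1) s2 Logic.I) (cderivZ _ c oT s1 Logic.I).
ring.
Qed.

Lemma smooth_opZ c phi : csmooth setT phi -> forall x, P (fun y => c * phi y) x = c * P phi x.
Proof.
move=> s1 x; have s0 := csmooth_cst oT (0 : C).
have P0 : P (fun=> 0) x = 0.
  have := smooth_op_linear (-1) s0 s0 x; rewrite (_ : (fun y => _) = fun=> 0).
    by rewrite mulN1r addNr.
  by apply/funext => y; rewrite mulr0 addr0.
rewrite -[RHS]addr0 -P0 -(smooth_op_linear c s1 s0); congr (P _ x).
by apply/funext => y; rewrite addr0.
Qed.

Lemma smooth_op_add phi psi : csmooth setT phi -> csmooth setT psi ->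
  forall x, P (fun y => phi y + psi y) x = P phi x + P psi x.
Proof.
move=> s1 s2 x; rewrite -[P phi x]mul1r -(smooth_op_linear 1 s1 s2); congr (P _ x).
by apply/funext => y; rewrite mul1r.
Qed.

Lemma smooth_opB phi psi : csmooth setT phi -> csmooth setT psi ->
  forall x, P (fun y => phi y - psi y) x = P phi x - P psi x.
Proof.
move=> s1 s2 x; rewrite -mulN1r addrC -(smooth_op_linear (-1) s2 s1); congr (P _ x).
by apply/funext => y; rewrite mulN1r addrC.
Qed.

Lemma smooth_op_local (U : set V) phi psi : open U -> csmooth setT phi -> csmooth setT psi ->
  (forall x, U x -> phi x = psi x) -> forall x, U x -> P phi x = P psi x.
Proof.
move=> oU s1 s2 E x Ux; have [Q nQ PQ] := sP; rewrite (PQ _ s1) (PQ _ s2).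
elim: nQ {PQ} => [//|Q0 b I sb _ ->]; congr (_ * _ + _).
exact: (cderiv_eq_on _ oU E Ux).
Qed.

Lemma smooth_op_supported D phi : compact D -> csmooth setT phi -> supported D phi -> supported D (P phi).
Proof.
move=> cD s1 phi0 x xD; have [Q nQ PQ] := sP; rewrite (PQ _ s1).
elim: nQ {PQ} => [//|Q0 b I sb _ ->]; rewrite cpartialE addr0.
by rewrite (cderiv_csupp _ cD phi0 xD) mulr0.
Qed.

(** The order [m] depends on the operator alone; only the constant depends on the compact set. *)
Lemma smooth_op_bound : exists m, forall D, compact D -> exists2 c, 0 <= c &
  forall phi x M, csmooth setT phi -> D x -> cdbound m phi x M -> Normc.normc (P phi x) <= c * M.
Proof.
have [Q nQ PQ] := sP.
suff [m H] : exists m, forall D, compact D -> exists2 c, 0 <= c &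
  forall phi x M, csmooth setT phi -> D x -> cdbound m phi x M -> Normc.normc (Q phi x) <= c * M.
  exists m => D cD; have [c c0 Hc] := H D cD; exists c => // phi x M s Dx b.
  by rewrite (PQ _ s); exact: Hc.
elim: nQ {PQ} => [|Q0 b I sb _ [m H]].
  by exists 0%N => D cD; exists 0 => // phi x M _ _ _; rewrite Normc.normc0 mul0r.
exists (maxn m (size I)) => D cD; have [c c0 Hc] := H D cD.
have [B B0 HB] := compact_cdbound 0 oT cD (@subsetT _ _) sb.
exists (2 * B * 2 + c); first by rewrite addr_ge0// !mulr_ge0.
move=> phi x M s Dx bM; apply: le_trans (le_normcD _ _) _; rewrite mulrDl; apply: lerD.
  rewrite Normc.normcM -[_ * 2 * M]mulrA; apply: ler_pM; rewrite ?normc_ge0//.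
    exact: cdboundW (HB _ Dx).
  apply: (cdbound_cderiv bM); first by rewrite size_map leq_maxr.
  by rewrite all_map; apply/allP => i _ /=; rewrite rV_norm_delta.
by apply: Hc => //; apply: cdbound_le bM; rewrite ?leq_maxl.
Qed.

Lemma smooth_op_param (k : nat) (G : 'rV[R]_(k + N) -> C) : csmooth setT G ->
  csmooth setT (fun z : 'rV[R]_(k + N) => P (fun y => G (row_mx (lsubmx z) y)) (rsubmx z)).
Proof.
move=> sG; have [Q nQ PQ] := sP; have oT' : open [set: 'rV[R]_(k + N)] by exact: openT.
have sslice x : csmooth setT (fun y => G (row_mx x y)).
  have sm : smooth_map setT (fun y : V => row_mx x y).
    by apply: smooth_map_row_mx; [exact: smooth_map_cst oT|exact: smooth_map_id oT].
  exact: (csmooth_comp (Om' := setT) oT oT' sm sG (fun _ _ => Logic.I)).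
rewrite (_ : (fun z => _) = fun z => Q (fun y => G (row_mx (lsubmx z) y)) (rsubmx z)); last first.
  by apply/funext => z; rewrite (PQ _ (sslice _)).
elim: nQ {PQ} => [|Q0 b I sb _ IH]; first exact: csmooth_cst.
have sb' : csmooth setT (fun z : 'rV[R]_(k + N) => b (rsubmx z)).
  exact: (csmooth_comp (Om' := setT) oT' oT (@smooth_map_rsubmx R k N) sb (fun _ _ => Logic.I)).
have sGI := cderiv_smooth (map (row_mx (0 : 'rV[R]_k)) [seq delta_mx ord0 i : V | i <- I]) sG.
have := csmoothD oT' (csmoothM oT' sb' sGI) IH.
rewrite (_ : (fun y => _) = (fun z => b (rsubmx z) * cpartial I (fun y => G (row_mx (lsubmx z) y)) (rsubmx z) +
   Q0 (fun y => G (row_mx (lsubmx z) y)) (rsubmx z)))//.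
apply/funext => z; congr (b _ * _ + _); rewrite /cpartial /cderiv.
by congr (_ +i* _)%C; rewrite -[in LHS](hsubmxK z) -iter_derive_row_mx.
Qed.

(** Differentiation under the integral sign, applied to each term of the normal form; the compact
    set outside which [G] vanishes in [x] is the same for all [y]. *)
Lemma smooth_op_integral (k : nat) (D : set 'rV[R]_k) (G : 'rV[R]_(k + N) -> C) : compact D -> csmooth setT G ->
  (forall x y, ~ D x -> G (row_mx x y) = 0) ->
  csmooth setT (fun y => cintegral setT (fun x => G (row_mx x y))) /\
  forall y, P (fun y => cintegral setT (fun x => G (row_mx x y))) y =
            cintegral setT (fun x => P (fun y => G (row_mx x y)) y).
Proof.
move=> cD sG G0; have [Q nQ PQ] := sP; have oT' : open [set: 'rV[R]_(k + N)] by exact: openT.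
have [sI EI] := csmooth_under_integral oT cD sG (fun x y _ => G0 x y).
have sslice x : csmooth setT (fun y => G (row_mx x y)).
  have sm : smooth_map setT (fun y : V => row_mx x y).
    by apply: smooth_map_row_mx; [exact: smooth_map_cst oT|exact: smooth_map_id oT].
  exact: (csmooth_comp (Om' := setT) oT oT' sm sG (fun _ _ => Logic.I)).
have sslice' (G' : 'rV[R]_(k + N) -> C) y : csmooth setT G' -> csmooth setT (fun x => G' (row_mx x y)).
  move=> sG'; have sm : smooth_map setT (fun x : 'rV[R]_k => row_mx x y).
    by apply: smooth_map_row_mx; [exact: smooth_map_id openT|exact: smooth_map_cst openT].
  exact: (csmooth_comp (Om' := setT) openT oT' sm sG' (fun _ _ => Logic.I)).
split=> [|y]; first exact: sI.
rewrite (PQ _ sI).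
rewrite (@cintegral_ext _ _ _ (fun x => Q (fun y => G (row_mx x y)) y)); last by move=> x; rewrite (PQ _ (sslice x)).
suff [H1 [H2 H3]] : ccontinuous (fun x => Q (fun y => G (row_mx x y)) y) /\
   supported D (fun x => Q (fun y => G (row_mx x y)) y) /\
   Q (fun y => cintegral setT (fun x => G (row_mx x y))) y = cintegral setT (fun x => Q (fun y => G (row_mx x y)) y) by [].
elim: nQ {PQ} => [|Q0 b I sb _ [H1 [H2 H3]]].
  split; first exact: ccontinuous_cst.
  split => //; have E := @cintegralZ R k D cD 0 (fun=> 0) (ccontinuous_cst 0) (fun _ _ => erefl).
  transitivity (cintegral setT (fun _ : 'rV[R]_k => 0 * (0 : C))); first by rewrite E mul0r.
  by apply: cintegral_ext => x; rewrite mul0r.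
set vs := [seq delta_mx ord0 i : V | i <- I].
have EG x : cpartial I (fun y => G (row_mx x y)) y = cderiv (map (row_mx 0) vs) G (row_mx x y).
  by rewrite /cpartial /cderiv; congr (_ +i* _)%C; rewrite -iter_derive_row_mx.
have cI : ccontinuous (fun x => cderiv (map (row_mx 0) vs) G (row_mx x y)).
  exact: csmooth_continuous (sslice' _ y (cderiv_smooth _ sG)).
have S0 : supported D (fun x => cderiv (map (row_mx 0) vs) G (row_mx x y)).
  move=> x xD; rewrite -EG cpartialE.
  rewrite (cderiv_eq_on _ oT (g := fun=> 0 * 0) _ Logic.I); last by move=> z _; rewrite G0// mulr0.
  by rewrite (cderivZ _ 0 oT (csmooth_cst oT 0) Logic.I) mul0r.
rewrite (_ : (fun x => _) = fun x => b y * cderiv (map (row_mx 0) vs) G (row_mx x y) +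
   Q0 (fun y => G (row_mx x y)) y); last by apply/funext => x; rewrite EG.
split; first exact: ccontinuousD (ccontinuousZ _ cI) H1.
split; first exact: supportedD (supportedMr _ S0) H2.
rewrite (cintegralD cD (ccontinuousZ _ cI) H1 (supportedMr _ S0) H2) (cintegralZ cD _ cI S0) H3.
by congr (_ * _ + _); rewrite cpartialE EI.
Qed.

End properties.

Lemma transpose_by_parts (L : diffop R N) (D : set V) (u phi : V -> C) : compact D ->
  csmooth setT u -> csmooth setT phi -> supported D u \/ supported D phi ->
  cintegral setT (fun x => transpose_fun L u x * phi x) =
  cintegral setT (fun x => u x * diffop_fun L phi x).
Proof.
move=> cD su sphi S.
have sc (k : 'I_(nterms L)) := coef_smooth k.
have sau k := csmoothM oT (sc k) su.
pose I (k : 'I_(nterms L)) := [seq delta_mx ord0 i : V | i <- dindex k].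
have S1 (k : 'I_(nterms L)) (vs vs' : seq V) : supported D (fun x => cderiv vs (fun y => coef k y * u y) x * cderiv vs' phi x).
  by case: S => S; [apply/supportedMl/(supported_cderiv cD)/supportedMr|apply/supportedMr/(supported_cderiv cD)].
have S2 (k : 'I_(nterms L)) : supported D (fun x => u x * (coef k x * cpartial (dindex k) phi x)).
  by case: S => S; [apply/supportedMl|apply/supportedMr/supportedMr/(supported_cderiv cD)].
have c1 (k : 'I_(nterms L)) (vs vs' : seq V) : ccontinuous (fun x => cderiv vs (fun y => coef k y * u y) x * cderiv vs' phi x).
  exact: (ccontinuousM (csmooth_continuous (cderiv_smooth vs (sau k))) (csmooth_continuous (cderiv_smooth vs' sphi))).
have c2 (k : 'I_(nterms L)) : ccontinuous (fun x => u x * (coef k x * cpartial (dindex k) phi x)).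
  exact: (ccontinuousM (csmooth_continuous su) (ccontinuousM (csmooth_continuous (sc k)) (csmooth_continuous (cderiv_smooth (I k) sphi)))).
rewrite (@cintegral_ext _ _ _ (fun x => \sum_(k < nterms L) (-1) ^+ size (dindex k) *
    (cderiv (rev (I k)) (fun y => coef k y * u y) x * cderiv [::] phi x))); last first.
  move=> x; rewrite /transpose_fun mulr_suml; apply: eq_bigr => k _.
  by rewrite cderiv_nil cpartialE map_rev mulrA.
rewrite [RHS](@cintegral_ext _ _ _ (fun x => \sum_(k < nterms L) u x * (coef k x * cpartial (dindex k) phi x))); last first.
  by move=> x; rewrite /diffop_fun mulr_sumr.
rewrite (cintegral_sum cD); last 2 first.
- by move=> k; exact: ccontinuousZ (c1 k _ _).
- by move=> k; exact: supportedMr (S1 k _ _).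
rewrite (cintegral_sum cD); last 2 first.
- exact: c2.
- exact: S2.
apply: eq_bigr => k _; rewrite (cintegralZ cD _ (c1 k _ _) (S1 k _ _)).
rewrite (@cintegral_ext _ _ (fun x => cderiv (rev (I k)) _ x * _) (fun x => cderiv (rev (I k)) (fun y => coef k y * u y) x * phi x)); last first.
  by move=> x; rewrite cderiv_nil.
rewrite (cintegral_by_parts cD _ (sau k) sphi); last first.
  by case: S => S; [left; exact: supportedMr|right].
rewrite revK size_rev size_map mulrA -exprD addnn -mul2n exprM sqrrN expr1n expr1n mul1r.
by apply: cintegral_ext => x; rewrite -mulrA mulrCA.
Qed.

End differential_operators.

(** * Dilations and translations *)

Lemma smooth_rV_coord {R : realType} (V : normedModType R) k (Om : set V) (F : V -> 'rV[R]_k) i :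
  open Om -> smooth Om F -> smooth Om (fun x => F x ord0 i).
Proof.
move=> oOm sF.
apply: (smooth_coind (W := R) oOm (C := fun g : V -> R => exists2 F : V -> 'rV[R]_k, smooth Om F & g = fun x => F x ord0 i)); last by exists F.
  move=> g [H sH ->] x Ox; split.
    apply: (@continuous_comp _ _ _ H (fun y : 'rV[R]_k => y ord0 i)); first exact: smooth_continuous sH Ox.
    exact: coord_continuous.
  by move=> v; have /derivable_mxP D : derivable H x v := smooth_derivable sH Ox; exact: (D ord0 i).
move=> g v [H sH ->]; exists (fun x => 'D_v H x ord0 i).
  exists ('D_v H); [exact: (smooth_derive v sH)|exact: erefl].
by move=> x Ox; rewrite (derive_mx (smooth_derivable sH Ox : derivable H x v)) mxE.
Qed.

Section dilations.
Context {R : realType} {N : nat}.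
Local Notation V := 'rV[R]_N.
Variable G : carnot_group R N.

Let s := step G.
Let U (i : 'I_s) : {vspace V} := stratum G i.+1.
Let pi (i : 'I_s) : {linear V -> V} := sumv_pi (\sum_(i < s) U i)%VS i.

Let sum_pi x : \sum_i pi i x = x.
Proof. by apply: sumv_pi_sum; rewrite [(\sum_i U i)%VS](stratum_full G) memvf. Qed.

Let mem_pi i x : pi i x \in U i. Proof. exact: memv_sum_pi. Qed.

Let direct_unique i x (u : 'I_s -> V) : x \in U i -> (forall j, u j \in U j) -> \sum_j u j = x ->
  forall j, u j = if j == i then x else 0.
Proof.
move=> xU uU ux; have /directv_sum_unique H := stratum_direct G.
have := H u (fun j => if j == i then x else 0); rewrite ux (bigD1 i)//= eqxx big1 => [|j /negbTE ->//].
rewrite addr0 eqxx => /(_ (fun j _ => uU j)) E j.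
have /esym/forallP /(_ j)/implyP/(_ isT)/eqP // : true = [forall (i0 | true), u i0 == (if i0 == i then x else 0)].
by apply: E => k _; case: eqP => [->|_]; rewrite ?xU ?mem0v.
Qed.

Let pi_id i x : x \in U i -> forall j, pi j x = if j == i then x else 0.
Proof. by move=> xU; exact: (direct_unique xU (fun j => mem_pi j x) (sum_pi x)). Qed.

Lemma dilation_linear t : linear (dilation G t : V -> V).
Proof.
move=> c x y; rewrite /dilation scaler_sumr -big_split /=; apply: eq_bigr => i _.
by rewrite linearP scalerDr !scalerA mulrC.
Qed.

HB.instance Definition _ t := GRing.isLinear.Build R V V *:%R (dilation G t : V -> V) (dilation_linear t).

Let dilationE t x : dilation G t x = \sum_(i < s) t ^+ i.+1 *: pi i x. Proof. by []. Qed.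

Let dilation_stratum t i x : x \in U i -> dilation G t x = t ^+ i.+1 *: x.
Proof.
move=> /pi_id xU; rewrite dilationE (bigD1 i)//= xU eqxx big1 ?addr0// => j /negbTE ji.
by rewrite xU ji scaler0.
Qed.

Lemma dilationM t u x : dilation G t (dilation G u x) = dilation G (t * u) x.
Proof.
rewrite [dilation G u x]dilationE linear_sum dilationE; apply: eq_bigr => i _.
by rewrite linearZ /= (dilation_stratum _ (mem_pi _ _)) scalerA exprMn mulrC.
Qed.

Lemma dilation1 x : dilation G 1 x = x.
Proof. by rewrite -[RHS]sum_pi dilationE; apply: eq_bigr => i _; rewrite expr1n scale1r. Qed.

Lemma dilationK t : t != 0 -> cancel (dilation G t) (dilation G t^-1).
Proof. by move=> t0 x; rewrite dilationM mulVf// dilation1. Qed.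

(** On the stratum of degree i + 1 the dilation is t^(i+1), which is at most [t] for [t <= 1]; [c]
    sums the Lipschitz constants of the projections onto the strata. *)
Lemma dilation_norm_le : exists2 c, 0 <= c & forall t x, 0 <= t <= 1 -> `|dilation G t x| <= c * t * `|x|.
Proof.
have H (i : 'I_s) : {c | 0 <= c & forall x, `|pi i x| <= c * `|x|}.
  by apply: cid2; exact: rV_linear_lipschitz.
exists (\sum_i s2val (H i)); first by apply: sumr_ge0 => i _; case: (H i).
move=> t x /andP[t0 t1]; rewrite dilationE (le_trans (ler_norm_sum _ _ _))// -mulrA mulr_suml.
apply: ler_sum => i _; case: (H i) => c c0 /= Hc.
rewrite normrZ ger0_norm ?exprn_ge0// exprS mulrCA -mulrA ler_wpM2l//.
apply: le_trans (Hc x); rewrite ler_piMl// exprn_ile1//.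
Qed.

(** The degree of a non-zero vector lying in a stratum, with 0 as default for the others. *)
Let weight (v : V) : nat := if [pick i | v \in U i] is Some i then i.+1 else 0.

Let weight_stratum i v : v != 0 -> v \in U i -> weight v = i.+1.
Proof.
move=> v0 vU; rewrite /weight; case: pickP => [j vj|/(_ i)]; last by rewrite vU.
have := pi_id vU j; rewrite (pi_id vj) eqxx; case: eqP => [->//|_ v00].
by rewrite v00 eqxx in v0.
Qed.

Let X : seq V := \big[cat/[::]]_(i < s) vbasis (U i).

Let basisX : basis_of fullv X.
Proof.
rewrite -(stratum_full G); apply: bigcat_basis; first exact: (stratum_direct G).
by move=> i _; exact: vbasisP.
Qed.

Let sizeX : size X == N.
Proof.
have := size_basis (X := in_tuple X) basisX; rewrite dimvf dim_matrix => H.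
by apply/eqP; rewrite -H; exact: mul1n.
Qed.

Let b : N.-tuple V := Tuple sizeX.

Let basis_weight t k : dilation G t b`_k = t ^+ weight b`_k *: b`_k.
Proof.
have [kN|kN] := ltnP k N; last by rewrite nth_default ?size_tuple// linear0 scaler0.
have : b`_k \in X by rewrite mem_nth// (eqP sizeX).
rewrite /X => H; have [i bi] : exists i, b`_k \in vbasis (U i).
  move: H; elim/big_ind : _ => [|x y Hx Hy|i _ H]; [by rewrite in_nil|by rewrite mem_cat => /orP[/Hx|/Hy]|].
  by exists i.
have b0 : b`_k != 0.
  have := basis_free basisX; move/free_not0 => H0; apply: H0; by rewrite mem_nth// (eqP sizeX).
have bU : b`_k \in U i by exact: vbasis_mem.
by rewrite (dilation_stratum _ bU) (weight_stratum b0 bU).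
Qed.

Let sum_weight : (\sum_(k < N) weight b`_k = hom_dim G)%N.
Proof.
transitivity (\sum_(v <- X) weight v)%N; first by rewrite (big_nth 0) (eqP sizeX) big_mkord.
have -> : (\sum_(v <- X) weight v = \sum_(i < s) \sum_(v <- vbasis (U i)) weight v)%N.
  by apply: (big_morph (fun s => \sum_(v <- s) weight v)%N) => [x y|]; rewrite ?big_cat ?big_nil.
apply: eq_bigr => i _; rewrite (eq_big_seq (fun=> i.+1)) => [|v vb].
  by rewrite big_tnth sum_nat_const card_ord mulnC size_tuple.
apply: weight_stratum; last exact: vbasis_mem.
by apply: (free_not0 (basis_free (vbasisP (U i)))).
Qed.

Let frame (x : V) : V := \sum_(k < N) x ord0 k *: b`_k.
Let frame_linear : linear frame.
Proof.
move=> c x y; rewrite /frame scaler_sumr -big_split /=; apply: eq_bigr => i _.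
by rewrite !mxE scalerDl scalerA.
Qed.
HB.instance Definition _ := GRing.isLinear.Build R V V *:%R frame frame_linear.

Let coframe (x : V) : V := \row_k coord b k x.
Let coframe_linear : linear coframe.
Proof. by move=> c x y; apply/rowP => i; rewrite !mxE linearP. Qed.
HB.instance Definition _ := GRing.isLinear.Build R V V *:%R coframe coframe_linear.

Let coframeK : cancel coframe frame.
Proof.
move=> x; rewrite [RHS](coord_basis (X := b) basisX (memvf x)).
by apply: eq_bigr => i _; rewrite mxE.
Qed.

Let frameK : cancel frame coframe.
Proof.
move=> x; apply/rowP => j; rewrite mxE /frame linear_sum.
have E (k : 'I_N) : coord b j (x ord0 k *: b`_k) = x ord0 k * (j == k)%:R.
  by rewrite linearZ /= (coord_free (X := b)) ?(basis_free basisX)// eq_sym.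
rewrite (eq_bigr _ (fun k _ => E k)) (bigD1 j)//= eqxx mulr1 big1 ?addr0// => i ij.
by rewrite eq_sym (negbTE ij) mulr0.
Qed.

Let diag t (x : V) : V := \row_k (t ^+ weight b`_k * x ord0 k).
Let diag_linear t : linear (diag t).
Proof. by move=> c x y; apply/rowP => i; rewrite !mxE mulrDr mulrCA. Qed.
HB.instance Definition _ t := GRing.isLinear.Build R V V *:%R (diag t) (diag_linear t).

Let dilation_frame t x : dilation G t x = frame (diag t (coframe x)).
Proof.
rewrite -{1}[x]coframeK {1}/frame linear_sum; apply: eq_bigr => k _.
by rewrite linearZ /= basis_weight scalerA !mxE [X in X *: _]mulrC.
Qed.

Let lebesgue_diag t : 0 < t -> lebesgue_rV N (diag t @^-1` unit_cube N) = (t ^- hom_dim G)%:E.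
Proof.
move=> t0; pose A (k : 'I_N) : set R := `]0, t ^- weight b`_k]%classic.
have -> : diag t @^-1` unit_cube N = [set x : 'rV[R]_N | forall k, A k (x ord0 k)].
  apply/predeqP => x; split => H k; have := H k; rewrite /A /= !in_itv /= !mxE => /andP[H1 H2].
    rewrite pmulr_rgt0 ?exprn_gt0// in H1.
    by rewrite H1/= -[_ ^- _]mulr1 ler_pdivlMl ?exprn_gt0.
  rewrite pmulr_rgt0 ?exprn_gt0// H1/=.
  by rewrite -[_ ^- _]mulr1 ler_pdivlMl ?exprn_gt0 in H2.
rewrite lebesgue_rV_box; last by move=> k; exact: measurable_itv.
rewrite (eq_bigr (fun k : 'I_N => (t ^- weight b`_k)%:E)) => [|k _]; last first.
  by rewrite lebesgue_measure_itv/= lte_fin invr_gt0 exprn_gt0// oppr0 adde0.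
by rewrite prodEFin prodfV -expr_sum sum_weight.
Qed.

(** In a basis made of bases of the strata the dilation is diagonal with entries t to the weights,
    whose sum is the homogeneous dimension. The preimage of the cube under the diagonal map is a
    box. *)
Lemma lebesgue_dilation t : 0 < t ->
  lebesgue_rV N (dilation G t @^-1` unit_cube N) = (t ^- hom_dim G)%:E.
Proof.
move=> t0; have mC := @measurable_unit_cube R N.
have tn0 : t != 0 by rewrite gt_eqF.
have diagK : cancel (diag t) (diag t^-1).
  by move=> x; apply/rowP => i; rewrite !mxE mulrA -exprMn mulVf// expr1n mul1r.
have diagK' : cancel (diag t^-1) (diag t).
  by move=> x; apply/rowP => i; rewrite !mxE mulrA -exprMn divff// expr1n mul1r.
have pre (M : {linear V -> V}) A : measurable A -> measurable (M @^-1` A).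
  by move=> mA; rewrite -[X in measurable X]setTI; exact: measurable_linear.
have -> : dilation G t @^-1` unit_cube N = coframe @^-1` (diag t @^-1` (frame @^-1` unit_cube N)).
  by apply/seteqP; split => x /=; rewrite dilation_frame.
rewrite (lebesgue_rV_linear (M := coframe) frameK (pre (diag t) _ (pre frame _ mC))).
rewrite (lebesgue_rV_linear (M := diag t) diagK' (pre frame _ mC)) lebesgue_diag//.
(* The Jacobian factors of the change of basis and of its inverse recombine into the measure of the
   unit cube, which is 1. *)
rewrite muleCA -(lebesgue_rV_linear (M := coframe) frameK (pre frame _ mC)).
have -> : coframe @^-1` (frame @^-1` unit_cube N) = unit_cube N; last rewrite ?lebesgue_unit_cube ?mule1//.
by apply/seteqP; split => x /=; rewrite coframeK.
Qed.

End dilations.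

(** The group law is smooth on [V * V]; precomposing with this linear map transfers that to R^(N+N),
    where the chain rule is stated. *)
Definition halves {R : realType} {N : nat} (z : 'rV[R]_(N + N)) : 'rV[R]_N * 'rV[R]_N := (lsubmx z, rsubmx z).
Lemma halves_linear {R : realType} {N : nat} : linear (@halves R N).
Proof. by move=> c x y; rewrite /halves !linearP. Qed.
HB.instance Definition _ {R : realType} {N : nat} := GRing.isLinear.Build R 'rV[R]_(N + N) ('rV[R]_N * 'rV[R]_N)%type *:%R halves halves_linear.

(** * Group law, left invariance and homogeneity of the transpose operator *)

Section group_law.
Context {R : realType} {N : nat}.
Local Notation C := R[i].
Local Notation V := 'rV[R]_N.
Variable G : carnot_group R N.
Let oT : open [set: V] := openT.

Lemma smooth_gmul : smooth_map setT (fun z : 'rV[R]_(N + N) => gmul G (lsubmx z) (rsubmx z)).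
Proof.
move=> i; have := @smooth_linear_comp R _ _ _ setT _ (halves : {linear 'rV[R]_(N + N) -> (V * V)%type})
  (@rV_linear_continuous R (N + N) _ halves) (gmul_smooth G).
rewrite preimage_setT => /(smooth_rV_coord i openT); exact: id.
Qed.

Lemma gmulNl x : gmul G (- x) x = 0.
Proof. by rewrite -[x in X in gmul G _ X]scale1r -scaleN1r gmul_exp addNr scale0r. Qed.

Lemma smooth_gmull x : smooth_map setT (gmul G x).
Proof.
move=> i; have H := smooth_map_comp openT (smooth_map_row_mx (smooth_map_cst x oT) (smooth_map_id oT)) smooth_gmul.
by have := H i; congr (smooth _ _); apply/funext => y; rewrite row_mxKl row_mxKr.
Qed.

(** Left invariance and homogeneity are assumed on distributions; tested on Dirac masses they become
    pointwise identities for the transpose acting on functions. *)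
Lemma distribution_dirac (y : V) : distribution_on setT (fun phi : V -> C => phi y).
Proof.
split=> // D _ _; exists 1, 0%N => phi M _ _ /(_ [::] y (leqnn _)).
by rewrite mul1r cpartialE cderiv_nil.
Qed.

Lemma test_cutoff (phi : V -> C) (x : V) : csmooth setT phi ->
  exists2 psi, test_fun setT psi & forall y, ball x 1 y -> phi y = psi y.
Proof.
move=> sphi; have [sp [D [cD _ Dp]]] := test_plateau x (@ltr01 R).
exists (fun y => ((plateau x 1 y)%:C)%C * phi y); last first.
  move=> y; rewrite -ball_normE /ball_ /= distrC => /ltW xy; rewrite plateau1//.
  by rewrite mul1r.
split; first exact: (csmoothM oT sp sphi).
exists D; split; [exact: cD|by []|]; by move=> y yD; rewrite Dp// mul0r.
Qed.

(** Both sides only depend on [phi] near [F x], since [P] is local. So the identity passes from test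
    functions to all smooth functions by a cutoff around that point. *)
Let test_smooth_map (P : (V -> C) -> V -> C) (F : V -> V) (c : C) : smooth_op P -> smooth_map setT F ->
  (forall phi, test_fun setT phi -> forall x, P (fun y => phi (F y)) x = c * P phi (F x)) ->
  forall phi, csmooth setT phi -> forall x, P (fun y => phi (F y)) x = c * P phi (F x).
Proof.
move=> sP sF E phi sphi x; have [psi tpsi Ep] := test_cutoff (F x) sphi.
have oB : open (ball (F x) (1 : R)) by exact: ball_open.
have oFB : open (F @^-1` ball (F x) (1 : R)).
  by apply: open_comp oB => y _; exact: (smooth_map_continuous sF).
have sc f : csmooth setT f -> csmooth setT (fun y => f (F y)).
  by move=> sf; exact: (csmooth_comp oT oT sF sf (fun _ _ => Logic.I)).
rewrite (smooth_op_local sP oB sphi tpsi.1 Ep (ballxx _ ltr01)).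
rewrite (smooth_op_local sP oFB (sc _ sphi) (sc _ tpsi.1) (fun y => Ep (F y)) (ballxx (F x) (@ltr01 R))).
exact: E.
Qed.

Section operator.
Variables (lambda : R) (L : diffop R N).
Local Notation P := (transpose_fun L).

Lemma transpose_translate : left_invariant G (diffop_distr L) ->
  forall alpha phi, csmooth setT phi -> forall x,
  P (fun y => phi (gmul G alpha y)) x = P phi (gmul G alpha x).
Proof.
move=> hinv alpha phi sphi x.
rewrite -[RHS]mul1r; apply: (test_smooth_map (smooth_op_transpose L) (smooth_gmull alpha) _ sphi).
move=> psi tpsi y; have := hinv (- alpha) _ psi (distribution_dirac y) tpsi.
by rewrite /diffop_distr /distr_translate opprK mul1r => ->.
Qed.

(** Homogeneity is used for the dilation of ratio 1/s and the Dirac mass at [y]; the Jacobian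
    factors of the two sides cancel. *)
Lemma transpose_dilate : homogeneous G lambda (diffop_distr L) ->
  forall s phi, 0 < s -> csmooth setT phi -> forall x,
  P (fun y => phi (dilation G s y)) x = ((s `^ lambda)%:C)%C * P phi (dilation G s x).
Proof.
move=> hhom s phi s0 sphi x.
apply: (test_smooth_map (smooth_op_transpose L) (smooth_map_linear (dilation G s) oT) _ sphi).
move=> psi tpsi y; have is0 : 0 < s^-1 by rewrite invr_gt0.
have := hhom _ _ psi is0 (distribution_dirac y) tpsi.
rewrite /diffop_distr /distr_dilate invrK mulrCA => /mulfI H.
rewrite {}H; last by rewrite exprVn invrK eq_complex /= expf_eq0 (gt_eqF s0) andbF.
rewrite mulrA -rmorphM /= -powRM ?ltW// divff ?gt_eqF// powR1.
by rewrite -[LHS]mul1r.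
Qed.

Lemma dilation_contracting : 1 <= lambda -> lambda < (hom_dim G)%:R -> exists t,
  [/\ 0 < t, forall x, `|dilation G t^-1 x| <= 2^-1 * `|x|, 1 < t `^ lambda & t `^ lambda < t ^+ hom_dim G].
Proof.
move=> l1 lQ; have [c c0 Hc] := dilation_norm_le G.
(* With this ratio t the inverse dilation has norm at most c / (2 c + 2) <= 1/2. Moreover t > 1, so
   powers of t increase with the exponent. *)
exists (2 * c + 2); have t1 : 1 < 2 * c + 2 by lra.
have t0 : 0 < 2 * c + 2 by lra.
have pm (u v : R) : u < v -> (2 * c + 2) `^ u < (2 * c + 2) `^ v.
  by move=> uv; rewrite /powR gt_eqF// ltr_expR ltr_pM2r// ln_gt0.
split=> //.
- move=> x; have /Hc H : 0 <= (2 * c + 2)^-1 <= 1 by rewrite invr_ge0 (ltW t0)/= invf_le1// ltW.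
  apply: le_trans (H x) _; rewrite ler_wpM2r// ler_pdivrMr// ; lra.
- by rewrite -[ltLHS](powRr0 (2 * c + 2)) pm//; lra.
- by rewrite -powR_mulrn ?(ltW t0)// pm.
Qed.

End operator.
End group_law.

(** * A priori estimate and local fundamental solutions *)

Section hahn_banach.
Context {R : realType} {X : lmodType R[i]}.
Local Notation C := R[i].
Variables (Y : set X) (q : X -> R).
Hypotheses (Y0 : Y 0) (YD : forall u v, Y u -> Y v -> Y (u + v)) (YZ : forall c u, Y u -> Y (c *: u)).
Hypotheses (qD : forall u v, Y u -> Y v -> q (u + v) <= q u + q v).
Hypotheses (qZ : forall (c : C) u, Y u -> q (c *: u) = Normc.normc c * q u).

(** A partial real-linear functional dominated by [q], coded by its graph. That the graph is
    single-valued follows from domination, see [real_graph0]. *)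
Let real_graph (G : set (X * R)) :=
  (forall (c : R) z z', G z -> G z' -> G ((c%:C)%C *: z.1 + z'.1, c * z.2 + z'.2)) /\
  (forall z, G z -> Y z.1 /\ z.2 <= q z.1).

Let q0 : q 0 = 0.
Proof. by rewrite -[X in q X](scale0r (0 : X)) qZ// normc_real normr0 mul0r. Qed.

Let s1 u : ((1 : R)%:C)%C *: u = u :> X.
Proof. exact: scale1r. Qed.

Let real_graph0 G a : real_graph G -> G (0, a) -> a = 0.
Proof.
move=> [GL Gq] Ga; apply/eqP; rewrite eq_le.
have [_] := Gq _ Ga; rewrite q0 /= => ->/=.
(* The coefficient -2 produces the pair (0, -2 a + a), whose second entry is -a. *)
have := GL (-2) _ _ Ga Ga; rewrite /= scaler0 addr0 => /Gq[_] /=; rewrite q0.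
lra.
Qed.

(** The value [s] at the new vector [w] has to lie between the numbers b - q (v - w) and q (u + w) -
    a. The triangle inequality [key] separates the two families, and [s] is the supremum of the
    first. *)
Let extend_graph (G : set (X * R)) (w : X) : real_graph G -> G (0, 0) -> Y w ->
  exists s : R, forall c u a, G (u, a) -> a + c * s <= q (u + (c%:C)%C *: w).
Proof.
move=> [GL Gq] G0 Yw.
have YN v : Y v -> Y (- v) by move=> Yv; rewrite -scaleN1r; exact: YZ.
have key u a v b : G (u, a) -> G (v, b) -> b - q (v - w) <= q (u + w) - a.
  move=> Gu Gv; have [Yu _] := Gq _ Gu; have [Yv _] := Gq _ Gv.
  have := GL 1 _ _ Gu Gv; rewrite /= scale1r mul1r => /Gq[_ /=] H.
  have := qD (YD Yu Yw) (YD Yv (YN _ Yw)); rewrite addrACA subrr addr0 => H2.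
  by rewrite lerBlDr addrAC lerBrDr addrC [X in _ <= X]addrC -lerBlDr; lra.
pose A : set R := [set z.2 - q (z.1 - w) | z in G].
have A0 : A !=set0 by exists (0 - q (0 - w)), (0, 0).
have Aub u a : G (u, a) -> ubound A (q (u + w) - a).
  by move=> Gu _ [[v b] Gv <-]; exact: key.
have sA : has_sup A by split=> //; exists (q (0 + w) - 0); exact: Aub.
have up u a : G (u, a) -> a + sup A <= q (u + w).
  by move=> Gu; have := ge_sup A0 (Aub _ _ Gu); lra.
have lo u a : G (u, a) -> a - sup A <= q (u - w).
  move=> Gu; have : a - q (u - w) <= sup A by apply: ub_le_sup; [case: sA|exists (u, a)].
  lra.
exists (sup A) => c u a Gu; have [Yu _] := Gq _ Gu.
have GZ (d : R) : G ((d%:C)%C *: u, d * a).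
  by have := GL d _ _ Gu G0; rewrite /= !addr0.
have [c0|c0|->] := ltgtP c 0; last first.
- by rewrite mul0r addr0 scale0r addr0; have [] := Gq _ Gu.
- have := up _ _ (GZ c^-1); rewrite -(ler_pM2l c0) mulrDr mulrA divff ?gt_eqF// mul1r => /le_trans; apply.
  rewrite -[X in X * q _]ger0_norm ?(ltW c0)// -normc_real -qZ; last by apply/YD => //; exact: YZ.
  rewrite scalerDr scalerA -rmorphM /= divff ?gt_eqF// s1.
  exact: lexx.
- have nc0 : 0 < - c by rewrite oppr_gt0.
  have := lo _ _ (GZ (- c)^-1); rewrite -(ler_pM2l nc0) mulrBr mulrA divff ?gt_eqF// mul1r mulNr opprK => /le_trans; apply.
  rewrite -[X in X * q _]ger0_norm ?(ltW nc0)// -normc_real -qZ; last first.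
    by apply/YD; [exact: YZ|exact: YN].
  rewrite scalerDr scalerA -rmorphM /= divff ?gt_eqF// s1 scalerN rmorphN /= scaleNr opprK.
  exact: lexx.
Qed.

Let real_extension (G0 : set (X * R)) : real_graph G0 -> G0 (0, 0) ->
  exists f : X -> R, [/\ forall u v, Y u -> Y v -> f (u + v) = f u + f v,
    forall (c : R) u, Y u -> f ((c%:C)%C *: u) = c * f u,
    forall u, Y u -> f u <= q u & forall z, G0 z -> f z.1 = z.2].
Proof.
move=> gG0 G00.
(* The union with [G0] is part of the condition, so that the union of the empty chain satisfies it
   too. *)
have [F FP tF|G [gG maxG]] := @Zorn_bigcup _ [set G | real_graph (G `|` G0)].
  have sub Z z : F Z -> (Z `|` G0) z -> (\bigcup_(Z in F) Z `|` G0) z.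
    by move=> FZ [Zz|]; [left; exists Z|right].
  split=> [c z z' Hz Hz'|z [[Z FZ Zz]|G0z]]; last 2 first.
  - by apply: (FP _ FZ).2; left.
  - exact: gG0.2.
  case: Hz Hz' => [[Z FZ Zz]|G0z] [[Z' FZ' Zz']|G0z'].
  - have [ZZ|ZZ] := tF _ _ FZ FZ'.
      by apply: (sub Z') => //; apply: (FP _ FZ').1; [left; exact: ZZ|left].
    by apply: (sub Z) => //; apply: (FP _ FZ).1; [left|left; exact: ZZ].
  - by apply: (sub Z) => //; apply: (FP _ FZ).1; [left|right].
  - by apply: (sub Z') => //; apply: (FP _ FZ').1; [right|left].
  - by right; exact: gG0.1.
have {}maxG H : real_graph H -> G `|` G0 `<=` H -> H `<=` G `|` G0.
  move=> gH GH; apply: contrapT => HG; apply: (maxG H).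
    split; first by move=> z Gz; apply: GH; left.
    by move=> HG'; apply: HG => z /HG'; left.
    change (real_graph (H `|` G0)); rewrite (_ : H `|` G0 = H)//; apply/setUidPl => z G0z; apply: GH; right; exact: G0z.
move: (G `|` G0) (gG : real_graph (G `|` G0)) maxG (@subsetUr _ G G0) => {gG} H gH maxH G0H.
have H0 : H (0, 0) by exact: G0H.
have dom w : Y w -> exists a, H (w, a).
  move=> Yw; have [s sP] := extend_graph gH H0 Yw.
  (* The graph of the extension of [H] to the span of its domain and [w], with value [s] at [w];
     maximality forces it into [H]. *)
  pose H' : set (X * R) := [set z | exists2 c : R, H (z.1 - (c%:C)%C *: w, z.2 - c * s) & True].
  have : H' `<=` H.
    apply: maxH; last by move=> [u a] Hu; exists 0 => //=; rewrite scale0r mul0r !subr0.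
    split=> [c [u a] [v b] [d /= Hu _] [d' /= Hv _]|[u a] [d /= Hu _]].
      exists (c * d + d') => //=.
      have := gH.1 c _ _ Hu Hv; congr (H (_, _)) => /=.
        rewrite scalerBr scalerA -rmorphM /= rmorphD /= scalerDl opprD addrACA //.
      by rewrite mulrBr mulrDl opprD addrACA mulrA.
    split; first by have [/= Yu _] := gH.2 _ Hu; rewrite -[u](subrK ((d%:C)%C *: w)); apply: YD => //; exact: YZ.
    by have := sP d _ _ Hu; rewrite !subrK.
  by move=> H'H; exists s; apply: H'H; exists 1 => //=; rewrite scale1r mul1r !subrr.
have [f fP] : {f : X -> R & forall w, Y w -> H (w, f w)}.
  have /choice[f fP] : forall w, exists a, Y w -> H (w, a).
    by move=> w; have [/dom[a]|] := pselect (Y w); [exists a|exists 0].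
  by exists f.
have uniq u a : H (u, a) -> f u = a.
  move=> Hu; have [Yu _] := gH.2 _ Hu.
  have := gH.1 (-1) _ _ Hu (fP _ Yu); rewrite /= rmorphN1 scaleN1r addNr => /(real_graph0 gH).
  by rewrite mulN1r; lra.
exists f; split.
- move=> u v Yu Yv; apply: uniq.
  by have := gH.1 1 _ _ (fP _ Yu) (fP _ Yv); rewrite /= scale1r mul1r.
- move=> c u Yu; apply: uniq.
  by have := gH.1 c _ _ (fP _ Yu) H0; rewrite /= !addr0.
- by move=> u Yu; have [] := gH.2 _ (fP _ Yu).
- by move=> [u a] /G0H; exact: uniq.
Qed.

(** The real part is extended first and the complex functional is rebuilt from it. Its real and
    imaginary parts are each bounded by [q], whence the factor 2. *)
Lemma hahn_banach (G0 : set (X * C)) :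
  (forall c z z', G0 z -> G0 z' -> G0 (c *: z.1 + z'.1, c * z.2 + z'.2)) -> G0 (0, 0) ->
  (forall z, G0 z -> Y z.1 /\ Normc.normc z.2 <= q z.1) ->
  exists f : X -> C, [/\ forall c u v, Y u -> Y v -> f (c *: u + v) = c * f u + f v,
    forall u, Y u -> Normc.normc (f u) <= 2 * q u & forall z, G0 z -> f z.1 = z.2].
Proof.
move=> GL G00 Gq.
have [||r [rD rZ rq rG]] := real_extension (G0 := [set z | exists2 b, G0 (z.1, b) & complex.Re b = z.2]).
- split=> [c [u a] [v b] /= [b1 Gu <-] [b2 Gv <-]|[u a] /= [b Gu <-]].
    exists ((c%:C)%C * b1 + b2); first by have := GL (c%:C)%C _ _ Gu Gv.
    by rewrite ReD ReM /= mul0r subr0.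
  by have [/= Yu qu] := Gq _ Gu; split=> //; apply: le_trans qu; apply: le_trans (ler_norm _) (Re_le_normc _).
- by exists 0.
pose i : C := 'i%C.
(* A complex-linear functional is determined by its real part r through f(u) = r(u) - i r(i u). *)
pose f u : C := (r u +i* - r (i *: u))%C.
have Yi u : Y u -> Y (i *: u) by exact: YZ.
have qi u : Y u -> q (i *: u) = q u.
  by move=> Yu; rewrite qZ// /i /= expr0n expr1n add0r sqrtr1 mul1r.
have fD u v : Y u -> Y v -> f (u + v) = f u + f v.
  by move=> Yu Yv; apply: complex_eq; rewrite ?ReD ?ImD /= ?rD ?scalerDr ?rD ?opprD//; exact: Yi.
have fZ c u : Y u -> f (c *: u) = c * f u.
  move=> Yu; have Ei v : Y v -> f (i *: v) = i * f v.
    move=> Yv; apply: complex_eq; rewrite ?ReM ?ImM /=.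
      by rewrite mul0r mul1r sub0r opprK.
    rewrite scalerA (_ : i * i = ((-1)%:C)%C); last first.
      by apply: complex_eq; rewrite ?ReM ?ImM /=; ring.
    by rewrite rZ//; ring.
  have Er (d : R) v : Y v -> f ((d%:C)%C *: v) = (d%:C)%C * f v.
    move=> Yv; apply: complex_eq; rewrite ?ReM ?ImM /= ?rZ//; first by ring.
    by rewrite scalerA mulrC -scalerA rZ; [ring|exact: Yi].
  have -> : c = (((complex.Re c)%:C) + i * ((complex.Im c)%:C))%C.
    by apply: complex_eq; rewrite ?ReD ?ImD ?ReM ?ImM /=; ring.
  rewrite scalerDl fD; [|exact: YZ|exact: YZ].
  by rewrite -scalerA Ei; [rewrite !Er// mulrDl mulrA|exact: YZ].
have nr u : Y u -> `|r u| <= q u.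
  move=> Yu; rewrite ler_norml rq// andbT.
  have := rq _ (YZ ((-1)%:C)%C Yu); rewrite rZ// qZ// normc_real normrN1 !mul1r mulN1r; lra.
exists f; split.
- by move=> c u v Yu Yv; rewrite fD ?fZ//; exact: YZ.
- move=> u Yu; apply: le_trans (normc_le _) _; rewrite /= normrN.
  have := nr _ Yu; have := nr _ (Yi _ Yu); rewrite qi//; lra.
- move=> [u b] Gu; apply: complex_eq => /=; first by apply: (rG (u, complex.Re b)); exists b.
  rewrite (rG (i *: u, - complex.Im b)) ?opprK//=; exists (i * b).
    by have := GL i _ _ Gu G00; rewrite /= !addr0.
  by rewrite ReM /=; ring.
Qed.

End hahn_banach.

(** * Convergence at a geometric rate for complex-valued functions *)

Section limits.
Context {R : realType} {N : nat}.
Local Notation C := R[i].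
Local Notation V := 'rV[R]_N.
Local Notation normc := (@Normc.normc R).
Let oT : open [set: V] := openT.

Lemma normc0P (z : C) : normc z = 0 -> z = 0.
Proof. exact: Normc.eq0_normc. Qed.

Lemma normcN (z : C) : normc (- z) = normc z.
Proof. by case: z => x y; rewrite /Normc.normc /= !sqrrN. Qed.

Lemma normcB (z w : C) : normc (z - w) = normc (w - z).
Proof. by rewrite -normcN opprB. Qed.

Lemma ler_normcD (z w : C) : normc (z + w) <= normc z + normc w.
Proof. exact: le_normcD. Qed.

Lemma geometric_eq0 (z : C) (A rho : R) m : 0 < rho < 1 ->
  (forall k, (m <= k)%N -> normc z <= A * rho ^+ k) -> z = 0.
Proof.
move=> rho01 H; apply: normc0P; apply/eqP; rewrite eq_le normc_ge0 andbT.
apply/ler_addgt0Pr => e e0; have [K [mK HK]] := geometric_small A m rho01 e0.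
by rewrite add0r; apply: le_trans (H K mK) (HK K (leqnn _)).
Qed.

Lemma csmooth_geometric_limit (f : nat -> V -> C) (rho : R) : 0 < rho < 1 ->
  (forall k, csmooth setT (f k)) ->
  (forall m r, exists A, forall k, (m <= k)%N -> forall x, `|x| <= r ->
    cdbound m (fun y => f k.+1 y - f k y) x (A * rho ^+ k)) ->
  exists2 g, csmooth setT g & forall m r, exists A, forall k, (m <= k)%N ->
    forall x, `|x| <= r -> cdbound m (fun y => f k y - g y) x (A * rho ^+ k).
Proof.
move=> rho01 sf H.
have E1 (u v : V -> C) : re_part (fun y => u y - v y) = fun y => re_part u y - re_part v y.
  by apply/funext => y; rewrite /re_part ReD ReN.
have E2 (u v : V -> C) : im_part (fun y => u y - v y) = fun y => im_part u y - im_part v y.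
  by apply/funext => y; rewrite /im_part ImD ImN.
have [|g1 s1 H1] := smooth_geometric_limit rho01 (fun k => (sf k).1).
  move=> m r; have [A HA] := H m r; exists A => k mk x xr.
  by have [b _] := HA k mk x xr; rewrite E1 in b.
have [|g2 s2 H2] := smooth_geometric_limit rho01 (fun k => (sf k).2).
  move=> m r; have [A HA] := H m r; exists A => k mk x xr.
  by have [_ b] := HA k mk x xr; rewrite E2 in b.
exists (fun x => g1 x +i* g2 x)%C; first exact: (conj s1 s2).
move=> m r; have [A1 HA1] := H1 m r; have [A2 HA2] := H2 m r.
have rk k : 0 <= rho ^+ k by rewrite exprn_ge0//; case/andP: rho01 => /ltW.
exists (Num.max A1 A2) => k mk x xr; split.
  rewrite E1; apply: (dbound_le (leqnn _) _ (HA1 k mk x xr)).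
  by rewrite ler_wpM2r// le_max lexx.
rewrite E2; apply: (dbound_le (leqnn _) _ (HA2 k mk x xr)).
by rewrite ler_wpM2r// le_max lexx orbT.
Qed.

Lemma ccontinuous_geometric_limit (f : nat -> V -> C) (A rho : R) : 0 < rho < 1 ->
  (forall k, ccontinuous (f k)) -> (forall k x, normc (f k.+1 x - f k x) <= A * rho ^+ k) ->
  exists2 g, ccontinuous g & forall k x, normc (f k x - g x) <= 2 * A / (1 - rho) * rho ^+ k.
Proof.
move=> rho01 cf H.
have lim (p : C -> R) : (forall z w, p z - p w = p (z - w)) -> (forall z, `|p z| <= normc z) ->
    (forall k, continuous (p \o f k)) ->
    exists2 g : V -> R, continuous g & forall k x, `|p (f k x) - g x| <= A / (1 - rho) * rho ^+ k.
  move=> pB pn pc.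
  have /choice[g Hg] : forall x, exists l, forall k, `|p (f k x) - l| <= A / (1 - rho) * rho ^+ k.
    move=> x; have [|l [_ Hl]] := @geometric_cvg _ (fun k => p (f k x)) A rho 0 rho01.
      by move=> k _; rewrite pB; exact: le_trans (pn _) (H k x).
    by exists l => k; exact: Hl.
  exists g => [x|k x]; last exact: Hg.
  apply: (@continuous_limit _ _ (fun k => p \o f k)); first by move=> k; exact: pc.
  move=> e e0; have [K [_ HK]] := geometric_small (A / (1 - rho)) 0 rho01 e0.
  by exists K => y _; exact: le_trans (Hg y K) (HK K (leqnn _)).
have [|//||g1 c1 H1] := @lim (@complex.Re R).
- by move=> z w; rewrite ReD ReN.
- exact: Re_le_normc.
- by move=> k; exact: (cf k).1.
have [|//||g2 c2 H2] := @lim (@complex.Im R).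
- by move=> z w; rewrite ImD ImN.
- exact: Im_le_normc.
- by move=> k; exact: (cf k).2.
exists (fun x => g1 x +i* g2 x)%C; first by split.
move=> k x; apply: le_trans (normc_le _) _; rewrite ReD ImD ReN ImN /=.
have -> : 2 * A / (1 - rho) * rho ^+ k = A / (1 - rho) * rho ^+ k + A / (1 - rho) * rho ^+ k by ring.
exact: lerD (H1 k x) (H2 k x).
Qed.

Lemma csmooth_lipschitz (Om : set V) (f : V -> C) x v M : open Om -> csmooth Om f ->
  (forall s : R, `|s| <= 1 -> Om (x + s *: v) /\ cdbound 1 f (x + s *: v) M) ->
  normc (f (x + v) - f x) <= 2 * M * `|v|.
Proof.
move=> oOm [f1 f2] H.
have key (g : V -> R) : smooth Om g -> (forall s : R, `|s| <= 1 -> dbound 1 g (x + s *: v) M) ->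
    `|g (x + v) - g x| <= M * `|v|.
  move=> sg gM; have [s|s] := @MVT_line R V g x v 1.
    by rewrite normr1 => /H[Os _]; exact: (smooth_derivable sg Os).
  rewrite normr1 => s1; rewrite scale1r mul1r => ->.
  rewrite mulrC; apply: derive_norm_le; last exact: gM.
  exact: (smooth_differentiable oOm sg (H s s1).1).
apply: le_trans (normc_le _) _; rewrite ReD ImD ReN ImN.
rewrite -mulrA mulr_natl mulr2n; apply: lerD.
  by apply: (key _ f1) => s /H[_ []].
by apply: (key _ f2) => s /H[_ []].
Qed.

Lemma cdboundZ m (f : V -> C) x (c M : R) : csmooth setT f -> cdbound m f x M ->
  cdbound m (fun y => (c%:C)%C * f y) x (`|c| * M).
Proof.
move=> [f1 f2] [b1 b2].
have E1 : re_part (fun y => (c%:C)%C * f y) = fun y => c * re_part f y.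
  by apply/funext => y; rewrite /re_part ReM /= mul0r subr0.
have E2 : im_part (fun y => (c%:C)%C * f y) = fun y => c * im_part f y.
  by apply/funext => y; rewrite /im_part ImM /= mul0r addr0.
split=> vs vm va; rewrite ?E1 ?E2.
  by rewrite (iter_deriveZ oT c vs f1 Logic.I) normrM ler_wpM2l//; exact: b1.
by rewrite (iter_deriveZ oT c vs f2 Logic.I) normrM ler_wpM2l//; exact: b2.
Qed.

(** A point where half of the supremum is reached is enough to normalize a hump: its modulus becomes
    1 there and at most 2 everywhere. *)
Lemma csupp_sup (f : V -> C) (D : set V) : compact D -> csmooth setT f -> supported D f ->
  forall x0, 0 < normc (f x0) ->
  exists x1, normc (f x0) <= 2 * normc (f x1) /\ forall x, normc (f x) <= 2 * normc (f x1).
Proof.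
move=> cD sf f0 x0 fx0.
have [M M0 HM] := compact_cdbound 0 oT cD (@subsetT _ _) sf.
pose A : set R := [set normc (f x) | x in setT].
have A0 : A !=set0 by exists (normc (f x0)), x0.
have Aub : has_ubound A.
  exists (2 * M) => _ [x _ <-]; have [/HM/cdboundW//|xD] := pselect (D x).
  by rewrite f0// /Normc.normc /= expr0n addr0 sqrtr0 mulr_ge0.
have le_sup x : normc (f x) <= sup A by apply: ub_le_sup => //; exists x.
have sA : 0 < sup A by exact: lt_le_trans fx0 _.
have [|_ [x1 _ <-]] := @sup_adherent _ A (sup A / 2) _ (conj A0 Aub); first by rewrite divr_gt0.
move=> H; exists x1; have {}H : sup A <= 2 * normc (f x1) by lra.
by split=> [|x]; exact: le_trans (le_sup _) H.
Qed.

End limits.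

(** * The a priori estimate *)

Section closed_graph.
Context {R : realType} {N : nat}.
Local Notation C := R[i].
Local Notation V := 'rV[R]_N.
Local Notation normc := (@Normc.normc R).
Let oT : open [set: V] := openT.
Variable L : diffop R N.
Local Notation P := (transpose_fun L).
Let sP := smooth_op_transpose L.

Lemma distribution_of_continuous (u : V -> C) : ccontinuous u -> distribution_on setT (distr_of_fun setT u).
Proof.
move=> cu; split=> [c phi psi [sphi [D [cD _ Dphi]]] [spsi [E [cE _ Epsi]]]|D cD _].
  have cDE := compactU cD cE.
  have S1 : supported (D `|` E) phi by move=> x xDE; apply: Dphi => Dx; apply: xDE; left.
  have S2 : supported (D `|` E) psi by move=> x xDE; apply: Epsi => Dx; apply: xDE; right.
  have c1 := ccontinuousM cu (csmooth_continuous sphi).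
  have c2 := ccontinuousM cu (csmooth_continuous spsi).
  rewrite /distr_of_fun -(cintegralZ cDE c c1 (supportedMr _ S1)).
  rewrite -(cintegralD cDE (ccontinuousZ c c1) c2 (supportedMr _ (supportedMr _ S1)) (supportedMr _ S2)).
  by apply: cintegral_ext => x; rewrite mulrDr mulrCA.
have [M1 M10 HM1] := compact_bound cD (fun x _ => cu.1 x).
have [M2 M20 HM2] := compact_bound cD (fun x _ => cu.2 x).
have mD : 0 <= fine (lebesgue_rV N D) by exact: fine_ge0.
exists (2 * (M1 + M2) * fine (lebesgue_rV N D)), 0%N => phi M [sphi _] phi0 HM.
have H x : normc (u x * phi x) <= (M1 + M2) * M.
  have HMx : normc (phi x) <= M by have := HM [::] x (leqnn _); rewrite cpartialE cderiv_nil.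
  have [Dx|/phi0 ->] := pselect (D x); last first.
    by rewrite mulr0 /Normc.normc /= expr0n addr0 sqrtr0 mulr_ge0 ?addr_ge0//; exact: le_trans (normc_ge0 _) HMx.
  rewrite Normc.normcM ler_pM// ?normc_ge0//.
  apply: le_trans (normc_le _) _; apply: lerD; [exact: HM1|exact: HM2].
apply: le_trans (cintegral_norm_le cD (ccontinuousM cu (csmooth_continuous sphi)) (supportedMr _ phi0) H) _.
by rewrite mulrA -[X in _ <= X]mulrA [X in _ <= _ * X]mulrC mulrA.
Qed.

(** The conclusion is the equation P u = w in the sense of distributions: integrate by parts for
    each smooth [f k] and pass to the limit on the support of [phi]. *)
Lemma weak_solution (f : nat -> V -> C) (u w : V -> C) (rho : R) : 0 < rho < 1 ->
  (forall k, test_fun setT (f k)) -> ccontinuous u -> csmooth setT w ->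
  (exists A, forall k x, normc (f k x - u x) <= A * rho ^+ k) ->
  (forall r, exists A, forall k x, `|x| <= r -> normc (P (f k) x - w x) <= A * rho ^+ k) ->
  forall phi, test_fun setT phi ->
    cintegral setT (fun x => u x * diffop_fun L phi x) = cintegral setT (fun x => w x * phi x).
Proof.
move=> rho01 tf cu sw [A HA] HP phi [sphi [D [cD _ phi0]]].
have [r r0 Dr] := compact_sub_ball cD; have {HP}[B HB] := HP r.
have sLphi := smooth_op_csmooth (smooth_op_diffop L) sphi.
have SL : supported D (diffop_fun L phi) := smooth_op_supported (smooth_op_diffop L) cD sphi phi0.
have [M1 M10 HM1] := compact_cdbound 0 oT cD (@subsetT _ _) sLphi.
have [M2 M20 HM2] := compact_cdbound 0 oT cD (@subsetT _ _) sphi.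
apply/eqP; rewrite -subr_eq0; apply/eqP.
have rk k : 0 <= rho ^+ k by rewrite exprn_ge0//; case/andP: rho01 => /ltW.
have rk0 : 0 < rho by case/andP: rho01.
have cf k := csmooth_continuous (tf k).1.
have cB (g h : V -> C) : ccontinuous g -> ccontinuous h -> ccontinuous (fun x => g x - h x).
  move=> cg ch; rewrite (_ : (fun x => _) = fun x => g x + -1 * h x); last by apply/funext => x; rewrite mulN1r.
  exact: ccontinuousD cg (ccontinuousZ _ ch).
have A0 : 0 <= A by have := le_trans (normc_ge0 _) (HA 0%N 0); rewrite expr0 mulr1.
have bd (g h : V -> C) (E M : R) k : ccontinuous g -> ccontinuous h -> supported D h -> 0 <= E ->
    (forall x, D x -> normc (g x) <= E * rho ^+ k) -> (forall x, D x -> cdbound 0 h x M) -> 0 <= M ->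
    normc (cintegral setT (fun x => g x * h x)) <= 2 * (E * (2 * M)) * fine (lebesgue_rV N D) * rho ^+ k.
  move=> cg ch Sh E0 Hg Hh M0.
  have H x : normc (g x * h x) <= E * rho ^+ k * (2 * M).
    have [Dx|/Sh ->] := pselect (D x); last first.
      by rewrite mulr0 /Normc.normc /= expr0n addr0 sqrtr0 !mulr_ge0.
    by rewrite Normc.normcM ler_pM// ?normc_ge0//; [exact: Hg|exact: cdboundW (Hh _ Dx)].
  apply: le_trans (cintegral_norm_le cD (ccontinuousM cg ch) (supportedMr _ Sh) H) _.
  by rewrite le_eqVlt; apply/orP; left; apply/eqP; ring.
apply: (@geometric_eq0 _ _ (2 * (A * (2 * M1)) * fine (lebesgue_rV N D) +
   2 * (`|B| * (2 * M2)) * fine (lebesgue_rV N D)) rho 0 rho01) => k _.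
have [sfk [Dk [cDk _ fk0]]] := tf k.
have by_parts := transpose_by_parts L cDk sfk sphi (or_introl fk0).
rewrite (_ : _ - _ = cintegral setT (fun x => (u x - f k x) * diffop_fun L phi x) +
    cintegral setT (fun x => (P (f k) x - w x) * phi x)); last first.
  have -> : cintegral setT (fun x => (u x - f k x) * diffop_fun L phi x) =
      cintegral setT (fun x => u x * diffop_fun L phi x) - cintegral setT (fun x => f k x * diffop_fun L phi x).
    rewrite -(cintegralB cD (ccontinuousM cu (csmooth_continuous sLphi)) (ccontinuousM (cf k) (csmooth_continuous sLphi)) (supportedMr _ SL) (supportedMr _ SL)).
    by apply: cintegral_ext => x; rewrite mulrBl.
  have cPf := csmooth_continuous (smooth_op_csmooth sP sfk).
  have -> : cintegral setT (fun x => (P (f k) x - w x) * phi x) =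
      cintegral setT (fun x => P (f k) x * phi x) - cintegral setT (fun x => w x * phi x).
    rewrite -(cintegralB cD (ccontinuousM cPf (csmooth_continuous sphi)) (ccontinuousM (csmooth_continuous sw) (csmooth_continuous sphi)) (supportedMr _ phi0) (supportedMr _ phi0)).
    by apply: cintegral_ext => x; rewrite mulrBl.
  by rewrite by_parts addrA subrK.
rewrite mulrDl; apply: le_trans (ler_normcD _ _) _; apply: lerD.
  apply: (bd _ _ _ _ k (cB _ _ cu (cf k)) (csmooth_continuous sLphi) SL A0 _ HM1 M10) => x _.
  by rewrite normcB.
apply: (bd _ _ _ _ k (cB _ _ (csmooth_continuous (smooth_op_csmooth sP sfk)) (csmooth_continuous sw)) (csmooth_continuous sphi) phi0 (normr_ge0 B) _ HM2 M20) => x Dx.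
by apply: le_trans (HB k x (Dr _ Dx)) _; rewrite ler_wpM2r// ler_norm.
Qed.

(** If every n failed, there would be humps z_n of height 1 supported in the ball of radius 1/(n+1)
    with P z_n bounded by 2 to order n. A lacunary sum u of t^k z_(n_k) is continuous and P u is
    smooth, so u is smooth by hypoellipticity, hence Lipschitz near 0. But u varies by about t^k
    over a distance of order 1/n_k, which is far smaller than t^k. *)
Lemma apriori_estimate : hypoelliptic (transpose_distr L) -> (0 < N)%N ->
  exists n : nat, forall psi : V -> C, csmooth setT psi ->
  supported [set x | `|x| <= n.+1%:R^-1] psi ->
  forall M, (forall x, cdbound n (P psi) x M) -> forall x, normc (psi x) <= n.+1%:R * M.
Proof.
move=> hypot N0; apply: contrapT => H.
have bad n : exists z : (V -> C) * V, [/\ csmooth setT z.1,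
    supported [set x | `|x| <= n.+1%:R^-1] z.1, forall y, cdbound n (P z.1) y 2,
    normc (z.1 z.2) = 1 & forall y, normc (z.1 y) <= 2].
  apply: contrapT => nz; apply: H; exists n => psi spsi Spsi M HM x.
  rewrite leNgt; apply/negP => lt; apply: nz.
  have M0 : 0 <= M := cdbound_ge0 (HM x).
  have n1 : M <= n.+1%:R * M by rewrite ler_peMl// ler1n.
  have [x1 [H1 H2]] := csupp_sup (@closed_ball_compact_rV R N _) spsi Spsi (le_lt_trans (le_trans M0 n1) lt).
  set t := normc (psi x1) in H1 H2; have t0 : 0 < t by lra.
  exists (fun y => ((t^-1)%:C)%C * psi y, x1); split => /=.
  - exact: (csmoothZ oT _ spsi).
  - exact: supportedMr.
  - move=> y; rewrite (_ : P _ = fun y => ((t^-1)%:C)%C * P psi y); last first.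
      by apply/funext => z; exact: (smooth_opZ sP _ spsi).
    have := cdboundZ t^-1 (smooth_op_csmooth sP spsi) (HM y).
    apply: cdbound_le => //.
    by rewrite ger0_norm ?invr_ge0 ?(ltW t0)// ler_pdivrMl//; lra.
  - by rewrite Normc.normcM normc_real ger0_norm ?invr_ge0 ?(ltW t0)// mulVf// gt_eqF.
  - move=> y; rewrite Normc.normcM normc_real ger0_norm ?invr_ge0 ?(ltW t0)//.
    by rewrite ler_pdivrMl// mulrC.
have /choice[z Hz] := bad.
have sz n : csmooth setT (z n).1 by case: (Hz n).
have lip (g : V -> C) : csmooth setT g ->
    exists A, 0 <= A /\ forall a v, `|a| <= 1 -> `|v| <= 3 -> normc (g (a + v) - g a) <= A * `|v|.
  move=> sg; have [M M0 HM] := compact_cdbound 1 oT (@closed_ball_compact_rV R N 4) (@subsetT _ _) sg.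
  exists (2 * M); split=> [|a v a1 v3]; first by rewrite mulr_ge0.
  apply: (csmooth_lipschitz oT sg) => s s1; split=> //; apply: HM => /=.
  rewrite (le_trans (ler_normD _ _))// normrZ.
  have : `|s| * `|v| <= 1 * 3 by rewrite ler_pM.
  lra.
have /choice[Lam HLam] := fun n => lip _ (sz n).
(* Small enough for the tail beyond the k-th hump, at most 8/99 of [t ^+ k], to be negligible. *)
pose t : R := 100^-1; have t0 : 0 < t by rewrite /t; lra.
have t01 : 0 < t < 1 by rewrite /t; lra.
have tk0 k : 0 <= t ^+ k by rewrite exprn_ge0// ltW.
have tk1 k : t ^+ k <= 1 by rewrite exprn_ile1// ltW//; case/andP: t01.
(* The index of the k-th hump is chosen once [S], a Lipschitz constant of the sum of the previous
   humps, is known: it is at least k, which gives control of P to order k, and so large that the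
   hump is much narrower than t^(2k) / (1 + S). *)
pose nx k (S : R) := maxn k (Num.truncn (40 * (1 + S) * t ^- (k + k))).
pose S k : R := iteri k (fun k S => S + Lam (nx k S)) 0.
pose n k := nx k (S k).
have S1 k : S k.+1 = S k + Lam (n k) by [].
have S0 k : 0 <= S k.
  by elim: k => [|k IH]; rewrite ?S1 ?addr_ge0//; case: (HLam (n k)).
have nk k : (k <= n k)%N by exact: leq_maxl.
have dk k : (1 + S k) * (40 * (n k).+1%:R^-1) <= t ^+ (k + k).
  have : 40 * (1 + S k) * t ^- (k + k) <= (n k).+1%:R.
    apply: le_trans (ltW (truncnS_gt _)) _; by rewrite ler_nat ltnS leq_maxr.
  rewrite ler_pdivrMr ?exprn_gt0// => Hn.
  rewrite mulrA ler_pdivrMr ?ltr0n//; lra.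
pose f K x : C := \sum_(l < K) ((t ^+ l)%:C)%C * (z (n l)).1 x.
have fS k x : f k.+1 x = f k x + ((t ^+ k)%:C)%C * (z (n k)).1 x by rewrite /f big_ord_recr.
have szk k := csmoothZ oT ((t ^+ k)%:C)%C (sz (n k)).
have sf k : csmooth setT (f k) by apply: csmooth_sum => [|l]; [exact: oT|exact: szk].
have fB k x : f k.+1 x - f k x = ((t ^+ k)%:C)%C * (z (n k)).1 x by rewrite fS addrC addKr.
have tf k : test_fun setT (f k).
  split; first exact: sf.
  exists [set x | `|x| <= 1]; split; [exact: closed_ball_compact_rV|by []|].
  move=> x x1; rewrite /f big1// => l _; have [_ Sz _ _ _] := Hz (n l).
  rewrite Sz ?mulr0// => /= xl; apply: x1; apply: le_trans xl _.
  by rewrite invf_le1 ?ltr0n// ler1n.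
have PB k : (fun y => P (f k.+1) y - P (f k) y) = fun y => ((t ^+ k)%:C)%C * P (z (n k)).1 y.
  apply/funext => y; rewrite (_ : f k.+1 = fun x => f k x + ((t ^+ k)%:C)%C * (z (n k)).1 x); last exact/funext.
  by rewrite (smooth_op_add sP (sf k) (szk k)) (smooth_opZ sP _ (sz (n k))) addrC addKr.
have [|w sw Hw] := csmooth_geometric_limit t01 (fun k => smooth_op_csmooth sP (sf k)).
  move=> m r; exists 2 => k mk x _; rewrite PB.
  have [_ _ Hb _ _] := Hz (n k).
  have := cdboundZ (t ^+ k) (smooth_op_csmooth sP (sz (n k))) (Hb x).
  by apply: cdbound_le; [exact: leq_trans (nk k)|rewrite ger0_norm// mulrC].
have [||u cu Hu] := @ccontinuous_geometric_limit _ _ f 2 t t01.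
- by move=> k; exact: csmooth_continuous (sf k).
- move=> k x; rewrite fB Normc.normcM normc_real ger0_norm// mulrC ler_wpM2r//.
  by have [_ _ _ _ ->] := Hz (n k).
have [||g [sg gE]] := hypot setT (distr_of_fun setT u) (distr_of_fun setT w) oT
    (distribution_of_continuous cu) (distribution_of_continuous (csmooth_continuous sw)).
- apply: (weak_solution t01 tf cu sw); first by exists (2 * 2 / (1 - t)).
  move=> r; have [A HA] := Hw 0%N r; exists (2 * A) => k x xr.
  by rewrite -mulrA; exact: cdboundW (HA k (leq0n k) x xr).
- by exists w.
have ug x : u x = g x.
  apply/eqP; rewrite -subr_eq0; apply/eqP.
  have cg := csmooth_continuous sg.
  have cN : ccontinuous (fun x => -1 * g x) := ccontinuousZ _ cg.
  have := @fundamental_lemma _ _ (fun x => u x + -1 * g x) (ccontinuousD cu cN).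
  move=> FL; rewrite -mulN1r; apply: FL => phi [sphi [D [cD DT Dphi]]].
  have cphi := csmooth_continuous sphi.
  have := gE phi (conj sphi (ex_intro _ D (And3 cD DT Dphi))); rewrite /distr_of_fun => E.
  rewrite (@cintegral_ext _ _ _ (fun x => u x * phi x - g x * phi x)); last first.
    by move=> y; rewrite mulrDl mulN1r mulNr.
  rewrite (cintegralB cD (ccontinuousM cu cphi) (ccontinuousM cg cphi) (supportedMr _ Dphi) (supportedMr _ Dphi)).
  by rewrite E subrr.
have [A [A0 HA]] := lip g sg.
(* The Lipschitz constant [A] of the limit is not known when the humps are chosen; [k] is now taken
   with A t^k <= 1. *)
have [k [_ /(_ k (leqnn k)) Ak]] := geometric_small A 0 t01 (@ltr01 R).
have [_ Sz _ za zb] := Hz (n k).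
set a := (z (n k)).2 in za.
set d : R := (n k).+1%:R^-1.
have d0 : 0 < d by rewrite invr_gt0 ltr0n.
have d1 : d <= 1 by rewrite invf_le1 ?ltr0n// ler1n.
have ad : `|a| <= d.
  apply: contrapT => /Sz az; move: za; rewrite az /Normc.normc /= expr0n addr0 sqrtr0.
  by move/eqP; rewrite eq_sym oner_eq0.
(* A point of norm [2 * d], outside the support of the k-th hump and at distance at most [3 * d]
   from its summit [a]; it exists because the dimension is positive. *)
pose b : V := const_mx (2 * d).
have bd : `|b| = 2 * d.
  apply/eqP; rewrite eq_le rV_norm_le/=; [|lra|move=> i; rewrite mxE ger0_norm//; lra].
  by have := rV_coord_le b (Ordinal N0); rewrite mxE ger0_norm//; lra.
have zb0 : (z (n k)).1 b = 0 by apply: Sz => /=; rewrite bd -/d; lra.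
pose v := b - a.
have vd : `|v| <= 3 * d by rewrite (le_trans (ler_normB _ _))// bd; lra.
have v3 : `|v| <= 3 by lra.
have a1 : `|a| <= 1 by lra.
have abv : a + v = b by rewrite /v addrC subrK.
have head j : normc (f j b - f j a) <= S j * `|v|.
  elim: j => [|j IH]; first by rewrite /f !big_ord0 subrr mul0r /Normc.normc /= expr0n addr0 sqrtr0.
  rewrite !fS opprD addrACA S1 mulrDl (le_trans (ler_normcD _ _))// lerD//.
  have := (HLam (n j)).2 a v a1 v3; rewrite abv -mulrBr Normc.normcM normc_real => Hj.
  apply: le_trans Hj; rewrite ger0_norm// ler_piMl ?normc_ge0//.
have Hg : normc (u b - u a) <= A * `|v|.
  by have := HA a v a1 v3; rewrite abv -!ug.
(* The height t^k is the drop of u from [a] to [b], corrected by the previous humps and by the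
   tail. *)
have main : t ^+ k <= S k * `|v| + A * `|v| + 2 * (2 * 2 / (1 - t) * t ^+ k.+1).
  have -> : t ^+ k = normc (((t ^+ k)%:C)%C * (z (n k)).1 a).
    by rewrite Normc.normcM za normc_real mulr1 ger0_norm.
  have -> : ((t ^+ k)%:C)%C * (z (n k)).1 a = (f k b - f k a) + - ((u b - u a) + ((f k.+1 b - u b) - (f k.+1 a - u a))).
    rewrite !fS zb0; ring.
  apply: le_trans (ler_normcD _ _) _; rewrite -[X in _ <= X]addrA; apply: lerD; first exact: head.
  rewrite normcN; apply: le_trans (ler_normcD _ _) _; apply: lerD; first exact: Hg.
  apply: le_trans (ler_normcD _ _) _; rewrite normcN mulr_natl mulr2n; exact: lerD (Hu _ _) (Hu _ _).
(* The three terms on the right are at most 3/40, 3/40 and 8/99 of t^k, a contradiction. *)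
have E1 : 40 * d * (1 + S k) <= t ^+ k * t ^+ k by rewrite -exprD; have := dk k; rewrite -/d; lra.
have E2 : S k * `|v| <= S k * (3 * d) by rewrite ler_wpM2l.
have E3 : A * `|v| <= A * (3 * d) by rewrite ler_wpM2l.
have E4 : A * (40 * d) <= t ^+ k.
  apply: (@le_trans _ _ (A * (t ^+ k * t ^+ k))).
    rewrite ler_wpM2l//; apply: le_trans E1; rewrite ler_peMr ?mulr_ge0 ?(ltW d0)//; have := S0 k; lra.
  by rewrite mulrA -[X in _ <= X]mul1r ler_wpM2r.
have E5 : t ^+ k * t ^+ k <= t ^+ k by rewrite ler_piMl.
have E6 : 2 * 2 / (1 - t) * t ^+ k.+1 = 4 / 99 * t ^+ k.
  by rewrite exprS /t; field.
have E7 : 0 < t ^+ k by rewrite exprn_gt0.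
have : 0 <= S k * d by rewrite mulr_ge0// ltW.
rewrite E6 in main; move: (t ^+ k) E1 E4 E5 E7 main => T E1 E4 E5 E7 main; lra.
Qed.

End closed_graph.

(** * A local fundamental solution by Hahn-Banach *)

Section fundamental_solution.
Context {R : realType} {N : nat}.
Local Notation C := R[i].
Local Notation V := 'rV[R]_N.
Local Notation normc := (@Normc.normc R).
Local Notation ball0 r := [set x : V | `|x| <= r].
Let oT : open [set: V] := openT.

Definition csupp (D : set V) (phi : V -> C) := csmooth setT phi /\ supported D phi.

Lemma csupp_linear D c phi psi : csupp D phi -> csupp D psi -> csupp D (fun x => c * phi x + psi x).
Proof.
move=> [s1 S1] [s2 S2]; split; first exact: (csmoothD oT (csmoothZ oT c s1) s2).
exact: supportedD (supportedMr _ S1) S2.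
Qed.

Lemma csupp_subset D D' phi : D `<=` D' -> csupp D phi -> csupp D' phi.
Proof. by move=> DD [s S]; split; [exact: s|exact: supported_subset DD S]. Qed.

Lemma csuppM D f phi : csmooth setT f -> csupp D phi -> csupp D (fun x => f x * phi x).
Proof. by move=> sf [s S]; split; [exact: (csmoothM oT sf s)|exact: supportedMr]. Qed.

Lemma csuppD D phi psi : csupp D phi -> csupp D psi -> csupp D (fun x => phi x + psi x).
Proof. by move=> [s S] [s' S']; split; [exact: (csmoothD oT s s')|exact: supportedD]. Qed.

Lemma csupp_test D phi : compact D -> csupp D phi -> test_fun setT phi.
Proof. by move=> cD [s S]; split; [exact: s|exists D; split; [exact: cD|by []|exact: S]]. Qed.

Lemma csupp_op Q D phi : smooth_op Q -> compact D -> csupp D phi -> csupp D (Q phi).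
Proof. by move=> sQ cD [s S]; split; [exact: (smooth_op_csmooth sQ s)|exact: (smooth_op_supported sQ cD s S)]. Qed.

Definition partial_sizes m (phi : V -> C) : set R :=
  [set y | exists I x, (size I <= m)%N /\ y = normc (cpartial I phi x)].

(** A C^m norm as a number: Hahn-Banach asks for a seminorm that is exactly homogeneous, while
    [cdbound] only expresses upper bounds. *)
Definition cnorm m (phi : V -> C) : R := sup (partial_sizes m phi).

Lemma cnorm_le m phi M : (forall I x, (size I <= m)%N -> normc (cpartial I phi x) <= M) -> cnorm m phi <= M.
Proof.
move=> H; apply: ge_sup; last by move=> _ [I [x [Im ->]]]; exact: H.
by exists (normc (cpartial [::] phi 0)), [::], 0.
Qed.

Lemma all_delta (I : seq 'I_N) : all (fun v : V => `|v| <= 1) [seq delta_mx ord0 i | i <- I].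
Proof. by apply/allP => _ /mapP[i _ ->]; rewrite rV_norm_delta. Qed.

Lemma cnorm_ub m D phi I x : compact D -> csupp D phi -> (size I <= m)%N ->
  normc (cpartial I phi x) <= cnorm m phi.
Proof.
move=> cD [sphi S] Im; apply: ub_le_sup; last by exists I, x.
have [M M0 HM] := compact_cdbound m oT cD (@subsetT _ _) sphi.
exists (2 * M) => _ [J [y [Jm ->]]]; rewrite cpartialE; have [Dy|yD] := pselect (D y).
  by apply: (cdbound_cderiv (HM _ Dy)); rewrite ?size_map ?all_delta.
by rewrite (supported_cderiv cD _ S yD) /Normc.normc /= expr0n addr0 sqrtr0 mulr_ge0.
Qed.

Lemma cnormD m D u v : compact D -> csupp D u -> csupp D v ->
  cnorm m (fun x => u x + v x) <= cnorm m u + cnorm m v.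
Proof.
move=> cD su sv; apply: cnorm_le => I x Im.
rewrite cpartialE (cderivD _ oT su.1 sv.1 Logic.I) -!cpartialE.
by apply: le_trans (ler_normcD _ _) _; apply: lerD; exact: (cnorm_ub _ cD).
Qed.

Lemma cnormZ m D c u : compact D -> csupp D u ->
  cnorm m (fun x => c * u x) = normc c * cnorm m u.
Proof.
move=> cD su.
have le (d : C) w : csupp D w -> cnorm m (fun x => d * w x) <= normc d * cnorm m w.
  move=> sw; apply: cnorm_le => I x Im.
  rewrite cpartialE (cderivZ _ _ oT sw.1 Logic.I) -cpartialE Normc.normcM ler_wpM2l ?normc_ge0//.
  exact: (cnorm_ub _ cD).
have [->|c0] := eqVneq c 0.
  rewrite /Normc.normc /= expr0n addr0 sqrtr0 mul0r; apply/eqP; rewrite eq_le; apply/andP; split.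
    by have := le 0 _ su; rewrite /Normc.normc /= expr0n addr0 sqrtr0 mul0r.
  have : csupp D (fun x => 0 * u x) by apply: csuppM su; exact: csmooth_cst.
  move=> H; apply: le_trans (cnorm_ub (m := m) (I := [::]) 0 cD H (leq0n m)); exact: normc_ge0.
apply/eqP; rewrite eq_le le//=.
have cu : csupp D (fun x => c * u x) by apply: csuppM su; exact: csmooth_cst.
have nc : 0 < normc c.
  by rewrite lt_def normc_ge0 andbT; apply: contra c0 => /eqP /normc0P ->.
rewrite -ler_pdivlMl//; have := le c^-1 _ cu.
rewrite (_ : (fun x => _) = u); last by apply/funext => x; rewrite mulrA mulVf// mul1r.
suff -> : normc c^-1 = (normc c)^-1 by [].
apply: (mulfI (lt0r_neq0 nc)); rewrite -Normc.normcM divff// divff ?gt_eqF//.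
by have := normc_real (1 : R); rewrite normr1.
Qed.

Lemma cdbound_linear (M : {linear V -> V}) m (f : V -> C) x (c A : R) : csmooth setT f -> 1 <= c ->
  (forall v, `|M v| <= c * `|v|) -> cdbound m f (M x) A -> cdbound m (fun y => f (M y)) x (c ^+ m * A).
Proof.
move=> [f1 f2] c1 Mc.
have c0 : 0 < c by exact: lt_le_trans c1.
have key (g : V -> R) : smooth setT g -> dbound m g (M x) A -> dbound m (g \o M) x (c ^+ m * A).
  move=> sg b vs vm va; rewrite iter_derive_linear_comp /=.
  have -> : map M vs = map ( *:%R c) (map (fun v => c^-1 *: M v) vs).
    rewrite -map_comp; apply: eq_map => v /=; by rewrite scalerA divff ?gt_eqF// scale1r.
  rewrite iter_derive_scale// normrM size_map normrX gtr0_norm//.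
  apply: ler_pM => //; first by rewrite exprn_ge0// ltW.
    by rewrite ler_weXn2l.
  apply: b; first by rewrite size_map.
  rewrite all_map; apply: sub_all va => v v1 /=; rewrite normrZ gtr0_norm ?invr_gt0//.
  rewrite ler_pdivrMl// mulr1; apply: le_trans (Mc v) _; by rewrite ger_pMr.
by move=> [b1 b2]; split; [exact: (key _ f1 b1)|exact: (key _ f2 b2)].
Qed.

Variable L : diffop R N.
Local Notation P := (transpose_fun L).
Let sP := smooth_op_transpose L.

(** The functional sending P psi to psi(0) is given by its graph over the range of [P]. The a priori
    estimate is its domination by a multiple of the C^n norm, from which its being well defined also
    follows. *)
Lemma local_fundamental_solution : hypoelliptic (transpose_distr L) -> (0 < N)%N ->
  exists (r A : R) (m : nat) (E : functional R N), [/\ 0 < r,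
    forall c phi psi, csupp (ball0 r) phi -> csupp (ball0 r) psi -> E (fun x => c * phi x + psi x) = c * E phi + E psi,
    forall phi M, csupp (ball0 r) phi -> (forall x, cdbound m phi x M) -> normc (E phi) <= A * M &
    forall psi, csupp (ball0 r) psi -> E (P psi) = psi 0].
Proof.
move=> hypot N0; have [n apriori] := apriori_estimate hypot N0.
set r : R := n.+1%:R^-1 in apriori.
have cB := @closed_ball_compact_rV R N r.
(* The factor [n.+1] is the constant of the a priori estimate; [N.+1 ^+ n] is the price of passing
   from partial derivatives to all directions. *)
pose q (phi : V -> C) := n.+1%:R * N.+1%:R ^+ n * cnorm n phi.
have k0 : 0 <= n.+1%:R * N.+1%:R ^+ n :> R by rewrite mulr_ge0 ?exprn_ge0.
have qD u v : csupp (ball0 r) u -> csupp (ball0 r) v -> q (fun x => u x + v x) <= q u + q v.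
  by move=> su sv; rewrite /q -mulrDr ler_wpM2l//; exact: (cnormD _ cB).
have qZ (c : C) u : csupp (ball0 r) u -> q (fun x => c * u x) = normc c * q u.
  by move=> su; rewrite /q (cnormZ _ _ cB su) mulrCA.
have s0 : csupp (ball0 r) (fun=> 0) by split; [exact: csmooth_cst|].
have [||||||E [E1 E2 E3]] := @hahn_banach R (V -> R[i]^o) (csupp (ball0 r)) q _ _ _ qD qZ
   [set z | exists2 psi, csupp (ball0 r) psi & z = (P psi, psi 0)].
- exact: s0.
- by move=> u v su sv; exact: csuppD.
- by move=> c u su; apply: csuppM su; exact: csmooth_cst.
- move=> c _ _ [u su ->] [v sv ->]; exists (fun x => c * u x + v x); first exact: csupp_linear.
  congr (_, _); apply/funext => x; by rewrite (smooth_op_linear sP _ su.1 sv.1).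
- exists (fun=> 0) => //; congr (_, _); apply/funext => x.
  by rewrite (smooth_op_supported sP (@compact0 _) s0.1 (fun _ _ => erefl)).
- move=> _ [u su ->] /=; have sPu := csupp_op sP cB su; split; first exact: sPu.
  have H x : cdbound n (P u) x (cnorm n (P u) * N.+1%:R ^+ n).
    apply: (cpartial_cdbound sPu.1) => I Im; exact: (cnorm_ub _ cB).
  apply: le_trans (apriori _ su.1 su.2 _ H 0) _.
  by rewrite /q mulrA mulrAC.
exists r, (2 * (n.+1%:R * N.+1%:R ^+ n * 2)), n, E; split.
- by rewrite invr_gt0 ltr0n.
- by move=> c phi psi; exact: E1.
- move=> phi M sphi HM; apply: le_trans (E2 _ sphi) _.
  rewrite -!mulrA ler_wpM2l// /q -!mulrA ler_wpM2l// ler_wpM2l ?exprn_ge0//.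
  apply: cnorm_le => I x Im; rewrite cpartialE.
  by apply: (cdbound_cderiv (HM x)); rewrite ?size_map ?all_delta.
- by move=> psi spsi; apply: (E3 (P psi, psi 0)); exists psi.
Qed.

End fundamental_solution.

(** * Functions and integrals under iterated dilations *)

Section homogeneous.
Context {R : realType} {N : nat}.
Local Notation C := R[i].
Local Notation V := 'rV[R]_N.
Local Notation normc := (@Normc.normc R).
Local Notation ball0 r := [set x : V | `|x| <= r].
Let oT : open [set: V] := openT.

Lemma normc_c0 : normc 0 = 0.
Proof. by rewrite /Normc.normc /= expr0n addr0 sqrtr0. Qed.

Lemma open_norm_lt (r : R) : open [set x : V | `|x| < r].
Proof.
by apply: (@open_comp _ _ (fun x : V => `|x|) [set t | t < r]); [move=> x _; exact: norm_continuous|exact: open_lt].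
Qed.

Lemma open_norm_gt (r : R) : open [set x : V | r < `|x|].
Proof.
by apply: (@open_comp _ _ (fun x : V => `|x|) [set t | r < t]); [move=> x _; exact: norm_continuous|exact: open_gt].
Qed.

Lemma csmooth_cutoff (Om D : set V) (chi h : V -> C) : open Om -> closed D -> D `<=` Om ->
  csmooth setT chi -> supported D chi -> csmooth Om h -> csmooth setT (fun x => chi x * h x).
Proof.
move=> oOm cD DO schi Schi sh; apply: csmooth_local => x _.
have [Dx|xD] := pselect (D x).
  exists Om; first exact: DO.
  exact: (csmoothM oOm (csmooth_subset (@subsetT _ _) schi) sh).
have oD : open (~` D) by rewrite openC.
exists (~` D); first exact: xD.
apply: (csmooth_eq_on oD _ (csmooth_cst oD 0)) => y yD; by rewrite Schi// mul0r.
Qed.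

Lemma cintegral_bound (D : set V) (f g : V -> C) A B : compact D -> ccontinuous f -> ccontinuous g ->
  supported D g -> (forall x, normc (f x) <= A) -> (forall x, normc (g x) <= B) ->
  normc (cintegral setT (fun x => f x * g x)) <= 2 * (A * B) * fine (lebesgue_rV N D).
Proof.
move=> cD cf cg Sg fA gB; apply: (cintegral_norm_le cD (ccontinuousM cf cg) (supportedMr _ Sg)) => x.
by rewrite Normc.normcM ler_pM ?normc_ge0.
Qed.

Lemma cdbound_cutoff m (u v : V -> C) x A B : csmooth setT u -> csmooth setT v ->
  cdbound m u x A -> cdbound m v x B -> cdbound m (fun y => u y * v y) x (2 * (2 ^+ m * (A * B))).
Proof. by move=> su sv; exact: (cdboundM oT su sv Logic.I). Qed.

Lemma csupp_cdbound m D (f : V -> C) : compact D -> csupp D f -> exists2 M, 0 <= M & forall x, cdbound m f x M.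
Proof.
move=> cD [sf Sf]; have [M M0 HM] := compact_cdbound m oT cD (@subsetT _ _) sf.
exists M => // x; have [/HM//|xD] := pselect (D x).
split=> vs vm va; have E := supported_cderiv cD vs Sf xD.
  by move: (congr1 (@complex.Re R) E) => /= ->; rewrite normr0.
by move: (congr1 (@complex.Im R) E) => /= ->; rewrite normr0.
Qed.

Variables (Dl Dl' : {linear V -> V}) (q : R).
Hypotheses (DK : cancel Dl Dl') (D'K : cancel Dl' Dl).
Hypothesis contr : forall x, `|Dl' x| <= 2^-1 * `|x|.
Hypothesis q0 : 0 < q.
Hypothesis jac : lebesgue_rV N (Dl @^-1` unit_cube N) = (q^-1)%:E.

Lemma norm_expand x : 2 * `|x| <= `|Dl x|.
Proof. by have := contr (Dl x); rewrite DK; lra. Qed.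

Lemma norm_iter_contract j x : `|iter j Dl' x| <= 2^-1 ^+ j * `|x|.
Proof.
elim: j => [|j IH]; first by rewrite expr0 mul1r.
rewrite iterS exprS -mulrA; apply: le_trans (contr _) _; by rewrite ler_wpM2l.
Qed.

Lemma norm_iter_le j x : `|iter j Dl' x| <= `|x|.
Proof. by apply: le_trans (norm_iter_contract j x) _; rewrite ler_piMl// exprn_ile1// invf_le1// ler1n. Qed.

Lemma iterDK j x : iter j Dl' (iter j Dl x) = x.
Proof. by elim: j x => // j IH x; rewrite iterSr iterS DK IH. Qed.

Lemma iterD'K j x : iter j Dl (iter j Dl' x) = x.
Proof. by elim: j x => // j IH x; rewrite iterSr iterS D'K IH. Qed.

Lemma csmooth_lin (M : {linear V -> V}) (f : V -> C) : csmooth setT f -> csmooth setT (fun x => f (M x)).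
Proof. by move=> sf; exact: (csmooth_comp oT oT (smooth_map_linear M oT) sf (fun _ _ => Logic.I)). Qed.

Lemma csmooth_iter (M : {linear V -> V}) (f : V -> C) j : csmooth setT f -> csmooth setT (fun x => f (iter j M x)).
Proof.
move=> sf; elim: j => [|j IH]; first exact: sf.
rewrite (_ : (fun x => _) = fun x => f (iter j M (M x))); last by apply/funext => x; rewrite iterSr.
exact: (csmooth_lin M IH).
Qed.

Lemma cdbound_iter m (f : V -> C) M j x : csmooth setT f -> (forall x, cdbound m f x M) ->
  cdbound m (fun x => f (iter j Dl' x)) x M.
Proof.
move=> sf H; elim: j x => [|j IH] x; first exact: H.
rewrite (_ : (fun x => _) = fun x => f (iter j Dl' (Dl' x))); last by apply/funext => y; rewrite iterSr.
rewrite -[M]mul1r -(expr1n _ m).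
apply: (cdbound_linear (csmooth_iter Dl' j sf) (lexx 1) _ (IH _)) => v.
by apply: le_trans (contr v) _; rewrite ler_wpM2r//; lra.
Qed.

Lemma csupp_dilate r f : csupp (ball0 r) f -> csupp (ball0 (r / 2)) (fun x => f (Dl x)).
Proof.
move=> [sf Sf]; split; first exact: csmooth_lin.
move=> x /= xr; apply: Sf => /= Dxr; apply: xr; have := norm_expand x; lra.
Qed.

Lemma csupp_iter_dilate r f j : csupp (ball0 r) f -> csupp (ball0 (2^-1 ^+ j * r)) (fun x => f (iter j Dl x)).
Proof.
move=> [sf Sf]; split; first exact: csmooth_iter.
move=> x /= xr; apply: Sf => /= Dxr; apply: xr.
rewrite -[x](iterDK j); apply: le_trans (norm_iter_contract j _) _; rewrite ler_wpM2l// exprn_ge0//.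
Qed.

Lemma op_iter_dilate (P : (V -> C) -> V -> C) (a : R) :
  (forall phi, csmooth setT phi -> forall x, P (fun y => phi (Dl y)) x = (a%:C)%C * P phi (Dl x)) ->
  forall phi j x, csmooth setT phi ->
  P (fun y => phi (iter j Dl y)) x = ((a ^+ j)%:C)%C * P phi (iter j Dl x).
Proof.
move=> PD phi j + sphi; elim: j => [|j IH] x; first by rewrite expr0 mul1r.
rewrite (_ : (fun y => _) = fun y => phi (iter j Dl (Dl y))); last by apply/funext => y; rewrite iterSr.
by rewrite (PD _ (csmooth_iter Dl j sphi)) IH mulrA -rmorphM /= -exprS -iterSr.
Qed.

Lemma cintegral_dilate D f : compact D -> ccontinuous f -> supported D f ->
  cintegral setT (fun x => f (Dl x)) = ((q^-1)%:C)%C * cintegral setT f.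
Proof. by move=> cD; exact: (cintegral_linear cD DK D'K jac). Qed.

Lemma cintegral_iter_dilate r f j : csupp (ball0 r) f ->
  cintegral setT (fun x => f (iter j Dl x)) = ((q ^- j)%:C)%C * cintegral setT f.
Proof.
move=> sf; elim: j => [|j IH]; first by rewrite expr0 invr1 mul1r.
rewrite (@cintegral_ext _ _ _ (fun x => f (iter j Dl (Dl x)))); last by move=> x; rewrite iterSr.
have [s S] := csupp_iter_dilate j sf.
rewrite (cintegral_dilate (@closed_ball_compact_rV R N _) (csmooth_continuous s) S) IH mulrA -rmorphM /=.
by rewrite exprS invfM.
Qed.

Variable c : R.
Hypothesis c01 : 0 < c < 1.

Lemma dilation_series D f : compact D -> csupp D f -> exists H (A : R), [/\ csmooth setT H,
  forall x, H x = f x + (c%:C)%C * H (Dl' x) &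
  forall k x, normc (\sum_(j < k) ((c ^+ j)%:C)%C * f (iter j Dl' x) - H x) <= A * c ^+ k].
Proof.
move=> cD sf; pose S k x : C := \sum_(j < k) ((c ^+ j)%:C)%C * f (iter j Dl' x).
have st j := csmooth_iter Dl' j sf.1.
have sS k : csmooth setT (S k) by apply: csmooth_sum => [|j]; [exact: oT|exact: (csmoothZ oT _ (st j))].
have ck k : 0 <= c ^+ k by rewrite exprn_ge0//; case/andP: c01 => /ltW.
have c0 : 0 < c by case/andP: c01.
have SB k : (fun y => S k.+1 y - S k y) = fun y => ((c ^+ k)%:C)%C * f (iter k Dl' y).
  apply/funext => y; have -> : S k.+1 y = S k y + ((c ^+ k)%:C)%C * f (iter k Dl' y) by rewrite /S big_ord_recr.
  by rewrite addrC addKr.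
have [|H sH HS] := csmooth_geometric_limit c01 sS.
  move=> m r; have [M M0 HM] := csupp_cdbound m cD sf; exists M => k _ x _; rewrite SB.
  apply: (cdbound_le (leqnn _) _ (cdboundZ (c ^+ k) (st k) (cdbound_iter k x sf.1 HM))).
  by rewrite ger0_norm// mulrC.
have [M M0 HM] := csupp_cdbound 0 cD sf.
have unif x : exists A, forall k, normc (S k x - H x) <= A * c ^+ k.
  have [A HA] := HS 0%N `|x|; exists (2 * A) => k; rewrite -mulrA.
  exact: cdboundW (HA k (leq0n k) x (lexx _)).
exists H, (2 * (2 * M) / (1 - c)); split=> //.
- move=> x; apply/eqP; rewrite -subr_eq0; apply/eqP.
  have [A HA] := unif x; have [B HB] := unif (Dl' x).
  apply: (@geometric_eq0 _ _ (A + `|B|) c 0 c01) => k _.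
  have E : S k.+1 x = f x + (c%:C)%C * S k (Dl' x).
    rewrite /S big_ord_recl /= expr0 mul1r mulr_sumr; congr (_ + _); apply: eq_bigr => j _.
    by rewrite /bump /= add1n -iterS iterSr mulrA -rmorphM /= -exprS.
  have -> : H x - (f x + (c%:C)%C * H (Dl' x)) = - (S k.+1 x - H x) + (c%:C)%C * (S k (Dl' x) - H (Dl' x)).
    by rewrite E; ring.
  apply: le_trans (ler_normcD _ _) _; rewrite normcN mulrDl; apply: lerD.
    have A0 : 0 <= A by have := le_trans (normc_ge0 _) (HA 0%N); rewrite expr0 mulr1.
    apply: le_trans (HA k.+1) _; rewrite ler_wpM2l// exprS ler_piMl//; by case/andP: c01 => _ /ltW.
  rewrite Normc.normcM normc_real gtr0_norm//.
  apply: (@le_trans _ _ (1 * (B * c ^+ k))).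
    apply: ler_pM; rewrite ?normc_ge0 ?(ltW c0)//; by case/andP: c01 => _ /ltW.
  by rewrite mul1r ler_wpM2r// ler_norm.
(* The smooth limit is only controlled on balls. The rate that is uniform over the whole space comes
   from the continuous limit, which is the same function. *)
- have [|g cg Hg] := @ccontinuous_geometric_limit _ _ S (2 * M) c c01 (fun k => csmooth_continuous (sS k)).
    move=> k x; have := congr1 (fun F => F x) (SB k) => /= ->.
    rewrite Normc.normcM normc_real ger0_norm// mulrC ler_wpM2r//; exact: cdboundW (HM _).
  move=> k x; suff -> : H x = g x by exact: Hg.
  apply/eqP; rewrite -subr_eq0; apply/eqP.
  have [A HA] := unif x.
  apply: (@geometric_eq0 _ _ (A + 2 * (2 * M) / (1 - c)) c 0 c01) => j _.
  have -> : H x - g x = - (S j x - H x) + (S j x - g x) by ring.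
  apply: le_trans (ler_normcD _ _) _; rewrite normcN mulrDl; exact: lerD.
Qed.

End homogeneous.

(** * A local fundamental solution homogeneous under the dilation *)

Section homogeneous_solution.
Context {R : realType} {N : nat}.
Local Notation C := R[i].
Local Notation V := 'rV[R]_N.
Local Notation normc := (@Normc.normc R).
Local Notation ball0 r := [set x : V | `|x| <= r].
Let oT : open [set: V] := openT.
Local Notation cB r := (@closed_ball_compact_rV R N r).

Variables (L : diffop R N) (Dl Dl' : {linear V -> V}) (a q : R).
Local Notation P := (transpose_fun L).
Hypotheses (DK : cancel Dl Dl') (D'K : cancel Dl' Dl).
Hypothesis contr : forall x, `|Dl' x| <= 2^-1 * `|x|.
Hypotheses (a1 : 1 < a) (aq : a < q).
Hypothesis jac : lebesgue_rV N (Dl @^-1` unit_cube N) = (q^-1)%:E.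
Hypothesis PD : forall phi, csmooth setT phi -> forall x, P (fun y => phi (Dl y)) x = (a%:C)%C * P phi (Dl x).
Hypothesis hypo : hypoelliptic (diffop_distr L).
Let sP := smooth_op_transpose L.

Let a0 : 0 < a. Proof. exact: lt_trans a1. Qed.
Let q0 : 0 < q. Proof. exact: lt_trans aq. Qed.
Let c : R := a / q.
Let c01 : 0 < c < 1.
Proof. by rewrite /c divr_gt0//= ltr_pdivrMr// mul1r. Qed.
Let half_exp_le j (s : R) : 0 <= s -> 2^-1 ^+ j * s <= s.
Proof. by move=> s0; rewrite ler_piMl// exprn_ile1// invf_le1// ler1n. Qed.

Lemma distribution_of_bounded (r B : R) (m : nat) (T : functional R N) (Om : set V) : Om `<=` ball0 r ->
  (forall c phi psi, csupp (ball0 r) phi -> csupp (ball0 r) psi -> T (fun x => c * phi x + psi x) = c * T phi + T psi) ->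
  (forall phi M, csupp (ball0 r) phi -> (forall x, cdbound m phi x M) -> normc (T phi) <= B * M) ->
  distribution_on Om T.
Proof.
move=> OmB Tl Tb; split.
  move=> k phi psi [s1 [D1 [_ D1O S1]]] [s2 [D2 [_ D2O S2]]]; apply: Tl.
    by apply: (csupp_subset _ (conj s1 S1)) => x /D1O/OmB.
  by apply: (csupp_subset _ (conj s2 S2)) => x /D2O/OmB.
move=> D _ DO; exists (B * N.+1%:R ^+ m), m => phi M [sphi _] S HM.
rewrite -mulrA [N.+1%:R ^+ m * _]mulrC; apply: Tb.
  by apply: (csupp_subset _ (conj sphi S)) => x /DO/OmB.
by move=> x; apply: (cpartial_cdbound sphi) => I; exact: HM.
Qed.

(** Hypoellipticity of L for the equation L T = 0 on [Om]; linearity and continuity of [T] are only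
    known on functions supported in a ball containing [Om]. *)
Lemma hypoelliptic_solution (r : R) (m : nat) (B : R) (T : functional R N) (Om : set V) :
  open Om -> Om `<=` ball0 r ->
  (forall c phi psi, csupp (ball0 r) phi -> csupp (ball0 r) psi -> T (fun x => c * phi x + psi x) = c * T phi + T psi) ->
  (forall phi M, csupp (ball0 r) phi -> (forall x, cdbound m phi x M) -> normc (T phi) <= B * M) ->
  (forall phi, test_fun Om phi -> T (P phi) = 0) ->
  exists2 h, csmooth Om h & forall phi, test_fun Om phi -> T phi = cintegral setT (fun x => h x * phi x).
Proof.
move=> oOm OmB Tl Tb TP.
have z0 phi : test_fun Om phi -> distr_of_fun Om (fun=> 0) phi = 0.
  move=> [sphi [D [cD DO S]]]; rewrite /distr_of_fun cintegral_setT; last by move=> x _; rewrite mul0r.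
  rewrite (@cintegral_ext _ _ _ (fun x => 0 * phi x))// (cintegralZ cD 0 (csmooth_continuous sphi) S) mul0r //.
have [|||h [sh Th]] := hypo (F := fun=> 0) oOm (distribution_of_bounded OmB Tl Tb).
- split=> [k phi psi _ _|D _ _]; first by rewrite mulr0 addr0.
  by exists 0, 0%N => phi M _ _ _; rewrite normc_c0 mul0r.
- exact: TP.
- exists (fun=> 0); split; [exact: (csmooth_cst oOm)|by move=> phi /z0 ->].
exists h; first exact: sh.
move=> phi tphi; rewrite (Th _ tphi) /distr_of_fun cintegral_setT//.
move: tphi => [_ [D [_ DO S]]] x xO; rewrite S ?mulr0// => /DO; exact: xO.
Qed.

(** Near 0 the defect T(phi) = a E(phi o D) - E(phi) is integration against a smooth h. With chi a
    cutoff and H = chi h + (a/q) H o D^-1, the functional G(phi) = E(phi) + \int H phi satisfies a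
    G(phi o D) = G(phi). *)
Lemma homogeneous_local_solution : hypoelliptic (transpose_distr L) -> (0 < N)%N ->
  exists (r B : R) (m : nat) (T : functional R N), [/\ 0 < r,
    forall c phi psi, csupp (ball0 r) phi -> csupp (ball0 r) psi -> T (fun x => c * phi x + psi x) = c * T phi + T psi,
    forall phi M, csupp (ball0 r) phi -> (forall x, cdbound m phi x M) -> normc (T phi) <= B * M,
    forall psi, csupp (ball0 r) psi -> T (P psi) = psi 0 &
    forall phi, csupp (ball0 r) phi -> (a%:C)%C * T (fun x => phi (Dl x)) = T phi].
Proof.
move=> hypot N0.
have [r [A [m [E [r0 El Eb EP]]]]] := local_fundamental_solution hypot N0.
have sub s t : s <= t -> ball0 s `<=` ball0 t by move=> st x /= /le_trans; exact.
have sdil s phi : 0 <= s -> csupp (ball0 s) phi -> csupp (ball0 s) (fun x => phi (Dl x)).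
  move=> s0 /(csupp_dilate DK contr); apply: csupp_subset; apply: sub; lra.
have [k k0 Dk] := rV_linear_lipschitz Dl.
pose T phi := (a%:C)%C * E (fun x => phi (Dl x)) - E phi.
have Tl (d : C) phi psi : csupp (ball0 r) phi -> csupp (ball0 r) psi ->
    T (fun x => d * phi x + psi x) = d * T phi + T psi.
  move=> s1 s2; rewrite /T (El _ _ _ s1 s2).
  rewrite (El d (fun x => phi (Dl x)) (fun x => psi (Dl x)) (sdil _ _ (ltW r0) s1) (sdil _ _ (ltW r0) s2)).
  ring.
have Tb phi M : csupp (ball0 r) phi -> (forall x, cdbound m phi x M) ->
    normc (T phi) <= (a * (A * (1 + k) ^+ m) + A) * M.
  move=> s1 HM; rewrite mulrDl; apply: le_trans (ler_normcD _ _) _; rewrite normcN; apply: lerD; last exact: Eb.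
  rewrite Normc.normcM normc_real gtr0_norm// -mulrA ler_wpM2l ?(ltW a0)// -mulrA.
  apply: Eb; first exact: sdil (ltW r0) s1.
  move=> x; apply: (cdbound_linear s1.1); [by rewrite lerDl| |exact: HM].
  by move=> v; apply: le_trans (Dk v) _; rewrite ler_wpM2r// lerDr.
pose U := [set x : V | `|x| < r].
have UB : U `<=` ball0 r by move=> x /ltW.
have D0 : Dl 0 = 0 by exact: linear0.
(* By homogeneity a (P psi) o D = P (psi o D), so both terms of T (P psi) are the value of psi at
   the fixed point 0 of D. *)
have TP psi : csupp (ball0 r) psi -> T (P psi) = 0.
  move=> s1; rewrite /T (EP _ s1).
  have s2 := sdil _ _ (ltW r0) s1.
  have z : csupp (ball0 r) (fun=> 0 : C) by split; [exact: (csmooth_cst oT)|].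
  have E0 : E (fun=> 0) = 0.
    rewrite -[RHS](addNr (E (fun=> 0))) -mulN1r -(El (-1) _ _ z z); congr (E _).
    by apply/funext => x; rewrite mulr0 addr0.
  have sPd : csupp (ball0 r) (P (fun y => psi (Dl y))) := csupp_op sP (cB r) s2.
  have := El ((a^-1)%:C)%C _ _ sPd z.
  rewrite (EP _ s2) D0 E0 addr0 => EZ.
  rewrite (_ : (fun x => P psi (Dl x)) = fun x => ((a^-1)%:C)%C * P (fun y => psi (Dl y)) x + 0); last first.
    by apply/funext => x; rewrite (PD s1.1) mulrA -rmorphM /= mulVf ?gt_eqF// mul1r addr0.
  by rewrite EZ mulrA -rmorphM /= divff ?gt_eqF// mul1r subrr.
have [|h sh Th] := hypoelliptic_solution (@open_norm_lt R N r) UB Tl Tb.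
  move=> phi [sphi [D [cD DU S]]]; apply: TP; apply: (csupp_subset _ (conj sphi S)) => x /DU; exact: UB.
(* The cutoff of radius [r1] is supported in the ball of radius r/2, where [h] is smooth, and is 1
   on the ball of radius [r1], where the conclusion is claimed. *)
pose r1 := r / 4; have r10 : 0 < r1 by rewrite /r1; lra.
pose chi (x : V) : C := ((plateau 0 r1 x)%:C)%C.
have schi : csmooth setT chi by apply: (csmooth_real oT); exact: smooth_plateau.
have Schi : supported (ball0 (2 * r1)) chi.
  move=> x /= /negP; rewrite -ltNge => xr; rewrite /chi plateau0//; by rewrite subr0.
have sh1 : csupp (ball0 (2 * r1)) (fun x => chi x * h x).
  split; last exact: supportedMl.
  apply: (csmooth_cutoff (@open_norm_lt R N r) (compact_closed_rV (cB (2 * r1))) _ schi Schi sh).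
  by move=> x /= xr; apply: le_lt_trans xr _; rewrite /r1; lra.
have r1r : ball0 r1 `<=` ball0 r by apply: sub; rewrite /r1; lra.
have Th1 phi : csupp (ball0 r1) phi -> T phi = cintegral setT (fun x => (chi x * h x) * phi x).
  move=> s1; rewrite Th; last first.
    split; [exact: s1.1|exists (ball0 r1); split; [exact: (cB r1)| |exact: s1.2]].
    by move=> x /= xr; apply: le_lt_trans xr _; rewrite /r1; lra.
  apply: cintegral_ext => x; have [xr|/s1.2 ->] := pselect (`|x| <= r1); last by rewrite !mulr0.
  by rewrite /chi plateau1 ?subr0// mul1r.
have [H [A1 [sH HE HA]]] := dilation_series contr c01 (cB _) sh1.
have Hb x : normc (H x) <= A1 by have := HA 0%N x; rewrite big_ord0 sub0r normcN expr0 mulr1.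
have cH := csmooth_continuous sH.
pose G phi := E phi + cintegral setT (fun x => H x * phi x).
(* The change of variables gives the factor 1/q; then (a/q) H o D^-1 = H - chi h by the equation of
   [H]. *)
have dil psi : csupp (ball0 r1) psi -> (a%:C)%C * cintegral setT (fun x => H x * psi (Dl x)) =
    cintegral setT (fun x => H x * psi x) - cintegral setT (fun x => (chi x * h x) * psi x).
  move=> s1; have cp := csmooth_continuous s1.1.
  rewrite (_ : cintegral setT (fun x => H x * psi (Dl x)) = ((q^-1)%:C)%C * cintegral setT (fun y => H (Dl' y) * psi y)); last first.
    rewrite -(cintegral_dilate DK D'K jac (cB r1) (ccontinuousM (csmooth_continuous (csmooth_lin Dl' sH)) cp) (supportedMr _ s1.2)).
    by apply: cintegral_ext => x; rewrite DK.
  have ch := csmooth_continuous sh1.1.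
  rewrite -(cintegralB (cB r1) (ccontinuousM cH cp) (ccontinuousM ch cp) (supportedMr _ s1.2) (supportedMr _ s1.2)).
  rewrite mulrA -rmorphM /= -/c.
  rewrite -(cintegralZ (cB r1) _ (ccontinuousM (csmooth_continuous (csmooth_lin Dl' sH)) cp) (supportedMr _ s1.2)).
  by apply: cintegral_ext => x; rewrite [in RHS]HE; ring.
(* Adding [H] must not spoil the value at P psi. The number \int H P psi is unchanged when psi is
   replaced by psi o D, because T (P psi) = 0. For psi o D^j rescaling gives (a/q)^j times a bounded
   quantity, so the number is 0. *)
have HP psi : csupp (ball0 r1) psi -> cintegral setT (fun x => H x * P psi x) = 0.
  move=> s1; pose S psi := cintegral setT (fun x => H x * P psi x).
  have SD phi : csupp (ball0 r1) phi -> S phi = S (fun y => phi (Dl y)).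
    move=> s2; have sPp := csupp_op sP (cB r1) s2.
    rewrite /S (@cintegral_ext _ _ (fun x => H x * P (fun y => phi (Dl y)) x) (fun x => (a%:C)%C * (H x * P phi (Dl x)))); last first.
      by move=> x; rewrite (PD s2.1) mulrCA.
    have sPd := csupp_dilate DK contr sPp.
    rewrite (cintegralZ (cB (r1 / 2)) _ (ccontinuousM cH (csmooth_continuous sPd.1)) (supportedMr _ sPd.2)).
    rewrite (dil _ sPp) -(Th1 _ sPp) (TP _ (csupp_subset r1r s2)) subr0 //.
  have sj j := csupp_iter_dilate DK contr j s1.
  have Sj j : S psi = S (fun y => psi (iter j Dl y)).
    elim: j => [|j IH]; first exact: erefl.
    have sj1 : csupp (ball0 r1) (fun y => psi (iter j Dl y)).
      exact: (csupp_subset (sub _ _ (half_exp_le j (ltW r10))) (sj j)).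
    transitivity (S (fun y => psi (iter j Dl y))); first exact: IH.
    transitivity (S (fun y => psi (iter j Dl (Dl y)))); first exact: (SD _ sj1).
    by apply: (congr1 S); apply/funext => y; rewrite -iterSr.
  have sPp := csupp_op sP (cB r1) s1.
  have [M M0 HM] := csupp_cdbound 0 (cB r1) sPp.
  apply: (@geometric_eq0 _ _ (2 * (A1 * (2 * M)) * fine (lebesgue_rV N (ball0 r1))) c 0 c01) => j _.
  rewrite -/(S psi) (Sj j) /S.
  rewrite (@cintegral_ext _ _ _ (fun x => ((a ^+ j)%:C)%C * (H (iter j Dl' (iter j Dl x)) * P psi (iter j Dl x)))); last first.
    by move=> x; rewrite (op_iter_dilate PD _ _ s1.1) (iterDK DK) mulrCA.
  have sF : csupp (ball0 r1) (fun x => ((a ^+ j)%:C)%C * (H (iter j Dl' x) * P psi x)).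
    apply: csuppM; first exact: (csmooth_cst oT).
    exact: (csuppM (csmooth_iter Dl' j sH) sPp).
  rewrite (cintegral_iter_dilate DK D'K contr jac j sF).
  have sG := csuppM (csmooth_iter Dl' j sH) sPp.
  rewrite (cintegralZ (cB r1) _ (csmooth_continuous sG.1) sG.2) mulrA.
  have -> : ((q ^- j)%:C)%C * ((a ^+ j)%:C)%C = ((q ^- j * a ^+ j)%:C)%C by rewrite rmorphM.
  rewrite Normc.normcM normc_real.
  have -> : `|q ^- j * a ^+ j| = c ^+ j.
    by rewrite ger0_norm /c ?exprMn ?exprVn 1?mulrC// mulr_ge0 ?invr_ge0 ?exprn_ge0// ltW.
  rewrite [_ * c ^+ j]mulrC ler_wpM2l ?exprn_ge0//; first by case/andP: c01 => /ltW.
  apply: (cintegral_bound (cB r1) (csmooth_continuous (csmooth_iter Dl' j sH)) (csmooth_continuous sPp.1) sPp.2).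
    by move=> x; exact: Hb.
  by move=> x; exact: cdboundW (HM x).
exists r1, (A + 2 * (A1 * 2) * fine (lebesgue_rV N (ball0 r1))), m, G; split=> //.
- move=> d phi psi s1 s2; rewrite /G (El _ _ _ (csupp_subset r1r s1) (csupp_subset r1r s2)).
  have c1 := ccontinuousM cH (csmooth_continuous s1.1); have c2 := ccontinuousM cH (csmooth_continuous s2.1).
  have S1 := supportedMr H s1.2; have S2 := supportedMr H s2.2.
  rewrite (@cintegral_ext _ _ _ (fun x => d * (H x * phi x) + H x * psi x)); last by move=> x; ring.
  rewrite (cintegralD (cB r1) (ccontinuousZ d c1) c2 (supportedMr _ S1) S2) (cintegralZ (cB r1) d c1 S1).
  ring.
- move=> phi M s1 HM; rewrite mulrDl; apply: le_trans (ler_normcD _ _) _; apply: lerD.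
    exact: Eb (csupp_subset r1r s1) HM.
  have := cintegral_bound (cB r1) cH (csmooth_continuous s1.1) s1.2 Hb (fun x => cdboundW (HM x)).
  by move=> /le_trans; apply; rewrite le_eqVlt; apply/orP; left; apply/eqP; ring.
- by move=> psi s1; rewrite /G (HP _ s1) addr0; exact: EP (csupp_subset r1r s1).
- move=> phi s1; rewrite /G mulrDr (dil _ s1) -(Th1 _ s1) /T; ring.
Qed.

End homogeneous_solution.

(** * Dyadic expansion of the fundamental solution *)

Section expansion.
Context {R : realType} {N : nat}.
Local Notation C := R[i].
Local Notation V := 'rV[R]_N.
Local Notation normc := (@Normc.normc R).
Local Notation ball0 r := [set x : V | `|x| <= r].
Let oT : open [set: V] := openT.
Local Notation cB r := (@closed_ball_compact_rV R N r).

Variables (L : diffop R N) (Dl Dl' : {linear V -> V}) (a q : R).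
Local Notation P := (transpose_fun L).
Hypotheses (DK : cancel Dl Dl') (D'K : cancel Dl' Dl).
Hypothesis contr : forall x, `|Dl' x| <= 2^-1 * `|x|.
Hypotheses (a1 : 1 < a) (aq : a < q).
Hypothesis jac : lebesgue_rV N (Dl @^-1` unit_cube N) = (q^-1)%:E.
Hypothesis PD : forall phi, csmooth setT phi -> forall x, P (fun y => phi (Dl y)) x = (a%:C)%C * P phi (Dl x).
Hypothesis hypo : hypoelliptic (diffop_distr L).
Hypothesis hypot : hypoelliptic (transpose_distr L).
Hypothesis N0 : (0 < N)%N.
Let sP := smooth_op_transpose L.

Let a0 : 0 < a. Proof. exact: lt_trans a1. Qed.
Let q0 : 0 < q. Proof. exact: lt_trans aq. Qed.
Let c : R := a / q.
Let c01 : 0 < c < 1.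
Proof. by rewrite /c divr_gt0//= ltr_pdivrMr// mul1r. Qed.

Let sub s t : s <= t -> ball0 s `<=` ball0 t.
Proof. by move=> st x /= /le_trans; exact. Qed.

(** Write chi f = theta f + (chi o D) f, where theta = chi - chi o D lives in an annulus. Off 0 the
    functional [T] is a smooth function [g], so the first term is an integral against gamma = theta
    g. Homogeneity turns the second into a^-1 T (chi (f o D^-1)), and one iterates. *)
Lemma local_expansion : exists (gamma : V -> C) (rho rho' : R), [/\ 0 < rho, 0 < rho' <= rho,
  csupp (ball0 (2 * rho)) gamma, forall x, `|x| < rho' -> gamma x = 0 &
  forall psi, csupp (ball0 rho) psi -> exists A, forall J : nat,
    normc (psi 0 - \sum_(j < J) ((a ^- j)%:C)%C * cintegral setT (fun z => gamma z * P psi (iter j Dl' z))) <= A * a ^- J].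
Proof.
have [r [B [m [T [r0 Tl Tb TP TD]]]]] := homogeneous_local_solution DK D'K contr a1 aq jac PD hypo hypot N0.
have [k k0 Dk] := rV_linear_lipschitz Dl.
pose rho := r / 4; have rho0 : 0 < rho by rewrite /rho; lra.
(* [k] is a Lipschitz constant of D, so [|x| < rho'] implies [|D x| <= rho]: both cutoffs are 1
   there and their difference vanishes. *)
pose rho' := rho / (1 + k); have k1 : 0 < 1 + k by lra.
have rho'0 : 0 < rho' by rewrite divr_gt0.
pose chi (x : V) : C := ((plateau 0 rho x)%:C)%C.
have schi : csmooth setT chi by apply: (csmooth_real oT); exact: smooth_plateau.
have chi1 x : `|x| <= rho -> chi x = 1 by move=> xr; rewrite /chi plateau1// subr0.
have Schi : supported (ball0 (2 * rho)) chi.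
  move=> x /= /negP; rewrite -ltNge => xr; rewrite /chi plateau0//; by rewrite subr0.
pose theta x := chi x - chi (Dl x).
have stheta : csmooth setT theta := csmoothB oT schi (csmooth_lin Dl schi).
pose D0 := ball0 (2 * rho) `&` [set x | rho' <= `|x|].
have theta0 x : `|x| < rho' -> theta x = 0.
  move=> xr; have H1 : `|Dl x| <= rho.
    apply: le_trans (Dk x) _; apply: (@le_trans _ _ ((1 + k) * `|x|)); first by rewrite ler_wpM2r// lerDr.
    by rewrite -ler_pdivlMl// mulrC ltW.
  by rewrite /theta !chi1 ?subrr//; have := norm_expand DK contr x; have := normr_ge0 x; lra.
have Sth : supported D0 theta.
  move=> x xD; have [xr|xr] := ltP `|x| rho'; first exact: theta0.
  have xr2 : ~ `|x| <= 2 * rho by move=> H; apply: xD; split.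
  rewrite /theta !Schi ?subrr//= => H; apply: xr2; have := norm_expand DK contr x; have := normr_ge0 x; lra.
have cD0 : closed D0.
  apply: closedI; first exact: compact_closed_rV (cB (2 * rho)).
  rewrite (_ : [set x | _] = ~` [set x : V | `|x| < rho']); last first.
    by apply/seteqP; split => x /=; rewrite leNgt => /negP.
  by rewrite closedC; exact: open_norm_lt.
have ccD0 : compact D0.
  by apply: (@subclosed_compact _ _ (ball0 (2 * rho))) => //; [exact: (cB (2 * rho))|exact: subIsetl].
pose U := [set x : V | `|x| < r] `&` [set x : V | 0 < `|x|].
have oU : open U by apply: openI; [exact: open_norm_lt|exact: open_norm_gt].
have UB : U `<=` ball0 r by move=> x [/ltW].
have D0U : D0 `<=` U.
  move=> x [/= H1 H2]; split => /=; last exact: lt_le_trans H2.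
  by apply: le_lt_trans H1 _; rewrite /rho; lra.
have [|g sg Tg] := hypoelliptic_solution hypo oU UB Tl Tb.
  move=> phi [sphi [D [cD DU S]]]; rewrite TP; last by apply: (csupp_subset _ (conj sphi S)) => x /DU; exact: UB.
  by apply: S => /DU[_ /=]; rewrite normr0 ltxx.
pose gamma x := theta x * g x.
have sgamma : csmooth setT gamma := csmooth_cutoff oU cD0 D0U stheta Sth sg.
exists gamma, rho, rho'; split=> //.
- by rewrite rho'0 ler_pdivrMr// ler_peMr ?(ltW rho0)// lerDl.
- by split; [exact: sgamma|apply: supportedMl => x xD; apply: Sth => -[/xD]].
- by move=> x /theta0; rewrite /gamma => ->; rewrite mul0r.
move=> psi spsi; set phi := P psi.
have sphi : csupp (ball0 rho) phi := csupp_op sP (cB rho) spsi.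
have rr : ball0 rho `<=` ball0 r by apply: sub; rewrite /rho; lra.
have rr2 : ball0 (2 * rho) `<=` ball0 r by apply: sub; rewrite /rho; lra.
pose f j (x : V) := phi (iter j Dl' x).
have sf j : csmooth setT (f j) := csmooth_iter Dl' j sphi.1.
have schif j : csupp (ball0 r) (fun x => chi x * f j x).
  apply: (csupp_subset rr2); split; [exact: (csmoothM oT schi (sf j))|exact: supportedMl].
have sthf j : test_fun U (fun x => theta x * f j x).
  split; first exact: (csmoothM oT stheta (sf j)).
  by exists D0; split; [exact: ccD0|exact: D0U|exact: supportedMl].
have sthf' j : csupp (ball0 r) (fun x => theta x * f j x).
  split; first exact: (csmoothM oT stheta (sf j)).
  by apply: supportedMl; apply: supported_subset Sth => x [/rr2].
(* One step of the recursion; each step brings a factor 1/a and composes with D^-1 once more. *)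
have step j : T (fun x => chi x * f j x) =
    cintegral setT (fun z => gamma z * f j z) + ((a^-1)%:C)%C * T (fun x => chi x * f j.+1 x).
  have sd : csupp (ball0 r) (fun x => chi (Dl x) * f j.+1 (Dl x)).
    have := csupp_dilate DK contr (schif j.+1); apply: csupp_subset; apply: sub; lra.
  rewrite -(TD _ (schif j.+1)) mulrA -rmorphM /= mulVf ?gt_eqF// mul1r.
  have -> : cintegral setT (fun z => gamma z * f j z) = T (fun x => theta x * f j x).
    by rewrite (Tg _ (sthf j)); apply: cintegral_ext => x; rewrite /gamma; ring.
  rewrite -[T (fun x => theta x * f j x)]mul1r -(Tl _ _ _ (sthf' j) sd); congr (T _).
  by apply/funext => x; rewrite /f iterSr DK /theta; ring.
have main J : psi 0 = \sum_(j < J) ((a ^- j)%:C)%C * cintegral setT (fun z => gamma z * f j z) +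
    ((a ^- J)%:C)%C * T (fun x => chi x * f J x).
  elim: J => [|J IH].
    rewrite big_ord0 add0r expr0 invr1 mul1r -(TP _ (csupp_subset rr spsi)); congr (T _).
    apply/funext => x; rewrite /f /=; have [xr|/sphi.2 E] := pselect (`|x| <= rho).
      by rewrite chi1// mul1r.
    by rewrite -/phi E mulr0.
  rewrite IH big_ord_recr /= step mulrDr addrA; congr (_ + _).
  by rewrite mulrA -rmorphM /= exprSr invfM mulrC.
have [Mc Mc0 HMc] := csupp_cdbound m (cB (2 * rho)) (conj schi Schi).
have [M M0 HM] := csupp_cdbound m (cB rho) sphi.
exists (B * (2 * (2 ^+ m * (Mc * M)))) => J.
rewrite (main J) addrC addKr Normc.normcM normc_real ger0_norm ?invr_ge0 ?exprn_ge0 ?(ltW a0)//.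
rewrite mulrC ler_wpM2r ?invr_ge0 ?exprn_ge0 ?(ltW a0)//.
apply: Tb (schif J) _ => x; apply: (cdbound_cutoff schi (sf J) (HMc x)).
exact: (cdbound_iter contr J x sphi.1 HM).
Qed.

(** For an arbitrary test function psi, the local expansion is applied to psi o D^k, whose support
    is small. Its terms of rank k and above are those wanted for psi; the first k, rescaled, are
    integrals of P psi against large-scale pieces. *)
Lemma fundamental_expansion : exists (gamma gammaoo : V -> C) (rho rho' : R), [/\ 0 < rho', csupp (ball0 rho) gamma,
  forall x, `|x| < rho' -> gamma x = 0, csmooth setT gammaoo &
  forall psi, test_fun setT psi -> exists A, forall J : nat,
    normc (psi 0 - (cintegral setT (fun z => gammaoo z * P psi z) +
      \sum_(j < J) ((a ^- j)%:C)%C * cintegral setT (fun z => gamma z * P psi (iter j Dl' z)))) <= A * a ^- J].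
Proof.
have [gamma [rho [rho' [rho0 /andP[rho'0 rho'le] sgamma gamma0 Hg]]]] := local_expansion.
have [H [A1 [sH HE HA]]] := dilation_series contr c01 (cB (2 * rho)) sgamma.
(* This is the sum over j >= 1 of c^j gamma(D^-j x), all the pieces at scales larger than that of
   [gamma]; unlike [k], it does not depend on psi. *)
pose gammaoo x := (c%:C)%C * H (Dl' x).
have sgoo : csmooth setT gammaoo := csmoothZ oT _ (csmooth_lin Dl' sH).
exists gamma, gammaoo, (2 * rho), rho'; split=> // psi [spsi [D [cD _ S]]].
have [d d0 Dd] := compact_sub_ball cD.
(* So large that D^-k maps the support of psi into a ball where [gamma] and [H] vanish and which
   lies in the domain of the local expansion. *)
have [k [_ /(_ k (leqnn k)) kd]] : exists K, (0 <= K)%N /\ forall k, (K <= k)%N -> d * 2^-1 ^+ k <= rho' / 2.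
  by apply: geometric_small; lra.
have spsid : csupp (ball0 d) psi by apply: (csupp_subset _ (conj spsi S)) => x /Dd.
have sk : csupp (ball0 rho) (fun x => psi (iter k Dl x)).
  have := csupp_iter_dilate DK contr k spsid; apply: csupp_subset; apply: sub; rewrite mulrC; lra.
have [A HAk] := Hg _ sk.
have H0 x : `|x| < rho' -> H x = 0.
  move=> xr; apply: (@geometric_eq0 _ _ A1 c 0 c01) => j _.
  have := HA j x; rewrite big1 ?sub0r ?normcN// => i _.
  by rewrite gamma0 ?mulr0// (le_lt_trans (norm_iter_le contr i x)).
have HS i x : H x = \sum_(j < i) ((c ^+ j)%:C)%C * gamma (iter j Dl' x) + ((c ^+ i)%:C)%C * H (iter i Dl' x).
  elim: i => [|i IH]; first by rewrite big_ord0 expr0 add0r mul1r.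
  by rewrite IH big_ord_recr /= HE mulrDr addrA mulrA -rmorphM /= -exprSr.
(* On the support of psi only the first k terms of the series [gammaoo] are non-zero. *)
have goo x : `|x| <= d -> gammaoo x = \sum_(j < k) ((c ^+ j.+1)%:C)%C * gamma (iter j.+1 Dl' x).
  move=> xd; have := HE x; rewrite (HS k.+1 x) big_ord_recl /= expr0 mul1r (H0 (Dl' _)) => [|]; last first.
    have := contr (iter k Dl' x); have := norm_iter_contract contr k x.
    have : 2^-1 ^+ k * `|x| <= 2^-1 ^+ k * d by rewrite ler_wpM2l// exprn_ge0.
    rewrite [_ * d]mulrC; have := normr_ge0 (iter k Dl' x); lra.
  by rewrite mulr0 addr0 /gammaoo => /addrI <-; apply: eq_bigr.
exists (A * a ^- k) => J.
suff -> : cintegral setT (fun z => gammaoo z * P psi z) +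
      \sum_(j < J) ((a ^- j)%:C)%C * cintegral setT (fun z => gamma z * P psi (iter j Dl' z)) =
    \sum_(j < k + J) ((a ^- j)%:C)%C * cintegral setT (fun z => gamma z * P (fun x => psi (iter k Dl x)) (iter j Dl' z)).
  have := HAk (k + J)%N; rewrite exprD invfM mulrA (_ : iter k Dl 0 = 0)//.
  by elim: k {sk HAk goo kd} => //= j ->; rewrite linear0.
have sPp := csupp_op sP (cB d) spsid.
have cPp := csmooth_continuous sPp.1; have cg := csmooth_continuous sgamma.1.
rewrite big_split_ord /=; congr (_ + _); last first.
  apply: eq_bigr => j _.
  rewrite (@cintegral_ext _ _ (fun z => gamma z * P (fun x => psi (iter k Dl x)) _) (fun z => ((a ^+ k)%:C)%C * (gamma z * P psi (iter j Dl' z)))); last first.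
    by move=> z; rewrite (op_iter_dilate PD _ _ spsi) iterD (iterD'K D'K) mulrCA.
  rewrite (cintegralZ (cB (2 * rho)) _ (ccontinuousM cg (csmooth_continuous (csmooth_iter Dl' j sPp.1))) (supportedMl _ sgamma.2)).
  by rewrite mulrA -rmorphM /= exprD invfM mulrAC mulVf ?mul1r// expf_neq0// gt_eqF.
rewrite (@cintegral_ext _ _ _ (fun z => \sum_(j < k) ((c ^+ j.+1)%:C)%C * (gamma (iter j.+1 Dl' z) * P psi z))); last first.
  move=> z; have [zd|/sPp.2 ->] := pselect (`|z| <= d); last by rewrite mulr0 big1// => j _; rewrite mulr0 mulr0.
  by rewrite goo// mulr_suml; apply: eq_bigr => j _; rewrite mulrA.
have sgj j := csuppM (csmooth_iter Dl' j sgamma.1) sPp.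
rewrite (cintegral_sum (cB d)); last 2 first.
- by move=> j; exact: (ccontinuousZ _ (csmooth_continuous (sgj j.+1).1)).
- by move=> j; exact: (supportedMr _ (sgj j.+1).2).
(* The j-th term of the expansion of psi o D^k is the piece of [gammaoo] at scale k - j, so one of
   the two sums is reversed. *)
rewrite (reindex_inj rev_ord_inj) /=; apply: eq_bigr => j _.
set i := (k - j.+1).+1; have ij : k = (i + j)%N by rewrite /i addSnnS subnK.
rewrite (cintegralZ (cB d) _ (csmooth_continuous (sgj i).1) (sgj i).2).
rewrite (@cintegral_ext _ _ (fun z => gamma z * P (fun x => psi (iter k Dl x)) _) (fun z => ((a ^+ k)%:C)%C * (gamma (iter i Dl' (iter i Dl z)) * P psi (iter i Dl z)))); last first.
  move=> z; rewrite (op_iter_dilate PD _ _ spsi) (iterDK DK) mulrCA; congr (_ * (_ * P psi _)).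
  transitivity (iter (i + j) Dl (iter j Dl' z)); first by rewrite -ij.
  by rewrite iterD (iterD'K D'K).
have sgi := csupp_iter_dilate DK contr i (sgj i).
rewrite (cintegralZ (cB (2^-1 ^+ i * d)) _ (csmooth_continuous sgi.1) sgi.2).
rewrite (cintegral_iter_dilate DK D'K contr jac i (sgj i)) !mulrA -!rmorphM /=; congr (_%:C%C * _).
have Ek : a ^+ k = a ^+ i * a ^+ j by rewrite -exprD -ij.
rewrite /c expr_div_n Ek; field.
by rewrite !expf_neq0 ?gt_eqF.
Qed.

End expansion.

(** * Jacobian of the left translations *)

Section determinant_calculus.
Context {R : realType} {n : nat}.
Local Notation V := 'rV[R]_n.
Let oT : open [set: V] := openT.

Lemma derive_mul (f g : V -> R) x v : smooth setT f -> smooth setT g ->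
  'D_v (fun y => f y * g y) x = f x * 'D_v g x + 'D_v f x * g x.
Proof.
move=> sf sg; have := @deriveM _ _ f g x v (smooth_derivable sf Logic.I) (smooth_derivable sg Logic.I).
by move=> /= ->; rewrite /GRing.scale /= [g x * _]mulrC.
Qed.

Lemma derive_prod1 (I : eqType) (s : seq I) (f : I -> V -> R) x v : (forall i, smooth setT (f i)) ->
  (forall i, i \in s -> f i x = 1) ->
  'D_v (fun y => \prod_(i <- s) f i y) x = \sum_(i <- s) 'D_v (f i) x.
Proof.
move=> sf; elim: s => [|i s IH] fx.
  rewrite big_nil (_ : (fun y => _) = cst 1) ?derive_cst//.
  by apply/funext => y; rewrite big_nil.
rewrite (_ : (fun y => _) = fun y => f i y * \prod_(i <- s) f i y); last by apply/funext => y; rewrite big_cons.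
have sp : smooth setT (fun y => \prod_(i <- s) f i y) by apply: (smooth_prod oT) => j _; exact: sf.
rewrite (derive_mul x v (sf i) sp) big_cons IH => [|j js]; last by apply: fx; rewrite inE js orbT.
rewrite (_ : \prod_(j <- s) f j x = 1); last first.
  by rewrite big_seq big1// => j js; apply: fx; rewrite inE js orbT.
by rewrite fx ?inE ?eqxx// mul1r mulr1 addrC.
Qed.

Lemma smooth_det k (A : 'I_k -> 'I_k -> V -> R) : (forall i j, smooth setT (A i j)) ->
  smooth setT (fun y => \det (\matrix_(i, j) A i j y)).
Proof.
move=> sA; rewrite (_ : (fun y => _) = fun y => \sum_(s : 'S_k) (-1) ^+ s * \prod_i A i (s i) y); last first.
  by apply/funext => y; apply: eq_bigr => s _; congr (_ * _); apply: eq_bigr => i _; rewrite mxE.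
apply: (smooth_sum oT) => s _; apply: (smoothM oT (smooth_cst _ oT)); apply: (smooth_prod oT) => i _; exact: sA.
Qed.

(** At the identity matrix the derivative of the determinant is the trace. A permutation other than
    the identity moves some i and also s(i), so its product has two factors vanishing at [x] and its
    derivative is 0. *)
Lemma derive_det1 k (A : 'I_k -> 'I_k -> V -> R) x v : (forall i j, smooth setT (A i j)) ->
  (forall i j, A i j x = (i == j)%:R) ->
  'D_v (fun y => \det (\matrix_(i, j) A i j y)) x = \sum_i 'D_v (A i i) x.
Proof.
move=> sA A1.
pose F (s : 'S_k) y : R := \prod_i A i (s i) y.
have sF s : smooth setT (F s) by apply: (smooth_prod oT) => i _; exact: sA.
rewrite (_ : (fun y => _) = fun y => \sum_(s : 'S_k) (-1) ^+ s * F s y); last first.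
  by apply/funext => y; apply: eq_bigr => s _; congr (_ * _); apply: eq_bigr => i _; rewrite mxE.
have sF' (s : 'S_k) : smooth setT (fun y => (-1) ^+ s * F s y) := smoothM oT (smooth_cst _ oT) (sF s).
rewrite (iter_derive_sum oT (index_enum {perm 'I_k}) [:: v] sF' Logic.I : 'D_v _ x = _) /=.
have DF (s : 'S_k) : 'D_v (fun y => (-1) ^+ s * F s y) x = (-1) ^+ s * 'D_v (F s) x.
  exact: (iter_deriveZ oT ((-1) ^+ s) [:: v] (sF s) Logic.I).
rewrite (eq_bigr _ (fun s _ => DF s)) (bigD1 1%g)//= odd_perm1 expr0 mul1r big1 ?addr0.
  rewrite (_ : F 1%g = fun y => \prod_(i <- index_enum 'I_k) A i i y); last first.
    by apply/funext => y; apply: eq_bigr => i _; rewrite perm1.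
  by rewrite derive_prod1// => i _; rewrite A1 eqxx.
move=> s s1; have [i si] : exists i, s i != i.
  apply/existsP; rewrite -negb_forall; apply: contra s1 => /forallP H; apply/eqP/permP => i.
  by rewrite perm1; exact/eqP.
have sis : s (s i) != s i by rewrite (inj_eq perm_inj).
pose G y := \prod_(j | (j != i) && (j != s i)) A j (s j) y.
have sG : smooth setT G by apply: (smooth_prod oT) => j _; exact: sA.
have sAG := smoothM oT (sA (s i) (s (s i))) sG.
rewrite (_ : F s = fun y => A i (s i) y * (A (s i) (s (s i)) y * G y)); last first.
  by apply/funext => y; rewrite /F (bigD1 i)//= (bigD1 (s i))//=.
rewrite (derive_mul x v (sA i (s i)) sAG) !A1 eq_sym (negbTE si) eq_sym (negbTE sis).
by rewrite !mul0r mulr0 addr0 mulr0.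
Qed.

End determinant_calculus.

(** * Change of variables under left translations *)

Section left_translations.
Context {R : realType} {N : nat}.
Local Notation C := R[i].
Local Notation V := 'rV[R]_N.
Local Notation mu := (lebesgue_rV N).
Local Notation ball0 r := [set x : V | `|x| <= r].
Let oT : open [set: V] := openT.
Let oT2 : open [set: 'rV[R]_(N + N)] := openT.

Variable mul : V -> V -> V.
Hypothesis smul : smooth_map setT (fun z : 'rV[R]_(N + N) => mul (lsubmx z) (rsubmx z)).
Hypotheses (mulA : associative mul) (mul0l : left_id 0 mul).
Hypothesis mulNl : forall x, mul (- x) x = 0.
Hypothesis mul_exp : forall (s t : R) x, mul (s *: x) (t *: x) = (s + t) *: x.

(* The pair (y, b) stands for the product [mul b y]. *)
Let mm (i : 'I_N) (z : 'rV[R]_(N + N)) : R := mul (rsubmx z) (lsubmx z) ord0 i.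

Let smm i : smooth setT (mm i).
Proof.
have H := smooth_map_comp oT2 (smooth_map_row_mx (@smooth_map_rsubmx R N N) (@smooth_map_lsubmx R N N)) smul.
by have := H i; congr (smooth _ _); apply/funext => z; rewrite row_mxKl row_mxKr.
Qed.

Let mmE i y b : mm i (row_mx y b) = mul b y ord0 i.
Proof. by rewrite /mm row_mxKl row_mxKr. Qed.

Let dir (v : V) : 'rV[R]_(N + N) := row_mx v 0.

Let derive_dir (g : 'rV[R]_(N + N) -> R) y b v : 'D_v (fun y => g (row_mx y b)) y = 'D_(dir v) g (row_mx y b).
Proof.
rewrite (line_derive0 (fun y => g (row_mx y b)) y v) (line_derive0 g (row_mx y b)).
rewrite (_ : (fun s : R => g (row_mx (y + s *: v) b)) = (fun s : R => g (row_mx y b + s *: dir v)))//.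
by apply/funext => s; rewrite scale_row_mx scaler0 add_row_mx addr0.
Qed.

Let A (i j : 'I_N) : 'rV[R]_(N + N) -> R := 'D_(dir (delta_mx ord0 j)) (mm i).

Let sA i j : smooth setT (A i j).
Proof. exact: (smooth_derive _ (smm i)). Qed.

Let AE i j y b : A i j (row_mx y b) = 'D_(delta_mx ord0 j) (fun y => mul b y ord0 i) y.
Proof.
rewrite /A -derive_dir; congr ('D_ _ _ y); by apply/funext => x; rewrite mmE.
Qed.

Definition jacobian (b y : V) : R := \det (\matrix_(i < N, j < N) 'D_(delta_mx ord0 j) (fun y => mul b y ord0 i) y).

Let J (z : 'rV[R]_(N + N)) : R := \det (\matrix_(i < N, j < N) A i j z).

Let JE y b : J (row_mx y b) = jacobian b y.
Proof. by congr (\det _); apply/matrixP => i j; rewrite !mxE AE. Qed.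

Let sJ : smooth setT J.
Proof. exact: smooth_det sA. Qed.

Lemma smooth_jacobian : smooth setT (fun z : 'rV[R]_(N + N) => jacobian (lsubmx z) (rsubmx z)).
Proof.
have := smooth_comp (Om' := setT) oT2 oT2
  (smooth_map_row_mx (@smooth_map_rsubmx R N N) (@smooth_map_lsubmx R N N)) sJ (fun _ _ => Logic.I).
by congr (smooth _ _); apply/funext => z; rewrite JE.
Qed.

Let smull b : smooth_map setT (mul b).
Proof.
move=> i; have H := smooth_map_comp oT (smooth_map_row_mx (smooth_map_cst b oT) (smooth_map_id oT)) smul.
by have := H i; congr (smooth _ _); apply/funext => y; rewrite row_mxKl row_mxKr.
Qed.

(** Chain rule for [mul b \o mul b']: the Jacobian is a cocycle. *)
Lemma jacobianM b b' y : jacobian (mul b b') y = jacobian b (mul b' y) * jacobian b' y.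
Proof.
rewrite /jacobian -det_mulmx; congr (\det _); apply/matrixP => i j; rewrite !mxE.
rewrite (_ : (fun y => mul (mul b b') y ord0 i) = (fun y => mul b y ord0 i) \o mul b'); last first.
  by apply/funext => x /=; rewrite mulA.
rewrite derive_comp_rV.
- by apply: eq_bigr => k _; rewrite !mxE mulrC.
- by move=> k; exact: (smooth_differentiable oT (smull b' k) Logic.I).
- exact: (smooth_differentiable oT (smull b i) Logic.I).
Qed.

Let A0 i j y : A i j (row_mx y 0) = (i == j)%:R.
Proof.
rewrite AE (_ : (fun y => _) = fun y : V => y ord0 i); last by apply/funext => x; rewrite mul0l.
have D : differentiable (id : V -> V) y.
  by apply: differentiable_rV => k; exact: (smooth_differentiable oT (smooth_coord k oT) Logic.I).
by have := derive_rV (delta_mx ord0 j) i D; rewrite derive_id mxE eqxx => <-.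
Qed.

Lemma jacobian0 y : jacobian 0 y = 1.
Proof.
rewrite -JE /J (_ : \matrix_(i, j) _ = 1%:M) ?det1//.
by apply/matrixP => i j; rewrite !mxE A0.
Qed.

Lemma mul_bounded r : exists2 r', 0 <= r' & forall x y, `|x| <= r -> `|y| <= r -> `|mul x y| <= r'.
Proof.
have [|M M0 HM] := compact_bound (f := fun z : 'rV[R]_(N + N) => `|mul (lsubmx z) (rsubmx z)|) (@closed_ball_compact_rV R (N + N) r).
  move=> z _; apply: (@continuous_comp _ _ _ (fun z : 'rV[R]_(N + N) => mul (lsubmx z) (rsubmx z)) (fun x : V => `|x|)).
    exact: (smooth_map_continuous smul).
  exact: norm_continuous.
exists M => // x y xr yr; have := HM (row_mx x y) (rV_norm_row_mx xr yr).
by rewrite row_mxKl row_mxKr normr_id.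
Qed.

Let Rintegral_sum0 (D : set V) (I : Type) (s : seq I) (h : I -> V -> R) : compact D ->
  (forall i, continuous (h i)) -> (forall i x, ~ D x -> h i x = 0) -> (forall i, \int[mu]_x h i x = 0) ->
  \int[mu]_x (\sum_(i <- s) h i x) = 0.
Proof.
move=> cD ch h0 H.
have ints t : mu.-integrable setT (EFin \o (fun x => \sum_(i <- t) h i x)).
  apply: (integrable_csupp cD) => [|x xD]; last by rewrite big1// => i _; exact: h0.
  elim: t => [|i t IH].
    by rewrite (_ : (fun x => _) = cst 0); [exact: cst_continuous|apply/funext => x; rewrite big_nil].
  rewrite (_ : (fun x => _) = fun x => h i x + \sum_(i <- t) h i x); last by apply/funext => x; rewrite big_cons.
  by move=> x; exact: (cvgD (ch i x) (IH x)).
elim: s => [|i t IH].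
  by rewrite (@eq_Rintegral _ _ _ mu setT (fun=> 0)) => [|x _]; rewrite ?big_nil// (Rintegral_cst _ measurableT) mul0r.
rewrite (@eq_Rintegral _ _ _ mu setT (fun x => h i x + \sum_(i <- t) h i x)) => [|x _]; last by rewrite big_cons.
rewrite RintegralD// ?H ?IH ?addr0//; exact: (integrable_csupp cD (ch i) (h0 i)).
Qed.

Let eqR (f g : V -> R) : (forall y, f y = g y) -> \int[mu]_y f y = \int[mu]_y g y.
Proof. by move=> fg; apply: eq_Rintegral => y _; exact: fg. Qed.

Let sl0 (g : 'rV[R]_(N + N) -> R) b : smooth setT g -> smooth setT (fun y : V => g (row_mx y b)).
Proof.
by move=> sg; exact: (smooth_comp (Om' := setT) oT oT2 (smooth_map_row_mx (smooth_map_id oT) (smooth_map_cst b oT)) sg (fun _ _ => Logic.I)).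
Qed.

Let derive_inr0 (g : V -> R) X z : 'D_(row_mx 0 X) (fun z : 'rV[R]_(N + N) => g (lsubmx z)) z = 0.
Proof.
rewrite (line_derive0 (fun z : 'rV[R]_(N + N) => g (lsubmx z)) z).
rewrite (_ : (fun s : R => _) = cst (g (lsubmx z))); first exact: derive_cst.
by apply/funext => s /=; rewrite linearD linearZ /= row_mxKl scaler0 addr0.
Qed.

Let slsub (g : V -> R) : smooth setT g -> smooth setT (fun z : 'rV[R]_(N + N) => g (lsubmx z)).
Proof. by move=> sg; exact: (smooth_comp (Om' := setT) oT2 oT (@smooth_map_lsubmx R N N) sg (fun _ _ => Logic.I)). Qed.

(** The integration by parts in y, with the i-th coordinate of [mul b y] against phi, holds for all
    b. Differentiating it in b at 0, along [X], gives the i-th part of the statement that a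
    divergence integrates to 0, without exchanging derivatives in b and y. *)
Let divergence (D : set V) (phi : V -> R) (X : V) i : compact D -> smooth setT phi -> (forall x, ~ D x -> phi x = 0) ->
  \int[mu]_y (phi y * 'D_(row_mx 0 X) (A i i) (row_mx y 0) +
    'D_(row_mx 0 X) (mm i) (row_mx y 0) * 'D_(delta_mx ord0 i) phi y) = 0.
Proof.
move=> cD sphi phi0.
set d := delta_mx ord0 i : V; set e := row_mx 0 X : 'rV[R]_(N + N).
have sdphi : smooth setT ('D_d phi) := smooth_derive d sphi.
have dphi0 x : ~ D x -> 'D_d phi x = 0 by exact: derive_csupp cD phi0.
pose G1 (z : 'rV[R]_(N + N)) := phi (lsubmx z) * A i i z.
pose G2 (z : 'rV[R]_(N + N)) := mm i z * 'D_d phi (lsubmx z).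
have sG1 : smooth setT G1 := smoothM oT2 (slsub sphi) (sA i i).
have sG2 : smooth setT G2 := smoothM oT2 (smm i) (slsub sdphi).
have G10 x y : [set: V] y -> ~ D x -> G1 (row_mx x y) = 0 by move=> _ xD; rewrite /G1 row_mxKl phi0// mul0r.
have G20 x y : [set: V] y -> ~ D x -> G2 (row_mx x y) = 0 by move=> _ xD; rewrite /G2 row_mxKl dphi0// mulr0.
have [s1 D1] := smooth_under_integral oT cD sG1 G10.
have [s2 D2] := smooth_under_integral oT cD sG2 G20.
have dG1 y : 'D_e G1 (row_mx y 0) = phi y * 'D_e (A i i) (row_mx y 0).
  by rewrite (derive_mul _ _ (slsub sphi) (sA i i)) derive_inr0 mul0r addr0 row_mxKl.
have dG2 y : 'D_e G2 (row_mx y 0) = 'D_e (mm i) (row_mx y 0) * 'D_d phi y.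
  by rewrite (derive_mul _ _ (smm i) (slsub sdphi)) (derive_inr0 ('D_d phi)) mulr0 add0r row_mxKl.
have E b : \int[mu]_y G1 (row_mx y b) = -1 * \int[mu]_y G2 (row_mx y b).
  have Q0 := integration_by_parts_rV d cD (sl0 b (smm i)) sphi phi0.
  have Q1 y : G1 (row_mx y b) = 'D_d (fun y => mm i (row_mx y b)) y * phi y.
    by rewrite derive_dir /G1 row_mxKl mulrC.
  have Q2 y : mm i (row_mx y b) * 'D_d phi y = G2 (row_mx y b) by rewrite /G2 row_mxKl.
  rewrite mulN1r; exact: (etrans (eqR Q1) (etrans Q0 (congr1 -%R (eqR Q2)))).
pose g1 y := 'D_e G1 (row_mx y 0); pose g2 y := 'D_e G2 (row_mx y 0).
have H : \int[mu]_y g1 y = -1 * \int[mu]_y g2 y.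
  have H1 : 'D_X (fun b => \int[mu]_y G1 (row_mx y b)) 0 = \int[mu]_y g1 y := D1 [:: X] 0 Logic.I.
  have H2 : 'D_X (fun b => \int[mu]_y G2 (row_mx y b)) 0 = \int[mu]_y g2 y := D2 [:: X] 0 Logic.I.
  have H3 : 'D_X (fun b => -1 * \int[mu]_y G2 (row_mx y b)) 0 = -1 * 'D_X (fun b => \int[mu]_y G2 (row_mx y b)) 0.
    exact: (iter_deriveZ oT (-1) [:: X] s2 Logic.I).
  have H4 := congr1 (fun f : V -> R => 'D_X f 0) (funext E).
  exact: (etrans (esym H1) (etrans H4 (etrans H3 (congr1 ( *%R (-1)) H2)))).
have c1 : continuous g1 := smoothT_continuous (sl0 0 (smooth_derive e sG1)).
have c2 : continuous g2 := smoothT_continuous (sl0 0 (smooth_derive e sG2)).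
have z1 y : ~ D y -> g1 y = 0 by move=> yD; rewrite /g1 dG1 phi0// mul0r.
have z2 y : ~ D y -> g2 y = 0 by move=> yD; rewrite /g2 dG2 dphi0// mulr0.
have Q y : phi y * 'D_e (A i i) (row_mx y 0) + 'D_e (mm i) (row_mx y 0) * 'D_d phi y = g1 y + g2 y.
  by rewrite -dG1 -dG2.
apply: (etrans (eqR Q)).
apply: (etrans (RintegralD measurableT (integrable_csupp cD c1 z1) (integrable_csupp cD c2 z2))).
by apply: (etrans (congr1 (fun t => t + _) H)); rewrite mulN1r; exact: addNr.
Qed.

Let F (phi : V -> R) (z : 'rV[R]_(N + N)) : R := phi (mul (rsubmx z) (lsubmx z)) * J z.

Let FE phi y b : F phi (row_mx y b) = phi (mul b y) * jacobian b y.
Proof. by rewrite /F row_mxKl row_mxKr JE. Qed.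

Let smulr : smooth_map setT (fun z : 'rV[R]_(N + N) => mul (rsubmx z) (lsubmx z)).
Proof. by move=> i; exact: smm. Qed.

Let scomp (phi : V -> R) : smooth setT phi -> smooth setT (fun z : 'rV[R]_(N + N) => phi (mul (rsubmx z) (lsubmx z))).
Proof. by move=> sphi; exact: (smooth_comp (Om' := setT) oT2 oT smulr sphi (fun _ _ => Logic.I)). Qed.

Let sF phi : smooth setT phi -> smooth setT (F phi).
Proof. by move=> sphi; exact: (smoothM oT2 (scomp sphi) sJ). Qed.

Let F0 (D : set V) (phi : V -> R) r : compact D -> (forall x, ~ D x -> phi x = 0) ->
  exists r', forall y b, `|b| < r -> ~ ball0 r' y -> F phi (row_mx y b) = 0.
Proof.
move=> cD phi0; have [d d0 Dd] := compact_sub_ball cD.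
have [r' _ H] := mul_bounded (Num.max d r); exists r' => y b br yr.
rewrite FE phi0 ?mul0r// => Dby; apply: yr => /=.
rewrite -[y]mul0l -(mulNl b) -mulA; apply: H; rewrite le_max ?normrN ?(ltW br) ?orbT//.
by rewrite Dd.
Qed.

(** At b = 0 the Jacobian matrix is the identity. The derivative in b of phi(mul b y) jacobian(b, y)
    is therefore the divergence of phi times the field of infinitesimal translations along [X]. *)
Let derive_flow0 (D : set V) (phi : V -> R) (X : V) : compact D -> smooth setT phi -> (forall x, ~ D x -> phi x = 0) ->
  'D_X (fun b => \int[mu]_y F phi (row_mx y b)) 0 = 0.
Proof.
move=> cD sphi phi0; have [r' Fr] := F0 1 cD phi0.
have B0 : [set b : V | `|b| < 1] 0 by rewrite /= normr0.
have [_ DF] := smooth_under_integral (@open_norm_lt R N 1) (@closed_ball_compact_rV R N r') (sF sphi) (fun y b => Fr y b).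
rewrite [LHS](DF [:: X] 0 B0) /=; set e := row_mx 0 X.
pose h i y := phi y * 'D_e (A i i) (row_mx y 0) + 'D_e (mm i) (row_mx y 0) * 'D_(delta_mx ord0 i) phi y.
have Q y : 'D_e (F phi) (row_mx y 0) = \sum_i h i y.
  rewrite /F (derive_mul _ _ (scomp sphi) sJ) JE jacobian0 mulr1 row_mxKl row_mxKr mul0l.
  rewrite /J (derive_det1 e sA); last by move=> i j; exact: A0.
  rewrite mulr_sumr big_split /=; congr (_ + _).
  rewrite (_ : (fun z => _) = phi \o (fun z : 'rV[R]_(N + N) => mul (rsubmx z) (lsubmx z))); last exact: erefl.
  rewrite derive_comp_rV ?row_mxKl ?row_mxKr ?mul0l.
  - exact: erefl.
  - by move=> i; exact: (smooth_differentiable oT2 (smm i) Logic.I).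
  - exact: (smooth_differentiable oT sphi Logic.I).
have ch i : continuous (h i).
  apply: smoothT_continuous.
  exact: (smoothD oT (smoothM oT sphi (sl0 0 (smooth_derive e (sA i i))))
    (smoothM oT (sl0 0 (smooth_derive e (smm i))) (smooth_derive _ sphi))).
have h0 i x : ~ D x -> h i x = 0.
  by move=> xD; rewrite /h phi0// (derive_csupp _ cD phi0 xD) mul0r mulr0 addr0.
apply: (etrans (eqR Q)).
exact: (Rintegral_sum0 (index_enum 'I_N) cD ch h0 (fun i => divergence X i cD sphi phi0)).
Qed.

(** Along the one-parameter subgroup s b the left side has zero derivative. By the cocycle rule its
    derivative at s b is the derivative at the neutral element for another function, [phis], and
    that one is 0 by [derive_flow0]. *)
Lemma Rintegral_left_translate (D : set V) (phi : V -> R) (b : V) : compact D -> smooth setT phi ->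
  (forall x, ~ D x -> phi x = 0) ->
  \int[mu]_y (phi (mul b y) * jacobian b y) = \int[mu]_y phi y.
Proof.
move=> cD sphi phi0; pose M b := \int[mu]_y F phi (row_mx y b).
have [r' Fr] := F0 (`|b| + 1) cD phi0.
have [sM _] := smooth_under_integral (@open_norm_lt R N (`|b| + 1)) (@closed_ball_compact_rV R N r') (sF sphi) (fun y b => Fr y b).
have Bs (s : R) : `|s| <= 1 -> [set c : V | `|c| < `|b| + 1] (s *: b).
  by move=> s1; rewrite /= normrZ ltr_pwDr// ler_piMl.
have [s|s] := @MVT_line _ _ M 0 b 1.
  by rewrite normr1 add0r => /Bs Os; exact: (smooth_derivable sM Os).
rewrite normr1 => s1; rewrite scale1r !add0r mul1r => E.
have : 'D_b M (s *: b) = 0.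
  (* The transported density: for it, moving from s b to (s + h) b amounts to moving from 0 to h
     b. *)
  pose phis y := phi (mul (s *: b) y) * jacobian (s *: b) y.
  have sphis : smooth setT phis.
    have H := smooth_comp (Om' := setT) oT oT2 (smooth_map_row_mx (smooth_map_id oT) (smooth_map_cst (s *: b) oT)) (sF sphi) (fun _ _ => Logic.I).
    by move: H; congr (smooth _ _); apply/funext => y; rewrite FE.
  have phis0 y : ~ ball0 r' y -> phis y = 0 by move=> yr; rewrite /phis -FE; apply: (Fr _ _ (Bs _ s1) yr).
  pose Ms b := \int[mu]_y F phis (row_mx y b).
  have e0 : 'D_b Ms 0 = 0 := derive_flow0 b (@closed_ball_compact_rV R N r') sphis phis0.
  have e1 := line_derive0 M (s *: b) b; have e2 := line_derive0 Ms 0 b.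
  have e3 (h : R) : M (s *: b + h *: b) = Ms (0 + h *: b).
    apply: eqR => y; rewrite add0r !FE /phis -mulrA -jacobianM.
    by rewrite mulA mul_exp scalerDl.
  exact: (etrans e1 (etrans (congr1 (fun f : R -> R => 'D_1 f 0) (funext e3)) (etrans (esym e2) e0))).
rewrite -E => /eqP; rewrite subr_eq0 => /eqP; rewrite /M.
move=> MM; apply: (etrans (eqR (fun y => esym (FE phi y b)))).
by apply: (etrans MM); apply: eqR => y; rewrite FE jacobian0 mulr1 mul0l.
Qed.

End left_translations.

(** * The parametrix kernel *)

Section kernel.
Context {R : realType} {N : nat}.
Local Notation C := R[i].
Local Notation V := 'rV[R]_N.
Local Notation V2 := 'rV[R]_(N + N).
Local Notation normc := (@Normc.normc R).
Local Notation mu := (lebesgue_rV N).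
Local Notation ball0 r := [set x : V | `|x| <= r].
Local Notation cB r := (@closed_ball_compact_rV R N r).
Let oT : open [set: V] := openT.
Let oT2 : open [set: V2] := openT.

Lemma smooth_op_mulr P (f : V -> C) : smooth_op P -> csmooth setT f -> smooth_op (fun psi x => P (fun y => f y * psi y) x).
Proof.
move=> [Q nQ PQ] sf.
suff H : smooth_op (fun psi x => Q (fun y => f y * psi y) x).
  by apply: smooth_op_ext H => psi s x; rewrite (PQ _ (csmoothM oT sf s)).
elim: nQ {PQ} => [|Q0 b I sb _ IH]; first by exists (fun _ _ => 0); [exact: normal_op0|].
exact: (smooth_opD (smooth_opM sb (smooth_op_cpartialM I sf)) IH).
Qed.

Lemma csmooth_slice k (G : 'rV[R]_(k + N) -> C) x : csmooth setT G -> csmooth setT (fun y => G (row_mx x y)).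
Proof.
move=> sG; exact: (csmooth_comp oT openT (smooth_map_row_mx (smooth_map_cst x oT) (smooth_map_id oT)) sG (fun _ _ => Logic.I)).
Qed.

Lemma cdbound_slice k m (G : 'rV[R]_(k + N) -> C) x y M : cdbound m G (row_mx x y) M ->
  cdbound m (fun y => G (row_mx x y)) y M.
Proof.
have key (g : 'rV[R]_(k + N) -> R) : dbound m g (row_mx x y) M -> dbound m (fun y => g (row_mx x y)) y M.
  move=> b vs vm va; rewrite iter_derive_row_mx; apply: b; first by rewrite size_map.
  rewrite all_map; apply: sub_all va => v v1 /=; apply: rV_norm_row_mx => //; by rewrite normr0.
by move=> [b1 b2]; split; [exact: (key _ b1)|exact: (key _ b2)].
Qed.

Variable mul : V -> V -> V.
Hypothesis smul : smooth_map setT (fun z : V2 => mul (lsubmx z) (rsubmx z)).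
Hypotheses (mulA : associative mul) (mul0l : left_id 0 mul) (mulx0 : right_id 0 mul).
Hypothesis mulNl : forall x, mul (- x) x = 0.
Hypothesis mul_exp : forall (s t : R) x, mul (s *: x) (t *: x) = (s + t) *: x.

Lemma mul_oppr x : mul x (- x) = 0.
Proof. by have := mulNl (- x); rewrite opprK. Qed.

Lemma mul_oppK x y : mul (- x) (mul x y) = y.
Proof. by rewrite mulA mulNl mul0l. Qed.

Lemma mul_Kopp x y : mul x (mul (- x) y) = y.
Proof. by rewrite mulA mul_oppr mul0l. Qed.

Lemma mul_opp x y : - mul x y = mul (- y) (- x).
Proof.
by rewrite -[RHS]mulx0 -(mul_oppr (mul x y)) mulA -(mulA (- y)) mul_oppK mulNl mul0l.
Qed.

Lemma smooth_mull x : smooth_map setT (mul x).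
Proof.
move=> i; have H := smooth_map_comp oT (smooth_map_row_mx (smooth_map_cst x oT) (smooth_map_id oT)) smul.
by have := H i; congr (smooth _ _); apply/funext => y; rewrite row_mxKl row_mxKr.
Qed.

Lemma csmooth_mull f x : csmooth setT f -> csmooth setT (fun y => f (mul x y)).
Proof. by move=> sf; exact: (csmooth_comp oT oT (smooth_mull x) sf (fun _ _ => Logic.I)). Qed.

Lemma csupp_mull r f : csupp (ball0 r) f -> forall b, exists r', forall x, `|x| <= b -> csupp (ball0 r') (fun y => f (mul x y)).
Proof.
move=> [sf Sf] b; have [r' _ H] := mul_bounded smul (Num.max b r).
exists r' => x xb; split; first exact: csmooth_mull.
move=> y /= yr; apply: Sf => /= xyr; apply: yr; rewrite -(mul_oppK x y).
by apply: H; rewrite le_max ?normrN ?xb// xyr orbT.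
Qed.

Local Notation JC b y := (((jacobian mul b y)%:C)%C : C).

Lemma cintegral_left_translate r f b : csupp (ball0 r) f ->
  cintegral setT (fun y => f (mul b y) * JC b y) = cintegral setT f.
Proof.
move=> [[f1 f2] Sf].
have H1 := Rintegral_left_translate smul mulA mul0l mulNl mul_exp b (cB r) f1 (supported_re Sf).
have H2 := Rintegral_left_translate smul mulA mul0l mulNl mul_exp b (cB r) f2 (supported_im Sf).
rewrite /cintegral -H1 -H2; congr (_ +i* _)%C; apply: eq_Rintegral => y _.
  by rewrite /re_part ReM /= mulr0 subr0.
by rewrite /im_part ImM /= mulr0 add0r mulrC.
Qed.

(* After the change of variables [x = y . z], the map [zeta -> (y -> \int kappa z * zeta (y . z) dz)] has this kernel
   at [(x, y)]; pairs are row vectors of length [N + N]. *)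
Definition kernel_of (kappa : V -> C) (z : V2) : C :=
  kappa (mul (- rsubmx z) (lsubmx z)) * JC (- rsubmx z) (lsubmx z).

Lemma kernel_ofE kappa x y : kernel_of kappa (row_mx x y) = kappa (mul (- y) x) * JC (- y) x.
Proof. by rewrite /kernel_of row_mxKl row_mxKr. Qed.

Let swapN : smooth_map setT (fun z : V2 => row_mx (- rsubmx z) (lsubmx z)).
Proof. exact: (smooth_map_row_mx (smooth_map_N oT2 (@smooth_map_rsubmx R N N)) (@smooth_map_lsubmx R N N)). Qed.

Lemma csmooth_kernel_of kappa : csmooth setT kappa -> csmooth setT (kernel_of kappa).
Proof.
move=> sk; apply: (csmoothM oT2).
  have H := smooth_map_comp oT2 swapN smul.
  have := csmooth_comp oT2 oT H sk (fun _ _ => Logic.I).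
  by congr (csmooth _ _); apply/funext => z; rewrite row_mxKl row_mxKr.
apply: (csmooth_real oT2).
have := smooth_comp (Om' := setT) oT2 oT2 swapN (smooth_jacobian smul) (fun _ _ => Logic.I).
by congr (smooth _ _); apply/funext => z; rewrite row_mxKl row_mxKr.
Qed.

Lemma cintegral_kernel_of r kappa zeta y : csmooth setT kappa -> csupp (ball0 r) zeta ->
  cintegral setT (fun x => kernel_of kappa (row_mx x y) * zeta x) = cintegral setT (fun z => kappa z * zeta (mul y z)).
Proof.
move=> sk sz; have [r' Hr] := csupp_mull sz `|y|.
have sf := csuppM sk (Hr _ (lexx _)).
rewrite -(cintegral_left_translate (- y) sf); apply: cintegral_ext => x.
by rewrite kernel_ofE mul_Kopp mulrAC.
Qed.

Variables (P : (V -> C) -> V -> C) (Dl Dl' : {linear V -> V}) (a q : R).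
Hypothesis sP : smooth_op P.
Hypothesis PT : forall b f, csmooth setT f -> forall x, P (fun y => f (mul b y)) x = P f (mul b x).
Hypotheses (DK : cancel Dl Dl') (D'K : cancel Dl' Dl).
Hypothesis contr : forall x, `|Dl' x| <= 2^-1 * `|x|.
Hypotheses (a1 : 1 < a) (aq : a < q).
Hypothesis jac : lebesgue_rV N (Dl @^-1` unit_cube N) = (q^-1)%:E.
Hypothesis PD : forall f, csmooth setT f -> forall x, P (fun y => f (Dl y)) x = (a%:C)%C * P f (Dl x).
Variables (gamma gammaoo : V -> C) (rho rho' : R).
Hypotheses (rho'0 : 0 < rho') (sgamma : csupp (ball0 rho) gamma) (gamma0 : forall x, `|x| < rho' -> gamma x = 0).
Hypothesis sgoo : csmooth setT gammaoo.
Hypothesis expansion : forall psi, test_fun setT psi -> exists A, forall J : nat,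
    normc (psi 0 - (cintegral setT (fun z => gammaoo z * P psi z) +
      \sum_(j < J) ((a ^- j)%:C)%C * cintegral setT (fun z => gamma z * P psi (iter j Dl' z)))) <= A * a ^- J.

Let a0 : 0 < a. Proof. exact: lt_trans a1. Qed.
Let q0 : 0 < q. Proof. exact: lt_trans aq. Qed.
Let ia01 : 0 < a^-1 < 1. Proof. by rewrite invr_gt0 a0 invf_lt1. Qed.

(* The j-th piece of the expansion of the fundamental solution, written as a function on the group. *)
Definition kappa_ (j : nat) (z : V) : C := (((q / a) ^+ j)%:C)%C * gamma (iter j Dl z).

Lemma csmooth_kappa j : csmooth setT (kappa_ j).
Proof. exact: (csmoothZ oT _ (csmooth_iter Dl j sgamma.1)). Qed.

(** The change of variables D^j contributes q^-j, which leaves a^-j out of the factor (q/a)^j of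
    [kappa_]. *)
Lemma cintegral_kappa zeta j y : csmooth setT zeta ->
  cintegral setT (fun z => kappa_ j z * zeta (mul y z)) =
  ((a ^- j)%:C)%C * cintegral setT (fun z => gamma z * zeta (mul y (iter j Dl' z))).
Proof.
move=> sz; pose f z := gamma z * zeta (mul y (iter j Dl' z)).
have sf : csupp (ball0 rho) f.
  split; last exact: supportedMl sgamma.2.
  exact: (csmoothM oT sgamma.1 (csmooth_iter Dl' j (csmooth_mull y sz))).
have sfj := csupp_iter_dilate DK contr j sf.
rewrite (@cintegral_ext _ _ _ (fun z => (((q / a) ^+ j)%:C)%C * f (iter j Dl z))); last first.
  by move=> z; rewrite /kappa_ /f (iterDK DK) mulrA.
rewrite (cintegralZ (cB (2^-1 ^+ j * rho)) _ (csmooth_continuous sfj.1) sfj.2).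
rewrite (cintegral_iter_dilate DK D'K contr jac j sf) mulrA -rmorphM /=; congr (_%:C%C * _).
by rewrite expr_div_n; field; rewrite !expf_neq0 ?gt_eqF.
Qed.

Section parametrix.
Variables (eta : V -> C) (d : R).
Hypothesis seta : csupp (ball0 d) eta.
Let zeta := P eta.
Let szeta : csupp (ball0 d) zeta. Proof. exact: csupp_op sP (cB d) seta. Qed.

Let kJ J (z : V2) : C := kernel_of gammaoo z + \sum_(j < J) kernel_of (kappa_ j) z.

Let skJ J : csmooth setT (kJ J).
Proof.
apply: (csmoothD oT2 (csmooth_kernel_of sgoo)); apply: csmooth_sum => [|j]; first exact: oT2.
exact: (csmooth_kernel_of (csmooth_kappa j)).
Qed.

(** The expansion of eta truncated at rank J, written at all points y at once. *)
Let G J y := cintegral setT (fun x => kJ J (row_mx x y) * zeta x).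

Let szl : csmooth setT (fun z : V2 => zeta (lsubmx z)).
Proof. exact: (csmooth_comp oT2 oT (@smooth_map_lsubmx R N N) szeta.1 (fun _ _ => Logic.I)). Qed.

Let sG J : csmooth setT (G J) /\ forall Q : (V -> C) -> V -> C, smooth_op Q -> forall y, Q (G J) y =
  cintegral setT (fun x => zeta x * Q (fun y => kJ J (row_mx x y)) y).
Proof.
pose F z := kJ J z * zeta (lsubmx z).
have sF : csmooth setT F := csmoothM oT2 (skJ J) szl.
have F0 x y : ~ ball0 d x -> F (row_mx x y) = 0.
  by move=> xd; rewrite /F row_mxKl szeta.2// mulr0.
have FE : G J = fun y => cintegral setT (fun x => F (row_mx x y)).
  by apply/funext => y; apply: cintegral_ext => x; rewrite /F row_mxKl.
split; first by rewrite FE; exact: (smooth_op_integral sP (cB d) sF F0).1.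
move=> Q sQ y; rewrite FE (smooth_op_integral sQ (cB d) sF F0).2; apply: cintegral_ext => x.
rewrite -(smooth_opZ sQ _ (csmooth_slice x (skJ J))); congr (Q _ y); apply/funext => y'.
by rewrite /F row_mxKl mulrC.
Qed.

Let slc (f : V2 -> C) y : csmooth setT f -> csmooth setT (fun x => f (row_mx x y)).
Proof.
move=> sf; exact: (csmooth_comp oT oT2 (smooth_map_row_mx (smooth_map_id oT) (smooth_map_cst y oT)) sf (fun _ _ => Logic.I)).
Qed.

Let GS J y : G J.+1 y = G J y + ((a ^- J)%:C)%C * cintegral setT (fun z => gamma z * zeta (mul y (iter J Dl' z))).
Proof.
have E : G J.+1 y = cintegral setT (fun x => kJ J (row_mx x y) * zeta x + kernel_of (kappa_ J) (row_mx x y) * zeta x).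
  by apply: cintegral_ext => x; rewrite /kJ big_ord_recr /= addrA mulrDl.
have c1 := csuppM (slc y (skJ J)) szeta; have c2 := csuppM (slc y (csmooth_kernel_of (csmooth_kappa J))) szeta.
rewrite E (cintegralD (cB d) (csmooth_continuous c1.1) (csmooth_continuous c2.1) c1.2 c2.2); congr (_ + _).
by rewrite (cintegral_kernel_of y (csmooth_kappa J) szeta) (cintegral_kappa _ _ szeta.1).
Qed.

Let GE J y : G J y = cintegral setT (fun z => gammaoo z * zeta (mul y z)) +
  \sum_(j < J) ((a ^- j)%:C)%C * cintegral setT (fun z => gamma z * zeta (mul y (iter j Dl' z))).
Proof.
elim: J => [|J IH]; last by rewrite GS IH big_ord_recr /= addrA.
rewrite big_ord0 addr0 -(cintegral_kernel_of y sgoo szeta); apply: cintegral_ext => x.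
by rewrite /kJ big_ord0 addr0.
Qed.

(** The expansion at 0 is applied to the translate x |-> eta(y x), with which P commutes. *)
Let G_cvg y : exists A, forall J, normc (eta y - G J y) <= A * a ^- J.
Proof.
have [r' Hr] := csupp_mull seta `|y|; have st := Hr _ (lexx _).
have [A HA] := expansion (csupp_test (cB r') st); exists A => J.
have E1 : cintegral setT (fun z => gammaoo z * P (fun x => eta (mul y x)) z) =
    cintegral setT (fun z => gammaoo z * zeta (mul y z)).
  by apply: cintegral_ext => z; rewrite (PT y seta.1).
have E2 (j : 'I_J) : ((a ^- j)%:C)%C * cintegral setT (fun z => gamma z * P (fun x => eta (mul y x)) (iter j Dl' z)) =
    ((a ^- j)%:C)%C * cintegral setT (fun z => gamma z * zeta (mul y (iter j Dl' z))).
  by congr (_ * _); apply: cintegral_ext => z; rewrite (PT y seta.1).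
by move: (HA J); rewrite mulx0 E1 (eq_bigr _ (fun j _ => E2 j)) -GE; exact: id.
Qed.

(** The increment is a^-J times the integral of gamma(z) zeta(y D^-J z) in z. Its derivatives in y
    are bounded independently of J, since D^-J z stays in the ball containing z. *)
Let G_step m r : exists A, forall J, (m <= J)%N -> forall y, `|y| <= r ->
  cdbound m (fun y => G J.+1 y - G J y) y (A * a^-1 ^+ J).
Proof.
pose Z (z : V2) := zeta (mul (rsubmx z) (lsubmx z)).
have sZ : csmooth setT Z.
  have H := smooth_map_comp oT2 (smooth_map_row_mx (@smooth_map_rsubmx R N N) (@smooth_map_lsubmx R N N)) smul.
  have := csmooth_comp oT2 oT H szeta.1 (fun _ _ => Logic.I).
  by congr (csmooth _ _); apply/funext => z; rewrite row_mxKl row_mxKr.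
have [MZ MZ0 HZ] := compact_cdbound m oT2 (@closed_ball_compact_rV R (N + N) (Num.max r rho)) (@subsetT _ _) sZ.
have [Mg Mg0 Hg] := csupp_cdbound 0 (cB rho) sgamma.
pose B := 2 * ((2 * Mg) * (2 * MZ)) * fine (mu (ball0 rho)).
exists B => J _ y yr.
pose Wf (z : V2) := gamma (lsubmx z) * Z (row_mx (iter J Dl' (lsubmx z)) (rsubmx z)).
have slin : smooth_map setT (fun z : V2 => iter J Dl' (lsubmx z)).
  elim: (J) => [|j IH]; first exact: (@smooth_map_lsubmx R N N).
  exact: (smooth_map_comp oT2 IH (smooth_map_linear Dl' oT)).
have sWf : csmooth setT Wf.
  apply: (csmoothM oT2); first exact: (csmooth_comp oT2 oT (@smooth_map_lsubmx R N N) sgamma.1 (fun _ _ => Logic.I)).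
  exact: (csmooth_comp oT2 oT2 (smooth_map_row_mx slin (@smooth_map_rsubmx R N N)) sZ (fun _ _ => Logic.I)).
have Wf0 x t : ~ ball0 rho x -> Wf (row_mx x t) = 0 by move=> xr; rewrite /Wf row_mxKl sgamma.2// mul0r.
have [sW HW] := csmooth_under_integral oT (cB rho) sWf (fun x t _ => Wf0 x t).
pose W y := cintegral setT (fun z => Wf (row_mx z y)).
have EW : (fun y => G J.+1 y - G J y) = fun y => ((a^-1 ^+ J)%:C)%C * W y.
  apply/funext => t; rewrite GS addrC addKr exprVn; congr (_ * _); apply: cintegral_ext => z.
  by rewrite /Wf row_mxKl row_mxKr /Z row_mxKl row_mxKr.
have Wb (vs : seq V) : (size vs <= m)%N -> all (fun v => `|v| <= 1) vs -> normc (cderiv vs W y) <= B.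
  move=> vm va; rewrite (HW vs y Logic.I).
  have vm' : (size (map (row_mx (0 : V)) vs) <= m)%N by rewrite size_map.
  have va' : all (fun v : V2 => `|v| <= 1) (map (row_mx (0 : V)) vs).
    rewrite all_map; apply: sub_all va => v v1 /=; apply: rV_norm_row_mx => //; by rewrite normr0.
  have EF z : cderiv (map (row_mx (0 : V)) vs) Wf (row_mx z y) =
      gamma z * cderiv (map (row_mx (0 : V)) vs) Z (row_mx (iter J Dl' z) y).
    have slice (f : V2 -> C) x : cderiv (map (row_mx (0 : V)) vs) f (row_mx x y) = cderiv vs (fun y => f (row_mx x y)) y.
      by rewrite /cderiv; congr (_ +i* _)%C; rewrite -iter_derive_row_mx.
    rewrite !slice -(cderivZ vs (gamma z) oT (csmooth_slice (iter J Dl' z) sZ) Logic.I).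
    by congr (cderiv vs _ y); apply/funext => t; rewrite /Wf row_mxKl row_mxKr.
  rewrite (cintegral_ext EF).
  have sJ : csmooth setT (fun z => cderiv (map (row_mx (0 : V)) vs) Z (row_mx (iter J Dl' z) y)).
    exact: (csmooth_iter Dl' J (slc y (cderiv_smooth (map (row_mx (0 : V)) vs) sZ))).
  apply: (cintegral_norm_le (cB rho) (ccontinuousM (csmooth_continuous sgamma.1) (csmooth_continuous sJ)) (supportedMl _ sgamma.2)).
  move=> z; have [zr|/sgamma.2 ->] := pselect (`|z| <= rho); last by rewrite mul0r normc_c0 !mulr_ge0.
  rewrite Normc.normcM; apply: ler_pM; rewrite ?normc_ge0//; first exact: cdboundW (Hg z).
  apply: (cdbound_cderiv _ vm' va'); apply: HZ => /=.
  apply: rV_norm_row_mx; last by rewrite le_max yr.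
  by rewrite le_max (le_trans (norm_iter_le contr J z) zr) orbT.
have dW : cdbound m W y B.
  split=> vs vm va.
    exact: le_trans (Re_le_normc (cderiv vs W y)) (Wb vs vm va).
  exact: le_trans (Im_le_normc (cderiv vs W y)) (Wb vs vm va).
rewrite EW; apply: (cdbound_le (leqnn _) _ (cdboundZ (a^-1 ^+ J) sW dW)).
by rewrite ger0_norm ?exprn_ge0 ?invr_ge0 ?(ltW a0)// mulrC.
Qed.

(** The truncations converge with all their derivatives by [G_step], and [G_cvg] identifies the
    limit with eta; hence Q can be applied to the expansion. The rate is uniform for y in a ball. *)
Lemma parametrix_expansion Q r : smooth_op Q -> exists A, forall J y, `|y| <= r ->
  normc (Q eta y - cintegral setT (fun x => zeta x *
    Q (fun y => kernel_of gammaoo (row_mx x y) + \sum_(j < J) kernel_of (kappa_ j) (row_mx x y)) y)) <= A * a ^- J.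
Proof.
move=> sQ; have [g sg Hg] := csmooth_geometric_limit ia01 (fun J => (sG J).1) G_step.
have geta : g = eta.
  apply/funext => y; apply/eqP; rewrite -subr_eq0; apply/eqP.
  have [A HA] := G_cvg y; have [B HB] := Hg 0%N `|y|.
  apply: (@geometric_eq0 _ _ (A + 2 * B) a^-1 0 ia01) => J _.
  have -> : g y - eta y = - (eta y - G J y) + - (G J y - g y) by ring.
  apply: le_trans (ler_normcD _ _) _; rewrite !normcN mulrDl exprVn; apply: lerD; first exact: HA.
  by rewrite -mulrA -exprVn; exact: cdboundW (HB J (leq0n J) y (lexx _)).
have [m HQ] := smooth_op_bound sQ; have [c c0 {}HQ] := HQ _ (cB r).
have [B HB] := Hg m r; rewrite geta in HB sg.
pose S J y := Q eta y - Q (G J) y.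
have SE J y : cintegral setT (fun x => zeta x *
    Q (fun y => kernel_of gammaoo (row_mx x y) + \sum_(j < J) kernel_of (kappa_ j) (row_mx x y)) y) = Q (G J) y.
  by rewrite (sG J).2.
have big J y : (m <= J)%N -> `|y| <= r -> normc (S J y) <= c * B * a ^- J.
  move=> mJ yr; rewrite /S -(smooth_opB sQ sg (sG J).1) -mulrA -exprVn.
  apply: (HQ _ y _ (csmoothB oT sg (sG J).1) yr).
  have := HB J mJ y yr; rewrite (_ : (fun y => G J y - eta y) = fun y => ((-1)%:C)%C * (eta y - G J y)); last first.
    by apply/funext => t; rewrite rmorphN1 mulN1r opprB.
  have -> : (fun y => eta y - G J y) = fun y => ((-1)%:C)%C * (((-1)%:C)%C * (eta y - G J y)).
    by apply/funext => t; rewrite mulrA -rmorphM /= mulrNN mulr1 mul1r.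
  have sB := csmoothB oT sg (sG J).1.
  move=> /(cdboundZ (-1) (csmoothZ oT ((-1)%:C)%C sB)).
  by rewrite normrN1 mul1r.
have /choice[M HM] : forall J, exists M, 0 <= M /\ forall y, `|y| <= r -> normc (S J y) <= M.
  move=> J; have sS : csmooth setT (S J).
    exact: (csmoothB oT (smooth_op_csmooth sQ sg) (smooth_op_csmooth sQ (sG J).1)).
  have [M M0 H] := compact_cdbound 0 oT (cB r) (@subsetT _ _) sS.
  by exists (2 * M); split=> [|y yr]; [rewrite mulr_ge0|exact: cdboundW (H y yr)].
(* The geometric estimate only holds from rank m, the order of Q, on. The sum absorbs the finitely
   many smaller J, bounded by compactness. *)
exists (`|c * B| + \sum_(j < m) M j * a ^+ j) => J y yr; rewrite SE -/(S J y).
have ap k : 0 < a ^+ k by rewrite exprn_gt0.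
have s0 : 0 <= \sum_(j < m) M j * a ^+ j.
  by apply: sumr_ge0 => j _; rewrite mulr_ge0 ?(ltW (ap _))//; case: (HM j).
have [mJ|Jm] := leqP m J.
  apply: le_trans (big J y mJ yr) _; rewrite ler_wpM2r ?invr_ge0 ?(ltW (ap J))//.
  by apply: le_trans (ler_norm _) _; rewrite lerDl.
rewrite ler_pdivlMr//; apply: (@le_trans _ _ (M J * a ^+ J)).
  by rewrite ler_wpM2r ?(ltW (ap J))//; apply: (HM J).2.
apply: (@le_trans _ _ (\sum_(j < m) M j * a ^+ j)); last by rewrite lerDr.
rewrite (bigD1 (Ordinal Jm))//= lerDl; apply: sumr_ge0 => j _.
by rewrite mulr_ge0 ?(ltW (ap _))//; case: (HM j).
Qed.

End parametrix.

End kernel.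

(** * Size and support of the pieces of the commutator kernel *)

Section kernel_bounds.
Context {R : realType} {N : nat}.
Local Notation C := R[i].
Local Notation V := 'rV[R]_N.
Local Notation V2 := 'rV[R]_(N + N).
Local Notation normc := (@Normc.normc R).
Local Notation mu := (lebesgue_rV N).
Local Notation ball0 r := [set x : V | `|x| <= r].
Local Notation cB r := (@closed_ball_compact_rV R N r).
Let oT : open [set: V] := openT.
Let oT2 : open [set: V2] := openT.

Variable mul : V -> V -> V.
Hypothesis smul : smooth_map setT (fun z : V2 => mul (lsubmx z) (rsubmx z)).
Hypotheses (mulA : associative mul) (mul0l : left_id 0 mul) (mulx0 : right_id 0 mul).
Hypothesis mulNl : forall x, mul (- x) x = 0.
Hypothesis mul_exp : forall (s t : R) x, mul (s *: x) (t *: x) = (s + t) *: x.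
Variables (P : (V -> C) -> V -> C) (Dl Dl' : {linear V -> V}) (a q : R).
Hypothesis sP : smooth_op P.
Hypothesis PT : forall b f, csmooth setT f -> forall x, P (fun y => f (mul b y)) x = P f (mul b x).
Hypotheses (DK : cancel Dl Dl') (D'K : cancel Dl' Dl).
Hypothesis contr : forall x, `|Dl' x| <= 2^-1 * `|x|.
Hypotheses (a1 : 1 < a) (aq : a < q).
Hypothesis jac : lebesgue_rV N (Dl @^-1` unit_cube N) = (q^-1)%:E.
Hypothesis PD : forall f, csmooth setT f -> forall x, P (fun y => f (Dl y)) x = (a%:C)%C * P f (Dl x).
Variables (gamma : V -> C) (rho rho' : R).
Hypotheses (rho'0 : 0 < rho') (sgamma : csupp (ball0 rho) gamma) (gamma0 : forall x, `|x| < rho' -> gamma x = 0).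

Let a0 : 0 < a. Proof. exact: lt_trans a1. Qed.
Let q0 : 0 < q. Proof. exact: lt_trans aq. Qed.

Definition commutator (phi : V -> C) (psi : V -> C) (x : V) : C :=
  P (fun y => phi y * psi y) x - phi x * P psi x.

Lemma smooth_op_commutator phi : csmooth setT phi -> smooth_op (commutator phi).
Proof.
move=> sphi; apply: smooth_op_ext (smooth_opD (smooth_op_mulr sP sphi) (smooth_opM (csmoothN oT sphi) sP)) => psi s x.
by rewrite mulNr.
Qed.

Let pow j (x : V) : V := iter j Dl' x.
Let pow_linear j : linear (pow j).
Proof.
elim: j => [|j IH] c x y; first by [].
by rewrite /pow !iterS (IH c x y : iter j Dl' _ = _) linearP.
Qed.
HB.instance Definition _ j := GRing.isLinear.Build R V V *:%R (pow j) (pow_linear j).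

Let iterDN j x : iter j Dl (- x) = - iter j Dl x.
Proof. by elim: j => // j IH; rewrite !iterS IH linearN. Qed.

(** At order 0 the increment vanishes at [w] itself; at higher orders the constant disappears and
    [dbound_contract] gives the factor 2^-j. *)
Lemma dbound_increment m (f : V -> R) j w M : smooth setT f -> dbound m f (pow j w) M ->
  dbound m (fun y => f (pow j y) - f (pow j w)) w (2^-1 ^+ j * M).
Proof.
move=> sf fM vs vm va; have M0 : 0 <= M := le_trans (normr_ge0 _) (dboundW fM).
have r0 : 0 <= 2^-1 ^+ j :> R by rewrite exprn_ge0.
case: vs vm va => [|v vs] vm va; first by rewrite /= subrr normr0 mulr_ge0.
have spow : smooth setT (fun y => f (pow j y)).
  exact: (smooth_comp (Om' := setT) oT oT (smooth_map_linear (pow j) oT) sf (fun _ _ => Logic.I)).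
rewrite (iter_deriveB oT (v :: vs) spow (smooth_cst (f (pow j w) : R^o) oT) Logic.I).
have -> : iter_derive (v :: vs) (fun _ : V => f (pow j w)) w = 0 :> R.
  have [c /= ->] : exists c : R, iter_derive vs (fun _ : V => f (pow j w)) = cst c; last exact: derive_cst.
  elim: (vs) => [|u us [c /= ->]]; first by exists (f (pow j w)).
  by exists 0; apply/funext => y; exact: derive_cst.
have r1 : 0 < (2^-1 ^+ j : R) <= 1 by rewrite exprn_gt0//= exprn_ile1// invf_le1// ler1n.
rewrite subr0.
exact: (@dbound_contract R N N f (pow j) (2^-1 ^+ j) m w M (v :: vs) sf r1 (norm_iter_contract contr j) fM vm va).
Qed.

(** In the coordinate w = D^j(x^-1 y), translation invariance and homogeneity of P produce the
    factor a^j, which with the (q/a)^j of [kappa_] makes q^j. What remains differs between scales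
    only through D^-j w, which stays bounded. *)
Lemma kernel_rescale phi j x y : csmooth setT phi ->
  commutator phi (fun y => kernel_of mul (kappa_ Dl a q gamma j) (row_mx x y)) y =
  ((q ^+ j)%:C)%C * P (fun w => (phi (mul x (pow j w)) - phi y) *
      (gamma (- w) * ((jacobian mul (- mul x (pow j w)) x)%:C)%C)) (iter j Dl (mul (- x) y)).
Proof.
move=> sphi; set K := fun y => _; set w := iter j Dl (mul (- x) y).
have sK : csmooth setT K := csmooth_slice x (csmooth_kernel_of smul (csmooth_kappa Dl a q sgamma j)).
have yE : y = mul x (pow j w) by rewrite /pow /w (iterDK DK) (mul_Kopp mulA mul0l mulNl).
(* The function (phi - phi y) K with [y] frozen: at the point [y], P of it is the commutator applied
   to K. *)
pose f y' := (- phi y) * K y' + phi y' * K y'.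
have sf : csmooth setT f := csmoothD oT (csmoothZ oT _ sK) (csmoothM oT sphi sK).
have -> : commutator phi K y = P f y.
  by rewrite (smooth_op_linear sP (- phi y) sK (csmoothM oT sphi sK)) /commutator mulNr addrC.
rewrite [in P f y]yE -(PT x sf).
pose g v := f (mul x v); have sg : csmooth setT g := csmooth_mull smul x sf.
have sgp : csmooth setT (fun v => g (pow j v)) := csmooth_iter Dl' j sg.
have -> : P (fun v => f (mul x v)) (pow j w) = ((a ^+ j)%:C)%C * P (fun v => g (pow j v)) w.
  transitivity (P (fun v => g (pow j (iter j Dl v))) (pow j w)).
    exact: (congr1 (fun F => P F (pow j w)) (funext (fun v => esym (congr1 (fun t => f (mul x t)) (iterDK DK j v))))).
  exact: (etrans (op_iter_dilate PD j (pow j w) sgp) (congr1 (fun t => ((a ^+ j)%:C)%C * P (fun v => g (pow j v)) t) (iterD'K D'K j w))).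
set h := fun w => _ * _.
have gE : (fun v => g (pow j v)) = fun v => (((q / a) ^+ j)%:C)%C * h v.
  apply/funext => v; rewrite /g /f /K kernel_ofE /kappa_ (mul_opp mulA mul0l mulx0 mulNl) -mulA mulNl mulx0.
  by rewrite iterDN /pow (iterD'K D'K) /h /pow (mul_opp mulA mul0l mulx0 mulNl); ring.
have sh : csmooth setT h.
  have qa : (((q / a) ^- j)%:C)%C * (((q / a) ^+ j)%:C)%C = 1 :> C.
    by rewrite -rmorphM /= mulVf// expf_neq0// (mulf_neq0 (lt0r_neq0 q0) (invr_neq0 (lt0r_neq0 a0))).
  have : csmooth setT (fun v => (((q / a) ^- j)%:C)%C * g (pow j v)) := csmoothZ oT _ sgp.
  congr (csmooth _ _); apply/funext => v.
  by have := congr1 (fun F => F v) gE => /= ->; rewrite mulrA qa mul1r.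
rewrite gE (smooth_opZ sP _ sh) mulrA -rmorphM /=; congr (_%:C%C * _).
by rewrite -exprMn mulrC divfK// gt_eqF.
Qed.

Let sJ2 : csmooth setT (fun z : V2 => ((jacobian mul (- mul (lsubmx z) (rsubmx z)) (lsubmx z))%:C)%C : C).
Proof.
apply: (csmooth_real oT2).
have H := smooth_map_row_mx (smooth_map_N oT2 smul) (@smooth_map_lsubmx R N N).
have := smooth_comp (Om' := setT) oT2 oT2 H (smooth_jacobian smul) (fun _ _ => Logic.I).
by congr (smooth _ _); apply/funext => z; rewrite row_mxKl row_mxKr.
Qed.

(** By [dbound_increment] the factor phi - phi(y) is O(2^-j) with its derivatives up to the order of
    P, while the other factors are bounded: this yields q^j 2^-j. The last two clauses locate the
    support; vanishing for small w makes every piece zero on the diagonal. *)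
Lemma kernel_bound phi r : csmooth setT phi -> exists2 A, 0 <= A & forall j x y, `|x| <= r ->
  let k := commutator phi (fun y => kernel_of mul (kappa_ Dl a q gamma j) (row_mx x y)) y in
  let w := iter j Dl (mul (- x) y) in
  [/\ normc k <= A * (q / 2) ^+ j, rho < `|w| -> k = 0 & `|w| < rho' -> k = 0].
Proof.
move=> sphi; have [m HP] := smooth_op_bound sP; have [c c0 {}HP] := HP _ (cB rho).
have c2B := @closed_ball_compact_rV R (N + N) (Num.max r rho).
have sphi2 : csmooth setT (fun z : V2 => phi (mul (lsubmx z) (rsubmx z))).
  exact: (csmooth_comp oT2 oT smul sphi (fun _ _ => Logic.I)).
have [M1 M10 H1] := compact_cdbound m oT2 c2B (@subsetT _ _) sphi2.
have [M2 M20 H2] := compact_cdbound m oT2 c2B (@subsetT _ _) sJ2.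
have sgN : csupp (ball0 rho) (fun w => gamma (- w)).
  split; last by move=> w /= wr; apply: sgamma.2; rewrite /= normrN.
  exact: (csmooth_comp oT oT (smooth_map_N oT (smooth_map_id oT)) sgamma.1 (fun _ _ => Logic.I)).
have [M3 M30 H3] := csupp_cdbound m (cB rho) sgN.
pose B := 2 * (2 ^+ m * (M1 * (2 * (2 ^+ m * (M3 * M2))))).
have B0 : 0 <= B by rewrite /B !mulr_ge0.
exists (c * B) => [|j x y xr k w]; first exact: mulr_ge0.
have kE : k = _ := kernel_rescale j x y sphi.
set h := (fun w => _ * _) in kE.
have yE : y = mul x (pow j w) by rewrite /pow /w (iterDK DK) (mul_Kopp mulA mul0l mulNl).
pose u v := phi (mul x v); pose Jx v : C := ((jacobian mul (- mul x v) x)%:C)%C.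
have su : csmooth setT u := csmooth_mull smul x sphi.
have sJx : csmooth setT Jx.
  have EF : (fun v => ((jacobian mul (- mul (lsubmx (row_mx x v : V2)) (rsubmx (row_mx x v : V2))) (lsubmx (row_mx x v : V2)))%:C)%C) = Jx.
    by apply/funext => v; rewrite row_mxKl row_mxKr.
  by rewrite -EF; exact: (csmooth_slice x sJ2).
have hE : h = fun v => (u (pow j v) - u (pow j w)) * (gamma (- v) * Jx (pow j v)).
  by apply/funext => v; rewrite /h /u -yE.
have sd : csmooth setT (fun v => u (pow j v) - u (pow j w)).
  exact: (csmoothB oT (csmooth_iter Dl' j su) (csmooth_cst oT _)).
have sJp : csmooth setT (fun v => Jx (pow j v)) := csmooth_iter Dl' j sJx.
have sgJ := csmoothM oT sgN.1 sJp.
have sh : csupp (ball0 rho) h.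
  rewrite hE; split; first exact: (csmoothM oT sd sgJ).
  by move=> v vr; rewrite sgN.2// mul0r mulr0.
split.
- have [wr|wr] := leP `|w| rho; last first.
    have wr' : ~ ball0 rho w by rewrite /= leNgt wr.
    rewrite kE (smooth_op_supported sP (cB rho) sh.1 sh.2 wr') mulr0 normc_c0.
    by rewrite !mulr_ge0// exprn_ge0// divr_ge0// ltW.
  have in2 : `|row_mx x (pow j w) : V2| <= Num.max r rho.
    apply: rV_norm_row_mx; first by rewrite le_max xr.
    by rewrite le_max (le_trans (norm_iter_le contr j w) wr) orbT.
  have b1 : cdbound m (fun v => u (pow j v) - u (pow j w)) w (2^-1 ^+ j * M1).
    have b : cdbound m u (pow j w) M1.
      have EF : (fun v => phi (mul (lsubmx (row_mx x v : V2)) (rsubmx (row_mx x v : V2)))) = u.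
        by apply/funext => v; rewrite row_mxKl row_mxKr.
      by rewrite -EF; exact: (cdbound_slice (H1 _ in2)).
    have E1 : re_part (fun v => u (pow j v) - u (pow j w)) = fun v => re_part u (pow j v) - re_part u (pow j w).
      by apply/funext => v; rewrite /re_part ReD ReN.
    have E2 : im_part (fun v => u (pow j v) - u (pow j w)) = fun v => im_part u (pow j v) - im_part u (pow j w).
      by apply/funext => v; rewrite /im_part ImD ImN.
    split; first by rewrite E1; exact: dbound_increment su.1 b.1.
    by rewrite E2; exact: dbound_increment su.2 b.2.
  have b2 : cdbound m (fun v => Jx (pow j v)) w M2.
    have b : cdbound m Jx (pow j w) M2.
      have EF : (fun v => ((jacobian mul (- mul (lsubmx (row_mx x v : V2)) (rsubmx (row_mx x v : V2))) (lsubmx (row_mx x v : V2)))%:C)%C) = Jx.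
        by apply/funext => v; rewrite row_mxKl row_mxKr.
      by rewrite -EF; exact: (cdbound_slice (H2 _ in2)).
    rewrite -[M2]mul1r -(expr1n _ m); apply: (cdbound_linear (M := pow j) sJx (lexx 1) _ b) => v.
    by rewrite mul1r; exact: norm_iter_le.
  have b3 : cdbound m h w (2^-1 ^+ j * B).
    rewrite hE; have := cdboundM oT sd sgJ Logic.I b1 (cdboundM oT sgN.1 sJp Logic.I (H3 w) b2).
    by apply: cdbound_le => //; rewrite /B le_eqVlt; apply/orP; left; apply/eqP; ring.
  rewrite kE Normc.normcM normc_real ger0_norm ?exprn_ge0 ?(ltW q0)//.
  have := HP h w _ sh.1 wr b3; rewrite expr_div_n => H.
  apply: (@le_trans _ _ (q ^+ j * (c * (2^-1 ^+ j * B)))).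
    by rewrite ler_wpM2l// exprn_ge0// ltW.
  by rewrite le_eqVlt; apply/orP; left; apply/eqP; rewrite exprVn; ring.
- move=> wr; have wr' : ~ ball0 rho w by rewrite /= leNgt wr.
  by rewrite kE (smooth_op_supported sP (cB rho) sh.1 sh.2 wr') mulr0.
- move=> wr; have s0 : csmooth setT (fun _ : V => 0 : C) := csmooth_cst oT 0.
  have h0 v : [set v : V | `|v| < rho'] v -> h v = 0.
    by move=> vr; rewrite /h gamma0 ?normrN// mul0r mulr0.
  rewrite kE (smooth_op_local sP (@open_norm_lt R N rho') sh.1 s0 h0 wr).
  by rewrite (smooth_op_supported sP (@compact0 _) s0 (fun _ _ => erefl)) ?mulr0.
Qed.

(** The integrand is multiplied by jacobian(b, (-b) y) jacobian(-b, y), which is 1 by the cocycle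
    rule. Undoing the translation and then the dilation leaves q^-j times the integral of eta
    against a Jacobian bounded on compact sets. *)
Lemma bump_integral (eta : V -> R) s r : smooth setT eta -> (forall x, ~ ball0 s x -> eta x = 0) ->
  exists2 A, 0 <= A & forall j b, `|b| <= r -> \int[mu]_y eta (iter j Dl (mul (- b) y)) <= A * q ^- j.
Proof.
move=> seta Seta.
have sJ : smooth setT (fun z : V2 => jacobian mul (lsubmx z) (rsubmx z)) := smooth_jacobian smul.
have [MJ MJ0 HJ] := compact_dbound 0 oT2 (@closed_ball_compact_rV R (N + N) (Num.max r s)) (@subsetT _ _) sJ.
have [Me Me0 He] := csupp_bounded (cB s) (smoothT_continuous seta) Seta.
have F0 : 0 <= fine (mu (ball0 s)) by rewrite fine_ge0.
exists (2 * (Me * MJ) * fine (mu (ball0 s))) => [|j b br]; first by rewrite !mulr_ge0.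
have sJb : smooth setT (jacobian mul b).
  have := smooth_comp (Om' := setT) oT oT2 (smooth_map_row_mx (smooth_map_cst b oT) (smooth_map_id oT)) sJ (fun _ _ => Logic.I).
  by congr (smooth _ _); apply/funext => z; rewrite row_mxKl row_mxKr.
pose f w : C := (eta w)%:C%C * ((jacobian mul b (iter j Dl' w))%:C)%C.
have se : csupp (ball0 s) (fun w => (eta w)%:C%C : C).
  by split; [exact: (csmooth_real oT seta)|move=> x /Seta ->].
have sJc : csmooth setT (fun w => ((jacobian mul b (iter j Dl' w))%:C)%C : C).
  exact: (csmooth_iter Dl' j (csmooth_real oT sJb)).
have sf : csupp (ball0 s) f.
  by split; [exact: (csmoothM oT se.1 sJc)|exact: supportedMl se.2].
have sfj := csupp_iter_dilate DK contr j sf.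
have E1 := cintegral_left_translate smul mulA mul0l mulNl mul_exp (- b) sfj.
have E2 := cintegral_iter_dilate DK D'K contr jac j sf.
have H : complex.Re (cintegral setT (fun y => f (iter j Dl (mul (- b) y)) * ((jacobian mul (- b) y)%:C)%C)) =
    \int[mu]_y eta (iter j Dl (mul (- b) y)).
  have Ef y : complex.Re (f (iter j Dl (mul (- b) y)) * ((jacobian mul (- b) y)%:C)%C) = eta (iter j Dl (mul (- b) y)).
    rewrite /f (iterDK DK) -mulrA -!rmorphM /= -(jacobianM smul mulA) (mul_oppr mulNl) (jacobian0 mul0l).
    exact: mulr1.
  by apply: eq_Rintegral => y _; exact: Ef.
have -> : \int[mu]_y eta (iter j Dl (mul (- b) y)) = q ^- j * complex.Re (cintegral setT f).
  apply: (etrans (esym H)); apply: (etrans (congr1 (@complex.Re R) (etrans E1 E2))).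
  by rewrite ReM /= mul0r subr0.
have qj0 : 0 <= q ^- j by rewrite invr_ge0 exprn_ge0 ?(ltW q0).
rewrite [X in X <= _]mulrC; apply: (ler_wpM2r qj0).
apply: le_trans (ler_norm _) _; apply: le_trans (Re_le_normc _) _.
apply: (cintegral_norm_le (cB s) (csmooth_continuous sf.1) sf.2) => w.
have [ws|/sf.2 ->] := pselect (`|w| <= s); last by rewrite normc_c0 mulr_ge0.
rewrite /f Normc.normcM !normc_real; apply: (ler_pM (normr_ge0 _) (normr_ge0 _) (He w)).
have /HJ/dboundW : `|row_mx b (iter j Dl' w) : V2| <= Num.max r s.
  apply: rV_norm_row_mx; first by rewrite le_max br.
  by rewrite le_max (le_trans (norm_iter_le contr j w) ws) orbT.
by rewrite row_mxKl row_mxKr.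
Qed.

End kernel_bounds.

(** * Schur test *)

Section schur.
Context {R : realType} {N : nat}.
Local Notation V := 'rV[R]_N.
Local Notation mu := (lebesgue_rV N).
Local Notation ball0 r := [set x : V | `|x| <= r].
Local Notation cB r := (@closed_ball_compact_rV R N r).

(** Domination by a weight [w] whose integrals in each variable are bounded. The weight has extended
    real values because it will be an infinite series. *)
Definition schur_kernel (E : set V) (k : V * V -> R) :=
  measurable_fun setT k /\ forall r : R, exists (w : V * V -> \bar R) (M : R),
  [/\ measurable_fun setT w, forall z, (0 <= w z)%E,
      forall x y, `|x| <= r -> E y -> (`|k (x, y)|%:E <= w (x, y))%E,
      forall x, `|x| <= r -> (\int[mu]_y w (x, y) <= M%:E)%E &
      forall y, E y -> (\int[mu]_x w (x, y) <= M%:E)%E].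

(** A crude Young inequality, valid from p = 1 on: compare s and t and replace the smaller by the
    larger. *)
Lemma le_add_powR (p s t : R) : 1 <= p -> 0 <= s -> 0 < t -> s * t `^ (p - 1) <= t `^ p + s `^ p.
Proof.
move=> p1 s0 t0; have pp : 0 < p by lra.
have [st|ts] := leP s t.
  rewrite -(mulr_powRB1 (ltW t0) pp); apply: le_trans (_ : t * t `^ (p - 1) <= _).
    by rewrite ler_wpM2r// powR_ge0.
  by rewrite lerDl powR_ge0.
rewrite -(mulr_powRB1 s0 pp); apply: le_trans (_ : s * s `^ (p - 1) <= _).
  by rewrite ler_wpM2l// ge0_ler_powR ?nnegrE ?(ltW t0) ?(ltW ts)//; lra.
by rewrite lerDr powR_ge0.
Qed.

Lemma le1_powR (p s : R) : 1 <= p -> 0 <= s -> s <= 1 + s `^ p.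
Proof. by move=> p1 s0; have := le_add_powR p1 s0 ltr01; rewrite !powR1 mulr1. Qed.

Variables (E : set V) (f : V -> R) (p : R) (k : V * V -> R).
Hypotheses (cE : compact E) (mf : measurable_fun setT f) (fE : forall y, ~ E y -> f y = 0) (p1 : 1 <= p).
Hypothesis fp : (\int[mu]_y (`|f y| `^ p)%:E < +oo)%E.
Hypothesis sk : schur_kernel E k.

Let mk : measurable_fun setT k. Proof. by case: sk. Qed.
Let mE : measurable E. Proof. exact: compact_measurable_rV. Qed.
Let pp : 0 < p. Proof. exact: lt_le_trans p1. Qed.

Let mfp : measurable_fun setT (fun y => `|f y| `^ p).
Proof. by apply: (measurableT_comp (measurable_powR p)); exact: measurableT_comp. Qed.

(** A p-integrable function supported in the compact set [E] is integrable. *)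
Let f_le y : `|f y| <= \1_E y + `|f y| `^ p.
Proof.
rewrite indicE; case: (boolP (y \in E)) => [_|/negP yE] /=; first exact: le1_powR.
by rewrite fE ?normr0 ?add0r ?powR_ge0// => Ey; apply: yE; exact: mem_set.
Qed.

Let le_int (g h : V -> \bar R) : (forall x, (0 <= g x)%E) -> measurable_fun setT g -> measurable_fun setT h ->
  (forall x, (g x <= h x)%E) -> (\int[mu]_x g x <= \int[mu]_x h x)%E.
Proof. by move=> g0 mg mh gh; apply: ge0_le_integral => // x _; exact: gh. Qed.

Let int_Zl (M : R) (g : V -> \bar R) : 0 <= M -> (forall x, (0 <= g x)%E) -> measurable_fun setT g ->
  (\int[mu]_x (M%:E * g x) = M%:E * \int[mu]_x g x)%E.
Proof. by move=> M0 g0 mg; apply: (ge0_integralZl _ measurableT mg (fun x _ => g0 x)); rewrite lee_fin. Qed.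

Let mfE : measurable_fun setT (fun y => `|f y|%:E).
Proof. by apply: measurableT_comp => //; exact: measurableT_comp. Qed.

Let mfpE : measurable_fun setT (fun y => (`|f y| `^ p)%:E).
Proof. exact: measurableT_comp. Qed.

Let mindE : measurable_fun setT (fun y : V => (\1_E y)%:E : \bar R).
Proof. by apply: measurableT_comp => //; exact: measurable_indic. Qed.

Let fp_ge0 y : (0 <= (`|f y| `^ p)%:E)%E.
Proof. by rewrite lee_fin powR_ge0. Qed.

Let f_int : (\int[mu]_y `|f y|%:E < +oo)%E.
Proof.
apply: (@le_lt_trans _ _ (\int[mu]_y ((\1_E y)%:E + (`|f y| `^ p)%:E))%E).
  apply: le_int => //; first exact: emeasurable_funD.
rewrite (ge0_integralD _ measurableT) => //.
rewrite integral_indic// setIT; apply: lte_add_pinfty => //; exact: compact_finite_measure.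
Qed.

Definition kernel_integral (x : V) : R := \int[mu]_y (f y * k (x, y)).

Section ball.
Variable r : R.
Let D : set V := ball0 r.
Let mD : measurable D. Proof. exact: compact_measurable_rV (cB r). Qed.
(** Restricting x to a ball makes the integrand integrable on the product space, whereas the Schur
    bounds are only local in x. *)
Let H (z : V * V) : R := \1_D z.1 * (f z.2 * k z).

Let mH : measurable_fun setT (EFin \o H).
Proof.
apply: measurableT_comp => //; apply: measurable_funM.
  by apply: (measurableT_comp (measurable_indic mD)); exact: measurable_fst.
by apply: measurable_funM => //; apply: (measurableT_comp mf); exact: measurable_snd.
Qed.

Let H_D x y : D x -> H (x, y) = f y * k (x, y).
Proof. by move=> Dx; rewrite /H /= indicE mem_set// mul1r. Qed.

Let H_notD x y : ~ D x -> H (x, y) = 0.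
Proof. by move=> Dx; rewrite /H /= indicE memNset// mul0r. Qed.

Let mslice (w : V * V -> \bar R) x : measurable_fun setT w -> measurable_fun setT (fun y => w (x, y)).
Proof. by move=> mw; exact: measurableT_comp. Qed.

Let mslice2 (w : V * V -> \bar R) y : measurable_fun setT w -> measurable_fun setT (fun x => w (x, y)).
Proof. by move=> mw; exact: measurableT_comp. Qed.

Let weight : exists (w : V * V -> \bar R) (M : R), [/\ measurable_fun setT w, (forall z, (0 <= w z)%E), 1 <= M,
  (forall x y, (`|H (x, y)|%:E <= `|f y|%:E * w (x, y))%E) &
  (forall x, D x -> (\int[mu]_y w (x, y) <= M%:E)%E) /\
  (forall y, E y -> (\int[mu]_x w (x, y) <= M%:E)%E)].
Proof.
have [w [M [mw w0 kw w1 w2]]] := sk.2 r; exists w, (Num.max M 1).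
have MM : (M%:E <= (Num.max M 1)%:E)%E by rewrite lee_fin le_max lexx.
split=> //; first (by rewrite le_max lexx orbT); last split.
- move=> x y; have [Dx|/H_notD->] := pselect (D x); last by rewrite normr0 mule_ge0.
  rewrite H_D//; have [Ey|/fE->] := pselect (E y); last by rewrite mul0r normr0 mul0e.
  by rewrite normrM EFinM; apply: lee_wpmul2l; [rewrite lee_fin|exact: kw].
- by move=> x Dx; exact: le_trans (w1 x Dx) MM.
- by move=> y Ey; exact: le_trans (w2 y Ey) MM.
Qed.

Lemma integrable_schur : (mu \x mu)%E.-integrable setT (EFin \o H).
Proof.
have [w [M [mw w0 M1 Hw [_ w2]]]] := weight; have M0 : 0 <= M by lra.
apply: (@integrable21ltyP _ _ _ _ R mu mu (EFin \o H) mH).2.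
apply: (@le_lt_trans _ _ (\int[mu]_y (M%:E * `|f y|%:E))%E); last first.
  by rewrite int_Zl//; apply: lte_mul_pinfty => //.
have mHa : measurable_fun setT (fun z => `|(EFin \o H) z|%E) by exact: measurableT_comp.
apply: le_int.
- by move=> y; exact: integral_ge0.
- apply: (measurable_fun_fubini_tonelli_G (m1 := mu) (fun z => `|(EFin \o H) z|%E)) => //.
- exact: measurable_funeM.
- move=> y; have [Ey|/fE fy0] := pselect (E y); last first.
    rewrite (eq_integral (fun=> 0%E)) ?integral0 ?mule_ge0// => x _.
    by rewrite /H /= fy0 mul0r mulr0 normr0.
  apply: (@le_trans _ _ (\int[mu]_x (`|f y|%:E * w (x, y)))%E).
    apply: le_int => //; first exact: (mslice2 y mHa).
      by apply: measurable_funeM; exact: mslice2.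
    by move=> x; exact: Hw.
  rewrite int_Zl//; last exact: mslice2.
  by rewrite muleC; apply: lee_wpmul2r => //; exact: w2.
Qed.

Lemma kernel_integral_ball x : D x -> kernel_integral x = \int[mu]_y H (x, y).
Proof. by move=> Dx; apply: eq_Rintegral => y _; rewrite H_D. Qed.

Lemma measurable_kernel_ball : measurable_fun setT (fun x => \int[mu]_y H (x, y)).
Proof.
apply: (measurableT_comp (f := fine)) => //.
exact: (measurable_fubini_F integrable_schur).
Qed.

(** Schur test for exponent p. The bound |f| t^(p-1) <= t^p + |f|^p is integrated in y against w(x,
    y), for a number t chosen for each x. The p-th power of the integral at x is thus at most C
    times the integral of |f|^p w(x, y), whose integral in x is finite by Tonelli. *)
Lemma kernel_integral_lp : (\int[mu]_(x in D) (`|kernel_integral x| `^ p)%:E < +oo)%E.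
Proof.
have [w [M [mw w0 M1 Hw [w1 w2]]]] := weight; have M0 : 0 < M by lra.
pose C := (2 * M) `^ p / M; have C0 : 0 <= C by rewrite divr_ge0 ?powR_ge0// ltW.
pose G (z : V * V) := ((`|f z.2| `^ p)%:E * w z)%E.
have mG : measurable_fun setT G.
  by apply: emeasurable_funM => //; apply: (measurableT_comp mfpE); exact: measurable_snd.
have G0 z : (0 <= G z)%E by rewrite mule_ge0.
have Gfin : (\int[mu]_x \int[mu]_y G (x, y) < +oo)%E.
  rewrite (@fubini_tonelli _ _ _ _ R mu mu G mG G0).
  apply: (@le_lt_trans _ _ (\int[mu]_y (M%:E * (`|f y| `^ p)%:E))%E); last first.
    by rewrite int_Zl ?(ltW M0)//; apply: lte_mul_pinfty => //; rewrite lee_fin ltW.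
  apply: le_int.
  - by move=> y; exact: integral_ge0.
  - exact: (measurable_fun_fubini_tonelli_G (m1 := mu) G mG G0).
  - exact: measurable_funeM.
  - move=> y; rewrite /G /= int_Zl ?powR_ge0//; last exact: mslice2.
    rewrite muleC; have [Ey|/fE ->] := pselect (E y).
      by apply: lee_wpmul2r => //; exact: w2.
    by rewrite normr0 powR0 ?gt_eqF// mule0 mule0.
have key x : D x -> ((`|kernel_integral x| `^ p)%:E <= C%:E * \int[mu]_y G (x, y))%E.
  move=> Dx; pose A := (\int[mu]_y (`|f y|%:E * w (x, y)))%E; pose I := (\int[mu]_y G (x, y))%E.
  have mfw : measurable_fun setT (fun y => `|f y|%:E * w (x, y))%E.
    by apply: emeasurable_funM => //; exact: mslice.
  have mGx : measurable_fun setT (fun y => G (x, y)) by exact: mslice.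
  have A0 : (0 <= A)%E by apply: integral_ge0 => y _; rewrite mule_ge0.
  have I0 : (0 <= I)%E by exact: integral_ge0.
  have TA : (`|kernel_integral x|%:E <= A)%E.
    rewrite kernel_integral_ball//.
    have := le_abse_integral mu measurableT (mslice x mH) => le1.
    have le2 : (\int[mu]_y `|(EFin \o H) (x, y)| <= A)%E.
      apply: le_int => //; first by apply: measurableT_comp => //; exact: (mslice x mH).
      by move=> y; exact: Hw.
    have := le_trans le1 le2; rewrite /Rintegral.
    (* Where the inner integral is infinite, the real integral takes the default value 0 and the
       bound is trivial. *)
    case: (\int[mu]_y _)%E => [s| |] /=; [exact: id|by move=> _; rewrite normr0|by move=> _; rewrite normr0].
  case: (ltP 0%E A) => [Apos|Ale]; last first.
    have : (`|kernel_integral x|%:E <= 0)%E by exact: le_trans TA Ale.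
    rewrite lee_fin normr_le0 => /eqP ->; rewrite normr0 powR0 ?gt_eqF//.
    by rewrite mule_ge0// lee_fin.
  have bound t : 0 < t -> (A * (t `^ (p - 1))%:E <= (t `^ p * M)%:E + I)%E.
    move=> t0; rewrite muleC -int_Zl ?powR_ge0//; last by move=> y; rewrite mule_ge0.
    apply: (@le_trans _ _ (\int[mu]_y ((t `^ p)%:E * w (x, y) + G (x, y)))%E).
      apply: le_int.
      - by move=> y; rewrite !mule_ge0 ?lee_fin ?powR_ge0.
      - exact: measurable_funeM.
      - by apply: emeasurable_funD => //; apply: measurable_funeM; exact: mslice.
      - move=> y; rewrite /G /= muleA -ge0_muleDl ?lee_fin ?powR_ge0//.
        apply: lee_wpmul2r => //; rewrite -EFinM -EFinD lee_fin mulrC; exact: le_add_powR.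
    rewrite (ge0_integralD _ measurableT)//; last 2 first.
    - by move=> y _; rewrite mule_ge0// lee_fin powR_ge0.
    - by apply: measurable_funeM; exact: mslice.
    rewrite leeD2r// int_Zl ?powR_ge0//; last exact: mslice.
    rewrite EFinM; apply: lee_wpmul2l; [by rewrite lee_fin powR_ge0|exact: w1].
  have [AI|Afin] := eqVneq A +oo%E.
    have := bound 1 ltr01; rewrite !powR1 AI mule1 mul1r -/I => {}AI.
    have -> : I = +oo%E by clear bound; move: AI I0; clearbody I; case: I => [s| |] //=.
    rewrite gt0_muley ?leey// lte_fin divr_gt0// powR_gt0//; lra.
  have {Afin A0}[s sE] : exists s, A = s%:E.
    by clear bound TA Apos mfw; move: Afin A0; clearbody A; case: A => [s _ _| |] //; exists s.
  rewrite sE in bound TA Apos; rewrite lte_fin in Apos; rewrite lee_fin in TA.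
  (* With s = 2 M t the inequality reads 2 M t^p <= M t^p + I, so M t^p <= I, and s^p = (2 M)^p t^p
     is at most C I. *)
  pose t := s / (2 * M); have t0 : 0 < t by rewrite divr_gt0//; lra.
  have st : s = 2 * M * t by rewrite /t mulrC divfK// gt_eqF//; lra.
  have := bound t t0; rewrite -EFinM.
  have -> : s * t `^ (p - 1) = 2 * M * t `^ p by rewrite -(mulr_powRB1 (ltW t0) pp) mulrA -st.
  move=> b; have tp0 : 0 <= t `^ p by rewrite powR_ge0.
  have {}b : ((M * t `^ p)%:E <= I)%E.
    clear bound; move: b I0; clearbody I; case: I => [u| |] //=; rewrite ?leey// -EFinD !lee_fin; lra.
  apply: (@le_trans _ _ (C%:E * (M * t `^ p)%:E)%E); last by rewrite lee_wpmul2l// lee_fin.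
  have twoM : 0 <= 2 * M by lra.
  rewrite -EFinM lee_fin /C mulrA divfK ?gt_eqF// -(powRM _ twoM (ltW t0)) -st.
  have nA : `|kernel_integral x| \is Num.nneg by rewrite nnegrE normr_ge0.
  have ns : s \is Num.nneg by rewrite nnegrE (ltW Apos).
  exact: (ge0_ler_powR (ltW pp) nA ns TA).
apply: (@le_lt_trans _ _ (\int[mu]_(x in D) (C%:E * \int[mu]_y G (x, y)))%E).
  apply: (@ge0_le_integral _ _ _ mu D mD).
  - by move=> x _; rewrite lee_fin powR_ge0.
  - apply: (eq_measurable_fun (fun x => (`|\int[mu]_y H (x, y)| `^ p)%:E)).
      by move=> x /set_mem Dx; rewrite kernel_integral_ball.
    apply: measurable_funTS; apply: measurableT_comp => //; apply: (measurableT_comp (measurable_powR p)).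
    by apply: measurableT_comp => //; exact: measurable_kernel_ball.
  - apply: measurable_funTS; apply: measurable_funeM; exact: (measurable_fun_fubini_tonelli_F (m2 := mu) G mG G0).
  - exact: key.
apply: (@le_lt_trans _ _ (\int[mu]_x (C%:E * \int[mu]_y G (x, y)))%E).
  apply: ge0_subset_integral => //; first by apply: measurable_funeM; exact: (measurable_fun_fubini_tonelli_F (m2 := mu) G mG G0).
  by move=> x _; rewrite mule_ge0 ?lee_fin//; exact: integral_ge0.
rewrite int_Zl//; first exact: lte_mul_pinfty.
- by move=> x; exact: integral_ge0.
- exact: (measurable_fun_fubini_tonelli_F (m2 := mu) G mG G0).
Qed.

(** The two integrabilities come along with the exchange because several such identities will be
    added. *)
Lemma kernel_integral_fubini (zeta : V -> R) : continuous zeta -> (forall x, ~ D x -> zeta x = 0) ->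
  [/\ mu.-integrable setT (EFin \o (fun y => f y * \int[mu]_x (k (x, y) * zeta x))),
    mu.-integrable setT (EFin \o (fun x => kernel_integral x * zeta x)) &
  \int[mu]_y (f y * \int[mu]_x (k (x, y) * zeta x)) = \int[mu]_x (kernel_integral x * zeta x)].
Proof.
move=> cz z0; have [Z Z0 HZ] := csupp_bounded (cB r) cz z0.
have mz : measurable_fun setT zeta by exact: continuous_measurable_rV.
pose F (z : V * V) : \bar R := ((zeta z.1)%:E * (EFin \o H) z)%E.
have mF : measurable_fun setT F.
  apply: emeasurable_funM => //; apply: measurableT_comp => //.
  by apply: (measurableT_comp mz); exact: measurable_fst.
have iF : (mu \x mu)%E.-integrable setT F.
  apply: (le_integrable measurableT (g := fun z => (Z%:E * (EFin \o H) z)%E) mF); last exact: integrableZl integrable_schur.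
  move=> z _; rewrite /F !abseM; apply: lee_wpmul2r => //; rewrite /= lee_fin.
  by apply: le_trans (HZ _) _; exact: ler_norm.
have FE x y : F (x, y) = (f y * (k (x, y) * zeta x))%:E.
  rewrite /F /= -EFinM; congr (_%:E); have [Dx|xD] := pselect (D x); first by rewrite H_D//; ring.
  by rewrite z0// !mul0r !mulr0.
(* For almost every x the inner integral converges, and then it is the real number [kernel_integral x * zeta x]. *)
have E1 : ae_eq mu setT (fun x => \int[mu]_y F (x, y))%E (EFin \o (fun x => kernel_integral x * zeta x)).
  have := ae_integrable1 integrable_schur; apply: filterS => x /= iHx _.
  rewrite /F /= integralZl//; have [Dx|xD] := pselect (D x); last by rewrite z0// mul0e mulr0.
  rewrite kernel_integral_ball// /Rintegral -(fineK (integrable_fin_num measurableT iHx)) -EFinM mulrC //.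
have integrable_slice y : E y -> mu.-integrable setT (EFin \o (fun x => k (x, y) * zeta x)).
  move=> Ey; have [w [M [mw w0 kw _ w2]]] := sk.2 r.
  have mky : measurable_fun setT (fun x => k (x, y) * zeta x).
    by apply: measurable_funM => //; exact: (measurableT_comp mk).
  apply/integrableP; split; first exact: measurableT_comp.
  apply: (@le_lt_trans _ _ (\int[mu]_x (Z%:E * w (x, y)))%E); last first.
    rewrite int_Zl//; last exact: mslice2.
    apply: (@le_lt_trans _ _ (Z%:E * M%:E)%E); last by rewrite -EFinM ltry.
    by apply: lee_wpmul2l => //; exact: w2.
  apply: le_int => //.
  - by apply: measurableT_comp => //; exact: measurableT_comp.
  - by apply: measurable_funeM; exact: mslice2.
  - move=> x /=; have [Dx|/z0 ->] := pselect (D x); last by rewrite mulr0 normr0 mule_ge0.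
    rewrite normrM mulrC EFinM; apply: lee_pmul => //; rewrite ?lee_fin//; exact: kw.
have E2 y : (\int[mu]_x F (x, y))%E = (f y * \int[mu]_x (k (x, y) * zeta x))%:E.
  have [Ey|/fE fy0] := pselect (E y); last first.
    rewrite fy0 mul0r (eq_integral (fun=> 0%E)) ?integral0// => x _.
    by rewrite FE fy0 mul0r.
  have ik := integrable_slice y Ey.
  rewrite (eq_integral (fun x => (f y)%:E * (k (x, y) * zeta x)%:E)%E); last first.
    by move=> x _; rewrite FE EFinM.
  rewrite (integralZl measurableT ik) EFinM; congr (_ * _)%E.
  by rewrite /Rintegral fineK//; exact: (integrable_fin_num measurableT ik).
have i1 := integrable_fubini_F iF.
have mT : measurable_fun setT (EFin \o (fun x => kernel_integral x * zeta x)).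
  apply: measurableT_comp => //.
  rewrite (_ : (fun x => _) = fun x => (\int[mu]_y H (x, y)) * zeta x); last first.
    apply/funext => x; have [Dx|/z0 ->] := pselect (D x); last by rewrite !mulr0.
    by rewrite kernel_integral_ball.
  by apply: measurable_funM => //; exact: measurable_kernel_ball.
have mG : measurable_fun setT (fun x => \int[mu]_y F (x, y))%E by exact: measurable_fubini_F iF.
have E3 : (fun y => (f y * \int[mu]_x (k (x, y) * zeta x))%:E) = (fun y => \int[mu]_x F (x, y))%E.
  by apply/funext => y; rewrite E2.
split.
- apply/integrableP; split; first by rewrite /comp E3; exact: measurable_fubini_G iF.
  apply: (@le_lt_trans _ _ (\int[mu]_y \int[mu]_x `|F (x, y)|)%E); last first.
    exact: ((@integrable21ltyP _ _ _ _ R mu mu F mF).1 iF).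
  have maF : measurable_fun setT (fun z => `|F z|%E) by exact: measurableT_comp.
  apply: le_int => //.
  - by apply: measurableT_comp => //; rewrite /comp E3; exact: measurable_fubini_G iF.
  - exact: (measurable_fun_fubini_tonelli_G (m1 := mu) (fun z => `|F z|%E) maF (fun z => abse_ge0 _)).
  - move=> y; suff : (`|\int[mu]_x F (x, y)| <= \int[mu]_x `|F (x, y)|)%E by rewrite E2.
    by apply: le_abse_integral => //; exact: (mslice2 y mF).
- apply/integrableP; split; first exact: mT.
  have E4 : ae_eq mu setT (fun x => `|\int[mu]_y F (x, y)|)%E (abse \o (EFin \o (fun x : V => kernel_integral x * zeta x))).
    by apply: filterS E1 => x H1 Dx; rewrite /= H1.
  rewrite -(@ae_eq_integral _ _ _ mu setT _ _ measurableT (measurableT_comp (@abse_measurable _ setT) mG) (measurableT_comp (@abse_measurable _ setT) mT) E4)//.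
  by case/integrableP: i1.
- congr fine; rewrite [LHS](eq_integral (fun y => \int[mu]_x F (x, y)))%E => [|y _]; last by rewrite E2.
  by rewrite -(Fubini iF); exact: (@ae_eq_integral _ _ _ mu setT _ _ measurableT mG mT E1).
Qed.

End ball.

(** At each point the truncations to the balls of integral radius are eventually constant. *)
Lemma measurable_kernel_integral : measurable_fun setT kernel_integral.
Proof.
pose T n x := \int[mu]_y (\1_(ball0 n%:R) x * (f y * k (x, y))).
apply: (@measurable_fun_cvg _ _ _ setT T).
  move=> n; exact: measurable_kernel_ball.
move=> x _; have [n xn] : exists n : nat, `|x| <= n%:R.
  by exists (Num.truncn `|x|).+1; rewrite ltW// truncnS_gt.
apply: cvg_near_cst; exists n => // m /= nm.
rewrite (@kernel_integral_ball m%:R)//=; by apply: le_trans xn _; rewrite ler_nat.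
Qed.

End schur.

(** Pointwise convergence is asked in the strong form of being eventually constant, which is how the
    truncated kernels converge. *)
Lemma Rintegral_cvg_dominated d (T : measurableType d) (R : realType) (m : {measure set T -> \bar R})
    (f_ : nat -> T -> R) (f : T -> R) (g : T -> \bar R) :
  (forall J, measurable_fun setT (f_ J)) -> measurable_fun setT f ->
  (forall x, exists n, forall J, (n <= J)%N -> f_ J x = f x) ->
  measurable_fun setT g -> (\int[m]_x g x < +oo)%E -> (forall J x, (`|f_ J x|%:E <= g x)%E) ->
  (fun J => \int[m]_x f_ J x) @ \oo --> \int[m]_x f x.
Proof.
move=> mf_ mf ff mg gfin fg.
have g0 x : (0 <= g x)%E by apply: le_trans (fg 0%N x); rewrite lee_fin.
have ig : m.-integrable setT g.
  by apply/integrableP; split=> //; rewrite (eq_integral g)// => x _; rewrite gee0_abs.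
have [if_ _] : [/\ m.-integrable setT (EFin \o f), True & (fun J => \int[m]_x (f_ J x)%:E)%E @ \oo --> (\int[m]_x (f x)%:E)%E].
  have [] := @dominated_convergence _ _ _ m setT measurableT (fun J x => (f_ J x)%:E) (EFin \o f) g _ _ _ ig _.
  - by move=> J; exact: measurableT_comp.
  - exact: measurableT_comp.
  - apply: aeW => x _; have [n Hn] := ff x; apply: cvg_near_cst.
    by exists n => // J /= nJ; rewrite Hn.
  - by apply: aeW => x J _; exact: fg.
  by move=> i1 _ i3; split.
rewrite -(fineK (integrable_fin_num measurableT if_)) => /fine_cvg; exact.
Qed.

Lemma nneseries_le {R : realType} (u : nat -> \bar R) (c : \bar R) : (forall n, (0 <= u n)%E) ->
  (forall n, (\sum_(0 <= i < n) u i <= c)%E) -> (\sum_(0 <= i <oo) u i <= c)%E.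
Proof.
move=> u0 H; apply: lime_le; first by apply: is_cvg_nneseries => n _ _; exact: u0.
by apply: nearW => n; exact: H.
Qed.

Lemma sum_half_le {R : realType} n : \sum_(0 <= i < n) 2^-1 ^+ i <= 2 :> R.
Proof.
suff -> : \sum_(0 <= i < n) 2^-1 ^+ i = 2 - 2 * 2^-1 ^+ n :> R by rewrite gerBl mulr_ge0// exprn_ge0.
elim: n => [|n IH]; first by rewrite big_nil expr0; ring.
by rewrite big_nat_recr//= IH exprS; field.
Qed.

Lemma cvg_geometric_bound {R : realType} (a A : R) (u : nat -> R) (l : R) : 1 < a ->
  (forall J, `|l - u J| <= A * a ^- J) -> u @ \oo --> l.
Proof.
move=> a1 H; have a0 : 0 < a := lt_trans ltr01 a1.
have c0 : (fun J => a^-1 ^+ J * A) @ \oo --> 0 * A.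
  by apply: cvgMr_tmp; apply: cvg_expr; rewrite ger0_norm ?invr_ge0 ?(ltW a0)// invf_lt1.
apply/cvgrPdist_le => eps eps0; move/cvgrPdist_le : c0 => /(_ eps eps0).
apply: filterS => J; rewrite mul0r sub0r normrN exprVn mulrC => HJ.
by apply: le_trans (H J) _; apply: le_trans HJ; exact: ler_norm.
Qed.

(** * The commutator kernel satisfies the Schur bounds *)

Section commutator_kernel.
Context {R : realType} {N : nat}.
Local Notation C := R[i].
Local Notation V := 'rV[R]_N.
Local Notation V2 := 'rV[R]_(N + N).
Local Notation normc := (@Normc.normc R).
Local Notation mu := (lebesgue_rV N).
Local Notation ball0 r := [set x : V | `|x| <= r].
Local Notation cB r := (@closed_ball_compact_rV R N r).
Let oT : open [set: V] := openT.
Let oT2 : open [set: V2] := openT.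

Variable mul : V -> V -> V.
Hypothesis smul : smooth_map setT (fun z : V2 => mul (lsubmx z) (rsubmx z)).
Hypotheses (mulA : associative mul) (mul0l : left_id 0 mul) (mulx0 : right_id 0 mul).
Hypothesis mulNl : forall x, mul (- x) x = 0.
Hypothesis mul_exp : forall (s t : R) x, mul (s *: x) (t *: x) = (s + t) *: x.
Variables (P : (V -> C) -> V -> C) (Dl Dl' : {linear V -> V}) (a q : R).
Hypothesis sP : smooth_op P.
Hypothesis PT : forall b f, csmooth setT f -> forall x, P (fun y => f (mul b y)) x = P f (mul b x).
Hypotheses (DK : cancel Dl Dl') (D'K : cancel Dl' Dl).
Hypothesis contr : forall x, `|Dl' x| <= 2^-1 * `|x|.
Hypotheses (a1 : 1 < a) (aq : a < q).
Hypothesis jac : lebesgue_rV N (Dl @^-1` unit_cube N) = (q^-1)%:E.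
Hypothesis PD : forall f, csmooth setT f -> forall x, P (fun y => f (Dl y)) x = (a%:C)%C * P f (Dl x).
Variables (gamma gammaoo : V -> C) (rho rho' : R).
Hypotheses (rho'0 : 0 < rho') (sgamma : csupp (ball0 rho) gamma) (gamma0 : forall x, `|x| < rho' -> gamma x = 0).
Hypothesis sgoo : csmooth setT gammaoo.
Hypothesis expansion : forall psi, test_fun setT psi -> exists A, forall J : nat,
    normc (psi 0 - (cintegral setT (fun z => gammaoo z * P psi z) +
      \sum_(j < J) ((a ^- j)%:C)%C * cintegral setT (fun z => gamma z * P psi (iter j Dl' z)))) <= A * a ^- J.

Let a0 : 0 < a. Proof. exact: lt_trans a1. Qed.
Let q0 : 0 < q. Proof. exact: lt_trans aq. Qed.

Let iterDN j x : iter j Dl (- x) = - iter j Dl x.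
Proof. by elim: j => // j IH; rewrite !iterS IH linearN. Qed.

Let iterD0 j : iter j Dl 0 = 0.
Proof. by elim: j => // j IH; rewrite iterS IH linear0. Qed.

Let iter_expand j x : 2 ^+ j * `|x| <= `|iter j Dl x|.
Proof.
elim: j => [|j IH]; first by rewrite expr0 mul1r.
rewrite iterS exprS -mulrA; apply: le_trans (norm_expand DK contr _).
by rewrite ler_pM2l.
Qed.

(* Evenness makes [even_bump (D^j ((-x) . y))], which controls the j-th piece of the kernel, symmetric in x and y. *)
Let s := 2 * (`|rho| + 1).
Definition even_bump (w : V) : R := plateau 0 (`|rho| + 1) w * plateau 0 (`|rho| + 1) (- w).
Let r1 : 0 < `|rho| + 1. Proof. by rewrite ltr_pwDr. Qed.

Let smooth_bump : smooth setT even_bump.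
Proof.
apply: (smoothM oT (smooth_plateau _ _)).
exact: (smooth_comp (Om' := setT) oT oT (smooth_map_N oT (smooth_map_id oT)) (smooth_plateau _ _) (fun _ _ => Logic.I)).
Qed.

Let bump_ge0 w : 0 <= even_bump w.
Proof.
by rewrite mulr_ge0//; [case/andP: (plateau_bound 0 (`|rho| + 1) w)|case/andP: (plateau_bound 0 (`|rho| + 1) (- w))].
Qed.

Let bump0 w : ~ ball0 s w -> even_bump w = 0.
Proof. by move=> /negP; rewrite -ltNge => ws; rewrite /even_bump plateau0 ?subr0// mul0r. Qed.

Let bump1 w : `|w| <= rho -> even_bump w = 1.
Proof.
move=> wr; have : `|w| <= `|rho| + 1 by apply: le_trans wr _; apply: le_trans (ler_norm _) _; rewrite lerDl.
by move=> w1; rewrite /even_bump !plateau1 ?subr0 ?normrN// mulr1.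
Qed.

Let bumpN w : even_bump (- w) = even_bump w.
Proof. by rewrite /even_bump opprK mulrC. Qed.

Let e j (z : V * V) : R := even_bump (iter j Dl (mul (- z.1) z.2)).

Let e_sym j x y : e j (x, y) = e j (y, x).
Proof. by rewrite /e /= -bumpN -iterDN (mul_opp mulA mul0l mulx0 mulNl) opprK. Qed.

Let me j : measurable_fun setT (e j).
Proof.
have H : smooth_map setT (fun z : V2 => row_mx (- lsubmx z) (rsubmx z)).
  exact: (smooth_map_row_mx (smooth_map_N oT2 (@smooth_map_lsubmx R N N)) (@smooth_map_rsubmx R N N)).
have sm := smooth_map_comp oT2 H smul.
have sb : csmooth setT (fun w => ((even_bump (iter j Dl w))%:C)%C : C) := csmooth_iter Dl j (csmooth_real oT smooth_bump).
have [c1 _] := csmooth_continuous (csmooth_comp oT2 oT sm sb (fun _ _ => Logic.I)).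
have := continuous_measurable_pair c1; congr (measurable_fun _ _).
by apply/funext => -[x y]; rewrite /re_part /e /= !row_mxKl !row_mxKr.
Qed.

Let e_integral r : exists2 A, 0 <= A & forall j x, `|x| <= r -> (\int[mu]_y (e j (x, y))%:E <= (A * q ^- j)%:E)%E.
Proof.
have [A A0 HA] := bump_integral smul mulA mul0l mulNl mul_exp DK D'K contr a1 aq jac r smooth_bump bump0.
exists A => // j x xr; have sb : csupp (ball0 s) (fun w => ((even_bump w)%:C)%C : C).
  by split; [exact: (csmooth_real oT smooth_bump)|move=> w /bump0 ->].
have [r' Hr'] := csupp_mull smul mulA mul0l mulNl (csupp_iter_dilate DK contr j sb) `|x|.
have [sf Sf] : csupp (ball0 r') (fun y => ((e j (x, y))%:C)%C : C) := Hr' (- x) (eq_ind_r (fun t => t <= `|x|) (lexx _) (normrN x)).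
have ie : mu.-integrable setT (EFin \o (fun y => e j (x, y))).
  exact: (integrable_csupp (cB r') (csmooth_continuous sf).1 (supported_re Sf)).
rewrite -(fineK (integrable_fin_num measurableT ie)) lee_fin; exact: HA.
Qed.

Variables (phi : V -> C) (E : set V).
Hypotheses (sphi : csmooth setT phi) (cE : compact E).

Let BB := commutator P phi.
Let sBB : smooth_op BB := smooth_op_commutator sP sphi.
Let sk j : csmooth setT (kernel_of mul (kappa_ Dl a q gamma j)) := csmooth_kernel_of smul (csmooth_kappa Dl a q sgamma j).
Let skoo : csmooth setT (kernel_of mul gammaoo) := csmooth_kernel_of smul sgoo.

Let sG J : csmooth setT (fun z => kernel_of mul gammaoo z + \sum_(j < J) kernel_of mul (kappa_ Dl a q gamma j) z) :=
  csmoothD oT2 skoo (csmooth_sum oT2 (index_enum 'I_J) (fun j : 'I_J => sk j)).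

Let k_ J x y := BB (fun y => kernel_of mul gammaoo (row_mx x y) + \sum_(j < J) kernel_of mul (kappa_ Dl a q gamma j) (row_mx x y)) y.
Let koo x y := BB (fun y => kernel_of mul gammaoo (row_mx x y)) y.
Let kj j x y := BB (fun y => kernel_of mul (kappa_ Dl a q gamma j) (row_mx x y)) y.

Let csmooth_k J : csmooth setT (fun z : V2 => k_ J (lsubmx z) (rsubmx z)) := smooth_op_param sBB (sG J).
Let csmooth_koo : csmooth setT (fun z : V2 => koo (lsubmx z) (rsubmx z)) := smooth_op_param sBB skoo.

Let kE J x y : k_ J x y = koo x y + \sum_(0 <= j < J) kj j x y.
Proof.
rewrite big_mkord /k_; elim: J => [|J IH].
  rewrite big_ord0 addr0; congr (BB _ y); apply/funext => t; by rewrite big_ord0 addr0.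
rewrite big_ord_recr /= addrA -IH.
have s1 := csmooth_slice x (sG J); have s2 := csmooth_slice x (sk J).
rewrite -[X in X + _]mul1r -(smooth_op_linear sBB 1 s1 s2); congr (BB _ y).
by apply/funext => t; rewrite big_ord_recr /= mul1r addrA.
Qed.

Let k_bound r := kernel_bound smul mulA mul0l mulx0 mulNl sP PT DK D'K contr a1 aq PD sgamma gamma0 r sphi.

(** At a given pair of points only finitely many pieces are non-zero, so the series of kernels is
    pointwise a finite sum. *)
Let k_stable x y : exists n, forall J, (n <= J)%N -> k_ J x y = k_ n x y.
Proof.
have [A _ HA] := k_bound `|x|.
suff [n Hn] : exists n, forall j, (n <= j)%N -> kj j x y = 0.
  exists n => J nJ; rewrite !kE (big_cat_nat (n := n))//= [X in _ + (_ + X)]big1_seq ?addr0// => j.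
  by rewrite mem_index_iota => /andP[_ /andP[nj _]]; exact: Hn.
(* On the diagonal the rescaled variable is always 0, where every piece vanishes. Off it D^j expands
   by at least 2^j and leaves the ball of radius [rho]. *)
have [w0|wn0] := eqVneq (mul (- x) y) 0.
  exists 0%N => j _; have [_ _ H] := HA j x y (lexx _); apply: H; by rewrite w0 iterD0 normr0.
have w0 : 0 < `|mul (- x) y| by rewrite normr_gt0.
exists (Num.truncn (rho / `|mul (- x) y|)).+1 => j nj; have [_ H _] := HA j x y (lexx _); apply: H.
apply: lt_le_trans (iter_expand _ _); rewrite -ltr_pdivrMr//.
apply: lt_le_trans (truncnS_gt _) _; apply: le_trans (_ : j%:R <= _); first by rewrite ler_nat.
by rewrite -natrX ler_nat ltnW// ltn_expl.
Qed.

(** The weight is a constant on ball times [E], for the smooth part, plus the sum of A (q/2)^j e_j,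
    for the pieces. The j-th term has integral at most A A' 2^-j in either variable, by the symmetry
    of [e]. One weight serves all truncations J. *)
Let weight r : exists (w : V * V -> \bar R) (M : R),
  [/\ measurable_fun setT w, (forall z, (0 <= w z)%E),
      (forall J x y, `|x| <= r -> E y -> ((normc (k_ J x y))%:E <= w (x, y))%E),
      (forall x, `|x| <= r -> (\int[mu]_y w (x, y) <= M%:E)%E) &
      (forall y, E y -> (\int[mu]_x w (x, y) <= M%:E)%E)].
Proof.
have [rE rE0 HE] := compact_sub_ball cE; pose r0 := Num.max r rE.
have [A A0 HA] := k_bound r; have [A' A'0 HA'] := e_integral r0.
have [B B0 HB] := compact_cdbound 0 oT2 (@closed_ball_compact_rV R (N + N) r0) (@subsetT _ _) csmooth_koo.
have mE : measurable E := compact_measurable_rV cE.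
have mD : measurable (ball0 r) := compact_measurable_rV (cB r).
pose u (z : V * V) := 2 * B * (\1_(ball0 r) z.1 * \1_E z.2).
have u0 z : 0 <= u z by rewrite !mulr_ge0.
pose c j := A * (q / 2) ^+ j.
have c0 j : 0 <= c j by rewrite mulr_ge0// exprn_ge0// divr_ge0// ltW.
have ce0 j z : (0 <= (c j * e j z)%:E)%E by rewrite lee_fin mulr_ge0// bump_ge0.
pose w z : \bar R := ((u z)%:E + \sum_(0 <= j <oo) (c j * e j z)%:E)%E.
have S0 z : (0 <= \sum_(0 <= j <oo) (c j * e j z)%:E)%E by apply: nneseries_ge0 => j _ _; exact: ce0.
have mu_ : measurable_fun setT (EFin \o u).
  apply: measurableT_comp => //; apply: measurable_funM => //; apply: measurable_funM.
    by apply: (measurableT_comp (measurable_indic mD)); exact: measurable_fst.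
  by apply: (measurableT_comp (measurable_indic mE)); exact: measurable_snd.
have mce j : measurable_fun setT (fun z => (c j * e j z)%:E).
  by apply: measurableT_comp => //; apply: measurable_funM.
have mS : measurable_fun setT (fun z => \sum_(0 <= j <oo) (c j * e j z)%:E)%E.
  by apply: (@ge0_emeasurable_sum _ _ _ setT (fun j z => (c j * e j z)%:E) xpredT) => // j z _ _; exact: ce0.
have sumb (I : nat -> \bar R) : (forall j, (0 <= I j)%E) -> (forall j, (I j <= (c j * (A' * q ^- j))%:E)%E) ->
    (\sum_(0 <= j <oo) I j <= (A * A' * 2)%:E)%E.
  move=> I0 HI; apply: nneseries_le => // n; apply: (@le_trans _ _ (\sum_(0 <= j < n) (A * A' * 2^-1 ^+ j)%:E)%E).
    apply: lee_sum => j _; apply: le_trans (HI j) _; rewrite lee_fin /c.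
    rewrite (_ : A * _ * _ = A * A' * 2^-1 ^+ j)//.
    have qj : q ^+ j != 0 by rewrite expf_neq0// lt0r_neq0.
    by rewrite exprMn; move: (q ^+ j) (2^-1 ^+ j) qj => X Y X0; field.
  by rewrite sumEFin lee_fin -mulr_sumr ler_wpM2l ?mulr_ge0// sum_half_le.
pose M := 2 * B * fine (mu E) + 2 * B * fine (mu (ball0 r)) + A * A' * 2.
have F0 (D : set V) : 0 <= fine (mu D) by rewrite fine_ge0.
have Fk (D : set V) : compact D -> mu D = (fine (mu D))%:E.
  by move=> cD; rewrite fineK// ge0_fin_numE//; exact: compact_finite_measure.
exists w, M; split.
- exact: emeasurable_funD.
- by move=> z; rewrite adde_ge0// lee_fin.
- move=> J x y xr Ey; rewrite kE; apply: (@le_trans _ _ (u (x, y) + \sum_(0 <= j < J) c j * e j (x, y))%:E); last first.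
    rewrite EFinD leeD2l// -sumEFin; exact: (nneseries_lim_ge J (fun j _ _ => ce0 j (x, y))).
  rewrite lee_fin; apply: le_trans (ler_normcD _ _) _; apply: lerD.
    rewrite /u /= !indicE !mem_set//= !mulr1.
    have := HB (row_mx x y); rewrite /= => H.
    have {}H : `|row_mx x y| <= r0 by apply: rV_norm_row_mx; rewrite le_max ?xr// HE// orbT.
    by have := cdboundW (HB _ H); rewrite row_mxKl row_mxKr.
  apply: le_trans (normc_sum _ _) _; apply: ler_sum => j _.
  have [b1 b2 _] := HA j x y xr.
  have [wr|wr] := leP `|iter j Dl (mul (- x) y)| rho; last by rewrite /kj /BB b2// normc_c0 mulr_ge0// bump_ge0.
  by rewrite /e /= bump1// mulr1.
- move=> x xr; rewrite (ge0_integralD _ measurableT) => [||||]; last 4 first.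
  + by move=> y _; rewrite lee_fin.
  + exact: (measurableT_comp mu_).
  + by move=> y _; exact: S0.
  + exact: (measurableT_comp mS).
  rewrite integral_nneseries => [||j|j y _]; last 3 first.
  + exact: measurableT.
  + exact: (measurableT_comp (mce j)).
  + exact: ce0.
  have b1 : (\int[mu]_y (u (x, y))%:E <= (2 * B * fine (mu E))%:E)%E.
    rewrite (eq_integral (fun y => (2 * B)%:E * (\1_E y)%:E)%E); last first.
      by move=> y _; rewrite /u /= [\1_(ball0 r) x]indicE mem_set// mul1r.
    rewrite ge0_integralZl//; last 2 first.
    + by apply: measurableT_comp => //; exact: measurable_indic.
    + by rewrite lee_fin mulr_ge0.
    by rewrite integral_indic// setIT [leRHS]EFinM -(Fk _ cE).
  have b2 : (\sum_(0 <= j <oo) (\int[mu]_y (c j * e j (x, y))%:E) <= (A * A' * 2)%:E)%E.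
    apply: sumb => j; first by apply: integral_ge0 => y _; exact: ce0.
    rewrite (eq_integral (fun y => (c j)%:E * (e j (x, y))%:E)%E); last by move=> y _; rewrite EFinM.
    rewrite ge0_integralZl//; last 3 first.
    + apply: measurableT_comp => //; exact: (measurableT_comp (me j)).
    + by move=> y _; rewrite lee_fin bump_ge0.
    + by rewrite lee_fin.
    rewrite [X in (_ <= X)%E]EFinM; apply: lee_wpmul2l; first by rewrite lee_fin.
    by apply: HA'; rewrite le_max xr.
  apply: le_trans (leeD b1 b2) _; rewrite -EFinD lee_fin /M lerD2r lerDl !mulr_ge0//.
- move=> y Ey; rewrite (ge0_integralD _ measurableT) => [||||]; last 4 first.
  + by move=> x _; rewrite lee_fin.
  + exact: (measurableT_comp mu_).
  + by move=> x _; exact: S0.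
  + exact: (measurableT_comp mS).
  rewrite integral_nneseries => [||j|j x _]; last 3 first.
  + exact: measurableT.
  + exact: (measurableT_comp (mce j)).
  + exact: ce0.
  have b1 : (\int[mu]_x (u (x, y))%:E <= (2 * B * fine (mu (ball0 r)))%:E)%E.
    rewrite (eq_integral (fun x => (2 * B)%:E * (\1_(ball0 r) x)%:E)%E); last first.
      by move=> x _; rewrite /u /= [\1_E y]indicE mem_set// mulr1.
    rewrite ge0_integralZl//; last 2 first.
    + by apply: measurableT_comp => //; exact: measurable_indic.
    + by rewrite lee_fin mulr_ge0.
    by rewrite integral_indic// setIT [leRHS]EFinM -(Fk _ (cB r)).
  have b2 : (\sum_(0 <= j <oo) (\int[mu]_x (c j * e j (x, y))%:E) <= (A * A' * 2)%:E)%E.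
    apply: sumb => j; first by apply: integral_ge0 => x _; exact: ce0.
    rewrite (eq_integral (fun x => (c j)%:E * (e j (y, x))%:E)%E); last by move=> x _; rewrite EFinM e_sym.
    rewrite ge0_integralZl//; last 3 first.
    + apply: measurableT_comp => //; exact: (measurableT_comp (me j)).
    + by move=> x _; rewrite lee_fin bump_ge0.
    + by rewrite lee_fin.
    rewrite [X in (_ <= X)%E]EFinM; apply: lee_wpmul2l; first by rewrite lee_fin.
    by apply: HA'; rewrite le_max HE// orbT.
  apply: le_trans (leeD b1 b2) _; rewrite -EFinD lee_fin /M lerD2r lerDr !mulr_ge0//.
Qed.

Let slice (H : V * V -> R) y : measurable_fun setT H -> measurable_fun setT (fun x => H (x, y)).
Proof. by move=> mH; exact: measurableT_comp. Qed.

(* [k1 + i k2] is the kernel of the map [P eta -> commutator P phi eta]: the commutator lowers the order of the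
   singularity of the fundamental solution, which makes the kernel integrable in each variable. *)
Lemma commutator_kernel : exists k1 k2 : V * V -> R, [/\ schur_kernel E k1, schur_kernel E k2 &
  forall eta d, csupp (ball0 d) eta -> forall y, E y -> let zeta := P eta in commutator P phi eta y =
    ((\int[mu]_x (k1 (x, y) * re_part zeta x) - \int[mu]_x (k2 (x, y) * im_part zeta x)) +i*
     (\int[mu]_x (k1 (x, y) * im_part zeta x) + \int[mu]_x (k2 (x, y) * re_part zeta x)))%C].
Proof.
have /choice[n Hn] : forall z : V * V, exists n, forall J, (n <= J)%N -> k_ J z.1 z.2 = k_ n z.1 z.2.
  by move=> z; exact: k_stable.
(* The kernel is the value at which the truncations stabilize, so no limit of kernels has to be
   formed. *)
pose k (z : V * V) := k_ (n z) z.1 z.2.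
have mk J : measurable_fun setT (fun z : V * V => complex.Re (k_ J z.1 z.2)) /\
            measurable_fun setT (fun z : V * V => complex.Im (k_ J z.1 z.2)).
  have [c1 c2] := csmooth_continuous (csmooth_k J).
  split; [have := continuous_measurable_pair c1|have := continuous_measurable_pair c2]; congr (measurable_fun _ _);
  by apply/funext => z; rewrite /re_part /im_part !row_mxKl !row_mxKr.
have stable (h : C -> R) : (forall J, measurable_fun setT (fun z : V * V => h (k_ J z.1 z.2))) ->
    (forall c, `|h c| <= normc c) -> schur_kernel E (fun z => h (k z)).
  move=> mh hn; split.
    apply: (@measurable_fun_cvg _ _ _ setT (fun J z => h (k_ J z.1 z.2))) => // z _.
    by apply: cvg_near_cst; exists (n z) => // J /= nJ; rewrite Hn.
  move=> r; have [w [M [mw w0 kw w1 w2]]] := weight r; exists w, M; split=> // x y xr Ey.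
  by apply: le_trans (kw (n (x, y)) x y xr Ey); rewrite lee_fin; exact: hn.
exists (fun z => complex.Re (k z)), (fun z => complex.Im (k z)).
have s1 := stable (@complex.Re R) (fun J => (mk J).1) (@Re_le_normc R).
have s2 := stable (@complex.Im R) (fun J => (mk J).2) (@Im_le_normc R).
split=> // eta d seta y Ey zeta.
have [sz Sz] : csupp (ball0 d) zeta := csupp_op sP (cB d) seta.
have [cz1 cz2] := csmooth_continuous sz.
have [A HA] := parametrix_expansion smul mulA mul0l mulx0 mulNl mul_exp sP PT DK D'K contr a1 aq jac sgamma sgoo expansion
  seta `|y| sBB.
have sslice J : csmooth setT (fun x => k_ J x y).
  have H := smooth_map_row_mx (smooth_map_id oT) (smooth_map_cst y oT).
  have := csmooth_comp oT oT2 H (csmooth_k J) (fun _ _ => Logic.I).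
  by congr (csmooth _ _); apply/funext => x; rewrite row_mxKl row_mxKr.
have lim (h : C -> R) (u : V -> R) : continuous u -> (forall x, ~ ball0 d x -> u x = 0) ->
    (forall J, measurable_fun setT (fun z : V * V => h (k_ J z.1 z.2))) -> (forall c, `|h c| <= normc c) ->
    (fun J => \int[mu]_x (h (k_ J x y) * u x)) @ \oo --> \int[mu]_x (h (k (x, y)) * u x).
  move=> cu Su mh hn; have [w [M [mw w0 kw _ w2]]] := weight d.
  have [Z Z0 HZ] := csupp_bounded (cB d) cu Su.
  have muu : measurable_fun setT u by exact: continuous_measurable_rV.
  have mwy : measurable_fun setT (fun x => w (x, y)) by exact: measurableT_comp.
  apply: (@Rintegral_cvg_dominated _ _ _ mu _ _ (fun x => Z%:E * w (x, y))%E).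
  - move=> J; exact: (measurable_funM (@slice (fun z => h (k_ J z.1 z.2)) y (mh J)) muu).
  - exact: (measurable_funM (@slice (fun z => h (k z)) y (stable h mh hn).1) muu).
  - by move=> x; exists (n (x, y)) => J nJ; rewrite (Hn (x, y) J nJ).
  - exact: measurable_funeM.
  - rewrite (ge0_integralZl _ measurableT mwy (fun x _ => w0 _)); last by rewrite lee_fin.
    apply: (@le_lt_trans _ _ (Z%:E * M%:E)%E); last by rewrite -EFinM ltry.
    by apply: lee_wpmul2l => //; exact: w2.
  - move=> J x; have [xd|/Su ->] := pselect (ball0 d x); last by rewrite mulr0 normr0 mule_ge0.
    rewrite normrM mulrC EFinM; apply: lee_pmul; rewrite ?lee_fin//.
    by apply: le_trans (kw J x y xd Ey); rewrite lee_fin; exact: hn.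
have Sr := supported_re Sz; have Si := supported_im Sz.
have L11 := lim (@complex.Re R) _ cz1 Sr (fun J => (mk J).1) (@Re_le_normc R).
have L12 := lim (@complex.Re R) _ cz2 Si (fun J => (mk J).1) (@Re_le_normc R).
have L21 := lim (@complex.Im R) _ cz1 Sr (fun J => (mk J).2) (@Im_le_normc R).
have L22 := lim (@complex.Im R) _ cz2 Si (fun J => (mk J).2) (@Im_le_normc R).
have ic (f g : V -> R) : continuous f -> continuous g -> (forall x, ~ ball0 d x -> g x = 0) ->
    mu.-integrable setT (EFin \o (fun x => f x * g x)).
  move=> cf cg Sg; apply: (integrable_csupp (cB d)); last by move=> x /Sg ->; rewrite mulr0.
  by move=> x; apply: continuousM; [exact: cf|exact: cg].
have c1 J := (csmooth_continuous (sslice J)).1.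
have c2 J := (csmooth_continuous (sslice J)).2.
(* Both sides are limits of the integrals of zeta against the truncated kernels: one by
   [parametrix_expansion], the other by dominated convergence. The limit is unique. *)
apply: complex_eq => /=.
- apply: (etrans (esym (cvg_lim (@Rhausdorff R) _)) (cvg_lim (@Rhausdorff R) (cvgB L11 L22))).
  apply: (cvg_geometric_bound a1) => J; apply: le_trans (HA J y (lexx _)).
  have E1 : \int[mu]_x (complex.Re (k_ J x y) * re_part zeta x) - \int[mu]_x (complex.Im (k_ J x y) * im_part zeta x) =
      \int[mu]_x re_part (fun x => zeta x * k_ J x y) x.
    apply: (etrans (esym (RintegralB measurableT (ic _ _ (c1 J) cz1 Sr) (ic _ _ (c2 J) cz2 Si)))).
    by apply: eq_Rintegral => x _; rewrite /re_part /im_part ReM mulrC [in X in _ - X]mulrC.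
  apply: le_trans (_ : `|complex.Re (BB eta y) - \int[mu]_x re_part (fun x => zeta x * k_ J x y) x| <= _); first by rewrite -E1.
  by have := Re_le_normc (BB eta y - cintegral setT (fun x => zeta x * k_ J x y)); rewrite ReD ReN; exact.
- apply: (etrans (esym (cvg_lim (@Rhausdorff R) _)) (cvg_lim (@Rhausdorff R) (cvgD L12 L21))).
  apply: (cvg_geometric_bound a1) => J; apply: le_trans (HA J y (lexx _)).
  have E1 : \int[mu]_x (complex.Re (k_ J x y) * im_part zeta x) + \int[mu]_x (complex.Im (k_ J x y) * re_part zeta x) =
      \int[mu]_x im_part (fun x => zeta x * k_ J x y) x.
    apply: (etrans (esym (RintegralD measurableT (ic _ _ (c1 J) cz2 Si) (ic _ _ (c2 J) cz1 Sr)))).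
    by apply: eq_Rintegral => x _; rewrite /re_part /im_part ImM addrC mulrC [in X in _ + X]mulrC.
  apply: le_trans (_ : `|complex.Im (BB eta y) - \int[mu]_x im_part (fun x => zeta x * k_ J x y) x| <= _); first by rewrite -E1.
  by have := Im_le_normc (BB eta y - cintegral setT (fun x => zeta x * k_ J x y)); rewrite ImD ImN; exact.
Qed.

End commutator_kernel.

(** * Local p-integrability of real and imaginary parts *)

Section local_lp.
Context {R : realType} {N : nat}.
Local Notation C := R[i].
Local Notation V := 'rV[R]_N.
Local Notation normc := (@Normc.normc R).
Local Notation mu := (lebesgue_rV N).
Local Notation ball0 r := [set x : V | `|x| <= r].
Local Notation cB r := (@closed_ball_compact_rV R N r).

Variable p : R.
Hypothesis p1 : 1 <= p.
Let p0 : 0 < p. Proof. exact: lt_le_trans p1. Qed.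

Lemma Lp_normE (D : set V) (f : V -> C) :
  Lp_norm p D f = ((\int[mu]_(x in D) (normc (f x) `^ p)%:E) `^ p^-1)%E.
Proof.
rewrite /Lp_norm unlock; congr (_ `^ _)%E; rewrite [RHS]integral_mkcond; apply: eq_integral => x _.
by rewrite /patch; case: ifP => _; [rewrite /= ger0_norm ?normc_ge0|rewrite /= normr0 powR0 ?gt_eqF].
Qed.

Lemma Lp_norm_lty (D : set V) (f : V -> C) :
  (Lp_norm p D f < +oo)%E <-> (\int[mu]_(x in D) (normc (f x) `^ p)%:E < +oo)%E.
Proof.
rewrite Lp_normE; split; last exact: poweR_lty.
by apply: lty_poweRy; rewrite invr_eq0 gt_eqF.
Qed.

Lemma Lp_norm_le1 (D : set V) (f : V -> C) :
  (\int[mu]_(x in D) (normc (f x) `^ p)%:E <= 1)%E -> (Lp_norm p D f <= 1)%E.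
Proof.
move=> H; rewrite Lp_normE -(poweR1r p^-1); apply: gt0_ler_poweR => //.
- by rewrite invr_ge0 ltW.
- by rewrite in_itv/= leey andbT; apply: integral_ge0 => x _; rewrite lee_fin powR_ge0.
- by rewrite in_itv/= leey andbT.
Qed.

Lemma powR_normD (s t : R) : `|s + t| `^ p <= 2 `^ p * (`|s| `^ p + `|t| `^ p).
Proof.
have key (u v : R) : `|u| <= `|v| -> `|u + v| `^ p <= 2 `^ p * `|v| `^ p.
  move=> uv; rewrite -powRM//; apply: (ge0_ler_powR (ltW p0)); rewrite ?nnegrE ?mulr_ge0//.
  by apply: le_trans (ler_normD _ _) _; rewrite mulr_natl mulr2n lerD2r.
case: (leP `|s| `|t|) => [st|/ltW ts].
  by apply: le_trans (key _ _ st) _; rewrite ler_wpM2l ?powR_ge0// lerDr powR_ge0.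
by rewrite addrC; apply: le_trans (key _ _ ts) _; rewrite ler_wpM2l ?powR_ge0// lerDl powR_ge0.
Qed.

(** Closed balls suffice to test compact sets, and real functions suffice since real and imaginary
    parts are treated separately. *)
Definition real_lploc (u : V -> R) :=
  measurable_fun setT u /\ forall r, (\int[mu]_(x in ball0 r) (`|u x| `^ p)%:E < +oo)%E.

Lemma measurable_norm_powR (u : V -> R) D : measurable_fun setT u -> measurable_fun D (fun x => (`|u x| `^ p)%:E).
Proof.
move=> mu'; apply: measurable_funTS; apply: measurableT_comp => //.
by apply: (measurableT_comp (measurable_powR p)); exact: measurableT_comp.
Qed.

Lemma integral_powR_lt (D : set V) (u v w : V -> R) (M : R) : measurable D -> measurable_fun setT v -> measurable_fun setT w ->
  measurable_fun D (fun x => (u x)%:E) -> (forall x, D x -> 0 <= u x) ->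
  (forall x, D x -> u x <= M * (`|v x| `^ p + `|w x| `^ p)) -> 0 <= M ->
  (\int[mu]_(x in D) (`|v x| `^ p)%:E < +oo)%E -> (\int[mu]_(x in D) (`|w x| `^ p)%:E < +oo)%E ->
  (\int[mu]_(x in D) (u x)%:E < +oo)%E.
Proof.
move=> mD mv mw mu' u0 uvw M0 vfin wfin.
have nn (z : V -> R) x : D x -> (0 <= (`|z x| `^ p)%:E)%E by move=> _; rewrite lee_fin powR_ge0.
apply: (@le_lt_trans _ _ (\int[mu]_(x in D) (M%:E * ((`|v x| `^ p)%:E + (`|w x| `^ p)%:E)))%E).
  apply: (@ge0_le_integral _ _ _ mu D mD).
  - by move=> x Dx; rewrite lee_fin; exact: u0.
  - exact: mu'.
  - by apply: measurable_funeM; apply: emeasurable_funD; exact: measurable_norm_powR.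
  - by move=> x Dx; rewrite -EFinD -EFinM lee_fin; exact: uvw.
rewrite (ge0_integralZl mu mD); last first.
- by rewrite lee_fin.
- by move=> x Dx; rewrite adde_ge0// nn.
- by apply: emeasurable_funD; exact: measurable_norm_powR.
rewrite (ge0_integralD mu mD (nn v) (measurable_norm_powR mv) (nn w) (measurable_norm_powR mw)).
have M0' : (0 <= M%:E)%E by rewrite lee_fin.
exact: (lte_mul_pinfty M0' isT (lte_add_pinfty vfin wfin)).
Qed.

Let mball r : measurable (ball0 r) := compact_measurable_rV (cB r).

Lemma real_lplocD (u v : V -> R) : real_lploc u -> real_lploc v -> real_lploc (fun x => u x + v x).
Proof.
move=> [mu1 u1] [mv1 v1]; split=> [|r]; first exact: measurable_funD.
apply: (@integral_powR_lt (ball0 r) _ u v (2 `^ p)) => //.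
- by apply: measurable_norm_powR; exact: measurable_funD.
- by move=> x _; exact: powR_normD.
Qed.

Lemma real_lplocM (c u : V -> R) : measurable_fun setT c -> (exists Z, forall x, `|c x| <= Z) -> real_lploc u -> real_lploc (fun x => c x * u x).
Proof.
move=> mc [Z HZ] [mu1 u1]; have Z0 : 0 <= Z := le_trans (normr_ge0 _) (HZ 0).
split=> [|r]; first exact: measurable_funM.
apply: (@integral_powR_lt (ball0 r) _ u u (Z `^ p)) => //.
- by apply: measurable_norm_powR; exact: measurable_funM.
- move=> x _; rewrite normrM powRM//; apply: ler_pM; [exact: powR_ge0|exact: powR_ge0| |by rewrite lerDl powR_ge0].
  by apply: (ge0_ler_powR (ltW p0)); rewrite ?nnegrE.
- exact: powR_ge0.
Qed.

Lemma measurable_normc (D : set V) (f : V -> C) : measurable_fun D (re_part f) -> measurable_fun D (im_part f) ->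
  measurable_fun D (fun x => normc (f x)).
Proof.
move=> m1 m2; rewrite (_ : (fun x => _) = fun x => (re_part f x ^+ 2 + im_part f x ^+ 2) `^ 2^-1); last first.
  apply/funext => x; rewrite powR12_sqrt ?addr_ge0 ?sqr_ge0//.
  by rewrite /re_part /im_part; case: (f x).
apply: (measurableT_comp (measurable_powR 2^-1)).
by apply: measurable_funD; apply: measurable_funX.
Qed.

Lemma Lp_loc_real (g : V -> C) : real_lploc (re_part g) -> real_lploc (im_part g) -> Lp_loc p setT g.
Proof.
move=> [m1 g1] [m2 g2]; split=> // D cD _; apply/Lp_norm_lty.
have [r _ Dr] := compact_sub_ball cD; have mD : measurable D := compact_measurable_rV cD.
have sub (u : V -> R) : measurable_fun setT u -> (\int[mu]_(x in ball0 r) (`|u x| `^ p)%:E < +oo)%E ->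
    (\int[mu]_(x in D) (`|u x| `^ p)%:E < +oo)%E.
  move=> mu'; apply: le_lt_trans; apply: ge0_subset_integral => //.
  exact: measurable_norm_powR.
apply: (@integral_powR_lt D _ (re_part g) (im_part g) (2 `^ p) mD m1 m2) => //; last 2 first.
- exact: (sub _ m1 (g1 r)).
- exact: (sub _ m2 (g2 r)).
- have := @measurable_norm_powR _ D (measurable_normc m1 m2); congr (measurable_fun _ _).
  by apply/funext => x; rewrite ger0_norm ?normc_ge0.
- by move=> x _; exact: powR_ge0.
- move=> x _; apply: le_trans (_ : `|(`|re_part g x| + `|im_part g x|)| `^ p <= _); last first.
    by have := powR_normD `|re_part g x| `|im_part g x|; rewrite !normr_id.
  apply: (ge0_ler_powR (ltW p0)); rewrite ?nnegrE ?normc_ge0//.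
  by apply: le_trans (normc_le _) _; exact: ler_norm.
Qed.

Lemma lp_integrable (E : set V) (f u : V -> R) : compact E -> measurable_fun setT f -> (forall y, ~ E y -> f y = 0) ->
  (\int[mu]_y (`|f y| `^ p)%:E < +oo)%E -> continuous u -> mu.-integrable setT (EFin \o (fun y => f y * u y)).
Proof.
move=> cE mf fE ffin cu; have mE : measurable E := compact_measurable_rV cE.
have [Z Z0 HZ] : exists2 Z, 0 <= Z & forall y, E y -> `|u y| <= Z.
  have cc : {within E, continuous u} by apply: continuous_subspaceT.
  have [Z [_ HZ]] := compact_bounded (continuous_compact cc cE).
  exists (`|Z| + 1) => [|y Ey]; first by rewrite addr_ge0.
  by apply: HZ; [apply: le_lt_trans (ler_norm Z) _; rewrite ltrDl|exists y].
apply/integrableP; split.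
  by apply: measurableT_comp => //; apply: measurable_funM => //; exact: continuous_measurable_rV.
apply: (@le_lt_trans _ _ (\int[mu]_y (Z%:E * ((\1_E y)%:E + (`|f y| `^ p)%:E)))%E).
  apply: ge0_le_integral => //.
  - apply: measurableT_comp => //; apply: measurableT_comp => //.
    by apply: measurable_funM => //; exact: continuous_measurable_rV.
  - apply: measurable_funeM; apply: emeasurable_funD; last exact: measurable_norm_powR.
    by apply: measurableT_comp => //; exact: measurable_indic.
  - move=> y _ /=; rewrite -EFinD -EFinM lee_fin normrM mulrC.
    have [Ey|/fE ->] := pselect (E y); last by rewrite normr0 mulr0 mulr_ge0// addr_ge0// powR_ge0.
    apply: ler_pM => //; first exact: HZ.
    by rewrite indicE mem_set//=; exact: le1_powR.
have m1 : measurable_fun setT (fun y : V => (\1_E y)%:E : \bar R).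
  by apply: measurableT_comp => //; exact: measurable_indic.
rewrite (ge0_integralZl mu measurableT); last first.
- by rewrite lee_fin.
- by move=> y _; rewrite adde_ge0// lee_fin powR_ge0.
- by apply: emeasurable_funD => //; exact: measurable_norm_powR.
apply: lte_mul_pinfty; [by rewrite lee_fin|by []|].
have i0 (y : V) : setT y -> (0 <= (\1_E y)%:E :> \bar R)%E by move=> _; rewrite lee_fin.
have f0 y : setT y -> (0 <= (`|f y| `^ p)%:E)%E by move=> _; rewrite lee_fin powR_ge0.
rewrite (ge0_integralD mu measurableT i0 m1 f0 (measurable_norm_powR (D := setT) mf)).
by rewrite integral_indic// setIT; apply: lte_add_pinfty => //; exact: compact_finite_measure.
Qed.

End local_lp.

Section same_cintegral.
Context {R : realType} {N : nat}.
Local Notation C := R[i].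
Local Notation V := 'rV[R]_N.
Local Notation mu := (lebesgue_rV N).

Definition cintegrable (h : V -> C) :=
  mu.-integrable setT (EFin \o re_part h) /\ mu.-integrable setT (EFin \o im_part h).

(** Integrability is bundled with the equality of integrals so that such equalities can be added
    term by term. *)
Definition same_cintegral (h h' : V -> C) :=
  [/\ cintegrable h, cintegrable h' & cintegral setT h = cintegral setT h'].

Lemma cintegrableD h h' : cintegrable h -> cintegrable h' -> cintegrable (fun x => h x + h' x).
Proof.
move=> [r1 i1] [r2 i2]; split.
  by have := integrableD measurableT r1 r2; congr (integrable _ _ _); apply/funext => x; rewrite /= /re_part ReD.
by have := integrableD measurableT i1 i2; congr (integrable _ _ _); apply/funext => x; rewrite /= /im_part ImD.
Qed.

Lemma cintegralD_integrable h h' : cintegrable h -> cintegrable h' ->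
  cintegral setT (fun x => h x + h' x) = cintegral setT h + cintegral setT h'.
Proof.
move=> [r1 i1] [r2 i2]; apply: complex_eq; rewrite ?ReD ?ImD /cintegral /= ?re_partD ?im_partD.
  exact: (RintegralD measurableT r1 r2).
exact: (RintegralD measurableT i1 i2).
Qed.

Lemma same_cintegralD h1 h1' h2 h2' : same_cintegral h1 h1' -> same_cintegral h2 h2' ->
  same_cintegral (fun x => h1 x + h2 x) (fun x => h1' x + h2' x).
Proof.
move=> [a a' aa] [b b' bb]; split; [exact: cintegrableD|exact: cintegrableD|].
by rewrite !cintegralD_integrable// aa bb.
Qed.

(* Taking (c, d) among (1, 0), (0, 1), (-1, 0), (0, -1) multiplies a real identity by a power of i. *)
Lemma same_cintegral_real (u v : V -> R) (c d : R) :
  mu.-integrable setT (EFin \o u) -> mu.-integrable setT (EFin \o v) ->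
  \int[mu]_x u x = \int[mu]_x v x ->
  same_cintegral (fun x => (c * u x +i* (d * u x))%C) (fun x => (c * v x +i* (d * v x))%C).
Proof.
move=> iu iv uv; have Z (e : R) w : mu.-integrable setT (EFin \o w) -> mu.-integrable setT (EFin \o (fun x : V => e * w x)).
  by move=> iw; have := integrableZl measurableT e iw; congr (integrable _ _ _); apply/funext => x; rewrite /= EFinM.
split; [split; exact: Z|split; exact: Z|].
by apply: complex_eq; rewrite /cintegral /= /re_part /im_part /= (RintegralZl _ measurableT iu) (RintegralZl _ measurableT iv) uv.
Qed.

End same_cintegral.

(** * Localization of a function by means of the kernel *)

Section localization.
Context {R : realType} {N : nat}.
Local Notation C := R[i].
Local Notation V := 'rV[R]_N.
Local Notation normc := (@Normc.normc R).
Local Notation mu := (lebesgue_rV N).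
Local Notation ball0 r := [set x : V | `|x| <= r].
Local Notation cB r := (@closed_ball_compact_rV R N r).
Let oT : open [set: V] := openT.

Variables (P : (V -> C) -> V -> C) (E : set V) (phi : V -> C) (k1 k2 : V * V -> R).
Hypotheses (sP : smooth_op P) (cE : compact E) (sphi : csupp E phi).
Hypotheses (sk1 : schur_kernel E k1) (sk2 : schur_kernel E k2).
Hypothesis kernel : forall eta d, csupp (ball0 d) eta -> forall y, E y -> let zeta := P eta in commutator P phi eta y =
    ((\int[mu]_x (k1 (x, y) * re_part zeta x) - \int[mu]_x (k2 (x, y) * im_part zeta x)) +i*
     (\int[mu]_x (k1 (x, y) * im_part zeta x) + \int[mu]_x (k2 (x, y) * re_part zeta x)))%C.

(** Writing P (phi eta) = phi P eta + [P, phi] eta, the second term tested against [F] becomes,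
    after Fubini, the integral of P eta against the kernel transform of [F], which is locally in L^p
    by the Schur test. *)
Lemma localized_solution (p : R) (F : V -> C) : 1 <= p -> measurable_fun setT (re_part F) -> measurable_fun setT (im_part F) ->
  supported E F -> (\int[mu]_y (`|re_part F y| `^ p)%:E < +oo)%E -> (\int[mu]_y (`|im_part F y| `^ p)%:E < +oo)%E ->
  exists g, Lp_loc p setT g /\ forall eta, test_fun setT eta ->
    cintegral setT (fun x => g x * P eta x) = cintegral setT (fun x => F x * P (fun y => phi y * eta y) x).
Proof.
move=> p1 m1 m2 SF p_1 p_2; have S1 := supported_re SF; have S2 := supported_im SF.
have [cphi1 cphi2] := csmooth_continuous sphi.1.
pose K11 := kernel_integral (re_part F) k1; pose K12 := kernel_integral (re_part F) k2.
pose K21 := kernel_integral (im_part F) k1; pose K22 := kernel_integral (im_part F) k2.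
have lK (f : V -> R) (k : V * V -> R) : measurable_fun setT f -> (forall y, ~ E y -> f y = 0) -> (\int[mu]_y (`|f y| `^ p)%:E < +oo)%E ->
    schur_kernel E k -> real_lploc p (kernel_integral f k).
  move=> mf Sf ff sk; split; first exact: (measurable_kernel_integral cE mf Sf p1 ff sk).
  by move=> r; exact: (kernel_integral_lp cE mf Sf p1 ff sk).
have l11 := lK _ _ m1 S1 p_1 sk1; have l12 := lK _ _ m1 S1 p_1 sk2.
have l21 := lK _ _ m2 S2 p_2 sk1; have l22 := lK _ _ m2 S2 p_2 sk2.
have lF (f : V -> R) : measurable_fun setT f -> (\int[mu]_y (`|f y| `^ p)%:E < +oo)%E -> real_lploc p f.
  move=> mf ff; split=> [|r]; first exact: mf.
  apply: le_lt_trans ff; apply: ge0_subset_integral.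
  - exact: compact_measurable_rV (cB r).
  - exact: measurableT.
  - exact: measurable_norm_powR.
  - by move=> x _; rewrite lee_fin powR_ge0.
  - exact: subsetT.
have lF1 := lF _ m1 p_1; have lF2 := lF _ m2 p_2.
have bphi (u : V -> R) : continuous u -> (forall y, ~ E y -> u y = 0) -> measurable_fun setT u /\ exists Z, forall x, `|u x| <= Z.
  move=> cu Su; split; first exact: continuous_measurable_rV.
  by have [Z _ HZ] := csupp_bounded cE cu Su; exists Z.
have [mph1 bph1] := bphi _ cphi1 (supported_re sphi.2); have [mph2 bph2] := bphi _ cphi2 (supported_im sphi.2).
have mN (u : V -> R) : real_lploc p u -> real_lploc p (fun x => (-1) * u x).
  apply: (real_lplocM p1) => [|]; first exact: measurable_cst.
  by exists 1 => x; rewrite normrN1.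
(* phi F plus the integral of F(y) k(x, y) in y for the complex kernel k = k1 + i k2, expanded into
   real and imaginary parts. *)
pose g x := phi x * F x + ((K11 x - K22 x) +i* (K12 x + K21 x))%C.
exists g; split.
  apply: (Lp_loc_real p1).
  - have -> : re_part g = fun x => (re_part phi x * re_part F x + (-1) * (im_part phi x * im_part F x)) + (K11 x + (-1) * K22 x).
      by apply/funext => x; rewrite /re_part /im_part ReD ReM /= !mulN1r.
    exact: (real_lplocD p1 (real_lplocD p1 (real_lplocM p1 mph1 bph1 lF1) (mN _ (real_lplocM p1 mph2 bph2 lF2))) (real_lplocD p1 l11 (mN _ l22))).
  - have -> : im_part g = fun x => (re_part phi x * im_part F x + im_part phi x * re_part F x) + (K12 x + K21 x).
      by apply/funext => x; rewrite /re_part /im_part ImD ImM.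
    exact: (real_lplocD p1 (real_lplocD p1 (real_lplocM p1 mph1 bph1 lF2) (real_lplocM p1 mph2 bph2 lF1)) (real_lplocD p1 l12 l21)).
move=> eta [seta [D [cD _ SD]]]; have [d d0 Dd] := compact_sub_ball cD.
have seta' : csupp (ball0 d) eta by split=> //; exact: supported_subset Dd SD.
pose zeta := P eta; have [sz Sz] : csupp (ball0 d) zeta := csupp_op sP (cB d) seta'.
have [cz1 cz2] := csmooth_continuous sz; have Sz1 := supported_re Sz; have Sz2 := supported_im Sz.
have base (f : V -> R) (k : V * V -> R) (u : V -> R) : measurable_fun setT f -> (forall y, ~ E y -> f y = 0) -> (\int[mu]_y (`|f y| `^ p)%:E < +oo)%E ->
    schur_kernel E k -> continuous u -> (forall x, ~ ball0 d x -> u x = 0) -> forall c c' : R,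
    same_cintegral (fun y => (c * (f y * \int[mu]_x (k (x, y) * u x)) +i* (c' * (f y * \int[mu]_x (k (x, y) * u x))))%C)
      (fun x => (c * (kernel_integral f k x * u x) +i* (c' * (kernel_integral f k x * u x)))%C).
  move=> mf Sf ff sk cu Su c c'; have [i1 i2 ii] := kernel_integral_fubini cE mf Sf p1 ff sk cu Su.
  exact: same_cintegral_real.
(* One Fubini identity for each of the eight products of a part of F, a part of the kernel and a
   part of zeta, with the power of i that it carries. *)
have H := base _ _ _ m1 S1 p_1 sk1 cz1 Sz1 1 0.
have {}H := same_cintegralD H (base _ _ _ m1 S1 p_1 sk2 cz2 Sz2 (-1) 0).
have {}H := same_cintegralD H (base _ _ _ m1 S1 p_1 sk1 cz2 Sz2 0 1).
have {}H := same_cintegralD H (base _ _ _ m1 S1 p_1 sk2 cz1 Sz1 0 1).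
have {}H := same_cintegralD H (base _ _ _ m2 S2 p_2 sk1 cz1 Sz1 0 1).
have {}H := same_cintegralD H (base _ _ _ m2 S2 p_2 sk2 cz2 Sz2 0 (-1)).
have {}H := same_cintegralD H (base _ _ _ m2 S2 p_2 sk1 cz2 Sz2 (-1) 0).
have {}H := same_cintegralD H (base _ _ _ m2 S2 p_2 sk2 cz1 Sz1 (-1) 0).
have [cw1 cw2] := csmooth_continuous (csmoothM oT sphi.1 sz).
have iF : cintegrable (fun x => F x * (phi x * zeta x)).
  have I (f u : V -> R) := lp_integrable (f := f) (u := u) p1 cE.
  split.
    have := integrableB measurableT (I _ _ m1 S1 p_1 cw1) (I _ _ m2 S2 p_2 cw2).
    by congr (integrable _ _ _); apply/funext => x; rewrite /= /re_part [in RHS]ReM EFinB.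
  have := integrableD measurableT (I _ _ m1 S1 p_1 cw2) (I _ _ m2 S2 p_2 cw1).
  by congr (integrable _ _ _); apply/funext => x; rewrite /= /re_part /im_part [in RHS]ImM EFinD.
have {}H := same_cintegralD (And3 iF iF erefl) H.
have [_ _ {}H] := H; apply: (etrans _ (etrans (esym H) _)); apply: cintegral_ext => x.
- rewrite /g /K11 /K12 /K21 /K22; apply: complex_eq; rewrite !(ReD, ImD, ReM, ImM) /= -/zeta /re_part /im_part; ring.
- have [Ex|xE] := pselect (E x); last by rewrite (SF x xE) (S1 x xE) (S2 x xE) !mul0r; apply: complex_eq; rewrite !(ReD, ImD) /=; ring.
  have -> : P (fun y => phi y * eta y) x = phi x * zeta x + commutator P phi eta x by rewrite /commutator addrC subrK.
  rewrite (kernel seta' Ex) -/zeta mulrDr; congr (_ + _); apply: complex_eq; rewrite !(ReD, ImD, ReM, ImM) /= /re_part /im_part; ring.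
Qed.

End localization.

(** * Localization and removability *)

Section restriction.
Context {R : realType} {N : nat}.
Local Notation C := R[i].
Local Notation V := 'rV[R]_N.
Local Notation normc := (@Normc.normc R).
Local Notation mu := (lebesgue_rV N).
Let oT : open [set: V] := openT.

Variable p : R.
Hypothesis p1 : 1 <= p.
Let p0 : 0 < p. Proof. exact: lt_le_trans p1. Qed.

(** [f] is only known on [Om]; its extension by 0 off the compact set [E] is measurable on the whole
    space and p-integrable. *)
Lemma Lp_loc_restrict (Om E : set V) (f : V -> C) : Lp_loc p Om f -> compact E -> measurable Om -> E `<=` Om -> exists F : V -> C,
  [/\ measurable_fun setT (re_part F), measurable_fun setT (im_part F), supported E F, (forall x, E x -> F x = f x) &
  (\int[mu]_y (`|re_part F y| `^ p)%:E < +oo)%E /\ (\int[mu]_y (`|im_part F y| `^ p)%:E < +oo)%E].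
Proof.
move=> [m1 m2 fl] cE mOm EOm; have mE : measurable E := compact_measurable_rV cE.
have {m1}m1 := measurable_funS mOm EOm m1; have {m2}m2 := measurable_funS mOm EOm m2.
have /(Lp_norm_lty p1) fE := fl E cE EOm.
pose F x := ((re_part f \_ E) x +i* (im_part f \_ E) x)%C.
have part (g : V -> R) : measurable_fun E g -> (forall x, `|g x| <= normc (f x)) ->
    (\int[mu]_y (`|(g \_ E) y| `^ p)%:E < +oo)%E.
  move=> mg gf; apply: le_lt_trans fE.
  have -> : (\int[mu]_y (`|(g \_ E) y| `^ p)%:E = \int[mu]_(y in E) (`|g y| `^ p)%:E)%E.
    rewrite [RHS]integral_mkcond; apply: eq_integral => y _; rewrite /patch.
    by case: ifP => _; [|rewrite normr0 powR0 ?gt_eqF].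
  apply: (@ge0_le_integral _ _ _ mu E mE).
  - by move=> x _; rewrite lee_fin powR_ge0.
  - by apply: measurableT_comp => //; apply: (measurableT_comp (measurable_powR p)); exact: measurableT_comp.
  - by apply: measurableT_comp => //; apply: (measurableT_comp (measurable_powR p)); exact: measurable_normc.
  - move=> x _; rewrite lee_fin; apply: (ge0_ler_powR (ltW p0)); rewrite ?nnegrE ?normc_ge0//.
exists F; split.
- exact: (measurable_restrictT (re_part f) mE).1.
- exact: (measurable_restrictT (im_part f) mE).1.
- by move=> x xE; rewrite /F /patch !memNset.
- by move=> x Ex; rewrite /F /patch !mem_set// /re_part /im_part; case: (f x).
- split; [apply: (part (re_part f)) => //|apply: (part (im_part f)) => //] => x.
  exact: Re_le_normc.
exact: Im_le_normc.
Qed.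

Lemma Lp_loc_cintegrable (f u : V -> C) (D : set V) : Lp_loc p setT f -> compact D -> csupp D u ->
  cintegrable (fun x => f x * u x).
Proof.
move=> lf cD [su Su]; have [F [m1 m2 SF FE [f1 f2]]] := Lp_loc_restrict lf cD measurableT (@subsetT _ D).
have [c1 c2] := csmooth_continuous su.
have I (g h : V -> R) := lp_integrable (f := g) (u := h) p1 cD.
have -> : (fun x => f x * u x) = fun x => F x * u x.
  by apply/funext => x; have [Dx|/Su ->] := pselect (D x); [rewrite FE|rewrite !mulr0].
split.
  have := integrableB measurableT (I _ _ m1 (supported_re SF) f1 c1) (I _ _ m2 (supported_im SF) f2 c2).
  by congr (integrable _ _ _); apply/funext => x; rewrite /= /re_part [in RHS]ReM EFinB.
have := integrableD measurableT (I _ _ m1 (supported_re SF) f1 c2) (I _ _ m2 (supported_im SF) f2 c1).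
by congr (integrable _ _ _); apply/funext => x; rewrite /= /re_part /im_part [in RHS]ImM EFinD.
Qed.

Lemma Lp_locZ (c : R) (f : V -> C) : Lp_loc p setT f -> Lp_loc p setT (fun x => (c%:C)%C * f x).
Proof.
move=> [m1 m2 lf]; split.
- have -> : re_part (fun x => (c%:C)%C * f x) = fun x => c * re_part f x by apply/funext => x; rewrite /re_part ReM /= mul0r subr0.
  exact: (measurable_funM (measurable_cst c) m1).
- have -> : im_part (fun x => (c%:C)%C * f x) = fun x => c * im_part f x by apply/funext => x; rewrite /im_part ImM /= mul0r addr0.
  exact: (measurable_funM (measurable_cst c) m2).
move=> D cD DT; apply/(Lp_norm_lty p1).
have /(Lp_norm_lty p1) fD := lf D cD DT; have mD : measurable D := compact_measurable_rV cD.
have mn : measurable_fun D (fun x => (normc (f x) `^ p)%:E).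
  apply: measurable_funTS; apply: measurableT_comp => //; apply: (measurableT_comp (measurable_powR p)).
  exact: measurable_normc.
rewrite (eq_integral (fun x => (`|c| `^ p)%:E * (normc (f x) `^ p)%:E)%E); last first.
  by move=> x _; rewrite Normc.normcM normc_real powRM ?normc_ge0// EFinM.
rewrite (ge0_integralZl mu mD mn); last first.
- by rewrite lee_fin powR_ge0.
- by move=> x _; rewrite lee_fin powR_ge0.
have c0 : (0 <= (`|c| `^ p)%:E)%E by rewrite lee_fin powR_ge0.
exact: (lte_mul_pinfty c0 isT fD).
Qed.

Lemma Lp_norm_normalize (K : set V) (f : V -> C) : compact K -> Lp_loc p setT f ->
  exists2 c : R, 0 < c & (Lp_norm p K (fun x => ((c%:C)%C * f x)%R) <= 1)%E.
Proof.
move=> cK [m1 m2 lf]; have /(Lp_norm_lty p1) fK := lf K cK (@subsetT _ K).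
have mK : measurable K := compact_measurable_rV cK.
have mn : measurable_fun K (fun x => (normc (f x) `^ p)%:E).
  apply: measurable_funTS; apply: measurableT_comp => //; apply: (measurableT_comp (measurable_powR p)).
  exact: measurable_normc.
have nn x : K x -> (0 <= (normc (f x) `^ p)%:E)%E by move=> _; rewrite lee_fin powR_ge0.
have I0 : (0 <= \int[mu]_(x in K) (normc (f x) `^ p)%:E)%E := integral_ge0 mu nn.
have [I [I_ge0 IE]] : exists I : R, 0 <= I /\ (\int[mu]_(x in K) (normc (f x) `^ p)%:E = I%:E)%E.
  move: I0 fK; case: (\int[mu]_(x in K) (normc (f x) `^ p)%:E)%E => [s| |] //; by exists s.
have J0 : 0 < 1 + I by lra.
(* Here I is the integral of |g|^p over K for the function g to be normalized; since p >= 1 and c <=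
   1, c^p I <= c I <= 1. *)
pose c := (1 + I)^-1; have c0 : 0 < c by rewrite invr_gt0.
have c1 : c <= 1 by rewrite invf_le1//; lra.
exists c => //; apply: (Lp_norm_le1 p1).
rewrite (eq_integral (fun x => (c `^ p)%:E * (normc (f x) `^ p)%:E)%E); last first.
  by move=> x _; rewrite Normc.normcM normc_real (gtr0_norm c0) powRM ?normc_ge0 ?(ltW c0)// EFinM.
rewrite (ge0_integralZl mu mK mn nn); last by rewrite lee_fin powR_ge0.
rewrite IE -EFinM lee_fin; apply: (@le_trans _ _ (c * I)).
  rewrite ler_wpM2r// -(mulr_powRB1 (ltW c0) p0) ler_piMr ?(ltW c0)//.
  have pm0 : 0 <= p - 1 by rewrite subr_ge0.
  have c_nneg : c \is Num.nneg by rewrite nnegrE ltW.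
  by have := ge0_ler_powR pm0 c_nneg (ler01 : 1 \is Num.nneg) c1; rewrite powR1.
by rewrite /c mulrC ler_pdivrMr//; lra.
Qed.

End restriction.

(** * Support of L f and test functions away from it *)

Section support.
Context {R : realType} {N : nat}.
Local Notation C := R[i].
Local Notation V := 'rV[R]_N.
Let oT : open [set: V] := openT.

Lemma cintegralZ_integrable (c : R) (h : V -> C) : cintegrable h ->
  cintegral setT (fun x => (c%:C)%C * h x) = (c%:C)%C * cintegral setT h.
Proof.
move=> [r i]; apply: complex_eq; rewrite ?ReM ?ImM /cintegral /= mul0r ?subr0 ?addr0.
  by rewrite -(RintegralZl _ measurableT r); apply: eq_Rintegral => x _; rewrite /re_part ReM /= mul0r subr0.
by rewrite -(RintegralZl _ measurableT i); apply: eq_Rintegral => x _; rewrite /im_part ImM /= mul0r addr0.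
Qed.

(** Removability is applied with the whole space as domain, so that space has to be connected: it is
    the union of the segments issued from 0. *)
Lemma connected_rV : connected [set: V].
Proof.
pose A (x : V) := [set t *: x | t in `[(0 : R), 1]].
have -> : [set: V] = \bigcup_(x in setT) A x.
  apply/seteqP; split=> // x _; exists x => //; exists 1; rewrite ?scale1r//.
  by rewrite /= in_itv /= ler01 lexx.
apply: bigcup_connected.
  by exists 0 => x _; exists 0; rewrite ?scale0r//= in_itv/= lexx ler01.
move=> x _; apply: connected_continuous_connected; first exact: segment_connected.
apply: continuous_subspaceT => t; exact: scalel_continuous.
Qed.

Variables (L : diffop R N) (p : R).
Hypothesis p1 : 1 <= p.
Local Notation P := (transpose_fun L).
Let sP := smooth_op_transpose L.

Variable f : V -> C.
Hypothesis lf : Lp_loc p setT f.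
Local Notation T := (diffop_distr L (distr_of_fun setT f)).

Let test_csupp phi : test_fun setT phi -> exists2 D : set V, compact D & csupp D phi.
Proof. by move=> [s [D [cD _ SD]]]; exists D => //; split. Qed.

Lemma distrZ (c : R) phi : test_fun setT phi ->
  diffop_distr L (distr_of_fun setT (fun x => (c%:C)%C * f x)) phi = (c%:C)%C * T phi.
Proof.
move=> /test_csupp[D cD sD]; have cQ := csupp_op sP cD sD.
rewrite /diffop_distr /distr_of_fun -(cintegralZ_integrable c (Lp_loc_cintegrable p1 lf cD cQ)).
by apply: cintegral_ext => x; rewrite mulrA.
Qed.

Let distrD phi psi : test_fun setT phi -> test_fun setT psi -> T (fun x => phi x + psi x) = T phi + T psi.
Proof.
move=> /test_csupp[D cD sD] /test_csupp[D' cD' sD'].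
have i1 := Lp_loc_cintegrable p1 lf cD (csupp_op sP cD sD).
have i2 := Lp_loc_cintegrable p1 lf cD' (csupp_op sP cD' sD').
rewrite /diffop_distr /distr_of_fun -(cintegralD_integrable i1 i2); apply: cintegral_ext => x.
rewrite -mulrDr; congr (_ * _).
have := smooth_op_linear sP 1 sD.1 sD'.1 x; rewrite mul1r => <-; congr (P _ x).
by apply/funext => y; rewrite mul1r.
Qed.

(* If [T] vanishes near the support of a bump [chi], then [T phi = T ((1 - chi) phi)]; finitely many bumps cover the support of [phi]. *)
Lemma distr_supp_test (K : set V) : distr_supp T `<=` K -> forall phi, test_fun (~` K) phi -> T phi = 0.
Proof.
move=> TK phi [sphi [D [cD DK SD]]].
have good x : D x -> exists r : R, 0 < r /\ forall psi, csmooth setT psi -> T (fun y => ((plateau x r y)%:C)%C * psi y) = 0.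
  move=> Dx; have /contrapT[U [oU TU] Ux] : ~ distr_supp T x by move=> /TK; exact: DK.
  have := oU; rewrite openE => /(_ x Ux); rewrite /interior -nbhs_ballE => -[e /= e0 He].
  exists (e / 3); have r0 : 0 < e / 3 by rewrite divr_gt0.
  split=> // psi spsi; apply: TU; split.
    exact: (csmoothM oT (csmooth_real oT (smooth_plateau x (e / 3))) spsi).
  have cc : compact [set y : V | `|y - x| <= 2 * (e / 3)].
    have -> : [set y : V | `|y - x| <= 2 * (e / 3)] = [set y + x | y in [set y : V | `|y| <= 2 * (e / 3)]].
      apply/seteqP; split=> [y /= yx|_ [y /= yx <-]]; last by rewrite /= addrK.
      by exists (y - x) => //; rewrite subrK.
    apply: continuous_compact; last exact: closed_ball_compact_rV.
    by apply: continuous_subspaceT; exact: continuous_translate.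
  exists [set y : V | `|y - x| <= 2 * (e / 3)]; split=> //.
  - move=> y /= yx; apply: He; rewrite -ball_normE /ball_ /= distrC; apply: le_lt_trans yx _; lra.
  - by move=> y /= /negP; rewrite -ltNge => yx; rewrite plateau0// mul0r.
have /choice[rad Hrad] : forall x, exists r : R, D x -> 0 < r /\ forall psi, csmooth setT psi ->
    T (fun y => ((plateau x r y)%:C)%C * psi y) = 0.
  by move=> x; have [/good[r Hr]|nD] := pselect (D x); [exists r|exists 0].
have [S SD' cov] : finite_subset_cover D (fun x => [set y : V | `|y - x| < rad x]) D.
  move: (cD); rewrite compact_cover; apply=> [x Dx|x Dx].
    have -> : [set y : V | `|y - x| < rad x] = (fun y => y + - x) @^-1` [set z : V | `|z| < rad x] by [].
    apply: open_comp; last exact: open_norm_lt.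
    by move=> y _; exact: continuous_translate.
  by exists x => //=; rewrite subrr normr0; case: (Hrad x Dx).
pose Pi (s : seq V) (y : V) : C := \prod_(x <- s) (1 - ((plateau x (rad x) y)%:C)%C).
have sPi s : csmooth setT (Pi s).
  elim: s => [|x s IH].
    have -> : Pi [::] = fun=> 1 by apply/funext => y; rewrite /Pi big_nil.
    exact: (csmooth_cst oT).
  have -> : Pi (x :: s) = fun y => (1 - ((plateau x (rad x) y)%:C)%C) * Pi s y by apply/funext => y; rewrite /Pi big_cons.
  exact: (csmoothM oT (csmoothB oT (csmooth_cst oT 1) (csmooth_real oT (smooth_plateau x (rad x)))) IH).
have tst psi : csmooth setT psi -> test_fun setT (fun y => psi y * phi y).
  move=> spsi; split; first exact: (csmoothM oT spsi sphi).
  by exists D; split=> [//|//|y yD]; rewrite SD// mulr0.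
have TPi s : (forall x, x \in s -> D x) -> T (fun y => Pi s y * phi y) = T phi.
  elim: s => [|x s IH] sD.
    by congr (diffop_distr _ _ _); apply/funext => y; rewrite /Pi big_nil mul1r.
  rewrite -IH; last by move=> z zs; apply: sD; rewrite inE zs orbT.
  have [_ T0] := Hrad x (sD x (mem_head x s)).
  pose chi y : C := ((plateau x (rad x) y)%:C)%C.
  have schi : csmooth setT chi := csmooth_real oT (smooth_plateau x (rad x)).
  have E1 : T (fun y => chi y * (Pi s y * phi y)) = 0 := T0 _ (csmoothM oT (sPi s) sphi).
  have t1 : test_fun setT (fun y => chi y * (Pi s y * phi y)).
    by have := tst _ (csmoothM oT schi (sPi s)); congr (test_fun _ _); apply/funext => y; rewrite mulrA.
  have t2 := tst _ (sPi (x :: s)).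
  have := distrD t1 t2; rewrite E1 add0r => <-; congr (diffop_distr _ _ _); apply/funext => y.
  by rewrite /Pi big_cons -/(Pi s y) /chi; ring.
rewrite -(TPi (finmap.enum_fset S)); last by move=> x /SD' /set_mem.
have -> : (fun y => Pi (finmap.enum_fset S) y * phi y) = fun=> 0.
  apply/funext => y; have [Dy|/SD ->] := pselect (D y); last by rewrite mulr0.
  have [x /= xS yx] := cov y Dy; have Dx : D x by apply/set_mem/SD'.
  rewrite /Pi (big_rem x)//= (plateau1 (Hrad x Dx).1 (ltW yx)) subrr !mul0r.
  by [].
have s0 : csmooth setT (fun _ : V => 0 : C) := csmooth_cst oT 0.
have [_ S0] := csupp_op sP (@compact0 V) (conj s0 (fun _ _ => erefl)).
rewrite /diffop_distr /distr_of_fun (cintegral_ext (g := fun=> 0)).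
  by apply: complex_eq; rewrite /cintegral /= /re_part /im_part /= /Rintegral integral0.
by move=> x; rewrite (S0 x (fun H => H)) mulr0.
Qed.

End support.

(** * Removability and capacity *)

Section removable_sets.
Context {R : realType} {N : nat}.
Local Notation C := R[i].
Local Notation V := 'rV[R]_N.
Local Notation normc := (@Normc.normc R).
Local Notation mu := (lebesgue_rV N).
Local Notation ball0 r := [set x : V | `|x| <= r].
Local Notation cB r := (@closed_ball_compact_rV R N r).
Let oT : open [set: V] := openT.

(** The condition [lambda < Q] excludes the trivial group; the a priori estimate needs a positive
    dimension. *)
Lemma hom_dim_gt0 (G : carnot_group R N) (lambda : R) : 0 <= lambda -> lambda < (hom_dim G)%:R -> (0 < N)%N.
Proof.
move=> l0 lQ; rewrite lt0n; apply/eqP => N0.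
suff Q0 : hom_dim G = 0%N by move: lQ; rewrite Q0 ltNge l0.
rewrite /hom_dim big1// => i _; have := dimvS (subvf (stratum G i.+1)).
rewrite dimvf; have -> : dim 'rV[R]_N = 0%N by rewrite [LHS]mul1n.
by rewrite leqn0 => /eqP ->; rewrite muln0.
Qed.

Variables (G : carnot_group R N) (p lambda : R) (L : diffop R N).
Hypotheses (p1 : 1 <= p) (l1 : 1 <= lambda) (lQ : lambda < (hom_dim G)%:R).
Hypotheses (hinv : left_invariant G (diffop_distr L)) (hhom : homogeneous G lambda (diffop_distr L)).
Hypotheses (hypo : hypoelliptic (diffop_distr L)) (hypot : hypoelliptic (transpose_distr L)).
Let sP := smooth_op_transpose L.

(** Only the values of [f] on the compact support [E] of [phi] enter, so [f] is first extended by 0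
    off [E]. The dilation D is the one of ratio t given by [dilation_contracting], with a = t^lambda
    and q = t^Q. *)
Lemma localization (Om : set V) (f phi : V -> C) : open Om -> Lp_loc p Om f -> test_fun Om phi ->
  exists g, Lp_loc p setT g /\ forall eta, test_fun setT eta ->
    diffop_distr L (distr_of_fun setT g) eta = diffop_distr L (distr_of_fun Om f) (fun x => phi x * eta x).
Proof.
move=> oOm lf [sphi [E [cE EOm SE]]].
have [F [m1 m2 SF FE [f1 f2]]] := Lp_loc_restrict p1 lf cE (open_measurable_rV oOm) EOm.
have [t [t0 contr a1 aq]] := dilation_contracting l1 lQ.
have N0 : (0 < N)%N := hom_dim_gt0 (le_trans ler01 l1) lQ.
pose Dl : {linear V -> V} := dilation G t; pose Dl' : {linear V -> V} := dilation G t^-1.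
have tn0 : t != 0 by rewrite gt_eqF.
have DK : cancel Dl Dl' := dilationK G tn0.
have D'K : cancel Dl' Dl by have := @dilationK _ _ G t^-1; rewrite invrK invr_eq0; exact.
have jac := lebesgue_dilation G t0.
have PD := fun psi s x => transpose_dilate hhom (phi := psi) t0 s x.
have PT := transpose_translate hinv.
have smul := smooth_gmul G; have mulNl := gmulNl G.
have [gamma [gammaoo [rho [rho' [rho'0 sgamma gamma0 sgoo expansion]]]]] :=
  fundamental_expansion (Dl := Dl) (Dl' := Dl') DK D'K contr a1 aq jac PD hypo hypot N0.
have [k1 [k2 [sk1 sk2 kernel]]] := commutator_kernel (Dl := Dl) (Dl' := Dl') smul (gmulA G) (gmul0l G) (gmul0r G) mulNl (gmul_exp G)
  sP PT DK D'K contr a1 aq jac PD rho'0 sgamma gamma0 sgoo expansion sphi cE.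
have [g [lg Hg]] := localized_solution sP cE (conj sphi SE) sk1 sk2 kernel p1 m1 m2 SF f1 f2.
exists g; split=> // eta teta; apply: (etrans (Hg eta teta)).
have cpe : csupp E (fun x => phi x * eta x) := conj (csmoothM oT sphi teta.1) (@supportedMl _ _ E phi eta SE).
have [_ SPe] := csupp_op sP cE cpe.
rewrite /diffop_distr /distr_of_fun cintegral_setT; last first.
  by move=> x xO; rewrite (SPe x (fun Ex => xO (EOm x Ex))) mulr0.
by apply: cintegral_ext => x; have [Ex|/SPe ->] := pselect (E x); [rewrite FE|rewrite !mulr0].
Qed.

(** The extra ball will contain the support of phi, so that psi = 1 there and phi psi = phi. *)
Lemma cutoff_ball (K : set V) r : compact K -> exists psi : V -> C, cutoff K psi /\ forall x, `|x| <= r -> psi x = 1.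
Proof.
move=> cK; have [s s0 Ks] := compact_sub_ball cK; pose M := s + `|r| + 1.
have r0 := normr_ge0 r; have M0 : 0 < M by rewrite /M; lra.
have one x : `|x| <= M -> ((plateau 0 M x)%:C)%C = 1 :> C by move=> xM; rewrite plateau1 ?subr0.
exists (fun x => ((plateau 0 M x)%:C)%C); split; [split; first exact: test_plateau|].
  exists [set x : V | `|x| < M]; split; first exact: open_norm_lt.
  - by move=> x /Ks xs /=; apply: le_lt_trans xs _; rewrite /M; lra.
  - by move=> x /= /ltW; exact: one.
by move=> x xr; apply: one; apply: le_trans xr _; have := ler_norm r; rewrite /M; lra.
Qed.

Lemma removable_kappa (K : set V) : compact K -> removable L p K -> kappa L p K = 0%E.
Proof.
move=> cK rem; have pn0 : p != 0 by rewrite gt_eqF// (lt_le_trans ltr01 p1).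
apply/eqP; rewrite eq_le; apply/andP; split.
  apply: ge_ereal_sup => _ [f [psi [lf _ sf [tpsi _] ->]]].
  have L0 := rem setT openT connected_rV (ex_intro _ 0 Logic.I) f lf.
  rewrite L0 ?Normc.normc0//; move=> phi tphi; apply: (distr_supp_test p1 lf sf).
  by rewrite setTD in tphi.
(* The zero function is admissible, so the supremum is at least 0; over an empty set it would be
   -oo. *)
have z0 : forall phi : V -> C, diffop_distr L (distr_of_fun setT (fun _ : V => 0 : C)) phi = 0.
  move=> phi; rewrite /diffop_distr /distr_of_fun (cintegral_ext (g := fun=> 0)) => [|x]; last by rewrite mul0r.
  by apply: complex_eq; rewrite /cintegral /= /re_part /im_part /= /Rintegral integral0.
have [psi [cpsi _]] := cutoff_ball 0 cK.
apply: ereal_sup_ubound; exists (fun=> 0), psi; split=> //; last by rewrite z0 Normc.normc0.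
- have c0 : real_lploc p (fun _ : V => 0 : R).
    split=> [|r]; first exact: measurable_cst.
    by rewrite normr0 powR0// integral0.
  exact: (@Lp_loc_real _ _ p p1 (fun=> 0) c0 c0).
- by apply: (Lp_norm_le1 p1); rewrite Normc.normc0 powR0// integral0.
- move=> x []; exists setT; last exact: Logic.I.
  by split; [exact: openT|move=> phi _; exact: z0].
Qed.

Lemma kappa_removable (K : set V) : compact K -> kappa L p K = 0%E -> removable L p K.
Proof.
move=> cK k0 Om oOm _ _ f lf fK phi tphi; apply: contrapT => Lf0.
have [g [lg Hg]] := localization oOm lf tphi.
have [c c0 cg] := Lp_norm_normalize p1 cK lg.
have [sphi [D [cD DOm SD]]] := tphi; have [r _ Dr] := compact_sub_ball cD.
have [psi [cpsi psi1]] := cutoff_ball r cK; have [tpsi _] := cpsi.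
have closedK : closed K by apply: compact_closed => //; exact: norm_hausdorff.
(* As psi is 1 on the support of phi, pairing L g = phi L f with psi gives back the value of L f at
   phi. *)
have LE : diffop_distr L (distr_of_fun setT (fun x => (c%:C)%C * g x)) psi = (c%:C)%C * diffop_distr L (distr_of_fun Om f) phi.
  rewrite (distrZ L p1 lg c tpsi) (Hg _ tpsi); congr (_ * diffop_distr _ _ _); apply/funext => x.
  by have [/Dr/psi1 ->|/SD ->] := pselect (D x); rewrite ?mulr1 ?mul0r.
have : ((normc (diffop_distr L (distr_of_fun setT (fun x => (c%:C)%C * g x)) psi))%:E <= kappa L p K)%E.
  apply: ereal_sup_ubound; exists (fun x => (c%:C)%C * g x), psi; split; [exact: (Lp_locZ p1 c lg)|exact: cg| |exact: cpsi|exact: erefl].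
  move=> x xs; apply: contrapT => xK; apply: xs; exists (~` K); last exact: xK.
  split; first exact: closed_openC.
  move=> eta [seta [D' [cD' D'K SD']]].
  have teta : test_fun setT eta := conj seta (ex_intro _ D' (And3 cD' (@subsetT _ D') SD')).
  rewrite (distrZ L p1 lg c teta) (Hg _ teta); apply: (etrans _ (mulr0 _)); congr (_ * _); apply: fK.
  (* If eta is supported off [K], then phi eta is a test function on the complement of [K] in [Om],
     where L f = 0. So L g is supported in [K]. *)
  split; first exact: (csmoothM oT sphi seta).
  exists (D `&` D'); split.
  - apply: compact_closedI; first exact: cD.
    by apply: compact_closed; [exact: norm_hausdorff|exact: cD'].
  - by move=> y [/DOm yO /D'K yK]; split.
  - move=> y yDD; have [Dy|/SD ->] := pselect (D y); last by rewrite mul0r.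
    by rewrite SD' ?mulr0// => D'y; apply: yDD.
rewrite k0 lee_fin LE Normc.normcM normc_real (gtr0_norm c0) pmulr_rle0// => n0.
by apply: Lf0; apply: normc0P; apply: le_anti; rewrite n0 normc_ge0.
Qed.

End removable_sets.

Theorem theorem7p2 (R : realType) (N : nat) (G : carnot_group R N)
    (p lambda : R) (L : diffop R N) (K : set 'rV[R]_N)
    (hp : 1 <= p)
    (hlambda1 : 1 <= lambda) (hlambdaQ : lambda < (hom_dim G)%:R)
    (hinv : left_invariant G (diffop_distr L))
    (hhom : homogeneous G lambda (diffop_distr L))
    (hypo : hypoelliptic (diffop_distr L))
    (hypot : hypoelliptic (transpose_distr L))
    (hK : compact K) :
  removable L p K <-> kappa L p K = 0%E.
Proof.
split; first exact: removable_kappa.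
exact: (kappa_removable hp hlambda1 hlambdaQ hinv hhom hypo hypot hK).
Qed.
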